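(* Let $T>0$, $\ell>0$, $\alpha\in(0,1)$, and let $a,f\in C^{2}([0,T]\times[-\ell,\ell]\times\mathbb{R}\times\mathbb{R})$ and $b(\cdot,\pm\ell,\cdot,\cdot),\,g(\cdot,\pm\ell,\cdot,\cdot)\in C^{2}([0,T]\times\mathbb{R}\times\mathbb{R})$ be real-valued and satisfy $$a(t,x,z,p)>0,\qquad \partial_4 b(t,\pm\ell,z,p)\,p+b(t,\pm\ell,z,p)\mp\partial_4 g(t,\pm\ell,z,p)>0$$ for all $(t,x,z,p)\in[0,T]\times[-\ell,\ell]\times\mathbb{R}\times\mathbb{R}$. Let $u^0\in C^{2+\alpha}([-\ell,\ell])$ satisfy the compatibility condition $$\mp b(0,x,u^0,u^0_x)u^0_x+g(0,x,u^0,u^0_x)=a(0,x,u^0,u^0_x)u^0_{xx}+f(0,x,u^0,u^0_x)\quad\text{at } x=\pm\ell.$$ Consider the problem $$u_t-a(t,x,u,u_x)u_{xx}=f(t,x,u,u_x),\qquad t>0,\ x\in(-\ell,\ell),$$ $$u_t\pm b(t,x,u,u_x)u_x=g(t,x,u,u_x),\qquad t>0,\ x=\pm\ell,$$ $$u(0,x)=u^0(x),\qquad x\in[-\ell,\ell].$$ Then this problem admits a unique solution $u$ on a maximal interval of existence $[0,\tau_\infty)\subset[0,T]$ such that $u\in\mathcal{C}^{1+\frac{\alpha}{2},2+\alpha}(\Omega_\tau)$ for every $\tau<\tau_\infty$, and either $$\lim_{\tau\nearrow\tau_\infty}|u|^{(1+\frac{\alpha}{2},2+\alpha)}_{\Omega_\tau}=\infty$$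 or $u\in\mathcal{C}^{1+\frac{\alpha}{2},2+\alpha}(\Omega_T)$. Moreover, in the special case that $b$ and $g$ are gradient-independent (i.e. $b=b(t,\pm\ell,z)$ and $g=g(t,\pm\ell,z)$ do not depend on the fourth variable $p$) and $b(\cdot,\pm\ell,\cdot)>0$, either $$\lim_{\tau\nearrow\tau_\infty}\Big(|u|_{\Omega_\tau}+|u_x|_{\Omega_\tau}+\langle u_x\rangle^{(\frac{\alpha}{2},\alpha)}_{\Omega_\tau}\Big)=\infty$$ or $u\in\mathcal{C}^{1+\frac{\alpha}{2},2+\alpha}(\Omega_T)$.
   Context: Conventions. $\Omega=(-\ell,\ell)$ and $\Omega_\tau=(0,\tau)\times(-\ell,\ell)$. Equations or conditions at $x=\pm\ell$ involving $\pm$ (or $\mp$) mean two conditions: the upper sign is taken at $x=+\ell$ and the lower sign at $x=-\ell$. $\partial_4$ is the derivative with respect to the last variable $p$ (the slot of $u_x$). $|u|_S=\sup_S|u|$ is the supremum norm on a set $S$. For an interval $I$ and $\beta\in(0,1)$: $[v]^{(\beta)}_I=\sup_{x\ne y\in I}|v(x)-v(y)|/|x-y|^\beta$; $C^{k+\beta}(I)$ for compact $I$ is the space of $k$-times continuously differentiable functions on $I$ whose $k$-th derivative is $\beta$-Hölder continuous. Parabolic Hölder spaces. For $u:\Omega_\tau\to\mathbb{R}$ and $\beta\in(0,1)$ set $\langle u\rangle^{(\beta)}_{t,\Omega_\tau}=\sup_{x\in\Omega}[u(\cdot,x)]^{(\beta)}_{(0,\tau)}$, $\langle u\rangle^{(\beta)}_{x,\Omega_\tau}=\sup_{t\in(0,\tau)}[u(t,\cdot)]^{(\beta)}_{\Omega}$,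 and for $\alpha\in(0,1)$: $\langle u\rangle^{(\frac{\alpha}{2},\alpha)}_{\Omega_\tau}=\langle u\rangle^{(\alpha/2)}_{t,\Omega_\tau}+\langle u\rangle^{(\alpha)}_{x,\Omega_\tau}$. For integer $k\ge1$, $$\langle u\rangle^{(\frac{k+\alpha}{2},k+\alpha)}_{\Omega_\tau}=\sum_{2j_0+j=k}\langle D_t^{j_0}D_x^ju\rangle^{(\frac{\alpha}{2},\alpha)}_{\Omega_\tau}+\sum_{2j_0+j=k-1}\langle D_t^{j_0}D_x^ju\rangle^{(\frac{1+\alpha}{2})}_{t,\Omega_\tau}.$$ $\mathcal{C}^{\frac{k+\alpha}{2},k+\alpha}(\Omega_\tau)$ is the set of $u:\Omega_\tau\to\mathbb{R}$ with finite norm $|u|^{(\frac{k+\alpha}{2},k+\alpha)}_{\Omega_\tau}=\sum_{2j_0+j\le k}|D_t^{j_0}D_x^ju|_{\Omega_\tau}+\langle u\rangle^{(\frac{k+\alpha}{2},k+\alpha)}_{\Omega_\tau}$; the case $k=2$ gives $\mathcal{C}^{1+\frac{\alpha}{2},2+\alpha}(\Omega_\tau)$. For such $u$ all derivatives $D_t^{j_0}D_x^ju$ with $2j_0+j\le k$ extend continuously to $\overline{\Omega}_\tau$, so the boundary and initial conditions make sense pointwise. *)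

(* Defs.v *)
From HB Require Import structures.
From mathcomp Require Import all_boot all_order all_algebra.
From mathcomp Require Import all_classical all_reals all_analysis.

Set Implicit Arguments.
Unset Strict Implicit.
Unset Printing Implicit Defensive.

Import Order.TTheory GRing.Theory Num.Theory.
Import numFieldNormedType.Exports.

Local Open Scope classical_set_scope.
Local Open Scope ring_scope.

(* Derivatives relative to a set: the increments are restricted to those that
   stay in D, so that they are one-sided at the boundary of a box. *)
Section RelativeDerivatives.
Context {R : realType} {V : normedModType R}.

Definition derivable_in (D : set V) (v : V) (f : V -> R) (x : V) : Prop :=
  cvg (h^-1 * (f (h *: v + x) - f x)
       @[h --> within [set h : R | D (h *: v + x)] 0^']).

Definition derive_in (D : set V) (v : V) (f : V -> R) (x : V) : R :=
  lim (h^-1 * (f (h *: v + x) - f x)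
       @[h --> within [set h : R | D (h *: v + x)] 0^']).

(* C^k(D), where the set E lists the coordinate directions of V; D is intended
   to be a product of nondegenerate intervals, possibly closed or unbounded. *)
Fixpoint Ck (k : nat) (E : set V) (D : set V) (f : V -> R) : Prop :=
  {within D, continuous f} /\
  (if k is k'.+1 then
     forall v, E v -> (forall x, D x -> derivable_in D v f x) /\
                      Ck k' E D (derive_in D v f)
   else True).

End RelativeDerivatives.

Section Spaces.
Context {R : realType}.
Implicit Types (I : set R) (S : set (R * R)) (u : R -> R -> R).

Definition coords (n : nat) : set 'rV[R]_n := [set delta_mx 0 i | i in setT].

Definition C2_3 (D1 D2 D3 : set R) (F : R -> R -> R -> R) : Prop :=
  Ck 2 (@coords 3) [set v | [/\ D1 (v 0 0), D2 (v 0 1) & D3 (v 0 2)]]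
    (fun v : 'rV[R]_3 => F (v 0 0) (v 0 1) (v 0 2)).

Definition C2_4 (D1 D2 D3 D4 : set R) (F : R -> R -> R -> R -> R) : Prop :=
  Ck 2 (@coords 4)
    [set v | [/\ D1 (v 0 0), D2 (v 0 1), D3 (v 0 2) & D4 (v 0 3)]]
    (fun v : 'rV[R]_4 => F (v 0 0) (v 0 1) (v 0 2) (v 0 3)).

Definition holder (beta : R) I (v : R -> R) : \bar R :=
  ereal_sup [set (`|v p.1 - v p.2| / `|p.1 - p.2| `^ beta)%:E
            | p in [set p : R * R | [/\ I p.1, I p.2 & p.1 != p.2]]].

Definition dx I (v : R -> R) : R -> R := derive_in (I : set R^o) 1 v.

Definition holder_space (k : nat) (beta : R) I (v : R -> R) : Prop :=
  Ck k [set (1 : R^o)] I v /\ (holder beta I (iter k (dx I) v) < +oo)%E.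

Definition Omega (l : R) : set R := `]-l, l[.

Definition Cyl (tau l : R) : set (R * R) := `]0, tau[ `*` Omega l.

Definition Dt u : R -> R -> R := fun t x => derive1 (fun s => u s x) t.

Definition Dx u : R -> R -> R := fun t x => derive1 (u t) x.

Definition Dtx (j0 j : nat) u : R -> R -> R := iter j0 Dt (iter j Dx u).

Definition supnorm S u : \bar R := ereal_sup [set `|u p.1 p.2|%:E | p in S].

Definition holder_t (beta tau l : R) u : \bar R :=
  ereal_sup [set holder beta `]0, tau[ (fun t => u t x) | x in Omega l].

Definition holder_x (beta tau l : R) u : \bar R :=
  ereal_sup [set holder beta (Omega l) (u t) | t in `]0, tau[].

Definition holder_tx (alpha tau l : R) u : \bar R :=
  (holder_t (alpha / 2) tau l u + holder_x alpha tau l u)%E.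

Definition par_seminorm (k : nat) (alpha tau l : R) u : \bar R :=
  (\sum_(j0 < k.+1) \sum_(j < k.+1 | (2 * j0 + j)%N == k)
      holder_tx alpha tau l (Dtx j0 j u) +
   \sum_(j0 < k.+1) \sum_(j < k.+1 | (2 * j0 + j).+1 == k)
      holder_t ((1 + alpha) / 2) tau l (Dtx j0 j u))%E.

Definition par_norm (k : nat) (alpha tau l : R) u : \bar R :=
  (\sum_(j0 < k.+1) \sum_(j < k.+1 | (2 * j0 + j <= k)%N)
      supnorm (Cyl tau l) (Dtx j0 j u) +
   par_seminorm k alpha tau l u)%E.

(* The derivatives have to exist: [Dt] and [Dx] are total operators, with an
   unspecified value where the function is not differentiable. *)
Definition par_space (k : nat) (alpha tau l : R) u : Prop :=
  [/\ forall j t x, (j.+1 <= k)%N -> Cyl tau l (t, x) ->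
        derivable (Dtx 0 j u t) x 1,
      forall j0 j t x, (2 * j0.+1 + j <= k)%N -> Cyl tau l (t, x) ->
        derivable (fun s => Dtx j0 j u s x) t 1
    & (par_norm k alpha tau l u < +oo)%E].

(* The value at (t, x) of the continuous extension of u from S to its
   closure. *)
Definition ext S u (t x : R) : R :=
  lim (u q.1 q.2 @[q --> within S (nbhs (t, x))]).

(* Conditions with the signs +- (or -+) at x = +-l are stated for s = 1 and
   s = -1, with x = s * l. *)
Definition is_solution (l alpha : R) (a f b g : R -> R -> R -> R -> R)
    (u0 : R -> R) (tau : R) u : Prop :=
  let bar := ext (Cyl tau l) in
  [/\ forall sigma, 0 < sigma < tau -> par_space 2 alpha sigma l u,
      forall t x, Cyl tau l (t, x) ->
        Dt u t x - a t x (u t x) (Dx u t x) * Dx (Dx u) t x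
          = f t x (u t x) (Dx u t x),
      forall s t, s \in [:: 1; -1] -> 0 < t < tau ->
        let x := s * l in
        bar (Dt u) t x + s * b t x (bar u t x) (bar (Dx u) t x) * bar (Dx u) t x
          = g t x (bar u t x) (bar (Dx u) t x)
    & forall x, -l <= x <= l -> bar u 0 x = u0 x].

End Spaces.

(* Main.v *)
(* Existence comes from the explicit Euler scheme on a uniform grid. With frozen
   coefficients, the third mixed differences D_m D_n D_k v of the scheme solve a
   discrete heat equation in the octant of the steps (m, n, k), for which
   r (mu s + r^2)^((1 + alpha) / 2), with r = (m n k)^(1/3) times the mesh, is a
   supersolution. The maximum principle therefore bounds these differences, and
   summation over dyadic scales turns the bound into a Schauder estimate for
   u_xx, uniform in the mesh; at the ends u_xx is read off from the two
   expressions a u_xx + f and g -+ b u_x of u_t. A limit of the scheme along an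
   ultrafilter is a local solution, and for a linear problem the length of its
   interval of existence does not depend on the datum.
   Two solutions agree by the maximum principle, because b p -+ g is increasing
   in p, so the local solutions glue to a maximal one. If its norm stays
   bounded, it extends to the closed interval and can be continued from there.
   Bounds on u, u_x and the Holder seminorm of u_x suffice for this: they make
   the frozen coefficients a(t,x,u,u_x), f(t,x,u,u_x) and g -+ b u_x Holder
   continuous, and u solves the linear problem with these coefficients, hence
   obeys its Schauder estimate. *)

Require Import Defs.
From HB Require Import structures.
From mathcomp Require Import all_boot all_order all_algebra.
From mathcomp Require Import all_classical all_reals all_analysis.
From mathcomp Require Import ring lra zify.

Set Implicit Arguments.
Unset Strict Implicit.
Unset Printing Implicit Defensive.

Import Order.TTheory GRing.Theory Num.Theory.
Import numFieldNormedType.Exports.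

Local Open Scope classical_set_scope.
Local Open Scope ring_scope.

(** * The octant barrier *)

Section PowerInequalities.
Context {R : realType}.
Implicit Types (x y c p q e : R).

(** The octant works because a mixed difference with a fixed centre sees the discrete Laplacian as a
    second difference in any one of its three steps: that step is widened by two and narrowed by
    two. A step narrowed to -1 reproduces the difference of step 1 with the opposite sign, so the
    faces of the octant act as Dirichlet faces. The cube root in r makes each direction gain a
    multiple of 1/m^2 from concavity, and the arithmetic-geometric mean inequality turns the three
    gains into 1/r^2, which is the rate at which the drift mu s must be paid. The dynamic end
    condition gives no boundary value for u_xx independent of the solution. The scheme is extended
    past the end with the second difference of the final time prescribed there. The mismatch at
    earlier times is then a power of the time left, one of the two source terms that the barrier
    tolerates. Freezing a coefficient leaves a source that contains the unknown Holder constant of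
    u_xx, but with the oscillation of the coefficient over a small window as a factor, so that it
    can be absorbed. *)

Lemma powR_bernoulli x c : 0 <= x -> 0 < c < 1 -> x `^ c <= 1 + c * (x - 1).
Proof.
move=> x0 /andP[c0 c1].
have c'0 : 0 < 1 - c by rewrite subr_gt0.
(* Young's inequality for x^c and 1 with the exponents 1/c and 1/(1 - c). *)
have := @conjugate_powR R (x `^ c) 1 c^-1 (1 - c)^-1 (powR_ge0 _ _) ler01.
rewrite !invr_gt0 !invrK mulr1 -powRrM mulfV ?gt_eqF// powRr1// powR1 mul1r.
by move=> /(_ c0 c'0); rewrite subrKC => /(_ erefl); lra.
Qed.

(** Strict concavity of the cube root with a quantitative gain. In terms of S = p + q and P = p q
    the hypotheses read S^3 - 3 S P = 2 and e^2 = 1 - P^3, and the identity 3 S (1 - P) = (2 - S) (S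
    + 1)^2 converts the defect of P into the defect of S. *)
Lemma cube_sum_le p q e : 0 <= p -> 0 <= q -> p ^+ 3 = 1 + e ->
  q ^+ 3 = 1 - e -> p + q <= 2 - e ^+ 2 / 9.
Proof.
move=> p0 q0 pe qe.
have S1 : 1 <= p + q.
  rewrite -(@ler_pXn2r _ 3) ?nnegrE ?addr_ge0// expr1n.
  have : 0 <= p * q by exact: mulr_ge0.
  have : 0 <= p * q * (p + q) by rewrite !mulr_ge0 ?addr_ge0.
  have -> : (p + q) ^+ 3 = p ^+ 3 + q ^+ 3 + 3 * (p * q * (p + q)) by ring.
  by rewrite pe qe; lra.
set S := p + q in S1 *; set P := p * q.
have P0 : 0 <= P by exact: mulr_ge0.
have SP : S ^+ 3 - 3 * S * P = 2.
  have -> : S ^+ 3 - 3 * S * P = p ^+ 3 + q ^+ 3 by rewrite /S /P; ring.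
  by rewrite pe qe; ring.
have eP : e ^+ 2 = 1 - P ^+ 3 by rewrite /P exprMn pe qe; ring.
have P4 : P <= S ^+ 2 / 4.
  have := sqr_ge0 (p - q); rewrite /P /S; nra.
have S2 : S <= 2 by nra.
have P1 : P <= 1 by nra.
have E1 : 3 * S * (1 - P) = (2 - S) * (S + 1) ^+ 2.
  have -> : 3 * S * (1 - P) = 3 * S - S ^+ 3 + (S ^+ 3 - 3 * S * P) by ring.
  by rewrite SP; ring.
have E2 : e ^+ 2 <= 3 * (1 - P).
  rewrite eP; have -> : 1 - P ^+ 3 = (1 - P) * (1 + P + P ^+ 2) by ring.
  rewrite mulrC ler_wpM2r ?subr_ge0//; nra.
have E3 : 3 * (1 - P) <= (2 - S) * 9.
  have : 3 * (1 - P) <= 3 * S * (1 - P).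
    by rewrite ler_wpM2r ?subr_ge0// ; nra.
  rewrite E1 => /le_trans; apply.
  by rewrite ler_wpM2l ?subr_ge0//; nra.
lra.
Qed.

Lemma cubeAMGM p q e : 0 <= p -> 0 <= q -> 0 <= e ->
  3 * (p * q * e) <= p ^+ 3 + q ^+ 3 + e ^+ 3.
Proof.
move=> p0 q0 e0; rewrite -subr_ge0.
have -> : p ^+ 3 + q ^+ 3 + e ^+ 3 - 3 * (p * q * e) =
  (p + q + e) * ((p - q) ^+ 2 + (q - e) ^+ 2 + (e - p) ^+ 2) / 2 by field.
by rewrite divr_ge0// mulr_ge0 ?addr_ge0 ?sqr_ge0.
Qed.

(* For a base point [Z = mu s + r^2] and a multiplier [p] of [r], concavity of
   [z `^ c] bounds the barrier by a cubic in [p]; the cube is what varies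
   linearly with the index. *)
Lemma barrier_mul_le (Z0 r c p lam : R) : 0 <= Z0 -> 0 < r -> 0 < c < 1 -> 0 <= p ->
  lam = r ^+ 2 / (Z0 + r ^+ 2) ->
  (r * p) * (Z0 + (r * p) ^+ 2) `^ c <=
  r * (Z0 + r ^+ 2) `^ c * ((1 - c * lam) * p + c * lam * p ^+ 3).
Proof.
move=> Z0_ge0 r0 c01 p0 lamE.
have Zp : 0 < Z0 + r ^+ 2 by rewrite ltr_wpDl// exprn_gt0.
have E : Z0 + (r * p) ^+ 2 = (Z0 + r ^+ 2) * (1 + lam * (p ^+ 2 - 1)).
  by rewrite lamE; field; rewrite gt_eqF.
have lam01 : 0 <= lam <= 1.
  by rewrite lamE divr_ge0 ?sqr_ge0 ?(ltW Zp)//= ler_pdivrMr// mul1r lerDr.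
have X0 : 0 <= 1 + lam * (p ^+ 2 - 1) by nra.
rewrite E powRM ?(ltW Zp)//.
have := powR_bernoulli X0 c01.
rewrite [1 + _ - 1]addrAC subrr add0r => H.
have -> : r * (Z0 + r ^+ 2) `^ c * ((1 - c * lam) * p + c * lam * p ^+ 3) =
  r * p * ((Z0 + r ^+ 2) `^ c * (1 + c * (lam * (p ^+ 2 - 1)))) by ring.
by rewrite ler_wpM2l ?mulr_ge0 ?(ltW r0)// ler_wpM2l// powR_ge0.
Qed.

(** The cubic bound is applied at both multipliers. Their cubes add up to 2, so only the linear
    parts lose, and 1 - c lam >= 1 - c bounds that loss from below whatever the base point. *)
Lemma barrier_second_diff (Z0 r c p q e : R) : 0 <= Z0 -> 0 < r -> 0 < c < 1 ->
  0 <= p -> 0 <= q -> p ^+ 3 = 1 + e -> q ^+ 3 = 1 - e ->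
  (r * p) * (Z0 + (r * p) ^+ 2) `^ c + (r * q) * (Z0 + (r * q) ^+ 2) `^ c
  - 2 * (r * (Z0 + r ^+ 2) `^ c)
  <= - ((1 - c) * (e ^+ 2 / 9)) * (r * (Z0 + r ^+ 2) `^ c).
Proof.
move=> Z0_ge0 r0 c01 p0 q0 pe qe.
have := barrier_mul_le Z0_ge0 r0 c01 p0 erefl.
have := barrier_mul_le Z0_ge0 r0 c01 q0 erefl.
have Zp : 0 < Z0 + r ^+ 2 by rewrite ltr_wpDl// exprn_gt0.
set lam := r ^+ 2 / (Z0 + r ^+ 2).
have lam01 : 0 <= lam <= 1.
  by rewrite /lam divr_ge0 ?sqr_ge0 ?(ltW Zp)//= ler_pdivrMr// mul1r lerDr.
set Y := r * (Z0 + r ^+ 2) `^ c => /= H1 H2.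
have Y0 : 0 <= Y by rewrite mulr_ge0 ?(ltW r0) ?powR_ge0.
have S := cube_sum_le p0 q0 pe qe.
suff : (1 - c * lam) * p + c * lam * p ^+ 3 + ((1 - c * lam) * q + c * lam * q ^+ 3)
   <= 2 - (1 - c) * (e ^+ 2 / 9).
  move=> /(ler_wpM2l Y0); lra.
rewrite pe qe.
have : (1 - c * lam) * (p + q) <= (1 - c * lam) * (2 - e ^+ 2 / 9).
  by rewrite ler_wpM2l// ; nra.
have e2 := sqr_ge0 e.
have : (1 - c) * (e ^+ 2 / 9) <= (1 - c * lam) * (e ^+ 2 / 9).
  by rewrite ler_wpM2r ?divr_ge0//; nra.
lra.
Qed.

(** The case of step one, where narrowing by two leads to step -1 and a change of sign: the stencil
    is the value at step 3 minus three times the value at step 1, and p is the cube root of 3. *)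
Lemma barrier_reflected_diff (Z0 r c p : R) : 0 <= Z0 -> 0 < r -> 0 < c < 1 ->
  0 <= p -> p ^+ 3 = 3 ->
  (r * p) * (Z0 + (r * p) ^+ 2) `^ c - 3 * (r * (Z0 + r ^+ 2) `^ c)
  <= - (1 - c) * (r * (Z0 + r ^+ 2) `^ c).
Proof.
move=> Z0_ge0 r0 c01 p0 pe.
have := barrier_mul_le Z0_ge0 r0 c01 p0 erefl.
have Zp : 0 < Z0 + r ^+ 2 by rewrite ltr_wpDl// exprn_gt0.
set lam := r ^+ 2 / (Z0 + r ^+ 2).
have lam01 : 0 <= lam <= 1.
  by rewrite /lam divr_ge0 ?sqr_ge0 ?(ltW Zp)//= ler_pdivrMr// mul1r lerDr.
set Y := r * (Z0 + r ^+ 2) `^ c => /= H1.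
have Y0 : 0 <= Y by rewrite mulr_ge0 ?(ltW r0) ?powR_ge0.
have p2 : p <= 2.
  by rewrite -(@ler_pXn2r _ 3) ?nnegrE// pe; lra.
suff : (1 - c * lam) * p + c * lam * p ^+ 3 <= 3 - (1 - c).
  move=> /(ler_wpM2l Y0); lra.
rewrite pe.
have : (1 - c * lam) * p <= (1 - c * lam) * 2 by rewrite ler_wpM2l//; nra.
nra.
Qed.

(** The quotient of x^al by x is nonincreasing, here without division. *)
Lemma powR_sublin x y al : 0 < x -> x <= y -> 0 <= al <= 1 ->
  y `^ al * x <= x `^ al * y.
Proof.
move=> x0 xy /andP[al0 al1].
have t1 : 1 <= y / x by rewrite ler_pdivlMr// mul1r.
have -> : y = x * (y / x) by rewrite mulrC divfK// gt_eqF.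
rewrite powRM ?(ltW x0) ?(le_trans ler01 t1)//.
rewrite -mulrA ler_wpM2l ?powR_ge0// mulrC ler_wpM2l ?(ltW x0)//.
exact: ler1_powR.
Qed.

Lemma powR_half_sq x al : 0 <= x -> (x ^+ 2) `^ (al / 2) = x `^ al.
Proof.
move=> x0; rewrite -powR_mulrn// -powRrM; congr (_ `^ _); lra.
Qed.

End PowerInequalities.

Section Barrier.
Context {R : realType}.
Variables (mu th d : R).
Hypotheses (mu0 : 0 < mu) (th0 : 0 < th) (th1 : th < 2^-1) (d0 : 0 < d).
Let mu_ge0 : 0 <= mu. Proof. exact: ltW. Qed.
Let d_ge0 : 0 <= d. Proof. exact: ltW. Qed.
Implicit Types (m n k : nat) (s t : R).

(** The geometric mean of the three step lengths. *)
Definition geo m n k : R := d * (m * n * k)%:R `^ 3^-1.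

Definition barrier s m n k : R :=
  geo m n k * (mu * s + geo m n k ^+ 2) `^ (2^-1 + th).

Lemma geo_ge0 m n k : 0 <= geo m n k.
Proof. by rewrite mulr_ge0 ?powR_ge0. Qed.

Lemma cbrtK (x : R) : 0 <= x -> (x `^ 3^-1) ^+ 3 = x.
Proof.
by move=> x0; rewrite -powR_mulrn ?powR_ge0// -powRrM mulVf ?powRr1// pnatr_eq0.
Qed.

Lemma geo3 m n k : geo m n k ^+ 3 = (m%:R * d) * (n%:R * d) * (k%:R * d).
Proof. by rewrite exprMn cbrtK// !natrM; ring. Qed.

Lemma geo_gt0 m n k : (0 < m)%N -> (0 < n)%N -> (0 < k)%N -> 0 < geo m n k.
Proof.
move=> m0 n0 k0; rewrite mulr_gt0// powR_gt0// ltr0n !muln_gt0.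
by rewrite m0 n0 k0.
Qed.

Lemma geoCA m n k : geo m n k = geo n m k.
Proof. by rewrite /geo (mulnC m). Qed.

Lemma geoAC m n k : geo m n k = geo m k n.
Proof. by rewrite /geo mulnAC. Qed.

Lemma barrierCA s m n k : barrier s m n k = barrier s n m k.
Proof. by rewrite /barrier geoCA. Qed.

Lemma barrierAC s m n k : barrier s m n k = barrier s m k n.
Proof. by rewrite /barrier geoAC. Qed.

Lemma barrier_ge0 s m n k : 0 <= barrier s m n k.
Proof. by rewrite mulr_ge0 ?powR_ge0 ?geo_ge0. Qed.

Lemma geo_min m n k : (m <= n)%N -> (m <= k)%N -> m%:R * d <= geo m n k.
Proof.
move=> mn mk.
rewrite -(@ler_pXn2r _ 3) ?nnegrE ?geo_ge0 ?mulr_ge0// geo3.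
have -> : (m%:R * d) ^+ 3 = (m%:R * d) * (m%:R * d) * (m%:R * d) by ring.
by apply: ler_pM; rewrite ?mulr_ge0// ?ler_wpM2r ?ler_nat// ?ler_wpM2l ?mulr_ge0// ?ler_wpM2r ?ler_nat.
Qed.

Lemma geo_max m n k : (n <= m)%N -> (k <= m)%N -> geo m n k <= m%:R * d.
Proof.
move=> mn mk.
rewrite -(@ler_pXn2r _ 3) ?nnegrE ?geo_ge0 ?mulr_ge0// geo3.
have -> : (m%:R * d) ^+ 3 = (m%:R * d) * (m%:R * d) * (m%:R * d) by ring.
by apply: ler_pM; rewrite ?mulr_ge0// ?ler_wpM2r ?ler_nat// ?ler_wpM2l ?mulr_ge0// ?ler_wpM2r ?ler_nat.
Qed.

(** Changing one index multiplies [geo] by a cube root, so the multipliers in the barrier bounds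
    satisfy p^3 = m' / m, which is 1 + 2/m or 1 - 2/m for the neighbours m + 2 and m - 2. *)
Lemma geo_mul m m' n k : (0 < m)%N ->
  geo m' n k = geo m n k * (m'%:R / m%:R) `^ 3^-1.
Proof.
move=> m0; rewrite /geo -mulrA -powRM ?divr_ge0//; congr (_ * _ `^ _).
by rewrite !natrM; field; rewrite pnatr_eq0 -lt0n.
Qed.

Lemma barrier_concave s m n k : 0 <= s -> (1 < m)%N -> (0 < n)%N -> (0 < k)%N ->
  barrier s (m + 2) n k + barrier s (m - 2) n k - 2 * barrier s m n k
  <= - ((2^-1 - th) * (4 / 9) / m%:R ^+ 2) * barrier s m n k.
Proof.
move=> s0 m1 n0 k0; have m0 : (0 < m)%N by exact: ltnW.
have mR : (m%:R : R) != 0 by rewrite pnatr_eq0 -lt0n.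
rewrite /barrier (geo_mul (m + 2) n k m0) (geo_mul (m - 2) n k m0).
have := @barrier_second_diff R (mu * s) (geo m n k) (2^-1 + th)
  (((m + 2)%:R / m%:R) `^ 3^-1) (((m - 2)%:R / m%:R) `^ 3^-1) (2 / m%:R).
rewrite (mulr_ge0 mu_ge0 s0) (geo_gt0 m0 n0 k0) !powR_ge0 !cbrtK ?divr_ge0//.
have -> : 0 < 2^-1 + th < 1 by move: th0 th1 => *; lra.
move=> /(_ isT isT isT isT isT) H.
have -> : (2^-1 - th) * (4 / 9) / m%:R ^+ 2 =
   (1 - (2^-1 + th)) * ((2 / m%:R) ^+ 2 / 9) by field.
apply: H.
- by rewrite natrD; field.
- by rewrite natrB//; field.
Qed.

(** The division by [1 ^+ 2] gives the form of [barrier_concave] at m = 1, so that one constant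
    serves both cases; it fits because 4/9 is at most 1. *)
Lemma barrier_concave1 s n k : 0 <= s -> (0 < n)%N -> (0 < k)%N ->
  barrier s 3 n k - 3 * barrier s 1 n k
  <= - ((2^-1 - th) * (4 / 9) / 1 ^+ 2) * barrier s 1 n k.
Proof.
move=> s0 n0 k0; rewrite /barrier (geo_mul 3 n k (ltn0Sn 0)) divr1.
have := @barrier_reflected_diff R (mu * s) (geo 1 n k) (2^-1 + th)
  (3 `^ 3^-1).
rewrite (mulr_ge0 mu_ge0 s0) (geo_gt0 (ltn0Sn 0) n0 k0) !powR_ge0 !cbrtK//.
have -> : 0 < 2^-1 + th < 1 by move: th0 th1 => *; lra.
move=> /(_ isT isT isT isT erefl) /le_trans; apply.
rewrite ler_wpM2r ?barrier_ge0// expr1n; move: th1 => ?; lra.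
Qed.

(** From (mu s + r^2)^(1/2) >= r. The remaining factor (mu s + r^2)^th dominates both r^(2 th) and
    (mu s)^th, the two shapes in which the source of the difference equation is estimated. *)
Lemma barrier_Z s m n k : 0 <= s -> (0 < m)%N -> (0 < n)%N -> (0 < k)%N ->
  barrier s m n k >=
  geo m n k ^+ 2 * (mu * s + geo m n k ^+ 2) `^ th.
Proof.
move=> s0 m0 n0 k0; rewrite /barrier.
have g0 := geo_gt0 m0 n0 k0; set r := geo m n k in g0 *.
have Z0 : 0 < mu * s + r ^+ 2 by rewrite ltr_wpDl ?exprn_gt0// mulr_ge0// ltW.
rewrite powRD; last by rewrite (gt_eqF Z0) implybT.
rewrite mulrA ler_wpM2r ?powR_ge0// expr2 ler_wpM2l ?(ltW g0)//.
rewrite powR12_sqrt ?(ltW Z0)// -[leLHS](ger0_norm (ltW g0)) -sqrtr_sqr.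
by rewrite ler_wsqrtr// lerDr mulr_ge0// ltW.
Qed.

(** At s = 0 the barrier is r^(2 + 2 th), the size of a third difference of a function whose second
    derivative is Holder continuous. *)
Lemma barrier_zero m n k : (0 < m)%N -> (0 < n)%N -> (0 < k)%N ->
  barrier 0 m n k = geo m n k ^+ 2 * geo m n k `^ (2 * th).
Proof.
move=> m0 n0 k0; have g0 := geo_gt0 m0 n0 k0.
rewrite /barrier mulr0 add0r powRD; last by rewrite sqrf_eq0 (gt_eqF g0) implybT.
have -> : th = 2 * th / 2 by field.
rewrite powR_half_sq ?(ltW g0)// powR12_sqrt ?sqr_ge0// sqrtr_sqr ger0_norm ?(ltW g0)//.
by rewrite expr2 mulrA; congr (_ * _ `^ _); field.
Qed.

(* The drift [mu s] is slow enough for the decrease of the barrier in time to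
   be dominated by its concavity. *)
Lemma barrier_time s t m n k : 0 <= t <= s ->
  (0 < m)%N -> (0 < n)%N -> (0 < k)%N ->
  barrier s m n k - mu * (s - t) * (barrier s m n k / geo m n k ^+ 2)
  <= barrier t m n k.
Proof.
move=> /andP[t0 ts] m0 n0 k0; rewrite /barrier.
have g0 := geo_gt0 m0 n0 k0; set r := geo m n k in g0 *.
have r20 : 0 < r ^+ 2 by exact: exprn_gt0.
have s0 : 0 <= s by exact: le_trans ts.
set Z := mu * s + r ^+ 2; set Z' := mu * t + r ^+ 2.
have Zr : r ^+ 2 <= Z by rewrite lerDr mulr_ge0// ltW.
have Z0 : 0 < Z by exact: lt_le_trans Zr.
have Zr' : r ^+ 2 <= Z' by rewrite lerDr mulr_ge0// ltW.
have Z0' : 0 < Z' by exact: lt_le_trans Zr'.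
have ZZ : Z' <= Z by rewrite lerD2r ler_wpM2l// ltW.
have E : Z' = Z * (Z' / Z) by rewrite mulrC divfK// gt_eqF.
have q01 : 0 < Z' / Z <= 1 by rewrite divr_gt0//= ler_pdivrMr// mul1r.
rewrite [in leRHS]E powRM ?(ltW Z0)//; last by case/andP: q01 => /ltW.
have q : Z' / Z <= (Z' / Z) `^ (2^-1 + th) by apply: ger1_powR => //; move: th1 => ?; lra.
have Y0 : 0 <= r * Z `^ (2^-1 + th) by rewrite mulr_ge0 ?powR_ge0// ltW.
rewrite (mulrA r); set Y := r * Z `^ _ in Y0 *.
have : Y * (Z' / Z) <= Y * (Z' / Z) `^ (2^-1 + th) by exact: ler_wpM2l.
apply: le_trans.
have -> : Z' / Z = 1 - mu * (s - t) / Z by rewrite /Z' /Z; field; rewrite gt_eqF.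
rewrite [in leRHS]mulrBr mulr1 lerD2l lerN2.
have -> : Y * (mu * (s - t) / Z) = mu * (s - t) * Y * Z^-1 by ring.
rewrite (mulrA (mu * (s - t))) ler_wpM2l ?lef_pV2 ?posrE//.
by rewrite (mulr_ge0 _ Y0)// mulr_ge0// subr_ge0.
Qed.

End Barrier.


(** * Mixed differences and the discrete Laplacian *)

Section Differences.
Context {R : realType}.
Implicit Types (m n k : nat) (v w : int -> R) (b j : int).

Definition sdiff m v b : R := v (b + m%:Z) - v b.

Definition lap v j : R := v (j + 1) + v (j - 1) - 2 * v j.

Lemma sdiffC m n v : sdiff m (sdiff n v) = sdiff n (sdiff m v).
Proof. by apply/funext => b; rewrite /sdiff (addrAC b); ring. Qed.

Lemma sdiff_lap m v : sdiff m (lap v) = lap (sdiff m v).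
Proof.
apply/funext => b; rewrite /sdiff /lap (addrAC b 1) (addrAC b (- 1)); ring.
Qed.

(** Both shifted differences keep the centre b + m/2. At a fixed centre the Laplacian in space is
    therefore a second difference of step two in the index m. *)
Lemma lap_sdiff m v b : (1 < m)%N ->
  lap (sdiff m v) b =
  sdiff (m + 2) v (b - 1) + sdiff (m - 2) v (b + 1) - 2 * sdiff m v b.
Proof.
move=> m1; rewrite /lap /sdiff.
have -> : b - 1 + (m + 2)%:Z = b + 1 + m%:Z by lia.
have -> : b + 1 + (m - 2)%:Z = b - 1 + m%:Z by lia.
ring.
Qed.

(** For m = 1 the narrowed difference has step -1 and is the negative of the original one, which
    turns the coefficient 2 into 3. *)
Lemma lap_sdiff1 v b : lap (sdiff 1 v) b = sdiff 3 v (b - 1) - 3 * sdiff 1 v b.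
Proof.
rewrite /lap /sdiff.
have -> : b - 1 + 3%:Z = b + 1 + 1 by lia.
have -> : b - 1 + 1 = b by lia.
have -> : b + 1%:Z = b + 1 by [].
ring.
Qed.

Definition diff3 m n k v b : R := sdiff m (sdiff n (sdiff k v)) b.

Lemma diff3CA m n k v : diff3 m n k v = diff3 n m k v.
Proof. by apply/funext => b; rewrite /diff3 sdiffC. Qed.

Lemma diff3AC m n k v : diff3 m n k v = diff3 m k n v.
Proof. by apply/funext => b; rewrite /diff3 (sdiffC n). Qed.

Lemma diff3_lap m n k v : diff3 m n k (lap v) = lap (diff3 m n k v).
Proof. by rewrite /diff3 !sdiff_lap. Qed.

Lemma diff3_0 n k v b : diff3 0 n k v b = 0.
Proof. by rewrite /diff3 /sdiff !addr0 subrr. Qed.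

Lemma diff3_step m n k v v' r b (c e : R) :
  (forall j, (b <= j <= b + m%:Z + n%:Z + k%:Z) ->
    v' j = v j + c * lap v j + e * r j) ->
  diff3 m n k v' b =
  diff3 m n k v b + c * lap (diff3 m n k v) b + e * diff3 m n k r b.
Proof.
move=> H; rewrite -diff3_lap /diff3 /sdiff !H; first ring; lia.
Qed.

(** A common form for m > 1 and m = 1: the diagonal coefficient c is 2 or 3, and the concavity
    constant C is the amount by which the off-diagonal part stays below c times the barrier. The
    relation between b' and m' expresses the fixed centre. *)
Lemma lap_dominated m w b (psi : nat -> R) (C : R) : (0 < m)%N ->
  (forall m' b', (b' *+ 2 + m'%:Z = b *+ 2 + m%:Z) -> (m' <= m + 2)%N ->
     `|sdiff m' w b'| <= psi m') ->
  ((1 < m)%N -> psi (m + 2)%N + psi (m - 2)%N - 2 * psi m <= - C * psi m) ->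
  (m = 1%N -> psi 3 - 3 * psi 1%N <= - C * psi 1%N) ->
  exists P c, [/\ lap (sdiff m w) b = P - c * sdiff m w b, 2 <= c <= 3 &
    `|P| <= (c - C) * psi m].
Proof.
move=> m0 H H2 H1; case: (ltnP 1 m) => [m1|m1].
  exists (sdiff (m + 2) w (b - 1) + sdiff (m - 2) w (b + 1)), 2.
  rewrite lap_sdiff//; split => //; first by rewrite lexx /= ler_nat.
  have h1 : `|sdiff (m + 2) w (b - 1)| <= psi (m + 2)%N by apply: H; lia.
  have h2 : `|sdiff (m - 2) w (b + 1)| <= psi (m - 2)%N by apply: H; lia.
  by have h3 := H2 m1; apply: le_trans (ler_normD _ _) _; lra.
have {m0}m1 : m = 1%N by lia.
subst m; exists (sdiff 3 w (b - 1)), 3.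
rewrite lap_sdiff1//; split => //; first by rewrite lexx ler_nat.
have h1 : `|sdiff 3 w (b - 1)| <= psi 3 by apply: H; lia.
by have h3 := H1 erefl; lra.
Qed.

End Differences.

Section OctantArithmetic.
Context {R : realType}.

Lemma scaled_second_diff (x y z C NN i2 : R) :
  NN * (x + y - 2 * z) <= NN * (- (C / i2) * z) ->
  NN * x + NN * y - 2 * (NN * z) <= - (C / i2) * (NN * z).
Proof. by lra. Qed.

Lemma scaled_reflected_diff (x z C NN i2 : R) :
  NN * (x - 3 * z) <= NN * (- (C / i2) * z) ->
  NN * x - 3 * (NN * z) <= - (C / i2) * (NN * z).
Proof. by lra. Qed.

Lemma src_arith (x M1 M2 c q : R) : x <= M1 * q + M2 * (c * q) ->
  4 * x <= 4 * (M1 + M2 * c) * q.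
Proof. by lra. Qed.

Lemma mean3_arith (C X x y z : R) : 0 <= C -> 3 * X <= x + y + z ->
  C * X <= (C * x + C * y + C * z) / 3.
Proof. by move=> C0 /(ler_wpM2l C0); lra. Qed.

Lemma surplus_arith (lam kap0 kap X Y : R) : 0 <= lam -> 0 <= kap0 ->
  kap0 <= kap -> 0 <= X -> X <= Y / 3 -> lam * kap0 * X <= lam * kap / 3 * Y.
Proof.
move=> l0 k0 kk X0 XY.
have H1 : lam * kap0 * X <= lam * kap * X by rewrite ler_wpM2r// ler_wpM2l.
have H2 : lam * kap * X <= lam * kap * (Y / 3).
  by rewrite ler_wpM2l// mulr_ge0// (le_trans k0).
lra.
Qed.

(** The Laplacian is the mean of its three representations, one per direction. Each c_i is at most
    3, so 3 lam kap <= 1 keeps the coefficient of w nonnegative. The concavity surplus is spent in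
    two halves: on the source S and on the decrease of the barrier in time. *)
Lemma octant_step_bound (w L S P1 P2 P3 c1 c2 c3 C1 C2 C3 p q NN p' lam kap dt mu : R) :
  L = P1 - c1 * w -> L = P2 - c2 * w -> L = P3 - c3 * w ->
  2 <= c1 <= 3 -> 2 <= c2 <= 3 -> 2 <= c3 <= 3 ->
  `|P1| <= (c1 - C1) * (NN * p) -> `|P2| <= (c2 - C2) * (NN * p) ->
  `|P3| <= (c3 - C3) * (NN * p) -> `|w| <= NN * p ->
  0 <= NN -> 0 <= p -> 0 <= q -> 0 <= lam * kap -> 0 <= dt ->
  3 * lam * kap <= 1 -> `|S| <= mu * (NN * q) ->
  2 * mu * dt * (NN * q) <= lam * kap / 3 * (C1 + C2 + C3) * (NN * p) ->
  p - mu * dt * q <= p' ->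
  `|w + lam * kap * L + dt * S| <= NN * p'.
Proof.
move=> L1 L2 L3 c1b c2b c3b A1 A2 A3 W NN0 p0 q0 lk0 dt0 cfl Sq surplus T.
set lk := lam * kap in lk0 surplus *.
have dtS : dt * `|S| <= mu * dt * (NN * q).
  by have := ler_wpM2l dt0 Sq; rewrite mulrCA mulrA.
have Le : w + lk * L + dt * S = (1 - lk / 3 * (c1 + c2 + c3)) * w +
   lk / 3 * (P1 + P2 + P3) + dt * S.
  have Ll : 3 * L = P1 + P2 + P3 - (c1 + c2 + c3) * w by lra.
  have -> : L = (P1 + P2 + P3 - (c1 + c2 + c3) * w) / 3 by lra.
  by field.
have co : 0 <= 1 - lk / 3 * (c1 + c2 + c3).
  have : lk / 3 * (c1 + c2 + c3) <= lk / 3 * 9.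
    by rewrite ler_wpM2l ?divr_ge0//; lra.
  by rewrite /lk; lra.
have N1 : `|(1 - lk / 3 * (c1 + c2 + c3)) * w| <=
    (1 - lk / 3 * (c1 + c2 + c3)) * (NN * p).
  by rewrite normrM ger0_norm// ler_wpM2l.
have N2 : `|lk / 3 * (P1 + P2 + P3)| <= lk / 3 *
    ((c1 + c2 + c3 - (C1 + C2 + C3)) * (NN * p)).
  rewrite normrM ger0_norm ?divr_ge0// ler_wpM2l ?divr_ge0//.
  apply: (le_trans (ler_normD _ _)); have := ler_normD P1 P2; lra.
have N3 : `|dt * S| <= mu * dt * (NN * q) by rewrite normrM (ger0_norm dt0).
rewrite Le.
apply: (@le_trans _ _ (NN * p - lk / 3 * (C1 + C2 + C3) * (NN * p) + mu * dt * (NN * q))).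
  apply: (le_trans (ler_normD _ _)).
  have := ler_normD ((1 - lk / 3 * (c1 + c2 + c3)) * w) (lk / 3 * (P1 + P2 + P3)).
  lra.
have {T} := ler_wpM2l NN0 T; apply: le_trans.
lra.
Qed.

End OctantArithmetic.

(** * The maximum principle in the octant of steps *)

Section OctantMaxPrinciple.
Context {R : realType}.

(** Chosen so that 2 mu is [kap0] times the concavity constant (1/2 - th) 4/9: the surplus then pays
    for the source and for the drift mu s in equal parts. *)
Definition octant_mu (kap0 th : R) : R := kap0 * ((2^-1 - th) * (2 / 9)).

(* Any [NN] above the listed thresholds makes [NN * barrier] a supersolution
   on the octant cut off at [k0]. *)
Record octant_data (al kap0 kap lam d M0 M1 M2 M3 B NN : R) (k0 N : nat)
    (c0 : int) (v r : nat -> int -> R) : Prop := OctantData {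
  od_al : 0 < al < 1;
  od_kap0 : 0 < kap0 <= kap;
  od_lam : 0 < lam;
  od_cfl : 3 * lam * kap <= 1;
  od_d : 0 < d;
  od_k0 : (2 < k0)%N;
  od_M1 : 0 <= M1;
  od_M2 : 0 <= M2;
  od_M0 : 0 <= M0;
  od_M3 : 0 <= M3;
  od_B : 0 <= B;
  od_eq : forall n j, (n < N)%N ->
    - ((3 * k0)%N%:Z) <= j *+ 2 - c0 <= (3 * k0)%N%:Z ->
    v n.+1 j = v n j + lam * kap * lap (v n) j + lam * d ^+ 2 * r n j;
  od_src : forall n j m, (n < N)%N -> (m <= k0)%N ->
    - ((3 * k0)%N%:Z) <= j *+ 2 - c0 -> (j + m%:Z) *+ 2 - c0 <= (3 * k0)%N%:Z ->
    `|sdiff m (r n) j| <= M1 * (m%:R * d) `^ al +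
                          M2 * ((N - n)%:R * (lam * d ^+ 2)) `^ (al / 2);
  od_face : forall n j m k, (n <= N)%N -> (m <= k0)%N -> (k <= k0)%N ->
    - ((3 * k0)%N%:Z) <= j *+ 2 - c0 ->
    (j + m%:Z + k%:Z) *+ 2 - c0 <= (3 * k0)%N%:Z ->
    `|sdiff m (sdiff k (v n)) j| <= B * ((m%:R * d) * (k%:R * d));
  od_init : forall b m n k, (m <= k0)%N -> (n <= k0)%N -> (k <= k0)%N ->
    b *+ 2 + (m + n + k)%:Z = c0 ->
    `|diff3 m n k (v 0%N) b| <= (n%:R * d) * (k%:R * d) *
      (M0 * (m%:R * d) `^ al + M3 * (N%:R * (lam * d ^+ 2)) `^ (al / 2));
  od_NN0 : M0 + M3 * octant_mu kap0 (al / 2) `^ (- (al / 2)) <= NN;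
  od_NN1 : 4 * (M1 + M2 * octant_mu kap0 (al / 2) `^ (- (al / 2)))
             <= octant_mu kap0 (al / 2) * NN;
  od_NN2 : 4 * B * (k0%:R * d) `^ (- al) <= NN }.

Variables (al kap0 kap lam d M0 M1 M2 M3 B NN : R) (k0 N : nat) (c0 : int).
Variables (v r : nat -> int -> R).
Hypothesis D : octant_data al kap0 kap lam d M0 M1 M2 M3 B NN k0 N c0 v r.

Let th := al / 2.
Let mu := octant_mu kap0 th.
Let dt := lam * d ^+ 2.
(** Time runs backwards in the barrier: its argument is the time left until level N. Coefficients
    are frozen at that level, so the source shrinks as n approaches N, and the sharp bound is
    reached there. *)
Let psi n := barrier mu th d ((N - n)%:R * dt).

Let th0 : 0 < th.
Proof. by case/andP: (od_al D) => ? ?; rewrite divr_gt0. Qed.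

Let th1 : th < 2^-1.
Proof. by case/andP: (od_al D) => ? ?; rewrite /th; lra. Qed.

Let mu0 : 0 < mu.
Proof.
have ? := th1; case/andP: (od_kap0 D) => ? ?.
by rewrite /mu /octant_mu mulr_gt0// mulr_gt0//; lra.
Qed.

Let dt0 : 0 < dt.
Proof. by rewrite mulr_gt0 ?(od_lam D)// exprn_gt0// (od_d D). Qed.

Let d_gt0 := od_d D.

Lemma mu_th_inv (s : R) : 0 <= s -> s `^ th <= mu `^ (- th) * (mu * s) `^ th.
Proof.
move=> s0; rewrite powRM ?(ltW mu0)// mulrA -powRD ?addNr ?powRr0 ?mul1r//.
by rewrite (gt_eqF mu0) implybT.
Qed.

(** The barrier divided by r^2 measures what diffusion can absorb per unit of time. It dominates
    r^al and, up to the factor mu^(-th), also s^th; hence it dominates the source. *)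
Lemma barrier_src (s : R) m n k : 0 <= s -> (0 < m)%N -> (0 < n)%N -> (0 < k)%N ->
  geo d m n k `^ al <= barrier mu th d s m n k / geo d m n k ^+ 2 /\
  s `^ th <= mu `^ (- th) * (barrier mu th d s m n k / geo d m n k ^+ 2).
Proof.
move=> s0 m0 n0 k0'.
have g0 := geo_gt0 d_gt0 m0 n0 k0'.
have H := barrier_Z th mu0 d_gt0 s0 m0 n0 k0'.
have {}H : (mu * s + geo d m n k ^+ 2) `^ th <=
    barrier mu th d s m n k / geo d m n k ^+ 2.
  by rewrite ler_pdivlMr ?exprn_gt0// mulrC.
have ms : 0 <= mu * s by rewrite mulr_ge0// ltW.
split.
  apply: le_trans H; rewrite -(powR_half_sq al (ltW g0)).
  by apply: ge0_ler_powR; rewrite ?(ltW th0) ?nnegrE ?addr_ge0 ?sqr_ge0// lerDr.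
apply: le_trans (mu_th_inv s0) _; rewrite ler_wpM2l ?powR_ge0//.
apply: le_trans H; apply: ge0_ler_powR; rewrite ?(ltW th0) ?nnegrE ?addr_ge0 ?sqr_ge0//.
by rewrite lerDl sqr_ge0.
Qed.

Lemma NN_ge0 : 0 <= NN.
Proof.
by apply: le_trans (od_NN0 D); rewrite addr_ge0 ?mulr_ge0 ?powR_ge0 ?(od_M0 D) ?(od_M3 D).
Qed.

(** By symmetry m may be taken largest, and the Holder modulus is used in that step: with g^3 = (m
    d)(n d)(k d) and m d >= g, sublinearity of the power gives (n d)(k d)(m d)^al <= g^(2 + al). *)
Lemma octant_init (b : int) m n k : (m <= k0)%N -> (n <= k0)%N -> (k <= k0)%N ->
  b *+ 2 + (m + n + k)%:Z = c0 ->
  `|diff3 m n k (v 0%N) b| <= NN * psi 0 m n k.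
Proof.
have zero n' k' b' : `|diff3 0 n' k' (v 0%N) b'| <= NN * psi 0 0 n' k'.
  by rewrite diff3_0 normr0 mulr_ge0 ?NN_ge0// barrier_ge0// d_gt0.
have /andP[/ltW al0 /ltW al1] := od_al D.
have H m' n' k' (b' : int) : (n' <= m')%N -> (k' <= m')%N ->
    (m' <= k0)%N -> (n' <= k0)%N -> (k' <= k0)%N ->
    b' *+ 2 + (m' + n' + k')%:Z = c0 ->
    `|diff3 m' n' k' (v 0%N) b'| <= NN * psi 0 m' n' k'.
  move=> nm km mk nk kk E.
  case: (posnP m') => [->//|m'0].
  case: (posnP n') => [->|n'0].
    by rewrite diff3CA /psi barrierCA; exact: zero.
  case: (posnP k') => [->|k'0].
    by rewrite diff3AC diff3CA /psi barrierAC barrierCA; exact: zero.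
  apply: le_trans (od_init D mk nk kk E) _.
  rewrite /psi subn0; set S := N%:R * dt.
  have S0 : 0 <= S by rewrite mulr_ge0// ltW.
  have [h1 h2] := barrier_src S0 m'0 n'0 k'0.
  have g0 := geo_gt0 d_gt0 m'0 n'0 k'0.
  set g := geo d m' n' k' in g0 h1 h2 *; set b0 := barrier _ _ _ _ _ _ _ in h1 h2 *.
  have gm : g <= m'%:R * d by exact: geo_max.
  have g3 : g ^+ 3 = (m'%:R * d) * (n'%:R * d) * (k'%:R * d) by exact: geo3.
  have m'd0 : 0 < m'%:R * d by rewrite mulr_gt0 ?ltr0n ?d_gt0.
  set y := m'%:R * d in gm g3 m'd0 *.
  have nk0 : 0 <= (n'%:R * d) * (k'%:R * d) by rewrite !mulr_ge0 ?(ltW d_gt0).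
  set x := (n'%:R * d) * (k'%:R * d) in nk0 *.
  have {}g3 : g ^+ 3 = y * x by rewrite g3 /x [RHS]mulrA.
  have x2 : x <= g ^+ 2.
    rewrite -(ler_pM2l m'd0) -g3 exprS ler_wpM2r ?sqr_ge0//.
  have e1 : x * y `^ al <= b0.
    have : x * y `^ al <= g ^+ 2 * g `^ al.
      rewrite -(ler_pM2r g0).
      have : x * (y `^ al * g) <= x * (g `^ al * y).
        by rewrite ler_wpM2l// powR_sublin// al0.
      rewrite mulrA => /le_trans; apply.
      have -> : x * (g `^ al * y) = g `^ al * (y * x) by ring.
      by rewrite -g3; have -> : g `^ al * g ^+ 3 = g ^+ 2 * g `^ al * g by ring.
    move=> /le_trans; apply.
    have -> : b0 = g ^+ 2 * (b0 / g ^+ 2) by field; rewrite gt_eqF.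
    by rewrite ler_wpM2l ?sqr_ge0.
  have e2 : x * S `^ th <= mu `^ (- th) * b0.
    have -> : mu `^ (- th) * b0 = g ^+ 2 * (mu `^ (- th) * (b0 / g ^+ 2)).
      by field; rewrite gt_eqF.
    by apply: ler_pM; rewrite ?powR_ge0.
  rewrite mulrDr !(mulrCA x).
  apply: (@le_trans _ _ ((M0 + M3 * mu `^ (- th)) * b0)).
    rewrite mulrDl -mulrA lerD// ler_wpM2l ?(od_M0 D) ?(od_M3 D)//.
  rewrite ler_wpM2r ?(od_NN0 D)//.
  by rewrite barrier_ge0// d_gt0.
move=> mk nk kk E.
have [/andP[h1 h2]|] := boolP ((n <= m)%N && (k <= m)%N); first exact: H.
have [/andP[h1 h2] _|] := boolP ((m <= n)%N && (k <= n)%N).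
  by rewrite diff3CA /psi barrierCA; apply: H => //; move: h1 h2 E; clear; lia.
move=> h1 h2.
rewrite diff3AC diff3CA /psi barrierAC barrierCA.
by apply: H => //; move: h1 h2 E; clear; lia.
Qed.

(** By symmetry m may be taken smallest, so that m d is at most [geo]. The difference over m is
    bounded at the four corners spanned by the other two steps, whence the factor 4. *)
Lemma octant_src l (b : int) m n k : (l < N)%N ->
  (0 < m <= k0)%N -> (0 < n <= k0)%N -> (0 < k <= k0)%N ->
  b *+ 2 + (m + n + k)%:Z = c0 ->
  `|diff3 m n k (r l) b| <=
    4 * (M1 * geo d m n k `^ al + M2 * ((N - l)%:R * dt) `^ th).
Proof.
move=> lN.
have H m' n' k' (b' : int) : (m' <= n')%N -> (m' <= k')%N ->
    (0 < m' <= k0)%N -> (0 < n' <= k0)%N -> (0 < k' <= k0)%N ->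
    b' *+ 2 + (m' + n' + k')%:Z = c0 ->
    `|diff3 m' n' k' (r l) b'| <=
      4 * (M1 * geo d m' n' k' `^ al + M2 * ((N - l)%:R * dt) `^ th).
  move=> mn mk /andP[m0 mk0] /andP[n0 nk0] /andP[k'0 kk0] E.
  have S j : (b' <= j <= b' + n'%:Z + k'%:Z) ->
      `|sdiff m' (r l) j| <= M1 * geo d m' n' k' `^ al + M2 * ((N - l)%:R * dt) `^ th.
    move=> /andP[j1 j2]; apply: (le_trans (od_src D (j := j) lN mk0 _ _)).
    - by move: j1 j2 E mk0 nk0 kk0; clear; lia.
    - by move: j1 j2 E mk0 nk0 kk0; clear; lia.
    rewrite lerD2r ler_wpM2l ?(od_M1 D)//.
    have /andP[/ltW al0 _] := od_al D.
    apply: ge0_ler_powR; rewrite ?nnegrE ?geo_ge0 ?mulr_ge0 ?(ltW d_gt0)//.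
    exact: geo_min.
  rewrite diff3CA diff3AC /diff3.
  have s1 : `|sdiff m' (r l) b'| <= _ := S _ _.
  have s2 : `|sdiff m' (r l) (b' + n'%:Z)| <= _ := S _ _.
  have s3 : `|sdiff m' (r l) (b' + k'%:Z)| <= _ := S _ _.
  have s4 : `|sdiff m' (r l) (b' + n'%:Z + k'%:Z)| <= _ := S _ _.
  set u := sdiff m' (r l) in s1 s2 s3 s4 *.
  have -> : sdiff n' (sdiff k' u) b' = u (b' + n'%:Z + k'%:Z) - u (b' + n'%:Z)
      - (u (b' + k'%:Z) - u b') by [].
  have := s1 ltac:(clear; lia); have := s2 ltac:(clear; lia).
  have := s3 ltac:(clear; lia); have := s4 ltac:(clear; lia).
  rewrite !ler_norml => /andP[? ?] /andP[? ?] /andP[? ?] /andP[? ?].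
  apply/andP; split; lra.
move=> mk nk kk E.
have [/andP[h1 h2]|] := boolP ((m <= n)%N && (m <= k)%N); first exact: H.
have [/andP[h1 h2] _|] := boolP ((n <= m)%N && (n <= k)%N).
  by rewrite diff3CA geoCA; apply: H => //; move: h1 h2 E; clear; lia.
move=> h1 h2.
rewrite diff3AC diff3CA geoAC geoCA.
by apply: H => //; move: h1 h2 E; clear; lia.
Qed.

(** Moves change a step by two, so the outer face has two layers, m = k0 - 1 and m = k0. There m d
    is comparable with the cutoff length k0 d, and the crude bound on second differences is
    enough. *)
Lemma octant_face l (b : int) m n k : (l <= N)%N -> (k0 <= m.+1)%N ->
  (0 < m <= k0)%N -> (0 < n <= k0)%N -> (0 < k <= k0)%N ->
  b *+ 2 + (m + n + k)%:Z = c0 ->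
  `|diff3 m n k (v l) b| <= NN * psi l m n k.
Proof.
move=> lN km /andP[m0 mk0] /andP[n0 nk0] /andP[k'0 kk0] E.
have /andP[/ltW al0 /ltW al1] := od_al D.
have s1 := od_face D (j := b) lN nk0 kk0
  ltac:(move: mk0 nk0 kk0 E; clear; lia) ltac:(move: mk0 nk0 kk0 E; clear; lia).
have s2 := od_face D (j := b + m%:Z) lN nk0 kk0
  ltac:(move: mk0 nk0 kk0 E; clear; lia) ltac:(move: mk0 nk0 kk0 E; clear; lia).
have S0 : 0 <= (N - l)%:R * dt by rewrite mulr_ge0// ltW.
have [h1 _] := barrier_src S0 m0 n0 k'0.
have g0 := geo_gt0 d_gt0 m0 n0 k'0.
have k00 : 0 < k0%:R * d :> R by rewrite mulr_gt0 ?d_gt0// ltr0n; move: m0 mk0; clear; lia.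
have gK : geo d m n k <= k0%:R * d.
  rewrite -(@ler_pXn2r _ 3) ?nnegrE ?(ltW g0) ?(ltW k00)// geo3.
  have -> : (k0%:R * d) ^+ 3 = (k0%:R * d) * (k0%:R * d) * (k0%:R * d) by ring.
  have d0 := ltW d_gt0.
  by apply: ler_pM; rewrite ?mulr_ge0// ?ler_pM ?mulr_ge0 ?ler_wpM2r ?ler_nat.
have yK : k0%:R * d <= 2 * (m%:R * d).
  rewrite mulrA ler_wpM2r ?(ltW d_gt0)// -natrM ler_nat.
  by move: (od_k0 D) km; clear; lia.
have g3 := geo3 d m n k.
have -> : diff3 m n k (v l) b = sdiff n (sdiff k (v l)) (b + m%:Z) -
   sdiff n (sdiff k (v l)) b by [].
rewrite /psi; set b0 := barrier _ _ _ _ _ _ _ in h1 *.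
set g := geo d m n k in g0 h1 gK g3 *.
set K := k0%:R * d in k00 gK yK *; set y := m%:R * d in g3 yK.
set x := (n%:R * d) * (k%:R * d) in s1 s2.
have {}g3 : g ^+ 3 = y * x by rewrite g3 /x [RHS]mulrA.
have x0 : 0 <= x by rewrite !mulr_ge0 ?(ltW d_gt0).
have xK : x * K <= 2 * g ^+ 3.
  by rewrite g3 mulrA mulrC ler_wpM2r.
have B0 := od_B D.
have e1 : x * K `^ al <= 2 * b0.
  rewrite -(ler_pM2r g0).
  have : x * (K `^ al * g) <= x * (g `^ al * K).
    by rewrite ler_wpM2l// powR_sublin// al0.
  rewrite mulrA => /le_trans; apply.
  have -> : x * (g `^ al * K) = g `^ al * (x * K) by ring.
  have : g `^ al * (x * K) <= g `^ al * (2 * g ^+ 3) by rewrite ler_wpM2l ?powR_ge0.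
  move=> /le_trans; apply.
  have -> : g `^ al * (2 * g ^+ 3) = 2 * g ^+ 3 * g `^ al by ring.
  have : 2 * g ^+ 3 * g `^ al <= 2 * g ^+ 3 * (b0 / g ^+ 2).
    by rewrite ler_wpM2l// mulr_ge0// exprn_ge0// ltW.
  move=> /le_trans; apply.
  by have -> : 2 * g ^+ 3 * (b0 / g ^+ 2) = 2 * b0 * g by field; rewrite gt_eqF.
have e2 : x <= 2 * b0 * K `^ (- al).
  have Kal : 0 < K `^ al by exact: powR_gt0.
  by rewrite powRN ler_pdivlMr.
have b00 : 0 <= b0 by rewrite barrier_ge0// d_gt0.
apply: (le_trans (ler_normB _ _)).
apply: (@le_trans _ _ (2 * B * x)); first lra.
apply: (@le_trans _ _ (2 * B * (2 * b0 * K `^ (- al)))).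
  by rewrite ler_wpM2l// mulr_ge0.
have -> : 2 * B * (2 * b0 * K `^ (- al)) = 4 * B * K `^ (- al) * b0 by ring.
by rewrite ler_wpM2r// (od_NN2 D).
Qed.

(** Concavity gains 1/m^2, 1/n^2 and 1/k^2 in the three directions. Their mean dominates d^2 / r^2,
    the form in which the barrier decreases in time. *)
Lemma inv_sq_AMGM m n k : (0 < m)%N -> (0 < n)%N -> (0 < k)%N ->
  3 * (d ^+ 2 / geo d m n k ^+ 2) <=
  (m%:R ^+ 2)^-1 + (n%:R ^+ 2)^-1 + (k%:R ^+ 2)^-1.
Proof.
move=> m0 n0 k'0; have g0 := geo_gt0 d_gt0 m0 n0 k'0.
have mR : (m%:R : R) != 0 by rewrite pnatr_eq0 -lt0n.
have nR : (n%:R : R) != 0 by rewrite pnatr_eq0 -lt0n.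
have kR : (k%:R : R) != 0 by rewrite pnatr_eq0 -lt0n.
have i0 j : 0 <= ((j%:R ^+ 2)^-1 : R) by rewrite invr_ge0 sqr_ge0.
have := cubeAMGM (powR_ge0 (m%:R ^+ 2)^-1 3^-1) (powR_ge0 (n%:R ^+ 2)^-1 3^-1)
  (powR_ge0 ((k%:R : R) ^+ 2)^-1 3^-1).
rewrite !cbrtK//; apply: le_trans; rewrite ler_pM2l// le_eqVlt; apply/orP; left.
rewrite -(@eqrXn2 _ 3)// ?divr_ge0 ?sqr_ge0 ?mulr_ge0 ?powR_ge0//.
rewrite [X in _ == X]exprMn [X in _ == X * _]exprMn !cbrtK//.
have -> : (d ^+ 2 / geo d m n k ^+ 2) ^+ 3 = d ^+ 6 / (geo d m n k ^+ 3) ^+ 2.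
  by field; rewrite gt_eqF.
rewrite geo3; apply/eqP; field.
by rewrite nR mR kR gt_eqF// d_gt0.
Qed.

(** Induction on the time level: a difference with a zero step vanishes, the outer faces are
    estimated directly, and inside the octant one step of the scheme is [octant_step_bound]. *)
Lemma octant_max l (b : int) m n k : (l <= N)%N ->
  (m <= k0)%N -> (n <= k0)%N -> (k <= k0)%N ->
  b *+ 2 + (m + n + k)%:Z = c0 ->
  `|diff3 m n k (v l) b| <= NN * psi l m n k.
Proof.
elim: l b m n k => [|l IH] b m n k lN mk nk kk E; first exact: octant_init.
have zero n' k' (b' : int) : `|diff3 0 n' k' (v l.+1) b'| <= NN * psi l.+1 0 n' k'.
  by rewrite diff3_0 normr0 mulr_ge0 ?NN_ge0// barrier_ge0// d_gt0.
case: (posnP m) => [->//|m0].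
case: (posnP n) => [->|n0].
  by rewrite diff3CA /psi barrierCA; exact: zero.
case: (posnP k) => [->|k'0].
  by rewrite diff3AC diff3CA /psi barrierAC barrierCA; exact: zero.
case: (leqP k0 m.+1) => [km|mk2]; first by apply: octant_face; rewrite ?m0 ?n0 ?k'0.
case: (leqP k0 n.+1) => [kn|nk2].
  by rewrite diff3CA /psi barrierCA; apply: octant_face; rewrite ?m0 ?n0 ?k'0//; move: E; clear; lia.
case: (leqP k0 k.+1) => [kk'|kk2].
  rewrite diff3AC diff3CA /psi barrierAC barrierCA.
  by apply: octant_face; rewrite ?m0 ?n0 ?k'0//; move: E; clear; lia.
have lN' : (l < N)%N by [].
have {}IH b' m' n' k' := IH b' m' n' k' (ltnW lN').
have S0 : 0 <= (N - l)%:R * dt by rewrite mulr_ge0// ltW.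
have NN0 := NN_ge0.
pose Cc (j : nat) : R := (2^-1 - th) * (4 / 9) / j%:R ^+ 2.
(* Stated for the first index only; the other two directions come from the symmetry of [diff3] and
   of the barrier. *)
have dom i j e : (0 < i)%N -> (0 < j)%N -> (0 < e)%N ->
    (i.+2 <= k0)%N -> (j <= k0)%N -> (e <= k0)%N ->
    b *+ 2 + (i + j + e)%:Z = c0 ->
    exists P c, [/\ lap (diff3 i j e (v l)) b = P - c * diff3 i j e (v l) b,
      2 <= c <= 3 & `|P| <= (c - Cc i) * (NN * psi l i j e)].
  move=> i0 j0 e0 ik jk ek Ei.
  apply: (@lap_dominated R i (sdiff j (sdiff e (v l))) b
    (fun i => NN * psi l i j e) (Cc i) i0).
  - move=> i' b' Eb ii; by move: ii ik Eb Ei jk ek; clear - IH; move=> *; apply: IH => //; lia.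
  - move=> i1; have := ler_wpM2l NN0 (barrier_concave mu0 th0 th1 d_gt0 S0 i1 j0 e0).
    by rewrite /psi /Cc -/th; exact: scaled_second_diff.
  - move=> i1; have := ler_wpM2l NN0 (barrier_concave1 mu0 th0 th1 d_gt0 S0 j0 e0).
    by rewrite /psi /Cc i1 -/th; exact: scaled_reflected_diff.
have [P1 [c1 [L1 C1 A1]]] := dom m n k m0 n0 k'0 mk2 nk kk E.
have [P2 [c2 [L2 C2 A2]]] := dom n m k n0 m0 k'0 nk2 mk kk ltac:(move: E; clear; lia).
have [P3 [c3 [L3 C3 A3]]] := dom k m n k'0 m0 n0 kk2 mk nk ltac:(move: E; clear; lia).
rewrite -diff3CA in L2; rewrite /psi barrierCA -/(psi l) in A2.
rewrite diff3CA diff3AC in L3; rewrite /psi barrierCA barrierAC -/(psi l) in A3.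
have Es : diff3 m n k (v l.+1) b = diff3 m n k (v l) b +
    lam * kap * lap (diff3 m n k (v l)) b + dt * diff3 m n k (r l) b.
  by apply: diff3_step => j jb; apply: (od_eq D) => //; move: jb E mk nk kk; clear; lia.
have W := IH b m n k mk nk kk E.
have src := octant_src (b := b) lN' (m := m) (n := n) (k := k) ltac:(by rewrite m0 mk) ltac:(by rewrite n0 nk) ltac:(by rewrite k'0 kk) E.
have [g1 g2] := barrier_src S0 m0 n0 k'0.
have T : barrier mu th d ((N - l)%:R * dt) m n k -
    mu * dt * (barrier mu th d ((N - l)%:R * dt) m n k / geo d m n k ^+ 2)
    <= barrier mu th d ((N - l.+1)%:R * dt) m n k.
  have e : (N - l)%:R * dt - (N - l.+1)%:R * dt = dt.
    rewrite -mulrBl -natrB; last by move: lN; clear; lia.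
    have -> : (N - l - (N - l.+1))%N = 1%N by move: lN; clear; lia.
    by rewrite mul1r.
  rewrite -[X in mu * X]e; apply: (barrier_time mu0 th1 d_gt0) => //.
  by rewrite mulr_ge0 ?(ltW dt0)//= ler_wpM2r ?(ltW dt0)// ler_nat; move: lN; clear; lia.
have am := inv_sq_AMGM m0 n0 k'0.
have g0 := geo_gt0 d_gt0 m0 n0 k'0.
have b00 : 0 <= psi l m n k by rewrite barrier_ge0// d_gt0.
have NN1 := od_NN1 D.
have M1' := od_M1 D; have M2' := od_M2 D.
rewrite Es.
apply: (octant_step_bound (mu := mu) (q := psi l m n k / geo d m n k ^+ 2)
  L1 L2 L3 C1 C2 C3 A1 A2 A3 W NN0 b00 _ _ _ (od_cfl D) _ _ T).
- by rewrite divr_ge0 ?sqr_ge0.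
- by rewrite mulr_ge0 ?(ltW (od_lam D))//; case/andP: (od_kap0 D) => /ltW; exact: le_trans.
- exact: ltW.
- apply: (le_trans src); rewrite mulrA.
  have q0 : 0 <= psi l m n k / geo d m n k ^+ 2 by rewrite divr_ge0 ?sqr_ge0.
  apply: le_trans (ler_wpM2r q0 NN1).
  have := lerD (ler_wpM2l M1' g1) (ler_wpM2l M2' g2).
  exact: src_arith.
- have th2 : 0 <= 2^-1 - th by rewrite subr_ge0; apply: ltW.
  have C0 : 0 <= (2^-1 - th) * (4 / 9) by rewrite mulr_ge0 ?divr_ge0.
  have CC : (2^-1 - th) * (4 / 9) * (d ^+ 2 / geo d m n k ^+ 2) <= (Cc m + Cc n + Cc k) / 3.
    exact: (mean3_arith C0 am).
  have E1 : 2 * mu * dt * (NN * (psi l m n k / geo d m n k ^+ 2)) =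
      (lam * kap0 * ((2^-1 - th) * (4 / 9) *
      (d ^+ 2 / geo d m n k ^+ 2))) * (NN * psi l m n k).
    rewrite /mu /octant_mu /dt; move: (psi l m n k) => p.
    by field; rewrite gt_eqF.
  rewrite E1; apply: ler_wpM2r; first exact: (mulr_ge0 NN0 b00).
  case/andP: (od_kap0 D) => k00 k01.
  apply: (surplus_arith (ltW (od_lam D)) (ltW k00) k01 _ CC).
  by rewrite mulr_ge0// divr_ge0 ?sqr_ge0.
Qed.

Lemma octant_bound (b : int) m n k : (0 < m <= k0)%N -> (0 < n <= k0)%N ->
  (0 < k <= k0)%N -> b *+ 2 + (m + n + k)%:Z = c0 ->
  `|diff3 m n k (v N) b| <= NN * (geo d m n k ^+ 2 * geo d m n k `^ al).
Proof.
move=> /andP[m0 mk] /andP[n0 nk] /andP[k'0 kk] E.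
have := octant_max (leqnn N) mk nk kk E.
rewrite /psi subnn mul0r barrier_zero// ?d_gt0//.
by have -> : 2 * th = al by rewrite /th; field.
Qed.

End OctantMaxPrinciple.

(** * The discrete Schauder estimate *)

Section SecondDifferences.
Context {R : realType}.
Implicit Types (w g : int -> R) (b j : int) (m n k q : nat) (Q : R).

Lemma sdiff_bound g b n Q :
  (forall j, b <= j -> j + 1 <= b + n%:Z -> `|g (j + 1) - g j| <= Q) ->
  `|sdiff n g b| <= n%:R * Q.
Proof.
elim: n => [|n IH] H; first by rewrite /sdiff addr0 subrr normr0 mul0r.
have -> : sdiff n.+1 g b = sdiff n g b + (g (b + n%:Z + 1) - g (b + n%:Z)).
  rewrite /sdiff; have -> : b + n.+1%:Z = b + n%:Z + 1 by lia.
  by ring.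
apply: (le_trans (ler_normD _ _)).
rewrite -natr1 mulrDl mul1r lerD//.
  by apply: IH => j j1 j2; apply: H => //; lia.
by apply: H; lia.
Qed.

(** A mixed second difference is a sum of n k values of the discrete Laplacian. *)
Lemma rect_bound w b n k Q :
  (forall j, b < j -> j < b + n%:Z + k%:Z -> `|lap w j| <= Q) ->
  `|sdiff n (sdiff k w) b| <= n%:R * (k%:R * Q).
Proof.
move=> H; apply: sdiff_bound => j j1 j2.
have -> : sdiff k w (j + 1) - sdiff k w j = sdiff k (fun i => w (i + 1) - w i) j.
  by rewrite /sdiff (addrAC j 1); ring.
apply: sdiff_bound => i i1 i2.
have -> : w (i + 1 + 1) - w (i + 1) - (w (i + 1) - w i) = lap w (i + 1).
  by rewrite /lap addrK; ring.
apply: H; lia.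
Qed.

Lemma lap_sqr (d c : R) j : lap (fun i : int => c * (i%:~R * d) ^+ 2 / 2) j = c * d ^+ 2.
Proof. by rewrite /lap !intrD !mulrDl; field. Qed.

Lemma sdiff2_sqr (d c : R) b q :
  sdiff q (sdiff q (fun i : int => c * (i%:~R * d) ^+ 2 / 2)) b = (q%:R * d) ^+ 2 * c.
Proof. by rewrite /sdiff !intrD -!pmulrn; field. Qed.

(** Subtracting the parabola with second difference d^2 c reduces the claim to [rect_bound]. *)
Lemma sdiff2_near w b q (d c e : R) :
  (forall j, b < j -> j < b + q%:Z + q%:Z -> `|lap w j - d ^+ 2 * c| <= d ^+ 2 * e) ->
  `|sdiff q (sdiff q w) b - (q%:R * d) ^+ 2 * c| <= (q%:R * d) ^+ 2 * e.
Proof.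
move=> H.
pose w' (i : int) : R := w i - c * (i%:~R * d) ^+ 2 / 2.
have -> : sdiff q (sdiff q w) b - (q%:R * d) ^+ 2 * c = sdiff q (sdiff q w') b.
  by rewrite -(sdiff2_sqr d c b q) /sdiff /w'; ring.
have -> : (q%:R * d) ^+ 2 * e = q%:R * (q%:R * (d ^+ 2 * e)) by ring.
apply: rect_bound => j j1 j2.
suff -> : lap w' j = lap w j - d ^+ 2 * c by exact: H.
have -> : d ^+ 2 * c = lap (fun i : int => c * (i%:~R * d) ^+ 2 / 2) j.
  by rewrite lap_sqr mulrC.
by rewrite /lap /w'; ring.
Qed.

(** The doubling identity behind the dyadic sum: after division by the square of the scale, second
    differences at the scales q and 2 q differ only by third differences. *)
Lemma sdiff2_double w b q :
  sdiff (2 * q) (sdiff (2 * q) w) b =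
  4 * sdiff q (sdiff q w) b + 3 * diff3 q q q w b + diff3 q q q w (b + q%:Z).
Proof.
rewrite /diff3 /sdiff.
have -> : b + (2 * q)%:Z = b + q%:Z + q%:Z by lia.
have -> : b + q%:Z + q%:Z + (2 * q)%:Z = b + q%:Z + q%:Z + q%:Z + q%:Z by lia.
ring.
Qed.

Lemma sdiff2_one w b : sdiff 1 (sdiff 1 w) b = lap w (b + 1).
Proof. by rewrite /sdiff /lap addrK; ring. Qed.

(* The differences of [w] at dyadic scales telescope: this is the passage from
   third differences to the modulus of continuity of the second ones. *)
Lemma dyadic_telescope w b p (d al NN : R) (k0 : nat) : 0 < d -> 0 < al ->
  (forall b' q, b <= b' <= b + k0%:Z -> (0 < q <= k0)%N ->
     `|diff3 q q q w b'| <= NN * ((q%:R * d) ^+ 2 * (q%:R * d) `^ al)) ->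
  (2 ^ p <= k0)%N -> 0 <= NN ->
  `|sdiff (2 ^ p) (sdiff (2 ^ p) w) b / ((2 ^ p)%:R * d) ^+ 2 - lap w (b + 1) / d ^+ 2|
  <= (2 `^ al - 1)^-1 * NN * ((2 ^ p)%:R * d) `^ al.
Proof.
move=> d0 al0 H pk NN0.
have c0 : 0 < 2 `^ al - 1 :> R.
  have : 1 `^ al < 2 `^ al :> R by apply: gt0_ltr_powR; rewrite ?nnegrE// ltr1n.
  by rewrite powR1 subr_gt0.
elim: p pk => [|p IH] pk.
  rewrite expn0 sdiff2_one mul1r subrr normr0.
  by rewrite !mulr_ge0 ?powR_ge0// invr_ge0 ltW.
have pk' : (2 ^ p <= k0)%N by apply: leq_trans pk; rewrite leq_exp2l.
have q0 : (0 < 2 ^ p)%N by rewrite expn_gt0.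
have {}IH := IH pk'.
rewrite expnS; rewrite expnS in pk; set q := (2 ^ p)%N in IH pk pk' q0 *.
have h1 := H b q ltac:(move: pk; clear; lia) ltac:(by rewrite q0 pk').
have h2 := H (b + q%:Z) q ltac:(move: pk'; clear; lia) ltac:(by rewrite q0 pk').
have qd : 0 < q%:R * d by rewrite mulr_gt0// ltr0n.
rewrite sdiff2_double natrM.
set D := sdiff q _ b in IH *; set T1 := diff3 _ _ _ _ b in h1 *.
set T2 := diff3 _ _ _ _ (b + q%:Z) in h2 *; set Y := lap w (b + 1) / d ^+ 2 in IH *.
have -> : (4 * D + 3 * T1 + T2) / (2 * q%:R * d) ^+ 2 - Y =
    (D / (q%:R * d) ^+ 2 - Y) + (3 * T1 + T2) / 4 / (q%:R * d) ^+ 2.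
  have qR : (q%:R : R) != 0 by rewrite pnatr_eq0 -lt0n.
  by field; rewrite qR gt_eqF.
apply: (le_trans (ler_normD _ _)).
have h3 : `|(3 * T1 + T2) / 4 / (q%:R * d) ^+ 2| <= NN * (q%:R * d) `^ al.
  rewrite normrM normfV (ger0_norm (sqr_ge0 _)) ler_pdivrMr ?exprn_gt0//.
  have : `|(3 * T1 + T2) / 4| <= NN * ((q%:R * d) ^+ 2 * (q%:R * d) `^ al).
    move: h1 h2; rewrite !ler_norml => /andP[? ?] /andP[? ?].
    by apply/andP; split; lra.
  by move=> h; rewrite -mulrA [X in _ <= _ * X]mulrC.
have -> : 2 * q%:R * d = 2 * (q%:R * d) by rewrite mulrA.
rewrite powRM ?(ltW qd)//.
move: (lerD IH h3) => /le_trans; apply.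
(* The constant c = 1 / (t - 1) solves c t = c + 1 for t = 2^al, so the bound reproduces itself when
   the scale doubles. *)
set x := (q%:R * d) `^ al; set t := 2 `^ al in c0 *.
have -> : (t - 1)^-1 * NN * (t * x) = (t - 1)^-1 * NN * x + NN * x.
  by field; rewrite gt_eqF.
by [].
Qed.

End SecondDifferences.

(** * Reflection at the ends and estimates for grid arrays *)

Section OddReflection.
Context {R : realType}.

(** The odd reflection about the point (0, s); its value at 0 is s even when f 0 differs from s. *)
Definition odd_reflect (f : int -> R) (s : R) (j : int) : R :=
  if 0 < j then f j else if j < 0 then 2 * s - f (- j) else s.

(** An increment across 0 is the sum of two increments of f starting at 0, up to twice the mismatch
    between s and f 0. The bounds K and K' confine the hypothesis to a window, since after freezing
    the source has a small constant only near the point of freezing. *)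
Lemma odd_reflect_holder (f : int -> R) (s d al H E : R) (j : int) (m : nat) (K K' : int) :
  0 < d -> 0 < al -> 0 <= H -> 0 <= E ->
  (forall (i : int) (n : nat), 0 <= i -> K' <= i -> i + n%:Z <= K -> (n <= m)%N ->
     `|f (i + n%:Z) - f i| <= H * (n%:R * d) `^ al) ->
  `|s - f 0| <= E -> - K <= j -> K' <= j -> j + m%:Z <= K ->
  `|odd_reflect f s (j + m%:Z) - odd_reflect f s j| <=
    2 * H * (m%:R * d) `^ al + 2 * E.
Proof.
move=> d0 al0 H0 E0 Hf sE jK jK' mK.
have mon n : (n <= m)%N -> H * (n%:R * d) `^ al <= H * (m%:R * d) `^ al.
  move=> nm; rewrite ler_wpM2l//; apply: ge0_ler_powR; rewrite ?(ltW al0)//.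
  - by rewrite nnegrE mulr_ge0 ?(ltW d0).
  - by rewrite nnegrE mulr_ge0 ?(ltW d0).
  - by rewrite ler_wpM2r ?(ltW d0)// ler_nat.
have Z0 : 0 <= H * (m%:R * d) `^ al by rewrite mulr_ge0 ?powR_ge0.
have f0 n : j <= 0 -> (n <= m)%N -> n%:Z <= K -> `|f n%:Z - f 0| <= H * (m%:R * d) `^ al.
  move=> j0 nm nK; apply: (le_trans _ (mon n nm)).
  have := Hf 0 n (lexx 0) (le_trans jK' j0); rewrite add0r.
  exact.
rewrite /odd_reflect; set Z := H * _ in Z0 f0 mon *.
have {Hf}Hf (i : int) n : 0 <= i -> K' <= i -> i + n%:Z <= K -> (n <= m)%N ->
    `|f (i + n%:Z) - f i| <= Z.
  by move=> h1 h2 h3 nm; exact: le_trans (Hf _ _ h1 h2 h3 nm) (mon _ nm).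
rewrite -mulrA -/Z.
case: (ltgtP 0 j) => [j0|j0|j0].
- rewrite (_ : 0 < j + m%:Z); last lia.
  by have := Hf j m (ltW j0) jK' mK (leqnn m); lra.
- case: (ltgtP 0 (j + m%:Z)) => [h|h|h].
  + have e1 : j + m%:Z = (m - `|j|)%N%:Z by lia.
    have e2 : - j = `|j|%N%:Z by lia.
    have h1 := f0 (m - `|j|)%N (ltW j0) ltac:(lia) ltac:(lia).
    have h2 := f0 `|j|%N (ltW j0) ltac:(lia) ltac:(lia).
    rewrite e1 e2; move: h1 h2 sE; rewrite !ler_norml => /andP[? ?] /andP[? ?] /andP[? ?].
    by apply/andP; split; lra.
  + have := Hf (- (j + m%:Z)) m ltac:(lia) ltac:(lia) ltac:(lia) (leqnn m).
    have -> : - (j + m%:Z) + m%:Z = - j by lia.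
    rewrite !ler_norml => /andP[? ?].
    by apply/andP; split; lra.
  + have e2 : - j = m%:Z by lia.
    have h2 := f0 m (ltW j0) (leqnn m) ltac:(lia).
    rewrite e2; move: h2 sE; rewrite !ler_norml => /andP[? ?] /andP[? ?].
    by apply/andP; split; lra.
- have j00 : j <= 0 by rewrite -j0.
  rewrite -j0 add0r in mK *.
  case: (posnP m) => [->|m0]; first by rewrite ltxx subrr normr0; lra.
  rewrite (_ : 0 < m%:Z)//; have h2 := f0 m j00 (leqnn m) mK.
  move: h2 sE; rewrite !ler_norml => /andP[? ?] /andP[? ?].
  by apply/andP; split; lra.
Qed.

End OddReflection.

(* [v] is the explicit Euler scheme for [v_t = A v_xx + F] with steps [d] and
   [lam d^2]; at the two ends [G] is not a second difference but is defined
   through the equation by the prescribed velocity [A G + F]. *)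
Record array_data {R : realType} (al kap0 kap1 lam d M M0 : R) (J N : nat)
    (v G A F : nat -> int -> R) : Prop := ArrayData {
  ad_al : 0 < al < 1;
  ad_kap : 0 < kap0 <= kap1;
  ad_lam : 0 < lam;
  ad_cfl : 3 * lam * kap1 <= 1;
  ad_d : 0 < d;
  ad_M : 0 <= M;
  ad_M0 : 0 <= M0;
  ad_eq : forall n (j : int), (n < N)%N -> 0 <= j <= J%:Z ->
    v n.+1 j = v n j + lam * d ^+ 2 * (A n j * G n j + F n j);
  ad_G : forall n (j : int), (n <= N)%N -> 0 < j < J%:Z ->
    lap (v n) j = d ^+ 2 * G n j;
  ad_A : forall n (j : int), (n <= N)%N -> 0 <= j <= J%:Z -> kap0 <= A n j <= kap1;
  ad_Ax : forall n (i : int) m, (n <= N)%N -> 0 <= i -> i + m%:Z <= J%:Z ->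
    `|A n (i + m%:Z) - A n i| <= M * (m%:R * d) `^ al;
  ad_At : forall n k (j : int), (n + k <= N)%N -> 0 <= j <= J%:Z ->
    `|A (n + k)%N j - A n j| <= M * (k%:R * (lam * d ^+ 2)) `^ (al / 2);
  ad_Fx : forall n (i : int) m, (n <= N)%N -> 0 <= i -> i + m%:Z <= J%:Z ->
    `|F n (i + m%:Z) - F n i| <= M * (m%:R * d) `^ al;
  ad_Ft : forall n k (j : int), (n + k <= N)%N -> 0 <= j <= J%:Z ->
    `|F (n + k)%N j - F n j| <= M * (k%:R * (lam * d ^+ 2)) `^ (al / 2);
  ad_V : forall n k (j : int), (n + k <= N)%N -> j = 0 \/ j = J%:Z ->
    `|A (n + k)%N j * G (n + k)%N j + F (n + k)%N j - (A n j * G n j + F n j)| <=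
      M * (k%:R * (lam * d ^+ 2)) `^ (al / 2);
  ad_G0 : forall j : int, 0 <= j <= J%:Z -> `|G 0%N j| <= M0;
  ad_G0x : forall (i : int) m, 0 <= i -> i + m%:Z <= J%:Z ->
    `|G 0%N (i + m%:Z) - G 0%N i| <= M0 * (m%:R * d) `^ al }.

Definition array_bounds {R : realType} (al d B X : R) (J N : nat)
    (G : nat -> int -> R) : Prop :=
  (forall n (j : int), (n <= N)%N -> 0 <= j <= J%:Z -> `|G n j| <= B) /\
  (forall n (i : int) m, (n <= N)%N -> 0 <= i -> i + m%:Z <= J%:Z ->
     `|G n (i + m%:Z) - G n i| <= X * (m%:R * d) `^ al).

Section ArrayBasics.
Context {R : realType}.
Variables (al kap0 kap1 lam d M M0 : R) (J N : nat).
Variables (v G A F : nat -> int -> R).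
Implicit Types (j : int).

Let rev (f : nat -> int -> R) n j := f n (J%:Z - j).

(** Reflection of the interval, which reduces the right half to the left half. *)
Lemma array_data_rev : array_data al kap0 kap1 lam d M M0 J N v G A F ->
  array_data al kap0 kap1 lam d M M0 J N (rev v) (rev G) (rev A) (rev F).
Proof.
case=> al01 kap lam0 cfl d0 M_ M0_ eq HG HA Ax At Fx Ft HV G0 G0x.
have flip (f : int -> R) (C : nat -> R) : (forall (i : int) m, 0 <= i -> i + m%:Z <= J%:Z ->
    `|f (i + m%:Z) - f i| <= C m) -> forall (i : int) m, 0 <= i -> i + m%:Z <= J%:Z ->
    `|f (J%:Z - (i + m%:Z)) - f (J%:Z - i)| <= C m.
  move=> H i m i0 im; rewrite distrC.
  have -> : J%:Z - i = J%:Z - (i + m%:Z) + m%:Z by clear; lia.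
  by apply: H; move: i0 im; clear; lia.
split => //; rewrite /rev.
- by move=> n j nN j0; apply: eq => //; move: j0; clear; lia.
- move=> n j nN j0; rewrite -HG//; last by move: j0; clear; lia.
  rewrite /lap; have -> : J%:Z - (j + 1) = J%:Z - j - 1 by clear; lia.
  have -> : J%:Z - (j - 1) = J%:Z - j + 1 by clear; lia.
  by ring.
- by move=> n j nN j0; apply: HA => //; move: j0; clear; lia.
- move=> n i m nN.
  exact: (flip (A n) (fun m => M * (m%:R * d) `^ al) (fun i m => Ax n i m nN)).
- by move=> n k j nN j0; apply: At => //; move: j0; clear; lia.
- move=> n i m nN.
  exact: (flip (F n) (fun m => M * (m%:R * d) `^ al) (fun i m => Fx n i m nN)).
- by move=> n k j nN j0; apply: Ft => //; move: j0; clear; lia.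
- by move=> n k j nN [->|->]; apply: HV => //; [right|left]; clear; lia.
- by move=> j j0; apply: G0; move: j0; clear; lia.
- exact: (flip (G 0%N) (fun m => M0 * (m%:R * d) `^ al) G0x).
Qed.

Lemma array_data_le N' : (N' <= N)%N ->
  array_data al kap0 kap1 lam d M M0 J N v G A F ->
  array_data al kap0 kap1 lam d M M0 J N' v G A F.
Proof.
move=> NN [al01 kap lam0 cfl d0 M_ M0_ eq HG HA Ax At Fx Ft HV G0 G0x].
split => //.
- by move=> *; apply: eq => //; exact: leq_trans NN.
- by move=> *; apply: HG => //; exact: leq_trans NN.
- by move=> *; apply: HA => //; exact: leq_trans NN.
- by move=> *; apply: Ax => //; exact: leq_trans NN.
- by move=> *; apply: At => //; exact: leq_trans NN.
- by move=> *; apply: Fx => //; exact: leq_trans NN.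
- by move=> *; apply: Ft => //; exact: leq_trans NN.
- by move=> *; apply: HV => //; exact: leq_trans NN.
Qed.

Lemma array_bounds_rev B X : array_bounds al d B X J N G ->
  array_bounds al d B X J N (rev G).
Proof.
move=> [HB HX]; split; rewrite /rev.
  by move=> n j nN j0; apply: HB => //; move: j0; clear; lia.
move=> n i m nN i0 im; rewrite distrC.
have -> : J%:Z - i = J%:Z - (i + m%:Z) + m%:Z by clear; lia.
by apply: HX => //; move: i0 im; clear; lia.
Qed.

Lemma array_bounds_le B X N' : (N' <= N)%N -> array_bounds al d B X J N G ->
  array_bounds al d B X J N' G.
Proof.
move=> NN [HB HX]; split => *; [apply: HB|apply: HX] => //; exact: leq_trans NN.
Qed.

Hypothesis D : array_data al kap0 kap1 lam d M M0 J N v G A F.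
Variables (B X : R).
Hypothesis BX : array_bounds al d B X J N G.

(** With kap = 0 this estimates the velocity; with kap a frozen value of A it estimates the source
    left by freezing, and then osc is small. *)
Lemma array_velocity_holder n (i : int) m (kap osc : R) : (n <= N)%N -> 0 <= i ->
  i + m%:Z <= J%:Z -> `|A n (i + m%:Z) - kap| <= osc -> 0 <= X ->
  `|((A n (i + m%:Z) - kap) * G n (i + m%:Z) + F n (i + m%:Z))
    - ((A n i - kap) * G n i + F n i)| <= (osc * X + M * (B + 1)) * (m%:R * d) `^ al.
Proof.
move=> nN i0 im osc_le X0; set x := _ `^ al.
have x0 : 0 <= x by exact: powR_ge0.
have h1 := ad_Ax D nN i0 im; have h2 := ad_Fx D nN i0 im.
have h3 := BX.2 n i m nN i0 im; rewrite -/x in h1 h2 h3.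
have h4 : `|G n i| <= B by apply: BX.1 => //; move: i0 im; clear; lia.
have -> : ((A n (i + m%:Z) - kap) * G n (i + m%:Z) + F n (i + m%:Z))
    - ((A n i - kap) * G n i + F n i) =
  (A n (i + m%:Z) - kap) * (G n (i + m%:Z) - G n i) +
  (A n (i + m%:Z) - A n i) * G n i + (F n (i + m%:Z) - F n i) by ring.
apply: (le_trans (ler_normD _ _)).
have -> : (osc * X + M * (B + 1)) * x = osc * (X * x) + M * x * B + M * x by ring.
rewrite lerD//; apply: (le_trans (ler_normD _ _)).
by rewrite !normrM lerD// ler_pM.
Qed.

(** The end velocity A G + F is Holder continuous in time by assumption, and G inherits this on
    division by A >= kap0. The constant involves the bound B of G but not its Holder constant X, so
    nothing has to be absorbed here. *)
Lemma array_end_holder n k : (n + k <= N)%N ->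
  `|G (n + k)%N 0 - G n 0| <= (M * (B + 2)) / kap0 * (k%:R * (lam * d ^+ 2)) `^ (al / 2).
Proof.
move=> nN; set x := _ `^ _; have x0 : 0 <= x by exact: powR_ge0.
have z0 : 0 <= (0 : int) <= J%:Z by [].
have h1 := ad_V D nN (or_introl erefl); have h2 := ad_Ft D nN z0.
have h3 := ad_At D nN z0; rewrite -/x in h1 h2 h3.
have h4 : `|G n 0| <= B by apply: BX.1 => //; apply: leq_trans nN; exact: leq_addr.
have /andP[k0 _] := ad_A D nN z0.
have /andP[kp _] := ad_kap D.
rewrite mulrAC ler_pdivlMr// mulrC.
apply: (@le_trans _ _ (A (n + k)%N 0 * `|G (n + k)%N 0 - G n 0|)).
  by rewrite ler_wpM2r.
rewrite -[X in X * `|_|]gtr0_norm ?(lt_le_trans kp)// -normrM.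
set A1 := A (n + k)%N 0 in h1 h2 h3 *; set G1 := G (n + k)%N 0 in h1 *.
set F1 := F (n + k)%N 0 in h1 h2 *.
have -> : A1 * (G1 - G n 0) = (A1 * G1 + F1 - (A n 0 * G n 0 + F n 0)) - (F1 - F n 0)
   - (A1 - A n 0) * G n 0 by ring.
apply: (le_trans (ler_normB _ _)).
have -> : M * (B + 2) * x = M * x + M * x + M * x * B by ring.
rewrite lerD//; last by rewrite normrM ler_pM.
by apply: (le_trans (ler_normB _ _)); rewrite lerD.
Qed.

End ArrayBasics.

Section Ghost.
Context {R : realType}.
Implicit Types (w g : int -> R) (j : int) (J : nat).

(* The extension of [w] beyond the left end with prescribed second difference
   [gam] there; its second differences are the odd reflection about [gam]. *)
Definition ghost (d gam : R) w j : R :=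
  if 0 <= j then w j else 2 * w 0 - w (- j) + gam * (j%:~R * d) ^+ 2.

Lemma ghost_nneg d gam w j : 0 <= j -> ghost d gam w j = w j.
Proof. by rewrite /ghost => ->. Qed.

Lemma ghost_npos d gam w j : j <= 0 ->
  ghost d gam w j = 2 * w 0 - w (- j) + gam * (j%:~R * d) ^+ 2.
Proof.
rewrite le_eqVlt => /orP[/eqP->|j0]; last by rewrite /ghost leNgt j0.
by rewrite /ghost lexx oppr0 mul0r expr0n /=; ring.
Qed.

Lemma lap_ghost d gam w g J j :
  (forall j, 0 < j < J%:Z -> lap w j = d ^+ 2 * g j) -> - J%:Z < j < J%:Z ->
  lap (ghost d gam w) j = d ^+ 2 * odd_reflect g gam j.
Proof.
move=> H /andP[j1 j2]; rewrite /odd_reflect /lap.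
case: (ltgtP 0 j) => [j0|j0|j0].
- rewrite !ghost_nneg; try lia.
  by rewrite -H//; lia.
- rewrite !ghost_npos; try lia.
  have := H (- j) ltac:(lia); rewrite /lap => e.
  rewrite mulrBr -e.
  have -> : - (j + 1) = - j - 1 by lia.
  have -> : - (j - 1) = - j + 1 by lia.
  by rewrite !intrD; ring.
- rewrite -j0 add0r sub0r (@ghost_nneg d gam w 1)// !ghost_npos// oppr0 opprK.
  by ring.
Qed.

(** The extension obeys the scheme with the constant coefficient kap on both sides of the end. Its
    source is again an odd reflection, about the value that makes the equation at j = 0 exact for
    the prescribed second difference gam. *)
Lemma ghost_step d gam w w' g A F (kap lam : R) J j :
  (forall j, 0 < j < J%:Z -> lap w j = d ^+ 2 * g j) ->
  (forall j, 0 <= j <= J%:Z -> w' j = w j + lam * d ^+ 2 * (A j * g j + F j)) ->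
  - J%:Z < j < J%:Z ->
  ghost d gam w' j = ghost d gam w j + lam * kap * lap (ghost d gam w) j +
    lam * d ^+ 2 * odd_reflect (fun i => (A i - kap) * g i + F i)
      (A 0 * g 0 + F 0 - kap * gam) j.
Proof.
move=> H Hw jJ; rewrite (lap_ghost gam H jJ) /odd_reflect.
case/andP: jJ => j1 j2.
case: (ltgtP 0 j) => [j0|j0|j0].
- by rewrite !ghost_nneg ?(ltW j0)// Hw; [ring|lia].
- by rewrite !ghost_npos ?(ltW j0)// !Hw; [ring|lia|lia].
- rewrite -j0 !ghost_nneg// Hw; [ring|lia].
Qed.

Lemma odd_reflect_bound g (gam B : R) J j : `|gam| <= B ->
  (forall j, 0 <= j <= J%:Z -> `|g j| <= B) -> - J%:Z <= j <= J%:Z ->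
  `|odd_reflect g gam j| <= 3 * B.
Proof.
move=> gB H jJ; have B0 : 0 <= B by apply: le_trans gB.
rewrite /odd_reflect; case: (ltgtP 0 j) => [j0|j0|j0].
- by have := H j ltac:(lia); lra.
- have := H (- j) ltac:(lia); move: gB; rewrite !ler_norml => /andP[? ?] /andP[? ?].
  by apply/andP; split; lra.
- lra.
Qed.

Lemma geo_diag (d al : R) q : 0 < d -> geo d q q q = q%:R * d.
Proof.
move=> d0; apply/le_anti/andP; split; first exact: geo_max.
exact: geo_min.
Qed.

End Ghost.

(** * Holder estimate in space *)

Section SpaceEstimate.
Context {R : realType}.

(** The octant estimate for the extended scheme. A is frozen at (N, i0), and the prescribed second
    difference is [G N 0]; at an earlier level its mismatch is at most E times a power of the time
    left. H is the Holder constant of the source, in which X carries the oscillation of A over the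
    window as a factor. *)
Lemma ghost_diff3 (al kap0 kap1 lam d M M0 B X NN : R) (J N k0 : nat)
    (v G A F : nat -> int -> R) (i0 b : int) (m n k : nat) :
  array_data al kap0 kap1 lam d M M0 J N v G A F ->
  array_bounds al d B X J N G -> 0 <= X -> 0 <= B ->
  (2 < k0)%N -> (12 * k0 + 10 <= J)%N -> 0 <= i0 -> i0 *+ 2 <= J%:Z ->
  let mu := octant_mu kap0 (al / 2) in
  let H := M * ((6 * (k0%:R * d)) `^ al + (N%:R * (lam * d ^+ 2)) `^ (al / 2)) * X
           + M * (B + 1) in
  let E := M * (B + 2) / kap0 in
  2 * M0 + 2 * E * mu `^ (- (al / 2)) <= NN ->
  4 * (2 * H + 2 * (kap1 * E) * mu `^ (- (al / 2))) <= mu * NN ->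
  4 * (3 * B) * (k0%:R * d) `^ (- al) <= NN ->
  i0 - 1 <= b <= i0 - 1 + (2 * k0)%:Z ->
  (0 < m <= k0)%N -> (0 < n <= k0)%N -> (0 < k <= k0)%N ->
  `|diff3 m n k (ghost d (G N 0) (v N)) b| <=
    NN * (geo d m n k ^+ 2 * geo d m n k `^ al).
Proof.
move=> D BX X0 B0 k03 kJ i00 i0J mu H E N0 N1 N2 bb mk nk kk.
have iJ : 0 <= i0 <= J%:Z by move: i00 i0J; clear; lia.
have zJ : 0 <= (0 : int) <= J%:Z by [].
have /andP[kap00 kap01] := ad_kap D.
have /andP[al0 al1] := ad_al D.
have d0 := ad_d D; have lam0 := ad_lam D; have M_ := ad_M D; have M0_ := ad_M0 D.
have dt0 : 0 < lam * d ^+ 2 by rewrite mulr_gt0// exprn_gt0.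
have /andP[kp0 kp1] := ad_A D (leqnn N) iJ.
set kap := A N i0 in kp0 kp1.
have E0 : 0 <= E by rewrite divr_ge0 ?(ltW kap00)// mulr_ge0// addr_ge0.
have H0 : 0 <= H by rewrite addr_ge0 ?mulr_ge0 ?addr_ge0 ?powR_ge0.
have kap0_ := lt_le_trans kap00 kp0.
have endh l : (l <= N)%N -> `|G N 0 - G l 0| <= E * ((N - l)%:R * (lam * d ^+ 2)) `^ (al / 2).
  move=> lN; have := array_end_holder D BX (n := l) (k := (N - l)%N).
  by rewrite subnKC//; apply.
have lapG l : (l <= N)%N -> forall j : int, 0 < j < J%:Z -> lap (v l) j = d ^+ 2 * G l j.
  by move=> lN j; exact: (ad_G D lN).
have GB l (j : int) : (l <= N)%N -> 0 <= j <= J%:Z -> `|G l j| <= B by exact: BX.1.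
have GNB : `|G N 0| <= B by exact: GB.
pose r l := odd_reflect (fun i => (A l i - kap) * G l i + F l i)
  (A l 0 * G l 0 + F l 0 - kap * G N 0).
pose w l := ghost d (G N 0) (v l).
pose c0 := b *+ 2 + (m + n + k)%:Z.
(* The points involved stay within 6 k0 of i0, and away from the right end because i0 lies in the
   left half and J >= 12 k0 + 10. *)
have lo (j : int) : - ((3 * k0)%N%:Z) <= j *+ 2 - c0 -> - (J%:Z - 5) <= j /\ i0 - (6 * k0)%:Z <= j.
  by move: kJ i00 bb k03; rewrite /c0; clear; lia.
have hi (j : int) : j *+ 2 - c0 <= (3 * k0)%N%:Z -> j <= J%:Z - 5 /\ j <= i0 + (6 * k0)%:Z.
  by move: kJ i0J i00 bb mk nk kk k03; rewrite /c0; clear; lia.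
have K0 : i0 + (6 * k0)%:Z <= J%:Z by move: kJ i0J; clear; lia.
have od : octant_data al kap0 kap lam d (2 * M0) (2 * H) (2 * (kap1 * E)) (2 * E)
    (3 * B) NN k0 N c0 w r.
  split => //.
  - by rewrite al0.
  - by rewrite kap00.
  - by apply: le_trans (ad_cfl D); rewrite ler_wpM2l// mulr_ge0 ?(ltW lam0).
  - by rewrite mulr_ge0.
  - by rewrite mulr_ge0// mulr_ge0// (le_trans (ltW kap00)).
  - by rewrite mulr_ge0.
  - by rewrite mulr_ge0.
  - by rewrite mulr_ge0.
  - move=> l j lN /andP[/lo[j1 _] /hi[j2 _]].
    apply: (@ghost_step _ _ _ _ _ _ _ _ _ _ J).
    + exact: lapG (ltnW lN).
    + by move=> i iJ'; exact: (ad_eq D lN iJ').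
    + by move: j1 j2; clear; lia.
  - move=> l j m' lN m'k /lo[j1 j1'] /hi[j2 j2'].
    rewrite /sdiff -[2 * (kap1 * E) * _]mulrA.
    apply: (@odd_reflect_holder _ _ _ d al H _ j m' (i0 + (6 * k0)%:Z) (i0 - (6 * k0)%:Z)) => //.
    + by rewrite mulr_ge0 ?powR_ge0// mulr_ge0// (le_trans (ltW kap00)).
    + move=> i n' i'0 i'1 i'2 n'm.
      apply: (array_velocity_holder D BX _ i'0) => //; [exact: ltnW| by move: i'2 K0; clear; lia|].
      set a := i + n'%:Z in i'2 *.
      have -> : A l a - kap = (A l a - A l i0) + (A l i0 - A N i0) by rewrite /kap; ring.
      rewrite mulrDr; apply: (le_trans (ler_normD _ _)); rewrite lerD//.
      * have aJ : 0 <= a <= J%:Z by move: i'0 i'2 K0; rewrite /a; clear; lia.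
        apply: (@le_trans _ _ (M * (`|a - i0|%N%:R * d) `^ al)).
          case: (leP i0 a) => ai.
            have e : a = i0 + `|a - i0|%N%:Z by move: ai; clear; lia.
            rewrite [in A l a]e; apply: (ad_Ax D (ltnW lN) i00).
            by rewrite -e; case/andP: aJ.
          have e : i0 = a + `|a - i0|%N%:Z by move: ai; clear; lia.
          rewrite distrC [in A l i0]e; apply: (ad_Ax D (ltnW lN)); first by case/andP: aJ.
          by rewrite -e; case/andP: iJ.
        rewrite ler_wpM2l//; apply: ge0_ler_powR; rewrite ?(ltW al0)// ?nnegrE ?mulr_ge0 ?(ltW d0)//.
        rewrite mulrA ler_wpM2r ?(ltW d0)// -natrM ler_nat.
        by move: i'0 i'1 i'2; rewrite /a; clear; lia.
      * have := ad_At D (n := l) (k := (N - l)%N) (j := i0); rewrite subnKC ?(ltnW lN)// distrC.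
        move=> /(_ (leqnn N) iJ) /le_trans; apply.
        rewrite ler_wpM2l//; apply: ge0_ler_powR.
        - by rewrite divr_ge0// ltW.
        - by rewrite nnegrE (mulr_ge0 _ (ltW dt0)).
        - by rewrite nnegrE (mulr_ge0 _ (ltW dt0)).
        - by rewrite (ler_wpM2r (ltW dt0))// ler_nat leq_subr.
    + have -> : A l 0 * G l 0 + F l 0 - kap * G N 0 - ((A l 0 - kap) * G l 0 + F l 0) =
        - (kap * (G N 0 - G l 0)) by ring.
      rewrite normrN normrM gtr0_norm// -mulrA.
      apply: ler_pM; rewrite ?(ltW kap0_)//.
      exact: endh (ltnW lN).
    + by move: j1' i00; clear; lia.
  - move=> l j m' n' lN m'k n'k /lo[j1 _] /hi[j2 _].
    have -> : 3 * B * (m'%:R * d * (n'%:R * d)) = m'%:R * (n'%:R * (d ^+ 2 * (3 * B))) by ring.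
    apply: rect_bound => i i1 i2; rewrite (@lap_ghost _ d _ _ (G l) J); last 2 first.
      exact: lapG.
      by move: i1 i2 j1 j2; clear; lia.
    rewrite normrM (ger0_norm (sqr_ge0 d)) ler_wpM2l ?sqr_ge0//.
    apply: (@odd_reflect_bound _ _ _ _ J) => //; first by move=> ? ?; exact: GB.
    by move: i1 i2 j1 j2; clear; lia.
  - move=> b' m' n' k' m'k n'k k'k e.
    rewrite diff3CA diff3AC.
    have -> : n'%:R * d * (k'%:R * d) * (2 * M0 * (m'%:R * d) `^ al +
        2 * E * (N%:R * (lam * d ^+ 2)) `^ (al / 2)) =
      n'%:R * (k'%:R * (d ^+ 2 * (2 * M0 * (m'%:R * d) `^ al +
        2 * (E * (N%:R * (lam * d ^+ 2)) `^ (al / 2))))) by ring.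
    have [b1 b1'] := lo b' ltac:(move: e m'k n'k k'k; clear; lia).
    have [b2 b2'] := hi (b' + (m' + n' + k')%:Z) ltac:(move: e m'k n'k k'k; clear; lia).
    apply: rect_bound => j j1 j2; rewrite -sdiff_lap /sdiff.
    rewrite !(@lap_ghost _ d _ _ (G 0%N) J); try exact: lapG; try by move: j1 j2 b1 b2; clear; lia.
    rewrite -mulrBr normrM (ger0_norm (sqr_ge0 d)) ler_wpM2l ?sqr_ge0//.
    apply: (@odd_reflect_holder _ _ _ d al M0 _ j m' J%:Z (- J%:Z)) => //.
    + by rewrite mulr_ge0 ?powR_ge0.
    + by move=> i i' i'0 _ i'1 _; exact: (ad_G0x D i'0 i'1).
    + by have := endh 0%N (leq0n N); rewrite subn0.
    + by move: j1 b1; clear; lia.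
    + by move: j1 b1; clear; lia.
    + by move: j2 b2; clear; lia.
exact: (octant_bound od mk nk kk).
Qed.

(** Two dyadic sums with the constant 1 / (2^al - 1), one at each of the compared points, and one
    third difference with the factor 4. *)
Definition scale_const (al : R) : R := 2 * (2 `^ al - 1)^-1 + 4.

Lemma powR2_gt1 (al : R) : 0 < al -> 0 < 2 `^ al - 1.
Proof.
move=> al0; have : 1 `^ al < 2 `^ al :> R by apply: gt0_ltr_powR; rewrite ?nnegrE// ltr1n.
by rewrite powR1 subr_gt0.
Qed.

Lemma scale_const_ge4 (al : R) : 0 < al -> 4 <= scale_const al.
Proof. by move=> al0; rewrite lerDr mulr_ge0// invr_ge0 ltW// powR2_gt1. Qed.

Lemma dyadic_arith (c4 NN gm gq D1 D2 Y1 Y2 T q2 : R) :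
  0 <= NN -> gq <= gm -> 0 <= c4 -> 0 < q2 ->
  `|D1 - Y1| <= c4 * NN * gq -> `|D2 - Y2| <= c4 * NN * gq ->
  D2 - D1 = T / q2 -> `|T| <= 4 * NN * q2 * gm ->
  `|Y2 - Y1| <= (2 * c4 + 4) * NN * gm.
Proof.
move=> NN0 gqm c40 q20 h1 h2 e hT.
have hT' : `|T / q2| <= 4 * NN * gm.
  by rewrite normrM normfV (gtr0_norm q20) ler_pdivrMr//; lra.
have h3 : c4 * NN * gq <= c4 * NN * gm by rewrite ler_wpM2l// mulr_ge0.
rewrite -e in hT'; move: h1 h2 hT'; rewrite !ler_norml => /andP[? ?] /andP[? ?] /andP[? ?].
by apply/andP; split; lra.
Qed.

(** Second differences at a dyadic scale q with q <= m < 2 q approximate G at i0 and at i0 + m;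
    their difference is the third difference with steps m, q, q. The base point i0 - 1 compensates
    the shift between [sdiff 1 (sdiff 1 w)] and [lap w]. *)
Lemma space_left (al kap0 kap1 lam d M M0 B X NN : R) (J N k0 : nat)
    (v G A F : nat -> int -> R) (i0 : int) (m : nat) :
  array_data al kap0 kap1 lam d M M0 J N v G A F ->
  array_bounds al d B X J N G -> 0 <= X -> 0 <= B ->
  (2 < k0)%N -> (12 * k0 + 10 <= J)%N -> 0 <= i0 -> i0 *+ 2 <= J%:Z ->
  let mu := octant_mu kap0 (al / 2) in
  let H := M * ((6 * (k0%:R * d)) `^ al + (N%:R * (lam * d ^+ 2)) `^ (al / 2)) * X
           + M * (B + 1) in
  let E := M * (B + 2) / kap0 in
  2 * M0 + 2 * E * mu `^ (- (al / 2)) <= NN ->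
  4 * (2 * H + 2 * (kap1 * E) * mu `^ (- (al / 2))) <= mu * NN ->
  4 * (3 * B) * (k0%:R * d) `^ (- al) <= NN -> 0 <= NN ->
  (m <= k0)%N ->
  `|G N (i0 + m%:Z) - G N i0| <= scale_const al * NN * (m%:R * d) `^ al.
Proof.
move=> D BX X0 B0 k03 kJ i00 i0J mu H E N0 N1 N2 NN0 mk.
case: (posnP m) => [->|m0].
  by rewrite addr0 subrr normr0 !mulr_ge0 ?powR_ge0// (le_trans _ (scale_const_ge4 _))//; case/andP: (ad_al D).
have diff3_le := ghost_diff3 D BX X0 B0 k03 kJ i00 i0J N0 N1 N2.
have d0 := ad_d D.
have /andP[al0 al1] := ad_al D.
set w := ghost d (G N 0) (v N) in diff3_le.
pose p := trunc_log 2 m.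
have qm : (2 ^ p <= m)%N by exact: trunc_logP.
have mq : (m < 2 * 2 ^ p)%N by rewrite -expnS; exact: trunc_log_ltn.
have q0 : (0 < 2 ^ p)%N by rewrite expn_gt0.
have qk : (2 ^ p <= k0)%N by exact: leq_trans qm mk.
have tele b : i0 - 1 <= b <= i0 - 1 + k0%:Z ->
    `|sdiff (2 ^ p) (sdiff (2 ^ p) w) b / ((2 ^ p)%:R * d) ^+ 2 - lap w (b + 1) / d ^+ 2|
      <= (2 `^ al - 1)^-1 * NN * ((2 ^ p)%:R * d) `^ al.
  move=> bb; apply: (dyadic_telescope (k0 := k0)) => // b' q b'b q0k.
  rewrite -(geo_diag al q d0); apply: diff3_le => //.
  by move: bb b'b; clear; lia.
have lapw j : 0 <= j -> j <= i0 + k0%:Z -> lap w j / d ^+ 2 = G N j.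
  move=> j0 jk; rewrite (@lap_ghost _ d _ _ (G N) J); last 2 first.
  - by move=> i iJ; exact: (ad_G D (leqnn N)).
  - by move: j0 jk i0J kJ; clear; lia.
  rewrite mulrC mulKf ?expf_neq0 ?gt_eqF// /odd_reflect.
  case: (ltgtP 0 j) => [//|h|<-//]; first by move: j0 h; clear; lia.
have t1 := tele (i0 - 1) ltac:(clear; lia).
have t2 := tele (i0 - 1 + m%:Z) ltac:(move: mk; clear; lia).
rewrite subrK lapw// in t1; last by clear; lia.
rewrite (_ : i0 - 1 + m%:Z + 1 = i0 + m%:Z) in t2; last by clear; lia.
rewrite lapw in t2; last 2 first.
- by move: i00; clear; lia.
- by move: mk; clear; lia.
have T := @diff3_le (i0 - 1) m (2 ^ p)%N (2 ^ p)%N ltac:(clear; lia) ltac:(by rewrite m0 mk)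
  ltac:(by rewrite q0 qk) ltac:(by rewrite q0 qk).
move: t1 t2 T qm mq q0; set q := (2 ^ p)%N => t1 t2 T qm mq q0.
have qd : 0 < q%:R * d by rewrite mulr_gt0// ltr0n.
have md : 0 < m%:R * d by rewrite mulr_gt0// ltr0n.
have gq : (q%:R * d) `^ al <= (m%:R * d) `^ al.
  apply: ge0_ler_powR; rewrite ?(ltW al0) ?nnegrE ?(ltW qd) ?(ltW md)//.
  by rewrite ler_wpM2r ?(ltW d0)// ler_nat.
have gm : geo d m q q <= m%:R * d by exact: geo_max.
have g0 := geo_ge0 d0 m q q.
apply: (dyadic_arith NN0 gq _ (exprn_gt0 2 qd) t1 t2).
- by rewrite invr_ge0 ltW// powR2_gt1.
- have -> : sdiff q (sdiff q w) (i0 - 1 + m%:Z) / (q%:R * d) ^+ 2 -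
    sdiff q (sdiff q w) (i0 - 1) / (q%:R * d) ^+ 2 =
    diff3 m q q w (i0 - 1) / (q%:R * d) ^+ 2 by rewrite -mulrBl.
  by [].
- apply: (le_trans T).
  have -> : 4 * NN * (q%:R * d) ^+ 2 * (m%:R * d) `^ al =
    NN * ((2 * (q%:R * d)) ^+ 2 * (m%:R * d) `^ al) by ring.
  rewrite ler_wpM2l//; apply: ler_pM; rewrite ?powR_ge0 ?sqr_ge0//.
    rewrite ler_pXn2r ?nnegrE//; last by rewrite mulr_ge0// ltW.
    apply: (le_trans gm); rewrite mulrA ler_wpM2r ?(ltW d0)// -natrM ler_nat.
    exact: ltnW.
  by apply: ge0_ler_powR; rewrite ?(ltW al0) ?nnegrE ?(ltW md).
Qed.

Lemma powR_small (a e : R) : 0 < a -> 0 < e -> exists2 x0 : R, 0 < x0 &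
  forall x : R, 0 <= x <= x0 -> x `^ a <= e.
Proof.
move=> a0 e0; exists (e `^ a^-1); first exact: powR_gt0.
move=> x /andP[x0 xe]; have -> : e = (e `^ a^-1) `^ a.
  by rewrite -powRrM mulVf ?gt_eqF// powRr1 ?ltW.
by apply: ge0_ler_powR; rewrite ?(ltW a0) ?nnegrE ?powR_ge0.
Qed.

(** All terms without X go into one constant; X comes with the factor 8 c osc / mu, which is at most
    1/4. *)
Lemma space_arith (c mu w kk M kap0 kap1 M0 B X osc E : R) :
  0 < mu -> 0 <= w -> 0 <= kk -> 0 <= M -> 0 < kap0 -> 0 <= kap1 -> 4 <= c ->
  0 <= M0 -> 0 <= B -> 0 <= X -> osc <= mu / (32 * c) ->
  E = M * (B + 2) / kap0 ->
  c * (2 * M0 + 2 * E * w + 4 / mu * (2 * (osc * X + M * (B + 1)) + 2 * (kap1 * E) * w)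
    + 4 * (3 * B) * kk) <=
  c * (2 + 4 * (M / kap0) * w + 4 / mu * (2 * M + 4 * (kap1 * (M / kap0)) * w)
      + 12 * kk) * (1 + M0 + B) + X / 4.
Proof.
move=> mu0 w0 kk0 M_ k0 k1 c4 M00 B0 X0 hosc EE.
have c0 : 0 < c by lra.
have hE : E <= 2 * (M / kap0) * (1 + M0 + B).
  have -> : E = (M / kap0) * (B + 2) by rewrite EE; ring.
  have : 0 <= M / kap0 by rewrite divr_ge0// ltW.
  set y := M / kap0 => y0.
  have : y * (B + 2) <= y * (2 * (1 + M0 + B)) by rewrite ler_wpM2l//; lra.
  lra.
set y := M / kap0 in hE *; set Q := 1 + M0 + B in hE *.
have hX : c * (4 / mu * (2 * (osc * X))) <= X / 4.
  have : osc * X <= mu / (32 * c) * X by rewrite ler_wpM2r.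
  have p : 0 <= c * (4 / mu) * 2 by rewrite !mulr_ge0 ?invr_ge0 ?(ltW mu0) ?(ltW c0).
  move=> /(ler_wpM2l p).
  have -> : c * (4 / mu) * 2 * (mu / (32 * c) * X) = X / 4.
    by field; rewrite !gt_eqF.
  lra.
have e1 : E * w <= 2 * y * Q * w by rewrite ler_wpM2r.
have e2 : kap1 * E * w <= kap1 * (2 * y * Q) * w by rewrite ler_wpM2r// ler_wpM2l.
have e3 : M * (B + 1) <= M * Q by rewrite ler_wpM2l// /Q; lra.
have e4 : B * kk <= Q * kk by rewrite ler_wpM2r// /Q; lra.
have m4 : 0 <= 4 / mu by rewrite divr_ge0// ltW.
have e5 : 4 / mu * (2 * (M * (B + 1)) + 2 * (kap1 * E * w)) <=
   4 / mu * (2 * (M * Q) + 2 * (kap1 * (2 * y * Q) * w)).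
  by rewrite ler_wpM2l//; lra.
have M0Q : M0 <= Q by rewrite /Q; lra.
have : c * (2 * M0 + 2 * (E * w) + 4 / mu * (2 * (M * (B + 1)) + 2 * (kap1 * E * w)) + 12 * (B * kk))
  <= c * (2 * Q + 2 * (2 * y * Q * w) + 4 / mu * (2 * (M * Q) + 2 * (kap1 * (2 * y * Q) * w)) + 12 * (Q * kk)).
  by rewrite (ler_wpM2l (ltW c0))//; lra.
move: hX; set im := 4 / mu; lra.
Qed.

Lemma space_terms_ge0 (M0 E w mu osc X M B kap1 kk : R) : 0 <= M0 -> 0 <= E ->
  0 <= w -> 0 < mu -> 0 <= osc -> 0 <= X -> 0 <= M -> 0 <= B -> 0 <= kap1 -> 0 <= kk ->
  [/\ 0 <= 2 * M0 + 2 * E * w,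
     0 <= 4 / mu * (2 * (osc * X + M * (B + 1)) + 2 * (kap1 * E) * w)
   & 0 <= 4 * (3 * B) * kk].
Proof.
move=> *; split.
- by rewrite addr_ge0 ?mulr_ge0.
- apply: mulr_ge0; first by rewrite divr_ge0// ltW.
  apply: addr_ge0; last by rewrite !mulr_ge0.
  by rewrite mulr_ge0// addr_ge0 ?mulr_ge0// addr_ge0.
- by rewrite !mulr_ge0.
Qed.

(** Only a quarter of the old Holder constant comes back, which leaves room for absorption. The
    smallness is due to the width of the window and to the duration de, not to the size of the
    coefficients. *)
Lemma space_step (al kap0 kap1 lam M Len : R) :
  0 < al < 1 -> 0 < kap0 <= kap1 -> 0 <= M -> 0 < Len ->
  exists C de d1 : R, [/\ 0 < C, 0 < de, 0 < d1 &
    forall (d M0 B X : R) (J N : nat) (v G A F : nat -> int -> R),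
    array_data al kap0 kap1 lam d M M0 J N v G A F ->
    J%:R * d = Len -> d <= d1 -> N%:R * (lam * d ^+ 2) <= de ->
    array_bounds al d B X J N G -> 0 <= X -> 0 <= B ->
    array_bounds al d B (C * (1 + M0 + B) + X / 4) J N G].
Proof.
move=> al01 kap M_ Len0.
have /andP[al0 al1] := al01; have /andP[kap00 kap01] := kap.
set c := scale_const al; have c4 : 4 <= c by exact: scale_const_ge4.
have c0 : 0 < c by exact: lt_le_trans c4.
pose mu := octant_mu kap0 (al / 2).
have mu0 : 0 < mu by rewrite /mu /octant_mu !mulr_gt0//; lra.
pose ep := mu / (32 * c) / (2 * (M + 1)).
have ep0 : 0 < ep by rewrite !divr_gt0 ?mulr_gt0//; lra.
have [K1 K10 HK1] := powR_small al0 ep0.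
have al20 : 0 < al / 2 by lra.
have [de de0 Hde] := powR_small al20 ep0.
(* K1 / 6 makes the oscillation over the distance 6 K small, Len / 24 makes the window fit into the
   interval, and the mesh bound K / 8 guarantees enough cells in it. *)
pose K := Num.min (K1 / 6) (Len / 24).
have K0 : 0 < K by rewrite lt_min !divr_gt0.
pose w := mu `^ (- (al / 2)).
pose kk := (K / 2) `^ (- al).
pose C := c * (2 + 4 * (M / kap0) * w + 4 / mu * (2 * M + 4 * (kap1 * (M / kap0)) * w)
      + 12 * kk) + 2 * kk.
have w0 : 0 <= w by exact: powR_ge0.
have kk0 : 0 <= kk by exact: powR_ge0.
have kap10 : 0 <= kap1 by rewrite (le_trans _ kap01)// ltW.
have C0 : 0 < C.
  rewrite ltr_wpDr ?mulr_ge0// mulr_gt0// !ltr_wpDr ?mulr_ge0 ?addr_ge0 ?mulr_ge0 ?invr_ge0 ?(ltW mu0) ?(ltW kap00)//.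
exists C, de, (K / 8); split=> //; first by rewrite divr_gt0.
move=> d M0 B X J N v G A F D JL dd Nde BX X0 B0.
have d0 := ad_d D; have M00 := ad_M0 D; have lam0 := ad_lam D.
have NG0 : 0 <= N%:R * (lam * d ^+ 2) by rewrite !mulr_ge0 ?sqr_ge0// ltW.
split; first exact: BX.1.
pose k0 := Num.truncn (K / d).
have Kd8 : 8 <= K / d by rewrite ler_pdivlMr//; lra.
have /andP[k0K Kk0] : k0%:R <= K / d < k0.+1%:R by apply: truncn_itv; lra.
have k03 : (7 <= k0)%N.
  by rewrite -ltnS -(ltr_nat R); apply: le_lt_trans Kk0; lra.
have k0d : k0%:R * d <= K by rewrite -ler_pdivlMr.
have k0d2 : K / 2 <= k0%:R * d.
  have : K < k0.+1%:R * d by rewrite -ltr_pdivrMr.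
  rewrite -natr1; lra.
have KL : K <= Len / 24 by rewrite ge_min lexx orbT.
have KK1 : K <= K1 / 6 by rewrite ge_min lexx.
have kJ : (12 * k0 + 10 <= J)%N.
  rewrite -(ler_nat R) -(ler_pM2r d0) JL natrD natrM mulrDl; lra.
have hosc : M * ((6 * (k0%:R * d)) `^ al + (N%:R * (lam * d ^+ 2)) `^ (al / 2)) <= mu / (32 * c).
  have h1 : (6 * (k0%:R * d)) `^ al <= ep.
    by apply: HK1; rewrite !mulr_ge0 ?(ltW d0)//=; lra.
  have h2 : (N%:R * (lam * d ^+ 2)) `^ (al / 2) <= ep by apply: Hde; rewrite NG0.
  have : M * ((6 * (k0%:R * d)) `^ al + (N%:R * (lam * d ^+ 2)) `^ (al / 2)) <= (M + 1) * (2 * ep).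
    by apply: ler_pM; rewrite ?addr_ge0 ?powR_ge0//; move: h1 h2 M_; clear; lra.
  have -> : (M + 1) * (2 * ep) = mu / (32 * c); last by [].
  by rewrite /ep; field; rewrite !gt_eqF//; lra.
set osc := M * _ in hosc.
pose E := M * (B + 2) / kap0.
pose kk' := (k0%:R * d) `^ (- al).
have kk'k : kk' <= kk.
  rewrite /kk' /kk !powRN lef_pV2 ?posrE ?powR_gt0 ?divr_gt0//; last first.
    by apply: lt_le_trans k0d2; rewrite divr_gt0.
  by apply: ge0_ler_powR; rewrite ?(ltW al0) ?nnegrE ?divr_ge0 ?(ltW K0) ?mulr_ge0 ?(ltW d0).
have kk'0 : 0 <= kk' by exact: powR_ge0.
(* The sum of the three thresholds rather than their maximum, so that the bound is linear in X. *)
pose NN := 2 * M0 + 2 * E * w + 4 / mu * (2 * (osc * X + M * (B + 1)) + 2 * (kap1 * E) * w)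
    + 4 * (3 * B) * kk'.
have osc0 : 0 <= osc by rewrite mulr_ge0 ?addr_ge0 ?powR_ge0.
have E0 : 0 <= E by rewrite divr_ge0 ?mulr_ge0 ?addr_ge0 ?(ltW kap00).
have [p1 p2 p3] := space_terms_ge0 M00 E0 w0 mu0 osc0 X0 M_ B0 kap10 kk'0.
have NN0 : 0 <= NN by exact: (addr_ge0 (addr_ge0 p1 p2) p3).
have cNN : c * NN + 2 * B * kk <= C * (1 + M0 + B) + X / 4.
  have h := space_arith mu0 w0 kk0 M_ kap00 kap10 c4 M00 B0 X0 hosc (erefl E).
  have : c * NN <= c * (2 * M0 + 2 * E * w + 4 / mu * (2 * (osc * X + M * (B + 1)) + 2 * (kap1 * E) * w) + 4 * (3 * B) * kk).
    rewrite ler_wpM2l ?(ltW c0)// lerD2l ler_wpM2l ?mulr_ge0//.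
  have : B * kk <= (1 + M0 + B) * kk by rewrite ler_wpM2r//; move: M00; clear; lra.
  rewrite /C; move: h; set Z := c * (2 + _ + _ + _); clear; lra.
have main (G' : nat -> int -> R) v' A' F' n (i : int) (m : nat) :
    array_data al kap0 kap1 lam d M M0 J n v' G' A' F' -> array_bounds al d B X J n G' ->
    (n <= N)%N -> 0 <= i -> i *+ 2 <= J%:Z -> (m <= k0)%N ->
    `|G' n (i + m%:Z) - G' n i| <= (C * (1 + M0 + B) + X / 4) * (m%:R * d) `^ al.
  move=> D' BX' nN i0 iJ mk.
  have mono : (n%:R * (lam * d ^+ 2)) `^ (al / 2) <= (N%:R * (lam * d ^+ 2)) `^ (al / 2).
    have dt0 : 0 <= lam * d ^+ 2 by rewrite mulr_ge0 ?sqr_ge0// ltW.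
    apply: ge0_ler_powR; first exact: ltW.
    - by rewrite nnegrE (mulr_ge0 _ dt0).
    - by rewrite nnegrE (mulr_ge0 _ dt0).
    - by rewrite (ler_wpM2r dt0)// ler_nat.
  have osc_n : M * ((6 * (k0%:R * d)) `^ al + (n%:R * (lam * d ^+ 2)) `^ (al / 2)) * X <= osc * X.
    by rewrite ler_wpM2r// ler_wpM2l// lerD2l.
  have k03' : (2 < k0)%N by exact: leq_trans k03.
  apply: (le_trans (space_left (NN := NN) D' BX' X0 B0 k03' kJ i0 iJ _ _ _ NN0 mk)).
  - rewrite -/E -/w /NN; move: p2 p3; clear; lra.
  - rewrite -/mu -/E -/w.
    have -> : mu * NN = mu * (2 * M0 + 2 * E * w + 4 * (3 * B) * kk') +
       4 * (2 * (osc * X + M * (B + 1)) + 2 * (kap1 * E) * w).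
      by rewrite /NN; field; rewrite gt_eqF.
    have : 0 <= mu * (2 * M0 + 2 * E * w + 4 * (3 * B) * kk') by exact: (mulr_ge0 (ltW mu0) (addr_ge0 p1 p3)).
    by move: osc_n; clear; lra.
  - rewrite -/kk' /NN; move: p1 p2; clear; lra.
  rewrite ler_wpM2r ?powR_ge0//; apply: le_trans cNN.
  by rewrite lerDl !mulr_ge0.
move=> n i m nN i0 im.
(* Beyond the window the increment is at most 2 B while the distance is at least k0 d. *)
case: (leqP m k0) => mk; last first.
  have h1 := BX.1 n i nN ltac:(move: i0 im; clear; lia).
  have h2 := BX.1 n (i + m%:Z) nN ltac:(move: i0 im; clear; lia).
  have k0d0 : 0 < k0%:R * d by apply: lt_le_trans k0d2; rewrite divr_gt0.
  have one : 1 <= kk' * (m%:R * d) `^ al.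
    rewrite /kk' powRN mulrC ler_pdivlMr ?powR_gt0// mul1r.
    apply: ge0_ler_powR; rewrite ?(ltW al0) ?nnegrE ?mulr_ge0 ?(ltW d0)//.
    by rewrite ler_wpM2r ?(ltW d0)// ler_nat ltnW.
  apply: (@le_trans _ _ (2 * B * (kk' * (m%:R * d) `^ al))).
    have : 2 * B * 1 <= 2 * B * (kk' * (m%:R * d) `^ al) by rewrite ler_wpM2l// mulr_ge0.
    by move: (ler_normB (G n (i + m%:Z)) (G n i)) h1 h2; clear; lra.
  rewrite mulrA ler_wpM2r ?powR_ge0//; apply: le_trans cNN.
  have : 2 * B * kk' <= 2 * B * kk by rewrite ler_wpM2l ?mulr_ge0.
  have : 0 <= c * NN by rewrite mulr_ge0// ltW.
  by clear; lra.
have Dn := array_data_le nN D; have BXn := array_bounds_le nN BX.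
case: (leP (i *+ 2) J%:Z) => iJ; first exact: (main G v A F n i m Dn BXn nN i0 iJ mk).
have Dr := array_data_rev Dn; have BXr := array_bounds_rev BXn.
have := main _ _ _ _ n (J%:Z - (i + m%:Z)) m Dr BXr nN.
rewrite distrC (_ : J%:Z - (J%:Z - (i + m%:Z)) = i + m%:Z); last by clear; lia.
rewrite (_ : J%:Z - (J%:Z - (i + m%:Z) + m%:Z) = i); last by clear; lia.
by apply=> //; move: iJ im; clear; lia.
Qed.

End SpaceEstimate.

(** * Holder estimate in time and the closed Schauder bound *)

Section TimeEstimate.
Context {R : realType}.

(** The scheme is summed over k levels; each summand is a second difference of the velocity, which
    is Holder continuous in space. *)
Lemma time_diff_bound (al kap0 kap1 lam d M M0 B X : R) (J N : nat)
    (v G A F : nat -> int -> R) n k (b : int) q :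
  array_data al kap0 kap1 lam d M M0 J N v G A F ->
  array_bounds al d B X J N G -> 0 <= X -> (n + k <= N)%N ->
  0 <= b -> b + (2 * q)%:Z <= J%:Z ->
  `|sdiff q (sdiff q (v (n + k)%N)) b - sdiff q (sdiff q (v n)) b| <=
  k%:R * (lam * d ^+ 2) * (2 * (kap1 * X + M * (B + 1)) * (q%:R * d) `^ al).
Proof.
move=> D BX X0 nk b0 bJ; elim: k nk => [|k IH] nk.
  by rewrite addn0 subrr normr0 !mul0r.
have nk' : (n + k <= N)%N by apply: leq_trans nk; rewrite addnS.
have {}IH := IH nk'.
have dt0 : 0 < lam * d ^+ 2 by rewrite mulr_gt0 ?(ad_lam D)// exprn_gt0// (ad_d D).
pose V j := A (n + k)%N j * G (n + k)%N j + F (n + k)%N j.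
have Vh (i : int) : 0 <= i -> i + q%:Z <= J%:Z ->
    `|V (i + q%:Z) - V i| <= (kap1 * X + M * (B + 1)) * (q%:R * d) `^ al.
  move=> i0 iJ; have := array_velocity_holder D BX (kap := 0) (osc := kap1) nk' i0 iJ.
  rewrite !subr0; apply=> //.
  have /andP[a0 a1] := ad_A D nk' (j := i + q%:Z) ltac:(move: i0 iJ; clear; lia).
  rewrite ger0_norm// (le_trans _ a0)// ltW//.
  by case/andP: (ad_kap D).
have E (j : int) : 0 <= j -> j <= J%:Z -> v (n + k.+1)%N j = v (n + k)%N j + lam * d ^+ 2 * V j.
  move=> j0 jJ; rewrite addnS (ad_eq D)//; last by rewrite j0.
  by move: nk; rewrite addnS.
have -> : sdiff q (sdiff q (v (n + k.+1)%N)) b = sdiff q (sdiff q (v (n + k)%N)) b +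
    lam * d ^+ 2 * ((V (b + q%:Z + q%:Z) - V (b + q%:Z)) - (V (b + q%:Z) - V b)).
  by rewrite /sdiff !E; try (by move: b0 bJ; clear; lia); ring.
have v1 := Vh b b0 ltac:(move: bJ; clear; lia).
have v2 := Vh (b + q%:Z) ltac:(move: b0; clear; lia) ltac:(move: bJ; clear; lia).
rewrite addrAC; apply: (le_trans (ler_normD _ _)).
rewrite -natr1 [in leRHS]mulrDl mul1r [in leRHS]mulrDl lerD// normrM (gtr0_norm dt0).
rewrite (ler_wpM2l (ltW dt0))//; apply: (le_trans (ler_normB _ _)).
move: v1 v2; clear; set x := _ * _ `^ al => v1 v2.
rewrite -mulrA -/x; lra.
Qed.

(** Interpolation: at both times G is replaced by a second difference at scale q, whose change in
    time is known. *)
Lemma time_local (al kap0 kap1 lam d M M0 B X : R) (J N : nat)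
    (v G A F : nat -> int -> R) n k (j : int) q :
  array_data al kap0 kap1 lam d M M0 J N v G A F ->
  array_bounds al d B X J N G -> 0 <= X -> (n + k <= N)%N -> (0 < q)%N ->
  0 <= j -> j + (2 * q)%:Z <= J%:Z ->
  (q%:R * d) ^+ 2 * `|G (n + k)%N j - G n j| <=
   2 * ((q%:R * d) ^+ 2 * (X * (2 * (q%:R * d)) `^ al)) +
   k%:R * (lam * d ^+ 2) * (2 * (kap1 * X + M * (B + 1)) * (q%:R * d) `^ al).
Proof.
move=> D BX X0 nk q0 j0 jJ.
have T := time_diff_bound D BX X0 nk j0 jJ.
have d0 := ad_d D; have /andP[al0 _] := ad_al D.
have near l : (l <= N)%N -> `|sdiff q (sdiff q (v l)) j - (q%:R * d) ^+ 2 * G l j| <=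
    (q%:R * d) ^+ 2 * (X * (2 * (q%:R * d)) `^ al).
  move=> lN; apply: sdiff2_near => i i1 i2.
  rewrite (ad_G D lN); last by move: i1 i2 j0 jJ; clear; lia.
  rewrite -mulrBr normrM ger0_norm ?sqr_ge0// ler_wpM2l ?sqr_ge0//.
  have e : i = j + `|i - j|%N%:Z by move: i1; clear; lia.
  rewrite e; apply: (le_trans (BX.2 _ _ _ lN j0 _)).
    by rewrite -e; move: i2 jJ; clear; lia.
  rewrite ler_wpM2l//; apply: ge0_ler_powR.
  - exact: ltW.
  - by rewrite nnegrE mulr_ge0// ltW.
  - by rewrite nnegrE !mulr_ge0// ltW.
  - rewrite mulrA ler_wpM2r ?(ltW d0)// -natrM ler_nat.
    by move: i1 i2; clear; lia.
have n1 := near _ nk; have n2 := near n (leq_trans (leq_addr _ _) nk).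
have Q0 : 0 <= (q%:R * d) ^+ 2 by exact: sqr_ge0.
rewrite -[X in X * `|_|](ger0_norm Q0) -normrM mulrBr.
move: T n1 n2; clear => T n1 n2.
move: (sdiff q (sdiff q (v (n + k)%N)) j) (sdiff q (sdiff q (v n)) j) T n1 n2 => a a' T n1 n2.
move: T n1 n2; move: (_ * G _ _) (_ * G _ _) (_ * (X * _)) (_ * _ * (2 * _ * _)) => b b' c e.
rewrite !ler_norml => /andP[? ?] /andP[? ?] /andP[? ?].
by apply/andP; split; lra.
Qed.

Lemma time_arith (Q c X H x x' s t D : R) : 0 < Q -> 0 <= X -> 0 <= H ->
  Q * D <= 2 * (Q * (X * x')) + t * (2 * H * x) ->
  x' <= 2 * c * s -> t * x <= Q * s ->
  D <= (4 * c * X + 2 * H) * s.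
Proof.
move=> Q0 X0 H0 h hx ht; rewrite -(ler_pM2l Q0); apply: (le_trans h).
have : Q * (X * x') <= Q * (X * (2 * c * s)) by rewrite ler_wpM2l ?(ltW Q0)// ler_wpM2l.
have : H * (t * x) <= H * (Q * s) by rewrite ler_wpM2l.
lra.
Qed.

(** The scale is chosen with q d comparable to the square root s of the elapsed time t, where both
    errors are of order t^(al/2). The constant c absorbs the rounding: one time step has length lam
    d^2, so d is at most s / sqrt lam. *)
Lemma time_left (al kap0 kap1 lam d M M0 B X : R) (J N : nat)
    (v G A F : nat -> int -> R) n k (j : int) :
  array_data al kap0 kap1 lam d M M0 J N v G A F ->
  array_bounds al d B X J N G -> 0 <= X -> 0 <= B -> (n + k <= N)%N ->
  0 <= j -> j *+ 2 <= J%:Z ->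
  let c := 1 + (Num.sqrt lam)^-1 in
  let t := k%:R * (lam * d ^+ 2) in
  4 * c * Num.sqrt t <= J%:R * d ->
  `|G (n + k)%N j - G n j| <= (4 * c * X + 2 * (kap1 * X + M * (B + 1))) * t `^ (al / 2).
Proof.
move=> D BX X0 B0 nk j0 jJ c t hJ.
have d0 := ad_d D; have /andP[al0 al1] := ad_al D; have lam0 := ad_lam D.
have /andP[k00 k01] := ad_kap D; have M_ := ad_M D.
have kap10 : 0 <= kap1 by rewrite (le_trans _ k01)// ltW.
have HV0 : 0 <= kap1 * X + M * (B + 1) by rewrite addr_ge0 ?mulr_ge0 ?addr_ge0.
have sl0 : 0 < Num.sqrt lam by rewrite sqrtr_gt0.
have c0 : 1 <= c by rewrite lerDl invr_ge0 ltW.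
case: (posnP k) => [->|kp].
  rewrite addn0 subrr normr0 mulr_ge0 ?powR_ge0// addr_ge0 ?mulr_ge0//.
  exact: le_trans c0.
have dt0 : 0 < lam * d ^+ 2 by rewrite mulr_gt0 ?exprn_gt0.
have t0 : 0 < t by rewrite mulr_gt0// ltr0n.
set s := Num.sqrt t in hJ *.
have s0 : 0 < s by rewrite sqrtr_gt0.
have s2 : s ^+ 2 = t by rewrite sqr_sqrtr// ltW.
have ds : d <= s / Num.sqrt lam.
  rewrite ler_pdivlMr// mulrC /s -[X in _ * X](ger0_norm (ltW d0)) -sqrtr_sqr -sqrtrM ?(ltW lam0)//.
  apply: ler_wsqrtr; rewrite /t ler_peMl ?(ltW dt0)//.
  by rewrite ler1n.
pose q := (Num.truncn (s / d)).+1.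
have sd0 : 0 <= s / d by rewrite divr_ge0// ltW.
have /andP[q1 q2] : (Num.truncn (s / d))%:R <= s / d < q%:R by apply: truncn_itv.
have sq : s <= q%:R * d by rewrite -ler_pdivrMr// ltW.
have qs : q%:R * d <= c * s.
  have : (Num.truncn (s / d))%:R * d <= s by rewrite -ler_pdivlMr.
  rewrite /q -natr1 mulrDl mul1r /c mulrDl mul1r => h.
  by rewrite lerD// mulrC.
have qd0 : 0 < q%:R * d by exact: lt_le_trans sq.
have qJ : (4 * q <= J)%N.
  rewrite -(ler_nat R) -(ler_pM2r d0); apply: le_trans hJ.
  by rewrite natrM -!mulrA ler_wpM2l.
have L := time_local (q := q) D BX X0 nk (ltn0Sn _) j0 ltac:(move: jJ qJ; clear; lia).
rewrite -s2 powR_half_sq ?(ltW s0)//.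
apply: (time_arith (exprn_gt0 2 qd0) X0 HV0 L).
  have c2s0 : 0 <= 2 * c * s by rewrite !mulr_ge0 ?(ltW s0)// (le_trans _ c0).
  apply: (@le_trans _ _ ((2 * c * s) `^ al)).
    apply: ge0_ler_powR; rewrite ?(ltW al0) ?nnegrE// ?(mulr_ge0 _ (ltW qd0))//.
    by rewrite -mulrA ler_wpM2l.
  have c20 : 1 <= 2 * c by lra.
  rewrite powRM ?(ltW s0) ?(le_trans ler01 c20)// ler_wpM2r ?powR_ge0//.
  by apply: ler1_powR => //; exact: ltW.
rewrite -/t -s2.
have := powR_sublin s0 sq (al := al); rewrite (ltW al0) (ltW al1) => /(_ isT) h.
have -> : s ^+ 2 * (q%:R * d) `^ al = s * ((q%:R * d) `^ al * s) by ring.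
apply: (@le_trans _ _ (s * (s `^ al * (q%:R * d)))).
  by rewrite ler_wpM2l ?(ltW s0).
have -> : s * (s `^ al * (q%:R * d)) = s `^ al * (s * (q%:R * d)) by ring.
by rewrite mulrC ler_wpM2r ?powR_ge0// [leRHS]expr2 (ler_wpM2r (ltW qd0)).
Qed.

Lemma time_step (al kap0 kap1 lam M Len : R) :
  0 < al < 1 -> 0 < kap0 <= kap1 -> 0 < lam -> 0 <= M -> 0 < Len ->
  exists C de : R, [/\ 0 < C, 0 < de &
    forall (d M0 B X : R) (J N : nat) (v G A F : nat -> int -> R),
    array_data al kap0 kap1 lam d M M0 J N v G A F ->
    J%:R * d = Len -> N%:R * (lam * d ^+ 2) <= de ->
    array_bounds al d B X J N G -> 0 <= X -> 0 <= B ->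
    forall n k (j : int), (n + k <= N)%N -> 0 <= j <= J%:Z ->
    `|G (n + k)%N j - G n j| <=
      C * (X + B + 1) * (k%:R * (lam * d ^+ 2)) `^ (al / 2)].
Proof.
move=> al01 kap lam0 M_ Len0; have /andP[al0 al1] := al01; have /andP[k00 k01] := kap.
pose c := 1 + (Num.sqrt lam)^-1.
have c0 : 0 < c by rewrite ltr_wpDr// invr_ge0 sqrtr_ge0.
have kap10 : 0 <= kap1 by rewrite (le_trans _ k01)// ltW.
have L4 : 0 < Len / (4 * c) by rewrite divr_gt0// mulr_gt0.
exists (4 * c + 2 * kap1 + 2 * M), ((Len / (4 * c)) ^+ 2); split.
- by rewrite !ltr_wpDr ?mulr_ge0// mulr_gt0.
- by rewrite exprn_gt0.
move=> d M0 B X J N v G A F D JL Nde BX X0 B0 n k j nk jJ.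
have d0 := ad_d D.
have dt0 : 0 < lam * d ^+ 2 by rewrite mulr_gt0 ?exprn_gt0.
have hs : 4 * c * Num.sqrt (k%:R * (lam * d ^+ 2)) <= J%:R * d.
  rewrite JL mulrC -ler_pdivlMr; last by rewrite mulr_gt0.
  rewrite -[leRHS]ger0_norm ?(ltW L4)// -sqrtr_sqr; apply: ler_wsqrtr.
  apply: le_trans Nde; rewrite (ler_wpM2r (ltW dt0))// ler_nat.
  by apply: leq_trans nk; exact: leq_addl.
have fin (G' : nat -> int -> R) v' A' F' (i : int) :
    array_data al kap0 kap1 lam d M M0 J N v' G' A' F' -> array_bounds al d B X J N G' ->
    0 <= i -> i *+ 2 <= J%:Z -> `|G' (n + k)%N i - G' n i| <=
      (4 * c + 2 * kap1 + 2 * M) * (X + B + 1) * (k%:R * (lam * d ^+ 2)) `^ (al / 2).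
  move=> D' BX' i0 iJ; apply: (le_trans (time_left D' BX' X0 B0 nk i0 iJ hs)).
  rewrite ler_wpM2r ?powR_ge0//.
  have h1 : c * X <= c * (X + B + 1) by rewrite (ler_wpM2l (ltW c0))//; lra.
  have h2 : kap1 * X <= kap1 * (X + B + 1) by rewrite ler_wpM2l//; lra.
  have h3 : M * (B + 1) <= M * (X + B + 1) by rewrite ler_wpM2l//; lra.
  rewrite -/c; lra.
case: (leP (j *+ 2) J%:Z) => j2.
  by apply: (fin _ _ _ _ _ D BX) => //; case/andP: jJ.
have := fin _ _ _ _ (J%:Z - j) (array_data_rev D) (array_bounds_rev BX).
rewrite (_ : J%:Z - (J%:Z - j) = j); last by clear; lia.
by apply; move: jJ j2; clear; lia.
Qed.

Lemma le_dyadic_lim (x a b : R) : 0 <= b -> (forall k, x <= a + b / 2 ^+ k) -> x <= a.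
Proof.
move=> b0 H; rewrite leNgt; apply/negP => ax.
have xa : 0 < x - a by rewrite subr_gt0.
have q0 : 0 <= b / (x - a) by rewrite divr_ge0// ltW.
have := archi_boundP q0; set k := Num.bound _ => kb.
have k2 : (k%:R : R) <= 2 ^+ k by rewrite -natrX ler_nat ltnW// ltn_expl.
have := H k; rewrite -lerBlDl ler_pdivlMr ?exprn_gt0// => h.
move: kb; rewrite ltr_pdivrMr// => kb.
have : (x - a) * k%:R <= (x - a) * 2 ^+ k by rewrite (ler_wpM2l (ltW xa)).
lra.
Qed.

Lemma array_bounds_weaken (al d B X B' X' : R) J N G : B <= B' -> X <= X' ->
  array_bounds al d B X J N G -> array_bounds al d B' X' J N G.
Proof.
move=> BB XX [h1 h2]; split.
  by move=> n j nN jJ; exact: le_trans (h1 _ _ nN jJ) BB.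
move=> n i m nN i0 iJ; apply: (le_trans (h2 _ _ _ nN i0 iJ)).
by rewrite ler_wpM2r ?powR_ge0.
Qed.

(** A finite bound that depends on the mesh and on the array; it only starts the iteration in
    [array_schauder]. *)
Lemma array_bounds_exist (al d L : R) J N (G : nat -> int -> R) : 0 < al -> 0 < d -> 1 <= L ->
  exists2 Q : R, 0 <= Q & array_bounds al d Q (L * Q) J N G.
Proof.
move=> al0 d0 L1.
pose Q0 := \sum_(i < N.+1) \sum_(j < J.+1) `|G i j%:Z|.
have GQ n (j : int) : (n <= N)%N -> 0 <= j <= J%:Z -> `|G n j| <= Q0.
  move=> nN jJ; have e : j = `|j|%N%:Z by move: jJ; clear; lia.
  have jn : (`|j| < J.+1)%N by move: jJ; clear; lia.
  rewrite /Q0 (bigD1 (Ordinal (nN : (n < N.+1)%N)))//= (bigD1 (Ordinal jn))//= -e.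
  rewrite -addrA lerDl addr_ge0// sumr_ge0// => i _; exact: sumr_ge0.
have Q00 : 0 <= Q0 by rewrite sumr_ge0// => i _; exact: sumr_ge0.
have da : 0 <= 2 * d `^ (- al) by rewrite mulr_ge0 ?powR_ge0.
exists (Q0 * (1 + 2 * d `^ (- al))); first by rewrite mulr_ge0// addr_ge0.
have Q0l : Q0 <= Q0 * (1 + 2 * d `^ (- al)) by rewrite ler_peMr// lerDl.
split; first by move=> n j nN jJ; exact: le_trans (GQ _ _ nN jJ) Q0l.
move=> n i m nN i0 im.
case: (posnP m) => [->|m0].
  rewrite addr0 subrr normr0 mulr_ge0 ?powR_ge0// mulr_ge0 ?(le_trans ler01 L1)//.
  by rewrite mulr_ge0// addr_ge0.
have h1 := GQ n i nN ltac:(move: i0 im; clear; lia).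
have h2 := GQ n (i + m%:Z) nN ltac:(move: i0 im; clear; lia).
have one : 1 <= d `^ (- al) * (m%:R * d) `^ al.
  rewrite powRN mulrC ler_pdivlMr ?powR_gt0// mul1r; apply: ge0_ler_powR.
  - exact: ltW.
  - by rewrite nnegrE ltW.
  - by rewrite nnegrE mulr_ge0// ltW.
  - by rewrite ler_peMl ?(ltW d0)// ler1n.
apply: (@le_trans _ _ (2 * Q0)).
  by apply: (le_trans (ler_normB _ _)); lra.
apply: (@le_trans _ _ (2 * Q0 * (d `^ (- al) * (m%:R * d) `^ al))).
  by rewrite ler_peMr// mulr_ge0.
rewrite mulrA ler_wpM2r ?powR_ge0//.
apply: (@le_trans _ _ (1 * (Q0 * (2 * d `^ (- al))))).
  by rewrite mul1r (mulrC 2) mulrA.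
apply: ler_pM => //; first by rewrite mulr_ge0.
by rewrite ler_wpM2l// lerDr.
Qed.

(** The two estimates send the bounds (Q, L Q) to the same pair with Q/2 + M0 + 1 in place of Q: the
    short duration limits the growth of G from its initial values, and L >= 4 C1 closes the spatial
    step. Iteration from any finite bound leads to the fixed point 2 (M0 + 1), in which no trace of
    the mesh remains. *)
Theorem array_schauder (al kap0 kap1 lam M Len : R) :
  0 < al < 1 -> 0 < kap0 <= kap1 -> 0 < lam -> 0 <= M -> 0 < Len ->
  exists C de d1 : R, [/\ 0 < C, 0 < de, 0 < d1 &
    forall (d M0 : R) (J N : nat) (v G A F : nat -> int -> R),
    array_data al kap0 kap1 lam d M M0 J N v G A F ->
    J%:R * d = Len -> d <= d1 -> N%:R * (lam * d ^+ 2) <= de ->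
    array_bounds al d (C * (M0 + 1)) (C * (M0 + 1)) J N G /\
    forall n k (j : int), (n + k <= N)%N -> 0 <= j <= J%:Z ->
    `|G (n + k)%N j - G n j| <=
      C * (M0 + 1) * (k%:R * (lam * d ^+ 2)) `^ (al / 2)].
Proof.
move=> al01 kap lam0 M_ Len0; have /andP[al0 al1] := al01.
have [C1 [de1 [d1 [C10 de10 d10 SP]]]] := space_step lam al01 kap M_ Len0.
have [C2 [de2 [C20 de20 TM]]] := time_step al01 kap lam0 M_ Len0.
pose L := 4 * C1 + 1.
have L1 : 1 <= L by rewrite /L; lra.
have al20 : 0 < al / 2 by lra.
have ep0 : 0 < (2 * (C2 * (L + 1)))^-1 by rewrite invr_gt0 !mulr_gt0//; lra.
have [de3 de30 Hde] := powR_small al20 ep0.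
pose de := Num.min de1 (Num.min de2 de3).
pose C := 2 + 2 * L + C2 * (2 * L + 3).
have C0 : 0 < C by rewrite /C !ltr_wpDr ?mulr_ge0//; rewrite ?(ltW C20)//; lra.
exists C, de, d1; split=> //; first by rewrite !lt_min de10 de20 de30.
move=> d M0 J N v G A F D JL dd1 Nde.
have d0 := ad_d D; have M00 := ad_M0 D.
have N1 : N%:R * (lam * d ^+ 2) <= de1 by apply: le_trans Nde _; rewrite ge_min lexx.
have N2 : N%:R * (lam * d ^+ 2) <= de2.
  by apply: le_trans Nde _; rewrite !ge_min lexx orbT.
have N3 : N%:R * (lam * d ^+ 2) <= de3.
  by apply: le_trans Nde _; rewrite !ge_min lexx !orbT.
have dt0 : 0 < lam * d ^+ 2 by rewrite mulr_gt0 ?exprn_gt0.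
have step Q : 0 <= Q -> array_bounds al d Q (L * Q) J N G ->
    array_bounds al d (Q / 2 + (M0 + 1)) (L * (Q / 2 + (M0 + 1))) J N G.
  move=> Q0 BX; have LQ0 : 0 <= L * Q by rewrite mulr_ge0// (le_trans ler01).
  have [_ h] := SP _ _ _ _ _ _ _ _ _ _ D JL dd1 N1 BX LQ0 Q0; split; last first.
    move=> n i m nN i0 im; apply: (le_trans (h _ _ _ nN i0 im)).
    rewrite ler_wpM2r ?powR_ge0// /L.
    have e1 := mulr_ge0 (ltW C10) Q0; have e2 := mulr_ge0 (ltW C10) M00.
    by move: e1 e2 M00 Q0 C10; clear; lra.
  move=> n j nN jJ; have := TM _ _ _ _ _ _ _ _ _ _ D JL N2 BX LQ0 Q0 0%N n j nN jJ.
  rewrite add0n => T; have g0 := ad_G0 D jJ.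
  have nd : (n%:R * (lam * d ^+ 2)) `^ (al / 2) <= (2 * (C2 * (L + 1)))^-1.
    apply: Hde; rewrite (mulr_ge0 _ (ltW dt0))//=; apply: le_trans N3.
    by rewrite (ler_wpM2r (ltW dt0))// ler_nat.
  have e : C2 * (L * Q + Q + 1) * (n%:R * (lam * d ^+ 2)) `^ (al / 2) <= (Q + 1) / 2.
    apply: (@le_trans _ _ (C2 * ((L + 1) * (Q + 1)) * (2 * (C2 * (L + 1)))^-1)).
      apply: ler_pM; rewrite ?powR_ge0//.
        by rewrite mulr_ge0 ?(ltW C20)//; move: LQ0 Q0; clear; lra.
      by rewrite (ler_wpM2l (ltW C20))//; move: LQ0 L1; clear; lra.
    rewrite le_eqVlt; apply/orP; left; apply/eqP; field.
    by rewrite !gt_eqF//; move: L1; clear; lra.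
  have := ler_normD (G 0%N j) (G n j - G 0%N j); rewrite subrKC; move: T e g0; clear; lra.
have [Q0 Q00 BX0] := array_bounds_exist J N G al0 d0 L1.
have iter k : array_bounds al d (2 * (M0 + 1) + Q0 / 2 ^+ k) (L * (2 * (M0 + 1) + Q0 / 2 ^+ k)) J N G.
  have LL : 0 <= L by exact: le_trans L1.
  elim: k => [|k IH].
    apply: array_bounds_weaken BX0; rewrite expr0 divr1; first by move: M00; clear; lra.
    by rewrite ler_wpM2l//; move: M00; clear; lra.
  have q0 : 0 <= Q0 / 2 ^+ k by rewrite divr_ge0// exprn_ge0.
  have := step _ _ IH.
  have -> : (2 * (M0 + 1) + Q0 / 2 ^+ k) / 2 + (M0 + 1) = 2 * (M0 + 1) + Q0 / 2 ^+ k.+1.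
    by rewrite exprS; field; rewrite expf_neq0// pnatr_eq0.
  by apply; move: q0 M00; clear; lra.
have BX : array_bounds al d (2 * (M0 + 1)) (L * (2 * (M0 + 1))) J N G.
  split.
    move=> n j nN jJ; apply: (le_dyadic_lim Q00) => k.
    exact: (iter k).1.
  move=> n i m nN i0 im.
  have b0 : 0 <= L * Q0 * (m%:R * d) `^ al.
    by rewrite !mulr_ge0 ?powR_ge0// (le_trans ler01).
  apply: (le_dyadic_lim b0) => k; apply: (le_trans ((iter k).2 _ _ _ nN i0 im)).
  rewrite le_eqVlt; apply/orP; left; apply/eqP.
  by field; rewrite expf_neq0// pnatr_eq0.
have LM : 0 <= L * (M0 + 1) by rewrite mulr_ge0//; move: M00 L1; clear; lra.
have CM : 0 <= C2 * (2 * L + 3) * (M0 + 1) by rewrite !mulr_ge0 ?(ltW C20)//; move: M00 L1; clear; lra.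
split.
  by apply: array_bounds_weaken BX; rewrite /C; move: CM LM M00; clear; lra.
move=> n k j nk jJ.
have X0 : 0 <= L * (2 * (M0 + 1)) by rewrite mulr_ge0 ?mulr_ge0//; move: M00 L1; clear; lra.
have B0 : 0 <= 2 * (M0 + 1) by rewrite mulr_ge0//; move: M00; clear; lra.
apply: (le_trans (TM _ _ _ _ _ _ _ _ _ _ D JL N2 BX X0 B0 _ _ _ nk jJ)).
rewrite ler_wpM2r ?powR_ge0//.
have : C2 * (L * (2 * (M0 + 1)) + 2 * (M0 + 1) + 1) <= C2 * (2 * L + 3) * (M0 + 1).
  by rewrite -mulrA (ler_wpM2l (ltW C20))//; move: M00; clear; lra.
by rewrite /C; move: LM M00; clear; lra.
Qed.

End TimeEstimate.

(** * The explicit scheme *)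

Section Slopes.
Context {R : realType}.
Implicit Types (w g : int -> R) (j : int) (m k n q J : nat).

(** Forward differences, with the backward one at the last node, so that every node has a slope made
    of values inside the interval. *)
Definition slope (d : R) J w j : R :=
  if j < J%:Z then (w (j + 1) - w j) / d else (w j - w (j - 1)) / d.

Record grid_fun (d B : R) J w g : Prop := GridFun {
  gf_d : 0 < d;
  gf_J : (0 < J)%N;
  gf_lap : forall j, 0 < j < J%:Z -> lap w j = d ^+ 2 * g j;
  gf_B : forall j, 0 <= j <= J%:Z -> `|g j| <= B }.

Lemma slope_succ (d B : R) J w g j : grid_fun d B J w g -> 0 <= j -> j + 1 < J%:Z ->
  slope d J w (j + 1) - slope d J w j = d * g (j + 1).
Proof.
move=> [d0 J0 L _] j0 jJ; rewrite /slope jJ (_ : j < J%:Z); last by move: jJ; clear; lia.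
have := L (j + 1) ltac:(move: j0 jJ; clear; lia); rewrite /lap addrK => e.
have -> : d * g (j + 1) = d ^+ 2 * g (j + 1) / d by field; rewrite gt_eqF.
by rewrite -e; field; rewrite gt_eqF.
Qed.

Lemma slope_last (d : R) J w : (0 < J)%N -> slope d J w J%:Z = slope d J w (J%:Z - 1).
Proof.
move=> J0; rewrite /slope ltxx (_ : J%:Z - 1 < J%:Z); last by clear; lia.
by rewrite subrK.
Qed.

Lemma slope_x (d B : R) J w g j m : grid_fun d B J w g -> 0 <= j -> j + m%:Z <= J%:Z ->
  `|slope d J w (j + m%:Z) - slope d J w j| <= B * (m%:R * d).
Proof.
move=> H j0 jm; have d0 := gf_d H.
have B0 : 0 <= B by apply: le_trans (gf_B H (j := 0) _).
have -> : B * (m%:R * d) = m%:R * (d * B) by ring.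
apply: sdiff_bound => i i1 i2.
case: (ltP (i + 1) J%:Z) => iJ.
  rewrite (slope_succ H) => //; last by move: j0 i1; clear; lia.
  rewrite normrM gtr0_norm// (ler_wpM2l (ltW d0))// (gf_B H)//.
  by move: j0 i1 iJ; clear; lia.
have -> : i = J%:Z - 1 by move: i2 iJ jm; clear; lia.
by rewrite subrK slope_last ?(gf_J H)// subrr normr0 mulr_ge0// ltW.
Qed.

Lemma slope_taylor (d B : R) J w g j m : grid_fun d B J w g -> 0 <= j -> j + m%:Z <= J%:Z ->
  `|w (j + m%:Z) - w j - m%:R * d * slope d J w j| <= B * (m%:R * d) ^+ 2.
Proof.
move=> H j0; have d0 := gf_d H.
have B0 : 0 <= B by apply: le_trans (gf_B H (j := 0) _).
elim: m => [|m IH] jm.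
  by rewrite addr0 subrr !mul0r subr0 normr0 expr0n/= mulr0.
have jm' : j + m%:Z < J%:Z by move: jm; clear; lia.
have {}IH := IH (ltW jm').
have sx := slope_x H j0 (ltW jm').
have e : j + m.+1%:Z = j + m%:Z + 1 by clear; lia.
have E : w (j + m.+1%:Z) - w j - m.+1%:R * d * slope d J w j =
   (w (j + m%:Z) - w j - m%:R * d * slope d J w j) +
   d * (slope d J w (j + m%:Z) - slope d J w j).
  rewrite e {3}/slope jm' -natr1; by field; rewrite gt_eqF.
rewrite E; apply: (le_trans (ler_normD _ _)); rewrite normrM (gtr0_norm d0).
have := ler_wpM2l (ltW d0) sx.
have m0 : 0 <= B * (m.+1%:R * d * d) by rewrite !mulr_ge0// ltW.
rewrite -natr1 in m0 *; move: IH; set y := slope _ _ _ j; nra.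
Qed.

Lemma slope_taylor_back (d B : R) J w g j m : grid_fun d B J w g -> 0 <= j -> j + m%:Z <= J%:Z ->
  `|w j - w (j + m%:Z) + m%:R * d * slope d J w (j + m%:Z)| <= 2 * B * (m%:R * d) ^+ 2.
Proof.
move=> H j0 jm; have d0 := gf_d H.
have h1 := slope_taylor H j0 jm; have h2 := slope_x H j0 jm.
have md0 : 0 <= m%:R * d by rewrite mulr_ge0// ltW.
have h3 := ler_wpM2l md0 h2; rewrite -[X in X * `|_|](ger0_norm md0) -normrM in h3.
move: h1 h3; set x := m%:R * d.
move: (slope d J w j) (slope d J w (j + m%:Z)) => y y'.
have -> : x * (B * x) = B * x ^+ 2 by ring.
rewrite !ler_norml => /andP[? ?] /andP[? ?]; apply/andP; split; lra.
Qed.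

(** The term d B is the price for the last node, where the slope repeats its predecessor; it
    vanishes with the mesh. *)
Lemma slope_taylor2 (d B X al : R) J w g j m : grid_fun d B J w g -> 0 <= j ->
  j + m%:Z <= J%:Z -> 0 <= X -> 0 < al ->
  (forall (i : int) k, 0 <= i -> i + k%:Z <= J%:Z -> `|g (i + k%:Z) - g i| <= X * (k%:R * d) `^ al) ->
  `|slope d J w (j + m%:Z) - slope d J w j - m%:R * d * g j| <=
    m%:R * d * (X * (m%:R * d) `^ al) + d * B.
Proof.
move=> H j0 jm X0 al0 gX; have d0 := gf_d H.
have B0 : 0 <= B by apply: le_trans (gf_B H (j := 0) _).
have main k : (k <= m)%N -> j + k%:Z < J%:Z ->
   `|slope d J w (j + k%:Z) - slope d J w j - k%:R * d * g j| <= k%:R * d * (X * (m%:R * d) `^ al).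
  elim: k => [|k IH] km jk; first by rewrite addr0 subrr !mul0r subr0 normr0.
  have {}IH := IH (ltnW km) ltac:(move: jk; clear; lia).
  have e : j + k.+1%:Z = j + k%:Z + 1 by clear; lia.
  have S := slope_succ H (j := j + k%:Z) ltac:(move: j0; clear; lia) ltac:(move: jk; clear; lia).
  rewrite -e in S.
  have -> : slope d J w (j + k.+1%:Z) - slope d J w j - k.+1%:R * d * g j =
     (slope d J w (j + k%:Z) - slope d J w j - k%:R * d * g j) + d * (g (j + k.+1%:Z) - g j).
    rewrite mulrBr -S -natr1; ring.
  apply: (le_trans (ler_normD _ _)); rewrite normrM (gtr0_norm d0).
  have G := gX j k.+1 j0 (ltW jk).
  have G' : `|g (j + k.+1%:Z) - g j| <= X * (m%:R * d) `^ al.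
    apply: (le_trans G); rewrite ler_wpM2l//; apply: ge0_ler_powR; first exact: ltW.
    - by rewrite nnegrE mulr_ge0// ltW.
    - by rewrite nnegrE mulr_ge0// ltW.
    - by rewrite (ler_wpM2r (ltW d0))// ler_nat.
  have := ler_wpM2l (ltW d0) G'.
  rewrite -natr1; move: IH; set Y := X * _; lra.
case: (posnP m) => [->|m0].
  by rewrite addr0 subrr !mul0r subr0 normr0 add0r mulr_ge0// ltW.
case: (ltP (j + m%:Z) J%:Z) => jmJ.
  by apply: (le_trans (main m (leqnn m) jmJ)); rewrite lerDl mulr_ge0// ltW.
have h := main m.-1 ltac:(move: m0; clear; lia) ltac:(move: jm m0; clear; lia).
have e1 : j + m%:Z = J%:Z by move: jm jmJ; clear; lia.
have e2 : j + m.-1%:Z = J%:Z - 1 by move: e1 m0; clear; lia.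
rewrite e1 slope_last ?(gf_J H)// -e2.
have gj := gf_B H (j := j) ltac:(move: j0 jm; clear; lia).
have -> : m%:R = m.-1%:R + 1 :> R by rewrite natr1 prednK.
have Y0 : 0 <= X * (m%:R * d) `^ al by rewrite mulr_ge0 ?powR_ge0.
have -> : slope d J w (j + m.-1%:Z) - slope d J w j - (m.-1%:R + 1) * d * g j =
  (slope d J w (j + m.-1%:Z) - slope d J w j - m.-1%:R * d * g j) - d * g j by ring.
apply: (le_trans (ler_normB _ _)); rewrite [`|d * _|]normrM (gtr0_norm d0).
have := ler_wpM2l (ltW d0) gj.
have <- : m%:R = m.-1%:R + 1 :> R by rewrite natr1 prednK.
have : m.-1%:R * d * (X * (m%:R * d) `^ al) <= m%:R * d * (X * (m%:R * d) `^ al).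
  by rewrite ler_wpM2r// (ler_wpM2r (ltW d0))// ler_nat leq_pred.
move: h; set Y := m.-1%:R * d * (X * _); lra.
Qed.

(** Parabolic scaling: a number of cells whose length is comparable to the square root of the
    elapsed time. *)
Lemma step_count (d lam : R) k : 0 < d -> 0 < lam -> (0 < k)%N ->
  let s := Num.sqrt (k%:R * (lam * d ^+ 2)) in
  exists q, [/\ (0 < q)%N, 0 < s, s <= q%:R * d & q%:R * d <= (1 + (Num.sqrt lam)^-1) * s].
Proof.
move=> d0 lam0 k0 s.
have dt0 : 0 < lam * d ^+ 2 by rewrite mulr_gt0 ?exprn_gt0.
have s0 : 0 < s by rewrite sqrtr_gt0 mulr_gt0// ltr0n.
have sl0 : 0 < Num.sqrt lam by rewrite sqrtr_gt0.
have ds : d <= s / Num.sqrt lam.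
  rewrite ler_pdivlMr// mulrC /s -[X in _ * X](ger0_norm (ltW d0)) -sqrtr_sqr -sqrtrM ?(ltW lam0)//.
  by apply: ler_wsqrtr; rewrite ler_peMl ?(ltW dt0)// ler1n.
exists (Num.truncn (s / d)).+1.
have sd0 : 0 <= s / d by rewrite divr_ge0// ltW.
have /andP[q1 q2] : (Num.truncn (s / d))%:R <= s / d < (Num.truncn (s / d)).+1%:R.
  exact: truncn_itv.
split=> //; first by rewrite -ler_pdivrMr// ltW.
have : (Num.truncn (s / d))%:R * d <= s by rewrite -ler_pdivlMr.
rewrite -natr1 mulrDl mul1r mulrDl mul1r => h.
by rewrite lerD// mulrC.
Qed.

Lemma slope_time_arith (x s c B VB D T : R) : 0 < x -> 0 <= s -> s <= x -> x <= c * s ->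
  0 <= B -> 0 <= VB ->
  x * D <= 4 * B * x ^+ 2 + T -> T <= 2 * VB * s ^+ 2 -> D <= (4 * c * B + 2 * VB) * s.
Proof.
move=> x0 s0 sx xc B0 VB0 h hT; rewrite -(ler_pM2l x0).
have h1 : B * x * x <= B * x * (c * s) by rewrite ler_wpM2l// mulr_ge0// ltW.
have h2 : VB * (s * s) <= VB * (x * s) by rewrite ler_wpM2l// ler_wpM2r.
nra.
Qed.

Lemma value_time (dt VB : R) (v V : nat -> int -> R) j n k N :
  (forall n, (n < N)%N -> v n.+1 j = v n j + dt * V n j) ->
  (forall n, (n < N)%N -> `|V n j| <= VB) -> 0 <= dt -> (n + k <= N)%N ->
  `|v (n + k)%N j - v n j| <= k%:R * dt * VB.
Proof.
move=> E HV dt0; elim: k => [|k IH] nk; first by rewrite addn0 subrr normr0 !mul0r.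
rewrite addnS in nk *.
have -> : v (n + k).+1 j - v n j = (v (n + k)%N j - v n j) + dt * V (n + k)%N j.
  by rewrite E//; ring.
apply: (le_trans (ler_normD _ _)).
rewrite -natr1 [in leRHS]mulrDl mul1r [in leRHS]mulrDl lerD ?IH ?(ltnW nk)//.
by rewrite normrM (ger0_norm dt0) ler_wpM2l// HV.
Qed.

(** The slope is compared with a difference quotient over a distance x comparable to s, the square
    root of the elapsed time: the Taylor error is of order B x, and the values move by at most VB
    s^2. Near the right end the quotient is taken to the left. *)
Lemma slope_time (d lam B VB : R) J N (v V g : nat -> int -> R) j n k :
  (forall n, (n <= N)%N -> grid_fun d B J (v n) (g n)) -> 0 < lam -> 0 <= VB ->
  (forall n j, (n < N)%N -> 0 <= j <= J%:Z -> v n.+1 j = v n j + lam * d ^+ 2 * V n j) ->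
  (forall n j, (n < N)%N -> 0 <= j <= J%:Z -> `|V n j| <= VB) ->
  (n + k <= N)%N -> 0 <= j <= J%:Z ->
  let c := 1 + (Num.sqrt lam)^-1 in
  let s := Num.sqrt (k%:R * (lam * d ^+ 2)) in
  4 * c * s <= J%:R * d ->
  `|slope d J (v (n + k)%N) j - slope d J (v n) j| <= (4 * c * B + 2 * VB) * s.
Proof.
move=> H lam0 VB0 E HV nk jJ c s hJ.
have d0 := gf_d (H 0%N (leq0n N)).
have B0 : 0 <= B by apply: le_trans (gf_B (H 0%N (leq0n N)) (j := 0) _).
have dt0 : 0 <= lam * d ^+ 2 by rewrite mulr_ge0 ?sqr_ge0// ltW.
case: (posnP k) => [k0|k0].
  rewrite /s k0 addn0 subrr normr0 mul0r sqrtr0 mulr0; exact: lexx.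
have [q [q0 s0 sq qc]] := step_count d0 lam0 k0.
rewrite -/s -/c in s0 sq qc.
have qJ : (4 * q <= J)%N.
  rewrite -(ler_nat R) -(ler_pM2r d0); apply: le_trans hJ.
  by rewrite natrM -!mulrA ler_wpM2l.
have x0 : 0 < q%:R * d by rewrite mulr_gt0// ltr0n.
have vt i : 0 <= i <= J%:Z -> `|v (n + k)%N i - v n i| <= VB * s ^+ 2.
  move=> iJ; rewrite /s sqr_sqrtr; last by rewrite mulr_ge0.
  rewrite mulrC.
  apply: (value_time (V := V) (N := N)) => //.
  - by move=> n' n'N; exact: E.
  - by move=> n' n'N; exact: HV.
have fin i i' (y y' : R) : 0 <= i <= J%:Z -> 0 <= i' <= J%:Z ->
    `|v (n + k)%N i' - v (n + k)%N i - q%:R * d * y'| <= 2 * B * (q%:R * d) ^+ 2 ->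
    `|v n i' - v n i - q%:R * d * y| <= 2 * B * (q%:R * d) ^+ 2 ->
    `|y' - y| <= (4 * c * B + 2 * VB) * s.
  move=> iJ i'J h1 h2; have t1 := vt i iJ; have t2 := vt i' i'J.
  apply: (@slope_time_arith _ _ _ _ _ _ (2 * (VB * s ^+ 2)) x0 (ltW s0) sq qc B0 VB0); last by rewrite mulrA.
  rewrite -[X in X * `|_|](ger0_norm (ltW x0)) -normrM mulrBr.
  move: h1 h2 t1 t2.
  move: (q%:R * d * y') (q%:R * d * y) (VB * _) => z' z e.
  have -> : 4 * B * (q%:R * d) ^+ 2 = 2 * (2 * B * (q%:R * d) ^+ 2) by ring.
  move: (2 * B * _) (v (n + k)%N i) (v (n + k)%N i') (v n i) (v n i') => e' p1 p2 p3 p4.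
  rewrite !ler_norml => /andP[? ?] /andP[? ?] /andP[? ?] /andP[? ?].
  by apply/andP; split; lra.
have B2 : B * (q%:R * d) ^+ 2 <= 2 * B * (q%:R * d) ^+ 2.
  by have := mulr_ge0 B0 (sqr_ge0 (q%:R * d)); lra.
have nN : (n <= N)%N by apply: leq_trans nk; exact: leq_addr.
case: (leP (j + q%:Z) J%:Z) => jq.
  have j0 : 0 <= j by case/andP: jJ.
  apply: (fin j (j + q%:Z)) => //.
  - by move: j0 jq; clear; lia.
  - exact: le_trans (slope_taylor (H _ nk) j0 jq) B2.
  - exact: le_trans (slope_taylor (H _ nN) j0 jq) B2.
have e : j = (j - q%:Z) + q%:Z by rewrite subrK.
have jq0 : 0 <= j - q%:Z by move: jq qJ; clear; lia.
have jJ' : j - q%:Z + q%:Z <= J%:Z by rewrite subrK; case/andP: jJ.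
have flip (w : int -> R) (y : R) : w j - w (j - q%:Z) - q%:R * d * y = - (w (j - q%:Z) - w j + q%:R * d * y).
  by ring.
apply: (fin (j - q%:Z) j) => //.
- by move: jq0 jJ'; clear; lia.
- rewrite flip normrN; have := slope_taylor_back (H _ nk) jq0 jJ'; rewrite subrK; exact.
- rewrite flip normrN; have := slope_taylor_back (H _ nN) jq0 jJ'; rewrite subrK; exact.
Qed.

End Slopes.

(** * Definition of the scheme and its bounds *)

Section Scheme.
Context {R : realType}.
Variables (l : R) (J : nat) (lam t0 : R) (a f ph : R -> R -> R -> R -> R) (u0 : R -> R).
Implicit Types (w : int -> R) (j : int).

Definition mesh : R := 2 * l / J%:R.
Definition tick : R := lam * mesh ^+ 2.
Definition node j : R := - l + j%:~R * mesh.
Definition clock (n : nat) : R := t0 + n%:R * tick.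

Definition sA n w j : R := a (clock n) (node j) (w j) (slope mesh J w j).
Definition sF n w j : R := f (clock n) (node j) (w j) (slope mesh J w j).
Definition sP n w j : R :=
  ph (if j == 0 then - 1 else 1) (clock n) (w j) (slope mesh J w j).
(** At the end nodes no second difference is available; the value is the one for which the equation
    yields the prescribed velocity [sP]. The scheme then has the same form at all nodes. *)
Definition sG n w j : R :=
  if 0 < j < J%:Z then lap w j / mesh ^+ 2 else (sP n w j - sF n w j) / sA n w j.

Fixpoint sv (n : nat) : int -> R :=
  if n is m.+1 then
    fun j => sv m j + tick * (sA m (sv m) j * sG m (sv m) j + sF m (sv m) j)
  else fun j => u0 (node j).

End Scheme.

(* [ph s t z p] is the velocity u_t prescribed at x = s l, for s = 1 and s = -1. *)
Record problem {R : realType} (al l T Rb kap0 kap1 Lam : R)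
    (a f ph : R -> R -> R -> R -> R) : Prop := Problem {
  pr_al : 0 < al < 1;
  pr_l : 0 < l;
  pr_Lam : 0 <= Lam;
  pr_kap : 0 < kap0 <= kap1;
  pr_a : forall t s x y z z' p p', 0 <= t <= T -> 0 <= s <= T -> - l <= x <= l ->
    - l <= y <= l -> `|z| <= Rb -> `|z'| <= Rb -> `|p| <= Rb -> `|p'| <= Rb ->
    `|a t x z p - a s y z' p'| <=
      Lam * (`|t - s| `^ (al / 2) + `|x - y| `^ al + `|z - z'| + `|p - p'|);
  pr_f : forall t s x y z z' p p', 0 <= t <= T -> 0 <= s <= T -> - l <= x <= l ->
    - l <= y <= l -> `|z| <= Rb -> `|z'| <= Rb -> `|p| <= Rb -> `|p'| <= Rb ->
    `|f t x z p - f s y z' p'| <=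
      Lam * (`|t - s| `^ (al / 2) + `|x - y| `^ al + `|z - z'| + `|p - p'|);
  pr_ph : forall sg t s z z' p p', sg = 1 \/ sg = -1 -> 0 <= t <= T -> 0 <= s <= T ->
    `|z| <= Rb -> `|z'| <= Rb -> `|p| <= Rb -> `|p'| <= Rb ->
    `|ph sg t z p - ph sg s z' p'| <=
      Lam * (`|t - s| `^ (al / 2) + `|z - z'| + `|p - p'|);
  pr_pos : forall t x z p, 0 <= t <= T -> - l <= x <= l -> `|z| <= Rb -> `|p| <= Rb ->
    kap0 <= a t x z p <= kap1;
  pr_fb : forall t x z p, 0 <= t <= T -> - l <= x <= l -> `|z| <= Rb -> `|p| <= Rb ->
    `|f t x z p| <= Lam }.

Section SchemeBounds.
Context {R : realType}.
Implicit Types (j : int).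

(** Bounds that keep the arguments of the coefficients in the range of [problem]. [sb_N1] lets a
    time be estimated by its power al/2, and [sb_Nl] makes room for the distance used in
    [slope_time]. *)
Record scheme_bounds (l : R) (J : nat) (lam t0 T Rb B : R) (a f ph : R -> R -> R -> R -> R)
    (u0 : R -> R) (N : nat) : Prop := SchemeBounds {
  sb_J : (0 < J)%N;
  sb_lam : 0 < lam;
  sb_t0 : 0 <= t0;
  sb_T : t0 + N%:R * tick l J lam <= T;
  sb_N1 : N%:R * tick l J lam <= 1;
  sb_Nl : 4 * (1 + (Num.sqrt lam)^-1) * Num.sqrt (N%:R * tick l J lam) <= 2 * l;
  sb_v : forall n j, (n <= N)%N -> 0 <= j <= J%:Z -> `|sv l J lam t0 a f ph u0 n j| <= Rb;
  sb_p : forall n j, (n <= N)%N -> 0 <= j <= J%:Z ->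
    `|slope (mesh l J) J (sv l J lam t0 a f ph u0 n) j| <= Rb;
  sb_G : forall n j, (n <= N)%N -> 0 <= j <= J%:Z ->
    `|sG l J lam t0 a f ph n (sv l J lam t0 a f ph u0 n) j| <= B }.

Variables (al l T Rb kap0 kap1 Lam lam t0 B : R) (a f ph : R -> R -> R -> R -> R).
Variables (u0 : R -> R) (J N : nat).
Hypothesis P : problem al l T Rb kap0 kap1 Lam a f ph.
Hypothesis S : scheme_bounds l J lam t0 T Rb B a f ph u0 N.

Let d := mesh l J.
Let dt := tick l J lam.
Let v := sv l J lam t0 a f ph u0.
Let A n := sA l J lam t0 a n (v n).
Let F n := sF l J lam t0 f n (v n).
Let G n := sG l J lam t0 a f ph n (v n).
Let V n j := A n j * G n j + F n j.

Lemma mesh_gt0 : 0 < d.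
Proof. by rewrite /d /mesh divr_gt0 ?mulr_gt0 ?(pr_l P)// ltr0n (sb_J S). Qed.

Lemma mesh_J : J%:R * d = 2 * l.
Proof. by rewrite /d /mesh mulrC divfK// pnatr_eq0 -lt0n (sb_J S). Qed.

Lemma tick_gt0 : 0 < dt.
Proof. by rewrite /dt /tick mulr_gt0 ?(sb_lam S)// exprn_gt0// mesh_gt0. Qed.

Lemma node_in j : 0 <= j <= J%:Z -> - l <= node l J j <= l.
Proof.
move=> /andP[j0 jJ]; rewrite /node lerDl -lerBrDl opprK.
rewrite mulr_ge0 ?(ltW mesh_gt0) ?ler0z//=.
have -> : l + l = J%:R * d by rewrite mesh_J; ring.
by rewrite (ler_wpM2r (ltW mesh_gt0))// -[X in _ <= X]/((J%:Z)%:~R) ler_int.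
Qed.

Lemma clock_in n : (n <= N)%N -> 0 <= clock l J lam t0 n <= T.
Proof.
move=> nN; rewrite /clock addr_ge0 ?(sb_t0 S)//=; last by rewrite mulr_ge0// ltW// tick_gt0.
apply: le_trans (sb_T S); rewrite lerD2l ler_wpM2r ?ler_nat// ltW//; exact: tick_gt0.
Qed.

Lemma scheme_A n j : (n <= N)%N -> 0 <= j <= J%:Z -> kap0 <= A n j <= kap1.
Proof.
by move=> nN jJ; apply: (pr_pos P); rewrite ?clock_in ?node_in ?(sb_v S) ?(sb_p S).
Qed.

Lemma scheme_F n j : (n <= N)%N -> 0 <= j <= J%:Z -> `|F n j| <= Lam.
Proof.
by move=> nN jJ; apply: (pr_fb P); rewrite ?clock_in ?node_in ?(sb_v S) ?(sb_p S).
Qed.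

Lemma scheme_grid n : (n <= N)%N -> grid_fun d B J (v n) (G n).
Proof.
move=> nN; split; [exact: mesh_gt0|exact: (sb_J S)| |by move=> j; exact: (sb_G S)].
move=> j jJ; rewrite /G /sG jJ -/d mulrC divfK//.
by rewrite expf_neq0// gt_eqF// mesh_gt0.
Qed.

Lemma scheme_V n j : (n <= N)%N -> 0 <= j <= J%:Z -> `|V n j| <= kap1 * B + Lam.
Proof.
move=> nN jJ; apply: (le_trans (ler_normD _ _)); rewrite lerD ?scheme_F// normrM.
have /andP[h1 h2] := scheme_A nN jJ; have /andP[k0 _] := pr_kap P.
by rewrite ler_pM ?(sb_G S)// ger0_norm// (le_trans (ltW k0)).
Qed.

Lemma scheme_end n j : (n <= N)%N -> j = 0 \/ j = J%:Z ->
  V n j = sP l J lam t0 ph n (v n) j.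
Proof.
move=> nN jJ; have jJ' : 0 <= j <= J%:Z by move: jJ; clear; lia.
have /andP[h1 h2] := scheme_A nN jJ'; have /andP[k0 _] := pr_kap P.
rewrite /V /G /sG (_ : (0 < j < J%:Z) = false).
  by rewrite mulrC -/(A n j) divfK ?subrK// gt_eqF// (lt_le_trans k0).
by case: jJ => ->; rewrite ltxx// andbF.
Qed.

Lemma dist_le_powR m : m%:R * d <= 2 * l -> m%:R * d <= (1 + 2 * l) * (m%:R * d) `^ al.
Proof.
move=> ml; have [al0 al1] : 0 < al /\ al < 1 by apply/andP; exact: (pr_al P).
have d0 := mesh_gt0; have l0 := pr_l P.
case: (posnP m) => [->|m0]; first by rewrite !mul0r powR0 ?gt_eqF// mulr0.
have x0 : 0 < m%:R * d by rewrite mulr_gt0// ltr0n.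
case: (leP (m%:R * d) 1) => x1.
  apply: (@le_trans _ _ ((m%:R * d) `^ al)); first by apply: ger1_powR; rewrite ?x0// ltW.
  by rewrite ler_peMl ?powR_ge0// lerDl mulr_ge0// ltW.
apply: (le_trans ml); apply: (@le_trans _ _ (1 + 2 * l)); first by rewrite lerDr.
rewrite ler_peMr ?addr_ge0 ?mulr_ge0 ?(ltW l0)//.
have := @ge0_ler_powR R al (ltW al0) 1 (m%:R * d); rewrite powR1; apply; rewrite ?nnegrE ?(ltW x1)//.
exact: ltW.
Qed.

Lemma scheme_slope_t n k j : (n + k <= N)%N -> 0 <= j <= J%:Z ->
  `|slope d J (v (n + k)%N) j - slope d J (v n) j| <=
    (4 * (1 + (Num.sqrt lam)^-1) * B + 2 * (kap1 * B + Lam)) * (k%:R * dt) `^ (al / 2).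
Proof.
move=> nk jJ; have /andP[al0 al1] := pr_al P; have dt0 := tick_gt0.
have VB0 : 0 <= kap1 * B + Lam by apply: le_trans (scheme_V (leq0n N) jJ).
have B0 : 0 <= B by apply: le_trans (sb_G S (leq0n N) jJ).
have kN : k%:R * dt <= N%:R * dt.
  by rewrite (ler_wpM2r (ltW dt0))// ler_nat (leq_trans _ nk)// leq_addl.
have k1 : k%:R * dt <= 1 by exact: le_trans kN (sb_N1 S).
have kdt0 : 0 <= k%:R * dt by rewrite mulr_ge0// ltW.
have c0 : 0 <= 1 + (Num.sqrt lam)^-1 by rewrite addr_ge0// invr_ge0 sqrtr_ge0.
have T1 := slope_time (V := V) scheme_grid (sb_lam S) VB0 _ _ nk jJ.
apply: (le_trans (T1 _ _ _)).
- by move=> n' j' n'N j'J.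
- by move=> n' j' n'N j'J; apply: scheme_V => //; exact: ltnW.
- rewrite mesh_J; apply: le_trans (sb_Nl S); rewrite ler_wpM2l ?mulr_ge0//.
  exact: ler_wsqrtr.
rewrite ler_wpM2l ?addr_ge0 ?mulr_ge0//.
set s := Num.sqrt _; have s0 : 0 <= s by exact: sqrtr_ge0.
have s2 : k%:R * dt = s ^+ 2 by rewrite /s sqr_sqrtr.
rewrite s2 powR_half_sq//.
have [->|sn0] := eqVneq s 0; first exact: powR_ge0.
apply: ger1_powR; last exact: ltW.
rewrite lt_neqAle eq_sym sn0 s0/=.
by rewrite -(@ler_pXn2r _ 2) ?nnegrE// expr1n -s2.
Qed.

Lemma scheme_v_t n k j : (n + k <= N)%N -> 0 <= j <= J%:Z ->
  `|v (n + k)%N j - v n j| <= (kap1 * B + Lam) * (k%:R * dt).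
Proof.
move=> nk jJ; rewrite mulrC; apply: (value_time (V := V) (N := N)) => //.
- by move=> n' n'N; apply: scheme_V => //; exact: ltnW.
- exact/ltW/tick_gt0.
Qed.

Lemma scheme_v_x n j m : (n <= N)%N -> 0 <= j -> j + m%:Z <= J%:Z ->
  `|v n (j + m%:Z) - v n j| <= Rb * (m%:R * d).
Proof.
move=> nN j0 jm; have -> : Rb * (m%:R * d) = m%:R * (d * Rb) by ring.
apply: sdiff_bound => i i1 i2.
have iJ : i < J%:Z by move: i2 jm; clear; lia.
have -> : v n (i + 1) - v n i = d * slope d J (v n) i.
  by rewrite /slope iJ mulrC divfK// gt_eqF// mesh_gt0.
rewrite normrM gtr0_norm ?mesh_gt0// ler_wpM2l ?(ltW mesh_gt0)// (sb_p S)//.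
by move: iJ i1 j0; clear; lia.
Qed.

End SchemeBounds.

(** * Holder bounds for the coefficients along the scheme *)

Section SchemeArrays.
Context {R : realType}.
Implicit Types (j : int).

Lemma clockD l J (lam t0 : R) n k :
  `|clock l J lam t0 (n + k) - clock l J lam t0 n| = k%:R * `|tick l J lam|.
Proof.
rewrite /clock natrD; set x := tick _ _ _.
have -> : t0 + (n%:R + k%:R) * x - (t0 + n%:R * x) = k%:R * x by ring.
by rewrite normrM normr_nat.
Qed.

Lemma nodeD (l : R) J j m : `|node l J (j + m%:Z) - node l J j| = m%:R * `|mesh l J|.
Proof.
rewrite /node intrD; set x := mesh _ _.
have -> : - l + (j%:~R + m%:R) * x - (- l + j%:~R * x) = m%:R * x by ring.
by rewrite normrM normr_nat.
Qed.

(** The Lipschitz constant times the sum of the moduli of t, x, u and u_x along the scheme, for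
    increments in time and in space together. *)
Definition nonlinear_const (l Rb kap1 Lam lam B : R) : R :=
  Lam * (1 + (kap1 * B + Lam) + (4 * (1 + (Num.sqrt lam)^-1) * B + 2 * (kap1 * B + Lam))
         + (Rb + B) * (1 + 2 * l)).

Section Nonlinear.
Variables (al l T Rb kap0 kap1 Lam lam t0 B M0 : R) (a f ph : R -> R -> R -> R -> R).
Variables (u0 : R -> R) (J N : nat).
Hypothesis P : problem al l T Rb kap0 kap1 Lam a f ph.
Hypothesis S : scheme_bounds l J lam t0 T Rb B a f ph u0 N.

Let d := mesh l J.
Let dt := tick l J lam.
Let v := sv l J lam t0 a f ph u0.
Let A n := sA l J lam t0 a n (v n).
Let F n := sF l J lam t0 f n (v n).
Let G n := sG l J lam t0 a f ph n (v n).

Lemma scheme_B_ge0 : 0 <= B.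
Proof. by apply: le_trans (sb_G S (leq0n N) (j := 0) _). Qed.

Lemma scheme_Rb_ge0 : 0 <= Rb.
Proof. by apply: le_trans (sb_v S (leq0n N) (j := 0) _). Qed.

Lemma nonlinear_t (g : R -> R -> R -> R) n k j : 
  (forall t s z z' p p', 0 <= t <= T -> 0 <= s <= T ->
    `|z| <= Rb -> `|z'| <= Rb -> `|p| <= Rb -> `|p'| <= Rb ->
    `|g t z p - g s z' p'| <= Lam * (`|t - s| `^ (al / 2) + `|z - z'| + `|p - p'|)) ->
  (n + k <= N)%N -> 0 <= j <= J%:Z ->
  `|g (clock l J lam t0 (n + k)) (v (n + k)%N j) (slope d J (v (n + k)%N) j) -
    g (clock l J lam t0 n) (v n j) (slope d J (v n) j)| <=
  nonlinear_const l Rb kap1 Lam lam B * (k%:R * dt) `^ (al / 2).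
Proof.
move=> H nk jJ; have nN : (n <= N)%N by apply: leq_trans nk; exact: leq_addr.
have dt0 : 0 < dt := tick_gt0 P S; have L0 := pr_Lam P.
have [al0 al1] : 0 < al /\ al < 1 by apply/andP; exact: (pr_al P).
apply: (le_trans (H _ _ _ _ _ _ (clock_in P S nk) (clock_in P S nN) (sb_v S nk jJ)
  (sb_v S nN jJ) (sb_p S nk jJ) (sb_p S nN jJ))).
rewrite clockD (gtr0_norm dt0).
have h1 := scheme_v_t P S nk jJ; have h2 := scheme_slope_t P S nk jJ.
set x := (k%:R * dt) `^ _ in h2 *; have x0 : 0 <= x by exact: powR_ge0.
have kdt : k%:R * dt <= x.
  have kN : k%:R * dt <= 1.
    apply: le_trans (sb_N1 S); rewrite (ler_wpM2r (ltW dt0))// ler_nat.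
    by apply: leq_trans nk; exact: leq_addl.
  have : 0 <= k%:R * dt by rewrite mulr_ge0// ltW.
  rewrite le_eqVlt => /orP[/eqP <-|k0]; first exact: x0.
  by apply: ger1_powR; [rewrite k0|lra].
have B0 := scheme_B_ge0; have Rb0 := scheme_Rb_ge0; have l0 := pr_l P.
have k10 : 0 <= kap1 by case/andP: (pr_kap P) => /ltW h h'; exact: le_trans h'.
have VB0 : 0 <= kap1 * B + Lam by rewrite addr_ge0// mulr_ge0.
have h1' : `|v (n + k)%N j - v n j| <= (kap1 * B + Lam) * x.
  by apply: (le_trans h1); rewrite ler_wpM2l.
have E0 : 0 <= (Rb + B) * (1 + 2 * l) * x.
  by rewrite !mulr_ge0 ?addr_ge0 ?mulr_ge0 ?(ltW l0).
rewrite /nonlinear_const -mulrA ler_wpM2l//.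
move: h1' h2 E0; clear.
move: (`|v _ _ - _|) (`|slope _ _ _ _ - _|) => y1 y2.
set c1 := kap1 * B + Lam; set c2 := 4 * _ * B + _; set c3 := (Rb + B) * _.
move=> h1 h2 h3.
rewrite (_ : (1 + c1 + c2 + c3) * x = x + c1 * x + c2 * x + c3 * x); last by ring.
by rewrite -[leLHS]addr0 !lerD.
Qed.

Lemma nonlinear_x (g : R -> R -> R -> R -> R) n i m :
  (forall t s x y z z' p p', 0 <= t <= T -> 0 <= s <= T -> - l <= x <= l ->
    - l <= y <= l -> `|z| <= Rb -> `|z'| <= Rb -> `|p| <= Rb -> `|p'| <= Rb ->
    `|g t x z p - g s y z' p'| <=
      Lam * (`|t - s| `^ (al / 2) + `|x - y| `^ al + `|z - z'| + `|p - p'|)) ->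
  (n <= N)%N -> 0 <= i -> i + m%:Z <= J%:Z ->
  `|g (clock l J lam t0 n) (node l J (i + m%:Z)) (v n (i + m%:Z)) (slope d J (v n) (i + m%:Z)) -
    g (clock l J lam t0 n) (node l J i) (v n i) (slope d J (v n) i)| <=
  nonlinear_const l Rb kap1 Lam lam B * (m%:R * d) `^ al.
Proof.
move=> H nN i0 im; have d0 : 0 < d := mesh_gt0 P S; have L0 := pr_Lam P.
have [al0 al1] : 0 < al /\ al < 1 by apply/andP; exact: (pr_al P).
have iJ : 0 <= i <= J%:Z by move: i0 im; clear; lia.
have imJ : 0 <= i + m%:Z <= J%:Z by move: i0 im; clear; lia.
apply: (le_trans (H _ _ _ _ _ _ _ _ (clock_in P S nN) (clock_in P S nN) (node_in P S imJ)
  (node_in P S iJ) (sb_v S nN imJ) (sb_v S nN iJ) (sb_p S nN imJ) (sb_p S nN iJ))).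
rewrite subrr normr0 powR0; last by rewrite gt_eqF// divr_gt0.
rewrite add0r nodeD (gtr0_norm d0).
have B0 := scheme_B_ge0; have Rb0 := scheme_Rb_ge0; have l0 := pr_l P.
have k10 : 0 <= kap1 by case/andP: (pr_kap P) => /ltW h h'; exact: le_trans h'.
have ml : m%:R * d <= 2 * l.
  rewrite -(mesh_J S) (ler_wpM2r (ltW d0))// ler_nat.
  by move: i0 im; clear; lia.
have xm := dist_le_powR P S ml.
have h1 := scheme_v_x P S nN i0 im; have h2 := slope_x (scheme_grid P S nN) i0 im.
have h1' := le_trans h1 (ler_wpM2l Rb0 xm).
have h2' := le_trans h2 (ler_wpM2l B0 xm).
set x := (m%:R * d) `^ al in h1' h2' *; have x0 : 0 <= x by exact: powR_ge0.
have VB0 : 0 <= kap1 * B + Lam by rewrite addr_ge0// mulr_ge0.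
have c0 : 0 <= 1 + (Num.sqrt lam)^-1 by rewrite addr_ge0// invr_ge0 sqrtr_ge0.
have E0 : 0 <= ((kap1 * B + Lam) + (4 * (1 + (Num.sqrt lam)^-1) * B + 2 * (kap1 * B + Lam))) * x.
  by rewrite mulr_ge0// addr_ge0// addr_ge0// ?mulr_ge0.
rewrite /nonlinear_const -mulrA ler_wpM2l//.
move: h1' h2' E0.
move: (`|v _ _ - _|) (`|slope _ _ _ _ - _|) => y1 y2.
set c1 := (kap1 * B + Lam); set c2 := 4 * _ * B + _; clear => h1 h2 h3.
have -> : (1 + c1 + c2 + (Rb + B) * (1 + 2 * l)) * x =
  x + Rb * ((1 + 2 * l) * x) + B * ((1 + 2 * l) * x) + (c1 + c2) * x by ring.
by rewrite -[leLHS]addr0 !lerD.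
Qed.

Hypothesis M00 : 0 <= M0.
Hypothesis cfl : 3 * lam * kap1 <= 1.
Hypothesis G0 : forall j, 0 <= j <= J%:Z -> `|G 0%N j| <= M0.
Hypothesis G0x : forall (i : int) m, 0 <= i -> i + m%:Z <= J%:Z ->
    `|G 0%N (i + m%:Z) - G 0%N i| <= M0 * (m%:R * d) `^ al.

Lemma nonlinear_const_ge0 : 0 <= nonlinear_const l Rb kap1 Lam lam B.
Proof.
have B0 := scheme_B_ge0; have Rb0 := scheme_Rb_ge0; have l0 := pr_l P; have L0 := pr_Lam P.
have k10 : 0 <= kap1 by case/andP: (pr_kap P) => /ltW h h'; exact: le_trans h'.
have VB0 : 0 <= kap1 * B + Lam by rewrite addr_ge0// mulr_ge0.
have c0 : 0 <= 1 + (Num.sqrt lam)^-1 by rewrite addr_ge0// invr_ge0 sqrtr_ge0.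
rewrite mulr_ge0// !addr_ge0//; last by rewrite mulr_ge0 ?addr_ge0 ?mulr_ge0 ?(ltW l0).
all: by rewrite ?mulr_ge0// ?mulr_ge0.
Qed.

(** The constant depends on the bound B of the second differences, because the slopes enter the
    coefficients. So B must be known before the Schauder estimate applies, which forces a
    continuation argument. *)
Lemma scheme_array_nonlinear :
  array_data al kap0 kap1 lam d (nonlinear_const l Rb kap1 Lam lam B) M0 J N v G A F.
Proof.
split; [exact: (pr_al P)|exact: (pr_kap P)|exact: (sb_lam S)|exact: cfl|exact: (mesh_gt0 P S)
  |exact: nonlinear_const_ge0|exact: M00| | | | | | | | |exact: G0|exact: G0x].
- by move=> n j nN jJ.
- move=> n j nN jJ; rewrite (gf_lap (scheme_grid P S nN)) //.
- by move=> n j nN jJ; exact: (scheme_A P S).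
- by move=> n i m nN i0 im; apply: nonlinear_x => //; exact: (pr_a P).
- move=> n k j nk jJ.
  apply: (@nonlinear_t (fun t z p => a t (node l J j) z p)) => // t s z z' p p' ht hs hz hz' hp hp'.
  apply: (le_trans (pr_a P ht hs (node_in P S jJ) (node_in P S jJ) hz hz' hp hp')).
  rewrite subrr normr0 powR0 ?addr0//.
  by case/andP: (pr_al P) => h _; rewrite gt_eqF.
- by move=> n i m nN i0 im; apply: nonlinear_x => //; exact: (pr_f P).
- move=> n k j nk jJ.
  apply: (@nonlinear_t (fun t z p => f t (node l J j) z p)) => // t s z z' p p' ht hs hz hz' hp hp'.
  apply: (le_trans (pr_f P ht hs (node_in P S jJ) (node_in P S jJ) hz hz' hp hp')).
  rewrite subrr normr0 powR0 ?addr0//.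
  by case/andP: (pr_al P) => h _; rewrite gt_eqF.
- move=> n k j nk jJ; have nN : (n <= N)%N by apply: leq_trans nk; exact: leq_addr.
  have jJ' : 0 <= j <= J%:Z by move: jJ; clear; lia.
  rewrite !(scheme_end P S)//.
  apply: (@nonlinear_t (fun t z p => ph (if j == 0 then -1 else 1) t z p)) => // t s z z' p p' ht hs hz hz' hp hp'.
  apply: (pr_ph P) => //.
  by case: ifP; [right|left].
Qed.

End Nonlinear.

Section Linear.
Variables (al l T Rb kap0 kap1 Lam lam t0 B M0 : R) (a f ph : R -> R -> R -> R -> R).
Variables (u0 : R -> R) (J N : nat).
Hypothesis P : problem al l T Rb kap0 kap1 Lam a f ph.
Hypothesis S : scheme_bounds l J lam t0 T Rb B a f ph u0 N.
Hypothesis a_lin : forall t x z p, a t x z p = a t x 0 0.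
Hypothesis f_lin : forall t x z p, f t x z p = f t x 0 0.
Hypothesis ph_lin : forall sg t z p, ph sg t z p = ph sg t 0 0.

Let d := mesh l J.
Let v := sv l J lam t0 a f ph u0.
Let A n := sA l J lam t0 a n (v n).
Let F n := sF l J lam t0 f n (v n).
Let G n := sG l J lam t0 a f ph n (v n).

Hypothesis M00 : 0 <= M0.
Hypothesis cfl : 3 * lam * kap1 <= 1.
Hypothesis G0 : forall j, 0 <= j <= J%:Z -> `|G 0%N j| <= M0.
Hypothesis G0x : forall (i : int) m, 0 <= i -> i + m%:Z <= J%:Z ->
    `|G 0%N (i + m%:Z) - G 0%N i| <= M0 * (m%:R * d) `^ al.

(** Here the constant is [Lam] itself and B does not enter, so the Schauder estimate applies at
    once. *)
Lemma scheme_array_linear : array_data al kap0 kap1 lam d Lam M0 J N v G A F.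
Proof.
have al0 : 0 < al by case/andP: (pr_al P).
have Rb0 : `|0 : R| <= Rb.
  by rewrite normr0; apply: le_trans (sb_v S (leq0n N) (j := 0) _).
have al20 : al / 2 != 0 by rewrite gt_eqF// divr_gt0.
have d0 : 0 < d := mesh_gt0 P S; have dt0 := tick_gt0 P S.
have gx (g : R -> R -> R -> R -> R) n i m :
  (forall t s x y z z' p p', 0 <= t <= T -> 0 <= s <= T -> - l <= x <= l ->
    - l <= y <= l -> `|z| <= Rb -> `|z'| <= Rb -> `|p| <= Rb -> `|p'| <= Rb ->
    `|g t x z p - g s y z' p'| <=
      Lam * (`|t - s| `^ (al / 2) + `|x - y| `^ al + `|z - z'| + `|p - p'|)) ->
  (n <= N)%N -> 0 <= i -> i + m%:Z <= J%:Z ->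
  `|g (clock l J lam t0 n) (node l J (i + m%:Z)) 0 0 - g (clock l J lam t0 n) (node l J i) 0 0| <=
  Lam * (m%:R * d) `^ al.
  move=> H nN i0 im.
  have iJ : 0 <= i <= J%:Z by move: i0 im; clear; lia.
  have imJ : 0 <= i + m%:Z <= J%:Z by move: i0 im; clear; lia.
  apply: (le_trans (H _ _ _ _ _ _ _ _ (clock_in P S nN) (clock_in P S nN) (node_in P S imJ)
    (node_in P S iJ) Rb0 Rb0 Rb0 Rb0)).
  by rewrite !subrr normr0 powR0// add0r !addr0 nodeD (gtr0_norm d0).
have gt (g : R -> R) n k :
  (forall t s, 0 <= t <= T -> 0 <= s <= T -> `|g t - g s| <= Lam * `|t - s| `^ (al / 2)) ->
  (n + k <= N)%N -> `|g (clock l J lam t0 (n + k)) - g (clock l J lam t0 n)| <=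
  Lam * (k%:R * (lam * d ^+ 2)) `^ (al / 2).
  move=> H nk; have nN : (n <= N)%N by apply: leq_trans nk; exact: leq_addr.
  apply: (le_trans (H _ _ (clock_in P S nk) (clock_in P S nN))).
  by rewrite clockD (gtr0_norm dt0).
split; [exact: (pr_al P)|exact: (pr_kap P)|exact: (sb_lam S)|exact: cfl|exact: d0
  |exact: (pr_Lam P)|exact: M00| | | | | | | | |exact: G0|exact: G0x].
- by move=> n j nN jJ.
- move=> n j nN jJ; rewrite (gf_lap (scheme_grid P S nN)) //.
- by move=> n j nN jJ; exact: (scheme_A P S).
- by move=> n i m nN i0 im; rewrite /A /sA !(a_lin _ _ (v _ _)); apply: gx => //; exact: (pr_a P).
- move=> n k j nk jJ; rewrite /A /sA !(a_lin _ _ (v _ _)).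
  apply: (gt (fun t => a t (node l J j) 0 0)) => // t s ht hs.
  apply: (le_trans (pr_a P ht hs (node_in P S jJ) (node_in P S jJ) Rb0 Rb0 Rb0 Rb0)).
  by rewrite !subrr normr0 powR0 ?addr0// gt_eqF.
- by move=> n i m nN i0 im; rewrite /F /sF !(f_lin _ _ (v _ _)); apply: gx => //; exact: (pr_f P).
- move=> n k j nk jJ; rewrite /F /sF !(f_lin _ _ (v _ _)).
  apply: (gt (fun t => f t (node l J j) 0 0)) => // t s ht hs.
  apply: (le_trans (pr_f P ht hs (node_in P S jJ) (node_in P S jJ) Rb0 Rb0 Rb0 Rb0)).
  by rewrite !subrr normr0 powR0 ?addr0// gt_eqF.
- move=> n k j nk jJ; have nN : (n <= N)%N by apply: leq_trans nk; exact: leq_addr.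
  rewrite !(scheme_end P S)// /sP !(ph_lin _ _ (v _ _)).
  apply: (gt (fun t => ph (if j == 0 then -1 else 1) t 0 0)) => // t s ht hs.
  have sg : (if j == 0 then -1 else 1 : R) = 1 \/ (if j == 0 then -1 else 1 : R) = -1.
    by case: ifP; [right|left].
  apply: (le_trans (pr_ph P sg ht hs Rb0 Rb0 Rb0 Rb0)).
  by rewrite !subrr normr0 !addr0.
Qed.

End Linear.

End SchemeArrays.

(** * A priori bounds for the scheme *)

Section Continuation.
Context {R : realType}.
Implicit Types (j : int).

Record initial_bounds (al l lam t0 Rb M0 : R) (a f ph : R -> R -> R -> R -> R) (u0 : R -> R) J : Prop :=
  InitialBounds {
  ib_v : forall j, 0 <= j <= J%:Z -> `|sv l J lam t0 a f ph u0 0 j| <= Rb;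
  ib_p : forall j, 0 <= j <= J%:Z ->
    `|slope (mesh l J) J (sv l J lam t0 a f ph u0 0) j| <= Rb;
  ib_G : forall j, 0 <= j <= J%:Z ->
    `|sG l J lam t0 a f ph 0 (sv l J lam t0 a f ph u0 0) j| <= M0;
  ib_Gx : forall (i : int) m, 0 <= i -> i + m%:Z <= J%:Z ->
    `|sG l J lam t0 a f ph 0 (sv l J lam t0 a f ph u0 0) (i + m%:Z) -
      sG l J lam t0 a f ph 0 (sv l J lam t0 a f ph u0 0) i| <= M0 * (m%:R * mesh l J) `^ al }.

Section OneStep.
Variables (al l T Rb kap0 kap1 Lam lam t0 B M0 M X : R) (a f ph : R -> R -> R -> R -> R).
Variables (u0 : R -> R) (J N : nat).

Let d := mesh l J.
Let dt := tick l J lam.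
Let v := sv l J lam t0 a f ph u0.
Let A n := sA l J lam t0 a n (v n).
Let F n := sF l J lam t0 f n (v n).
Let G n := sG l J lam t0 a f ph n (v n).
Let V n j := A n j * G n j + F n j.
Let HV := kap1 * X + M * (B + 1).

Hypothesis P : problem al l T Rb kap0 kap1 Lam a f ph.
Hypothesis S : scheme_bounds l J lam t0 T Rb B a f ph u0 N.
Hypothesis D : array_data al kap0 kap1 lam d M M0 J N v G A F.
Hypothesis BX : array_bounds al d B X J N G.
Hypothesis X0 : 0 <= X.

Lemma velocity_succ j : 0 <= j -> j + 1 <= J%:Z -> `|V N (j + 1) - V N j| <= HV * d `^ al.
Proof.
move=> j0 jJ; have := array_velocity_holder D BX (n := N) (i := j) (m := 1) (kap := 0) (osc := kap1) (leqnn N) j0 jJ.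
rewrite !subr0 mul1r; apply=> //.
have /andP[a0 a1] := scheme_A P S (leqnn N) (j := j + 1) ltac:(move: j0 jJ; clear; lia).
rewrite ger0_norm// (le_trans _ a0)// ltW//.
by case/andP: (pr_kap P).
Qed.

(** One time step changes slopes and second differences by a positive power of the mesh. These crude
    bounds replace continuity in time when bounds are carried from one level to the next. *)
Lemma slope_next j : 0 <= j <= J%:Z ->
  `|slope d J (v N.+1) j - slope d J (v N) j| <= lam * d * (HV * d `^ al).
Proof.
move=> jJ; have d0 : 0 < d := mesh_gt0 P S; have lam0 := sb_lam S.
have J0 := sb_J S.
have vE i : v N.+1 i = v N i + lam * d ^+ 2 * V N i by [].
rewrite /slope; case: ifP => jJ'.
  rewrite !vE.
  have -> : (v N (j + 1) + lam * d ^+ 2 * V N (j + 1) - (v N j + lam * d ^+ 2 * V N j)) / d -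
    (v N (j + 1) - v N j) / d = lam * d * (V N (j + 1) - V N j).
    by field; rewrite gt_eqF.
  rewrite normrM (gtr0_norm (mulr_gt0 lam0 d0)); apply: (ler_wpM2l (ltW (mulr_gt0 lam0 d0))).
  by apply: velocity_succ; move: jJ jJ'; clear; lia.
rewrite !vE.
have -> : (v N j + lam * d ^+ 2 * V N j - (v N (j - 1) + lam * d ^+ 2 * V N (j - 1))) / d -
    (v N j - v N (j - 1)) / d = lam * d * (V N j - V N (j - 1)).
  by field; rewrite gt_eqF.
rewrite normrM (gtr0_norm (mulr_gt0 lam0 d0)); apply: (ler_wpM2l (ltW (mulr_gt0 lam0 d0))).
have := velocity_succ (j := j - 1); rewrite subrK; apply; move: jJ jJ' J0; clear; lia.
Qed.

Lemma G_next_interior j : 0 < j < J%:Z -> `|G N.+1 j - G N j| <= 2 * lam * (HV * d `^ al).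
Proof.
move=> jJ; have d0 : 0 < d := mesh_gt0 P S; have lam0 := sb_lam S.
have vE i : v N.+1 i = v N i + lam * d ^+ 2 * V N i by [].
rewrite /G /sG jJ /lap -/d !vE.
set w1 := v N (j + 1); set w2 := v N (j - 1); set w3 := v N j.
have -> : (w1 + lam * d ^+ 2 * V N (j + 1) + (w2 + lam * d ^+ 2 * V N (j - 1))
     - 2 * (w3 + lam * d ^+ 2 * V N j)) / d ^+ 2 - (w1 + w2 - 2 * w3) / d ^+ 2 =
  lam * ((V N (j + 1) - V N j) - (V N j - V N (j - 1))) by field; rewrite gt_eqF.
have h1 := velocity_succ (j := j) ltac:(move: jJ; clear; lia) ltac:(move: jJ; clear; lia).
have h2 := velocity_succ (j := j - 1) ltac:(move: jJ; clear; lia) ltac:(move: jJ; clear; lia).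
rewrite subrK in h2.
rewrite normrM (gtr0_norm lam0) (mulrC 2) -mulrA; apply: (ler_wpM2l (ltW lam0)).
apply: (le_trans (ler_normB _ _)); rewrite mulr_natl mulr2n.
exact: lerD.
Qed.

(** At the ends G is the quotient of ph - f by a, so its change is controlled by the changes of t, u
    and u_x in these coefficients. *)
Lemma G_next_end j : j = 0 \/ j = J%:Z -> t0 + N.+1%:R * dt <= T ->
  (forall j, 0 <= j <= J%:Z -> `|v N.+1 j| <= Rb) ->
  (forall j, 0 <= j <= J%:Z -> `|slope d J (v N.+1) j| <= Rb) ->
  kap0 * `|G N.+1 j - G N j| <= Lam * (2 + B) *
    (dt `^ (al / 2) + dt * (kap1 * B + Lam) + lam * d * (HV * d `^ al)).
Proof.
move=> jE HT Hv Hp; have d0 : 0 < d := mesh_gt0 P S; have lam0 := sb_lam S.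
have dt0 : 0 < dt := tick_gt0 P S.
have jJ : 0 <= j <= J%:Z by move: jE; clear; lia.
have vE i : v N.+1 i = v N i + dt * V N i by [].
have hp := slope_next jJ.
have hv : `|v N.+1 j - v N j| <= dt * (kap1 * B + Lam).
  rewrite vE addrAC subrr add0r normrM (gtr0_norm dt0) (ler_wpM2l (ltW dt0))//.
  exact: (scheme_V P S (leqnn N) jJ).
have c0 := clock_in P S (leqnn N).
have c1 : 0 <= clock l J lam t0 N.+1 <= T.
  rewrite /clock HT andbT addr_ge0 ?(sb_t0 S)// mulr_ge0//; exact: ltW.
have cc : `|clock l J lam t0 N.+1 - clock l J lam t0 N| = dt.
  by have := clockD l J lam t0 N 1; rewrite addn1 mul1r => ->; rewrite gtr0_norm.
have nj := node_in P S jJ.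
have Vj := Hv j jJ; have Pj := Hp j jJ.
have vj := sb_v S (leqnn N) jJ; have pj := sb_p S (leqnn N) jJ.
have al0 : 0 < al by case/andP: (pr_al P).
have hA := pr_a P c1 c0 nj nj Vj vj Pj pj.
have hF := pr_f P c1 c0 nj nj Vj vj Pj pj.
have sg : (if j == 0 then -1 else 1 : R) = 1 \/ (if j == 0 then -1 else 1 : R) = -1.
  by case: ifP; [right|left].
have hP := pr_ph P sg c1 c0 Vj vj Pj pj.
rewrite subrr normr0 powR0 ?gt_eqF// addr0 cc in hA hF.
rewrite cc in hP.
have L0 := pr_Lam P.
set E := dt `^ (al / 2) + _ + _.
have E0 : Lam * (dt `^ (al / 2) + `|v N.+1 j - v N j| +
    `|slope d J (v N.+1) j - slope d J (v N) j|) <= Lam * E.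
  by rewrite ler_wpM2l// !lerD.
have {}hA := le_trans hA E0; have {}hF := le_trans hF E0; have {}hP := le_trans hP E0.
have /andP[a0 _] := pr_pos P c1 nj Vj Pj.
have /andP[a0' _] := scheme_A P S (leqnn N) jJ.
have /andP[k0 _] := pr_kap P.
have gB := sb_G S (leqnn N) jJ.
have je : (0 < j < J%:Z) = false by case: jE => ->; rewrite ltxx// andbF.
have gE n : A n j != 0 -> A n j * G n j = sP l J lam t0 ph n (v n) j - F n j.
  by move=> An0; rewrite /G /sG je mulrC divfK.
have A1 : A N.+1 j * G N.+1 j = sP l J lam t0 ph N.+1 (v N.+1) j - F N.+1 j.
  by apply: gE; rewrite gt_eqF// (lt_le_trans k0 a0).
have A2 : A N j * G N j = sP l J lam t0 ph N (v N) j - F N j.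
  by apply: gE; rewrite gt_eqF// (lt_le_trans k0 a0').
apply: (@le_trans _ _ (A N.+1 j * `|G N.+1 j - G N j|)).
  by rewrite ler_wpM2r.
rewrite -[X in X * `|_|]gtr0_norm ?(lt_le_trans k0 a0)// -normrM mulrBr A1.
have -> : sP l J lam t0 ph N.+1 (v N.+1) j - F N.+1 j - A N.+1 j * G N j =
  (sP l J lam t0 ph N.+1 (v N.+1) j - sP l J lam t0 ph N (v N) j) - (F N.+1 j - F N j)
  - (A N.+1 j - A N j) * G N j.
  by rewrite [in RHS]mulrBl A2; ring.
apply: (le_trans (ler_normB _ _)).
have -> : Lam * (2 + B) * E = Lam * E + Lam * E + Lam * E * B by ring.
rewrite lerD//; last by rewrite normrM ler_pM.
by apply: (le_trans (ler_normB _ _)); rewrite lerD.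
Qed.

End OneStep.

Lemma crude_arith (lam d dal HV : R) : 0 < lam -> 0 < d -> d <= 1 -> 0 <= HV -> d <= dal ->
  lam * d * (HV * dal) <= lam * HV * dal.
Proof.
move=> l0 d0 d1 H0 dd; have dal0 : 0 <= dal by exact: le_trans (ltW d0) dd.
have : lam * HV * dal * d <= lam * HV * dal * 1 by rewrite ler_wpM2l// !mulr_ge0// ltW.
lra.
Qed.

Lemma norm_incr (x y b c e : R) : `|x| <= b -> `|y - x| <= c -> b + c <= e -> `|y| <= e.
Proof.
move=> xb yc h; have -> : y = x + (y - x) by rewrite subrKC.
by apply: (le_trans (ler_normD _ _)); apply: le_trans h; exact: lerD.
Qed.

Lemma sqrt_le_arith (x c L : R) : 0 < c -> 0 < L -> x <= (L / c) ^+ 2 -> c * Num.sqrt x <= L.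
Proof.
move=> c0 L0 h; have : Num.sqrt x <= L / c; last by rewrite ler_pdivlMr// mulrC.
rewrite -[leRHS]ger0_norm ?divr_ge0 ?(ltW c0) ?(ltW L0)// -sqrtr_sqr; exact: ler_wsqrtr.
Qed.

(** Continuation over the levels: while slopes and second differences obey the weak bounds Rb and M0
    + 2, the Schauder estimate on a short time improves them to Rb - 1/2 and M0 + 1, and one further
    step costs at most the difference. The datum influences de and d2 only through M0 and Rb. *)
Theorem nonlinear_estimate (al l T Rb kap0 kap1 Lam lam t0 M0 : R) (a f ph : R -> R -> R -> R -> R) :
  problem al l T Rb kap0 kap1 Lam a f ph -> 0 <= t0 < T -> 0 < lam -> 3 * lam * kap1 <= 1 ->
  0 <= M0 -> 1 <= Rb ->
  exists de d2 C : R, [/\ 0 < de, 0 < d2, t0 + de <= T &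
    forall (u0 : R -> R) J N, (0 < J)%N -> mesh l J <= d2 -> N%:R * tick l J lam <= de ->
    initial_bounds al l lam t0 (Rb - 1) M0 a f ph u0 J ->
    let G n := sG l J lam t0 a f ph n (sv l J lam t0 a f ph u0 n) in
    [/\ scheme_bounds l J lam t0 T Rb (M0 + 2) a f ph u0 N,
      array_bounds al (mesh l J) C C J N G &
      forall n k (j : int), (n + k <= N)%N -> 0 <= j <= J%:Z ->
      `|G (n + k)%N j - G n j| <= C * (k%:R * tick l J lam) `^ (al / 2)]].
Proof.
move=> P /andP[t00 t0T] lam0 cfl M00 Rb1.
have al01 := pr_al P; have /andP[al0 al1] := al01; have l0 := pr_l P; have L0 := pr_Lam P.
have /andP[k00 k01] := pr_kap P.
have kap10 : 0 <= kap1 by rewrite (le_trans _ k01)// ltW.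
pose B := M0 + 2; have B0 : 0 <= B by rewrite addr_ge0.
pose cl := 1 + (Num.sqrt lam)^-1.
have cl0 : 0 < cl by rewrite ltr_wpDr// invr_ge0 sqrtr_ge0.
pose VB := kap1 * B + Lam; have VB0 : 0 <= VB by rewrite addr_ge0// mulr_ge0.
pose M := nonlinear_const l Rb kap1 Lam lam B.
have Rb0 : 0 <= Rb by exact: le_trans Rb1.
have M_ : 0 <= M.
  rewrite /M /nonlinear_const -/cl -/VB; apply: mulr_ge0 => //.
  have h1 := mulr_ge0 (mulr_ge0 (ler0n R 4) (ltW cl0)) B0.
  have h2 := mulr_ge0 (addr_ge0 Rb0 B0) (addr_ge0 ler01 (mulr_ge0 (ler0n R 2) (ltW l0))).
  by move: h1 h2 VB0; clear; lra.
have l20 : 0 < 2 * l by rewrite mulr_gt0.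
have M12 : M0 + 1 <= B by rewrite lerD2l ler1n.
have Rb2 : Rb - 2^-1 <= Rb by rewrite gerBl invr_ge0.
have Rb3 : Rb - 1 <= Rb by rewrite gerBl.
have Rb4 : Rb - 1 <= Rb - 2^-1 by clear; lra.
have Rb5 : Rb - 2^-1 + 2^-1 <= Rb by rewrite subrK.
have M1 : M0 <= M0 + 1 by rewrite lerDl.
have M2 : M0 + 1 + 1 <= B by rewrite -addrA.
have [C [de1 [d1 [C0 de10 d10 SCH]]]] := array_schauder al01 (pr_kap P) lam0 M_ l20.
pose X := C * (M0 + 1).
have X0 : 0 < X by rewrite mulr_gt0//; lra.
pose HV := kap1 * X + M * (B + 1).
have HV0 : 0 <= HV.
  exact: addr_ge0 (mulr_ge0 kap10 (ltW X0)) (mulr_ge0 M_ (addr_ge0 B0 ler01)).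
have al20 : 0 < al / 2 by lra.
have e10 : 0 < (2 * (X + 4 * cl * B + 2 * VB + 1))^-1.
  rewrite invr_gt0 mulr_gt0// !ltr_wpDr ?mulr_ge0// ?(ltW cl0)//.
have [de2 de20 Hde2] := powR_small al20 e10.
pose ec := Num.min (kap0 / (Lam * (2 + B) * (lam `^ (al / 2) + lam * VB + lam * HV) + 1))
  (2 * (lam * HV + 1))^-1.
have lal0 : 0 <= lam `^ (al / 2) := powR_ge0 _ _.
have den0 : 0 <= Lam * (2 + B) * (lam `^ (al / 2) + lam * VB + lam * HV).
  by rewrite !mulr_ge0 ?addr_ge0 ?mulr_ge0 ?(ltW lam0).
have lHV0 : 0 <= lam * HV by rewrite mulr_ge0// ltW.
have ec0 : 0 < ec.
  by rewrite lt_min divr_gt0 ?ltr_wpDl//= invr_gt0 mulr_gt0// ltr_wpDl.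
have [d3 d30 Hd3] := powR_small al0 ec0.
(* The entries serve, in turn, the Schauder estimate, the improvement of the weak bounds, times
   below 1 and before T, values within 1 of the datum, and room for [slope_time]. *)
pose de := Num.min (Num.min de1 de2) (Num.min (Num.min 1 (T - t0))
   (Num.min (VB + 1)^-1 ((2 * l / (4 * cl)) ^+ 2))).
have Q0 : 0 < 2 * l / (4 * cl) by rewrite divr_gt0// mulr_gt0.
have de0 : 0 < de.
  by rewrite !lt_min de10 de20 ltr01 subr_gt0 t0T invr_gt0 ltr_wpDl// exprn_gt0.
exists de, (Num.min (Num.min d1 1) d3), X; split => //.
- by rewrite !lt_min d10 d30 ltr01.
- by rewrite -lerBrDl !ge_min lexx !orbT.
move=> u0 J N J0; rewrite !le_min => /andP[/andP[dd1 dd01] dd3] Nde I.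
case/and3P: Nde => /andP[N1 N2] /andP[N3 N4] /andP[N5 N6].
set d := mesh l J in dd1 dd01 dd3 *; set dt := tick l J lam in N1 N2 N3 N4 N5 N6 *.
have d0 : 0 < d by rewrite /d /mesh divr_gt0// ltr0n.
have dt0 : 0 < dt by rewrite /dt /tick mulr_gt0// exprn_gt0.
have JL : J%:R * d = 2 * l by rewrite /d /mesh mulrC divfK// pnatr_eq0 -lt0n.
pose v := sv l J lam t0 a f ph u0.
pose G n := sG l J lam t0 a f ph n (v n).
have pde n x : (n <= N)%N -> N%:R * dt <= x -> n%:R * dt <= x.
  by move=> nN; apply: le_trans; rewrite (ler_wpM2r (ltW dt0))// ler_nat.
(* Bounds inside those of [scheme_bounds] for slopes and second differences; the values are
   controlled directly by the velocity. *)
pose Q n := forall m j, (m <= n)%N -> 0 <= j <= J%:Z ->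
  [/\ `|v m j| <= Rb, `|slope d J (v m) j| <= Rb - 2^-1 & `|G m j| <= M0 + 1].
have mkS n (B' : R) : (n <= N)%N -> (forall m j, (m <= n)%N -> 0 <= j <= J%:Z ->
    [/\ `|v m j| <= Rb, `|slope d J (v m) j| <= Rb & `|G m j| <= B']) ->
    scheme_bounds l J lam t0 T Rb B' a f ph u0 n.
  move=> nN H; split => //.
  - by rewrite -lerBrDl; exact: pde N4.
  - exact: pde N3.
  - by apply: sqrt_le_arith; rewrite ?mulr_gt0//; exact: pde N6.
  - by move=> m j mn jJ; case: (H m j mn jJ).
  - by move=> m j mn jJ; case: (H m j mn jJ).
  - by move=> m j mn jJ; case: (H m j mn jJ).
have SC n (Sn : scheme_bounds l J lam t0 T Rb B a f ph u0 n) : (n <= N)%N ->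
    [/\ array_data al kap0 kap1 lam d M M0 J n v G (fun n => sA l J lam t0 a n (v n))
         (fun n => sF l J lam t0 f n (v n)),
      array_bounds al d X X J n G &
      forall n' k (j : int), (n' + k <= n)%N -> 0 <= j <= J%:Z ->
      `|G (n' + k)%N j - G n' j| <= X * (k%:R * dt) `^ (al / 2)].
  move=> nN.
  have D := scheme_array_nonlinear P Sn M00 cfl (ib_G I) (ib_Gx I).
  by have [] := SCH _ _ _ _ _ _ _ _ D JL dd1 (pde _ _ nN N1); split.
have small n : (n <= N)%N -> (X + 4 * cl * B + 2 * VB) * (n%:R * dt) `^ (al / 2) <= 2^-1.
  move=> nN; set K := X + 4 * cl * B + 2 * VB in e10 Hde2 *.
  have K0 : 0 <= K := addr_ge0 (addr_ge0 (ltW X0) (mulr_ge0 (mulr_ge0 (ler0n R 4) (ltW cl0)) B0)) (mulr_ge0 (ler0n R 2) VB0).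
  have h : (n%:R * dt) `^ (al / 2) <= (2 * (K + 1))^-1.
    by apply: Hde2; rewrite (pde _ _ nN N2) andbT mulr_ge0// ltW.
  apply: (le_trans (ler_wpM2l K0 h)).
  rewrite invfM mulrCA ler_piMr ?invr_ge0//.
  by rewrite ler_pdivrMr ?mul1r ?lerDl// ltr_wpDl.
have refine n : (n <= N)%N -> scheme_bounds l J lam t0 T Rb B a f ph u0 n -> Q n.
  move=> nN Sn; have [D BX TH] := SC n Sn nN.
  move=> m j mn jJ; have mN := leq_trans mn nN.
  have sm := small m mN.
  set x := (m%:R * dt) `^ (al / 2) in sm; have x0 : 0 <= x by exact: powR_ge0.
  have Xx : 0 <= X * x by rewrite mulr_ge0// ltW.
  have clx : 0 <= 4 * cl * B * x + 2 * VB * x by rewrite addr_ge0 ?mulr_ge0// ltW.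
  split; first by exact: (sb_v Sn).
  - have := scheme_slope_t P Sn (n := 0%N) (k := m) (j := j) mn jJ.
    rewrite add0n -/cl -/VB -/dt -/d -/v -/x => h.
    have := ib_p I jJ; rewrite -/d -/(v 0%N).
    have := ler_normD (slope d J (v 0%N) j) (slope d J (v m) j - slope d J (v 0%N) j).
    rewrite subrKC; move: h sm Xx; clear.
    by rewrite !mulrDl; lra.
  - have := TH 0%N m j mn jJ; rewrite add0n -/x => h.
    have := ib_G I jJ; rewrite -/(v 0%N) -/(G 0%N).
    have := ler_normD (G 0%N j) (G m j - G 0%N j).
    rewrite subrKC; move: h sm clx; rewrite !mulrDl; clear; lra.
have dal : d <= d `^ al by apply: ger1_powR; rewrite ?d0// ltW.
have dec : d `^ al <= ec by apply: Hd3; rewrite dd3 ltW.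
have dal0 : 0 <= d `^ al by exact: powR_ge0.
have lHVd : lam * HV * d `^ al <= 2^-1.
  apply: (@le_trans _ _ (lam * HV * (2 * (lam * HV + 1))^-1)).
    by rewrite ler_wpM2l// (le_trans dec)// ge_min lexx orbT.
  rewrite invfM mulrCA ler_piMr ?invr_ge0//.
  by rewrite ler_pdivrMr ?mul1r ?lerDl// ltr_wpDl.
have crude := crude_arith lam0 d0 dd01 HV0 dal.
have main n : (n <= N)%N -> Q n.
  elim: n => [|n IH] nN.
    move=> m j; rewrite leqn0 => /eqP-> jJ; split.
    - exact: le_trans (ib_v I jJ) Rb3.
    - exact: le_trans (ib_p I jJ) Rb4.
    - exact: le_trans (ib_G I jJ) M1.
  have {}IH := IH (ltnW nN).
  have Sn : scheme_bounds l J lam t0 T Rb B a f ph u0 n.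
    apply: mkS (ltnW nN) _ => m j mn jJ; have [h1 h2 h3] := IH m j mn jJ.
    by split=> //; [exact: le_trans h2 Rb2|exact: le_trans h3 M12].
  have [D BX TH] := SC n Sn (ltnW nN).
  have BXB : array_bounds al d B X J n G.
    split; last exact: BX.2.
    by move=> m j mn jJ; have [_ _ h3] := IH m j mn jJ; exact: le_trans h3 M12.
  have vn j : 0 <= j <= J%:Z -> `|v n.+1 j| <= Rb.
    move=> jJ.
    have := @value_time R dt VB v (fun n j => sA l J lam t0 a n (v n) j * G n j + sF l J lam t0 f n (v n) j) j 0 n.+1 n.+1.
    rewrite add0n => /(_ (fun _ _ => erefl)) h.
    have {h}h : `|v n.+1 j - v 0%N j| <= n.+1%:R * dt * VB.
      apply: h => //; last exact: ltW.
      by move=> m mn; exact: (scheme_V P Sn).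
    have h2 := pde _ _ nN N5.
    have : n.+1%:R * dt * VB <= 1.
      apply: (@le_trans _ _ ((VB + 1)^-1 * VB)); first by rewrite ler_wpM2r.
      by rewrite mulrC ler_pdivrMr ?mul1r ?lerDl// ltr_wpDl.
    move=> h1; apply: (norm_incr (ib_v I jJ) (le_trans h h1)).
    by rewrite subrK.
  have pn j : 0 <= j <= J%:Z -> `|slope d J (v n.+1) j| <= Rb.
    move=> jJ; have := slope_next P Sn D BXB (ltW X0) jJ.
    rewrite -/d -/v -/HV => h; have [_ h2 _] := IH n j (leqnn n) jJ.
    exact: (norm_incr h2 (le_trans h (le_trans crude lHVd))).
  have Gn j : 0 <= j <= J%:Z -> `|G n.+1 j| <= B.
    move=> jJ; have [_ _ h3] := IH n j (leqnn n) jJ.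
    suff : `|G n.+1 j - G n j| <= 1.
      by move=> h; exact: (norm_incr h3 h).
    have [jin|jend] := boolP (0 < j < J%:Z).
      have := G_next_interior P Sn D BXB (ltW X0) jin; rewrite -/d -/v -/HV -/(G n) -/(G n.+1).
      by move: lHVd; clear; lra.
    have jE : j = 0 \/ j = J%:Z by move: jJ jend; clear; lia.
    have HT : t0 + n.+1%:R * dt <= T by rewrite -lerBrDl; exact: pde N4.
    have := G_next_end P Sn D BXB (ltW X0) jE HT vn pn.
    rewrite -/d -/v -/HV -/(G n) -/(G n.+1) -/dt => h.
    rewrite -(ler_pM2l k00) mulr1; apply: (le_trans h).
    have e1 : dt `^ (al / 2) = lam `^ (al / 2) * d `^ al.
      by rewrite /dt /tick powRM ?sqr_ge0 ?(ltW lam0)// powR_half_sq// ltW.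
    have e2 : dt * VB <= lam * VB * d `^ al.
      have -> : dt * VB = lam * VB * (d * d) by rewrite /dt /tick -/d; ring.
      rewrite ler_wpM2l ?mulr_ge0 ?(ltW lam0)//.
      apply: le_trans dal; rewrite ler_piMr// ltW//.
    have c2 : kap0 * (Lam * (2 + B) * (lam `^ (al / 2) + lam * VB + lam * HV)) <=
        kap0 * (Lam * (2 + B) * (lam `^ (al / 2) + lam * VB + lam * HV) + 1).
      by rewrite (ler_wpM2l (ltW k00))// lerDl.
    apply: (@le_trans _ _ (Lam * (2 + B) * (lam `^ (al / 2) + lam * VB + lam * HV) * d `^ al)).
      rewrite -[leRHS]mulrA; apply: (ler_wpM2l (mulr_ge0 L0 (addr_ge0 (ler0n R 2) B0))).
      rewrite [leRHS]mulrDl [X in _ <= X + _]mulrDl; apply: lerD; last exact: crude.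
      by apply: lerD; [rewrite e1|exact: e2].
    apply: (@le_trans _ _ (Lam * (2 + B) * (lam `^ (al / 2) + lam * VB + lam * HV) *
       (kap0 / (Lam * (2 + B) * (lam `^ (al / 2) + lam * VB + lam * HV) + 1)))).
      by rewrite ler_wpM2l// (le_trans dec)// ge_min lexx.
    by rewrite mulrA ler_pdivrMr ?ltr_wpDl// mulrC.
  apply: refine => //; apply: mkS nN _ => m j; rewrite leq_eqVlt => /orP[/eqP->|mn] jJ.
    by split; [exact: vn|exact: pn|exact: Gn].
  have [h1 h2 h3] := IH m j mn jJ.
  by split=> //; [exact: le_trans h2 Rb2|exact: le_trans h3 M12].
have QN := main N (leqnn N).
have SN : scheme_bounds l J lam t0 T Rb B a f ph u0 N.
  apply: mkS (leqnn N) _ => m j mn jJ; have [h1 h2 h3] := QN m j mn jJ.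
  by split=> //; [exact: le_trans h2 Rb2|exact: le_trans h3 M12].
by have [D BX TH] := SC N SN (leqnn N); split.
Qed.

(** The duration de and the mesh bound d2 are fixed before the datum: the constants of the Schauder
    estimate depend on the coefficients alone, and the bound on G is affine in M0. *)
Theorem linear_estimate (al l kap0 kap1 Lam lam : R) :
  0 < al < 1 -> 0 < l -> 0 < kap0 <= kap1 -> 0 <= Lam -> 0 < lam -> 3 * lam * kap1 <= 1 ->
  exists de d2 C : R, [/\ 0 < de, 0 < d2, 0 <= C &
    forall (T t0 M0 Rb0 : R) (a f ph : R -> R -> R -> R -> R) (u0 : R -> R) J N,
    (forall Rb, problem al l T Rb kap0 kap1 Lam a f ph) ->
    [/\ forall t x z p, a t x z p = a t x 0 0, forall t x z p, f t x z p = f t x 0 0 &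
      forall s t z p, ph s t z p = ph s t 0 0] ->
    0 <= t0 -> 0 <= M0 -> (0 < J)%N -> mesh l J <= d2 -> N%:R * tick l J lam <= de ->
    t0 + N%:R * tick l J lam <= T ->
    initial_bounds al l lam t0 Rb0 M0 a f ph u0 J ->
    let G n := sG l J lam t0 a f ph n (sv l J lam t0 a f ph u0 n) in
    [/\ scheme_bounds l J lam t0 T (Rb0 + C * (M0 + 1)) (C * (M0 + 1)) a f ph u0 N,
      array_bounds al (mesh l J) (C * (M0 + 1)) (C * (M0 + 1)) J N G &
      forall n k (j : int), (n + k <= N)%N -> 0 <= j <= J%:Z ->
      `|G (n + k)%N j - G n j| <= C * (M0 + 1) * (k%:R * tick l J lam) `^ (al / 2)]].
Proof.
move=> al01 l0 kk L0 lam0 cfl; have /andP[al0 al1] := al01; have /andP[k00 k01] := kk.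
have kap10 : 0 <= kap1 by rewrite (le_trans _ k01)// ltW.
have l20 : 0 < 2 * l by rewrite mulr_gt0.
pose cl := 1 + (Num.sqrt lam)^-1.
have cl0 : 0 < cl by rewrite ltr_wpDr// invr_ge0 sqrtr_ge0.
have [C [de1 [d1 [C0 de10 d10 SCH]]]] := array_schauder al01 kk lam0 L0 l20.
have Q0 : 0 < 2 * l / (4 * cl) by rewrite divr_gt0// mulr_gt0.
pose K := 4 * cl * C + 2 * (kap1 * C + Lam).
have K0 : 0 <= K.
  have h1 := mulr_ge0 (mulr_ge0 (ler0n R 4) (ltW cl0)) (ltW C0); have h2 := mulr_ge0 kap10 (ltW C0).
  by rewrite /K; move: h1 h2 L0; clear; lra.
exists (Num.min de1 (Num.min 1 ((2 * l / (4 * cl)) ^+ 2))), d1, (C + K); split => //.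
- by rewrite !lt_min de10 ltr01 exprn_gt0.
- by rewrite addr_ge0// ltW.
move=> T t0 M0 Rb0 a f ph u0 J N P [ai fi phi] t00 M00 J0 dd1.
rewrite !le_min => /and3P[N1 N3 N6] NT I; move=> G.
set d := mesh l J in dd1 *; set dt := tick l J lam in N1 N3 N6 NT *.
have d0 : 0 < d by rewrite /d /mesh divr_gt0// ltr0n.
have dt0 : 0 < dt by rewrite /dt /tick mulr_gt0// exprn_gt0.
have JL : J%:R * d = 2 * l by rewrite /d /mesh mulrC divfK// pnatr_eq0 -lt0n.
pose v := sv l J lam t0 a f ph u0.
pose E (g : nat -> int -> R) : R := \sum_(n < N.+1) \sum_(j < J.+1) `|g n j%:Z|.
have EP g n (j : int) : (n <= N)%N -> 0 <= j <= J%:Z -> `|g n j| <= E g.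
  move=> nN /andP[j0 jJ]; have [i ji] : exists i : nat, j = i%:Z.
    by exists `|j|%N; rewrite gez0_abs.
  have iJ : (i < J.+1)%N by move: jJ; rewrite ji; clear; lia.
  rewrite /E (bigD1 (Ordinal (nN : (n < N.+1)%N)))//= (bigD1 (Ordinal iJ))//= -ji -addrA lerDl addr_ge0//.
    by apply: sumr_ge0.
  by apply: sumr_ge0 => ? _; apply: sumr_ge0.
pose X := C * (M0 + 1); have X0 : 0 < X by rewrite mulr_gt0//; lra.
have mkS (Rb B : R) : (forall n (j : int), (n <= N)%N -> 0 <= j <= J%:Z ->
    [/\ `|v n j| <= Rb, `|slope d J (v n) j| <= Rb & `|G n j| <= B]) ->
    scheme_bounds l J lam t0 T Rb B a f ph u0 N.
  move=> H; split => //.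
  - by apply: sqrt_le_arith; rewrite ?mulr_gt0.
  - by move=> m j mn jJ; case: (H m j mn jJ).
  - by move=> m j mn jJ; case: (H m j mn jJ).
  - by move=> m j mn jJ; case: (H m j mn jJ).
(* The problem is posed for every Rb, so crude sums over the array can serve as first bounds; they
   disappear from the result. *)
pose Rb1 : R := E v + E (fun n => slope d J (v n)).
have E0 g : 0 <= E g by apply: sumr_ge0 => ? _; apply: sumr_ge0.
have S1 : scheme_bounds l J lam t0 T Rb1 (E G) a f ph u0 N.
  apply: mkS => n j nN jJ; split; last exact: EP.
    by rewrite (le_trans (EP v n j nN jJ))// lerDl.
  by rewrite (le_trans (EP (fun n => slope d J (v n)) n j nN jJ))// lerDr.
have D := scheme_array_linear (P Rb1) S1 ai fi phi M00 cfl (ib_G I) (ib_Gx I).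
have [[XB XX] XT] := SCH _ _ _ _ _ _ _ _ D JL dd1 N1.
have XC : X <= (C + K) * (M0 + 1) by rewrite ler_wpM2r ?lerDl// addr_ge0.
have S2 : scheme_bounds l J lam t0 T Rb1 X a f ph u0 N.
  by apply: mkS => n j nN jJ; split; [exact: sb_v S1 _ _ nN jJ|exact: sb_p S1 _ _ nN jJ|exact: XB].
have up (Y : R) : 0 <= Y -> X * Y <= (C + K) * (M0 + 1) * Y by move=> Y0; rewrite ler_wpM2r.
split.
- have KX : 4 * cl * X + 2 * (kap1 * X + Lam) <= (C + K) * (M0 + 1).
    have -> : (C + K) * (M0 + 1) = X + (4 * cl * X + 2 * (kap1 * X + Lam * (M0 + 1))).
      by rewrite /K /X; ring.
    have : 0 <= Lam * M0 by rewrite mulr_ge0.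
    by move: X0; clear; lra.
  have cX : 0 <= 4 * cl * X by exact: mulr_ge0 (mulr_ge0 (ler0n R 4) (ltW cl0)) (ltW X0).
  have kX : 0 <= kap1 * X := mulr_ge0 kap10 (ltW X0).
  apply: mkS => n j nN jJ.
  have ndt : n%:R * dt <= 1.
    by apply: le_trans N3; rewrite (ler_wpM2r (ltW dt0))// ler_nat.
  have ndt0 : 0 <= n%:R * dt by rewrite mulr_ge0// ltW.
  split; last exact: le_trans (XB _ _ nN jJ) XC.
  + have := scheme_v_t (P Rb1) S2 (n := 0%N) (k := n) nN jJ.
    rewrite add0n -/v -/dt => h.
    have : (kap1 * X + Lam) * (n%:R * dt) <= (kap1 * X + Lam) * 1.
      by rewrite ler_wpM2l// addr_ge0.
    have := ib_v I jJ; rewrite -/(v 0%N).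
    have := ler_normD (v 0%N j) (v n j - v 0%N j); rewrite subrKC.
    move: h KX cX kX L0; clear; lra.
  + have := scheme_slope_t (P Rb1) S2 (n := 0%N) (k := n) nN jJ.
    rewrite add0n -/v -/dt -/d -/cl => h.
    have p1 : (n%:R * dt) `^ (al / 2) <= 1.
      have := @ge0_ler_powR R (al / 2) _ (n%:R * dt) 1; rewrite powR1; apply; rewrite ?nnegrE//.
      by rewrite divr_ge0// ltW.
    have := ler_wpM2l (addr_ge0 cX (mulr_ge0 (ler0n R 2) (addr_ge0 kX L0))) p1.
    have := ib_p I jJ; rewrite -/(v 0%N) -/d.
    have := ler_normD (slope d J (v 0%N) j) (slope d J (v n) j - slope d J (v 0%N) j).
    rewrite subrKC mulr1; move: h KX; clear; lra.
- split=> [n j nN jJ|n i m nN i0 im]; first exact: le_trans (XB _ _ nN jJ) XC.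
  by apply: le_trans (XX _ _ _ nN i0 im) (up _ _); exact: powR_ge0.
- by move=> n k j nk jJ; apply: le_trans (XT _ _ _ nk jJ) (up _ _); exact: powR_ge0.
Qed.

End Continuation.

(** * Passage to the limit *)

Section PowerLimits.
Context {R : realType}.

Lemma powR_subadd (al x y : R) : 0 < al <= 1 -> 0 <= x -> 0 <= y ->
  (x + y) `^ al <= x `^ al + y `^ al.
Proof.
move=> /andP[al0 al1] x0 y0.
have [->|xn] := eqVneq x 0; first by rewrite powR0 ?gt_eqF// !add0r.
have [->|yn] := eqVneq y 0; first by rewrite powR0 ?gt_eqF// !addr0.
have xp : 0 < x by rewrite lt_neqAle eq_sym xn.
have yp : 0 < y by rewrite lt_neqAle eq_sym yn.
have a01 : 0 <= al <= 1 by rewrite (ltW al0).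
have h1 := powR_sublin xp (_ : x <= x + y) a01.
have h2 := powR_sublin yp (_ : y <= x + y) a01.
rewrite lerDl in h1; rewrite lerDr in h2.
rewrite -(@ler_pM2r _ (x + y)) ?addr_gt0//.
by rewrite mulrDr [leRHS]mulrDl lerD// ?h1 ?h2.
Qed.

Lemma powR_dist (al x y : R) : 0 < al <= 1 -> 0 <= x -> 0 <= y ->
  `|x `^ al - y `^ al| <= `|x - y| `^ al.
Proof.
move=> a01 x0 y0.
wlog xy : x y x0 y0 / y <= x.
  by move=> H; case: (leP y x) => h; [exact: H|rewrite distrC (distrC x); apply: H => //; exact: ltW].
have /andP[al0 _] := a01.
have xy0 : 0 <= x - y by rewrite subr_ge0.
rewrite (ger0_norm xy0) ger0_norm; last first.
  by rewrite subr_ge0 ge0_ler_powR// ltW.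
by rewrite lerBlDr -[X in X `^ _ <= _](subrK y); exact: powR_subadd.
Qed.

Lemma cvg_powR {U} (F : set_system U) {FF : Filter F} (g : U -> R) (b al : R) : 0 < al <= 1 ->
  (forall k, 0 <= g k) -> 0 <= b -> g @ F --> b -> (fun k => g k `^ al) @ F --> b `^ al.
Proof.
move=> a01 g0 b0 /cvgrPdist_le H; apply/cvgrPdist_le => e e0.
have /andP[al0 _] := a01.
have [x0 x00 Hx] := powR_small al0 e0.
move: (H _ x00); apply: filterS => k hk.
by apply: (le_trans (powR_dist a01 b0 (g0 k))); apply: Hx; rewrite normr_ge0.
Qed.

Lemma sum_ge_terms (x y z s t : R) : 0 <= x -> 0 <= y -> 0 <= z -> 0 <= s -> 0 <= t ->
  [/\ x <= x + y + z + s + t, y <= x + y + z + s + t, z <= x + y + z + s + t &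
     s <= x + y + z + s + t] /\ t <= x + y + z + s + t.
Proof. by move=> *; split; [split|]; lra. Qed.

Lemma sign_end_in (l s : R) : 0 < l -> s = 1 \/ s = -1 -> - l <= s * l <= l.
Proof. by move=> l0 [->|->]; rewrite ?mul1r ?mulN1r lexx ?andbT /=; lra. Qed.

Lemma N1_neq1 : (-1 == 1 :> R) = false.
Proof. by apply/negbTE; rewrite lt_eqF//; lra. Qed.

Lemma half01 (al : R) : 0 < al < 1 -> 0 < al / 2 <= 1.
Proof. by move=> /andP[a0 a1]; apply/andP; split; lra. Qed.

(** Along one ultrafilter every bounded sequence converges, so the limits at all points (t, x) exist
    at once, without extracting subsequences. *)
Lemma ultra_limit (F : set_system nat) (g : nat -> R) (K : R) : UltraFilter F ->
  (forall k, `|g k| <= K) -> exists b : R, g @ F --> b.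
Proof.
move=> UF gK; have PF := @ultra_proper _ _ UF.
have := @segment_compact R (- K) K (g @ F) _.
case=> [|b [_ bc]].
  apply: (@filterE _ F _ (g @^-1` `[- K, K]%classic)) => k /=.
  by rewrite in_itv/= -ler_norml; exact: gK.
exists b; apply/cvgrPdist_lt => e e0.
have [//|Fn] := in_ultra_setVsetC [set k | `|b - g k| < e] UF.
exfalso; have [] := bc [set x | ~ (`|b - x| < e)] (ball b e) Fn.
  exact: nbhsx_ballx.
by move=> x [].
Qed.

Lemma lim_le (F : set_system nat) (f g : nat -> R) (x y : R) : ProperFilter F ->
  f @ F --> x -> g @ F --> y -> (forall k, f k <= g k) -> x <= y.
Proof. by move=> FF fx gy fg; apply: (ler_cvg_to fx gy); exact: nearW. Qed.

End PowerLimits.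

Section Regular.
Context {R : realType}.

(* [p], [w] and [z] stand for u_x, u_xx and u_t. Differentiability is expressed by
   Taylor expansions with explicit remainders, which make sense up to the boundary
   and pass to limits. *)
Record regular (al l t0 t1 C : R) (u p w z : R -> R -> R) : Prop := Regular {
  rg_bd : forall t x, t0 <= t <= t1 -> - l <= x <= l ->
    [/\ `|u t x| <= C, `|p t x| <= C, `|w t x| <= C & `|z t x| <= C];
  rg_w : forall t s x y, t0 <= t <= t1 -> t0 <= s <= t1 -> - l <= x <= l -> - l <= y <= l ->
    `|w t x - w s y| <= C * (`|t - s| `^ (al / 2) + `|x - y| `^ al);
  rg_z : forall t s x y, t0 <= t <= t1 -> t0 <= s <= t1 -> - l <= x <= l -> - l <= y <= l ->
    `|z t x - z s y| <= C * (`|t - s| `^ (al / 2) + `|x - y| `^ al);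
  rg_ux : forall t x y, t0 <= t <= t1 -> - l <= x <= l -> - l <= y <= l ->
    `|u t y - u t x - (y - x) * p t x| <= C * `|y - x| ^+ 2;
  rg_px : forall t x y, t0 <= t <= t1 -> - l <= x <= l -> - l <= y <= l ->
    `|p t y - p t x - (y - x) * w t x| <= C * (`|y - x| * `|y - x| `^ al);
  rg_ut : forall t s x, t0 <= t <= t1 -> t0 <= s <= t1 -> - l <= x <= l ->
    `|u s x - u t x - (s - t) * z t x| <= C * (`|s - t| * `|s - t| `^ (al / 2)) }.

(** The equation and the end conditions are required on closed sets, initial time included. Each
    time slice is then compatible and can serve as a new datum. *)
Definition solves (l t0 t1 : R) (a f ph : R -> R -> R -> R -> R) (u0 : R -> R)
    (u p w z : R -> R -> R) : Prop :=
  [/\ forall t x, t0 <= t <= t1 -> - l <= x <= l ->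
        z t x = a t x (u t x) (p t x) * w t x + f t x (u t x) (p t x),
      forall s t, s = 1 \/ s = -1 -> t0 <= t <= t1 ->
        z t (s * l) = ph s t (u t (s * l)) (p t (s * l))
    & forall x, - l <= x <= l -> u t0 x = u0 x].

End Regular.

Section Velocity.
Context {R : realType}.
Variables (al l T Rb kap0 kap1 Lam lam t0 B X : R) (a f ph : R -> R -> R -> R -> R).
Variables (u0 : R -> R) (J N : nat).
Hypothesis P : problem al l T Rb kap0 kap1 Lam a f ph.
Hypothesis S : scheme_bounds l J lam t0 T Rb B a f ph u0 N.

Let d := mesh l J.
Let dt := tick l J lam.
Let v := sv l J lam t0 a f ph u0.
Let A n := sA l J lam t0 a n (v n).
Let F n := sF l J lam t0 f n (v n).
Let G n := sG l J lam t0 a f ph n (v n).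
Let V n j := A n j * G n j + F n j.
Let Mn := nonlinear_const l Rb kap1 Lam lam B.
Let HV := kap1 * X + Mn * (B + 1).

Lemma product_holder (a1 a2 g1 g2 f1 f2 y : R) : `|a1| <= kap1 -> `|g2| <= B -> 0 <= y ->
  `|a1 - a2| <= Mn * y -> `|g1 - g2| <= X * y -> `|f1 - f2| <= Mn * y ->
  `|a1 * g1 + f1 - (a2 * g2 + f2)| <= HV * y.
Proof.
move=> h1 h2 y0 h3 h4 h5.
have -> : a1 * g1 + f1 - (a2 * g2 + f2) = a1 * (g1 - g2) + (a1 - a2) * g2 + (f1 - f2) by ring.
have -> : HV * y = kap1 * (X * y) + Mn * y * B + Mn * y by rewrite /HV; ring.
apply: (le_trans (ler_normD _ _)); rewrite lerD//.
by apply: (le_trans (ler_normD _ _)); rewrite lerD// normrM ler_pM.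
Qed.

Lemma scheme_A_norm n (j : int) : (n <= N)%N -> 0 <= j <= J%:Z -> `|A n j| <= kap1.
Proof.
move=> nN jJ; have /andP[h1 h2] := scheme_A P S nN jJ; have /andP[k0 _] := pr_kap P.
by rewrite ger0_norm// (le_trans (ltW k0)).
Qed.

Lemma velocity_x n (i : int) m : array_bounds al d B X J N G -> (n <= N)%N -> 0 <= i -> i + m%:Z <= J%:Z ->
  `|V n (i + m%:Z) - V n i| <= HV * (m%:R * d) `^ al.
Proof.
move=> [GB GX] nN i0 im.
have iJ : 0 <= i <= J%:Z by move: i0 im; clear; lia.
have imJ : 0 <= i + m%:Z <= J%:Z by move: i0 im; clear; lia.
apply: product_holder; [exact: scheme_A_norm|exact: GB|exact: powR_ge0| |exact: GX|].
- by apply: (nonlinear_x P S) => //; exact: (pr_a P).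
- by apply: (nonlinear_x P S) => //; exact: (pr_f P).
Qed.

Lemma velocity_t n k (j : int) :
  (forall n k (j : int), (n + k <= N)%N -> 0 <= j <= J%:Z ->
      `|G (n + k)%N j - G n j| <= X * (k%:R * dt) `^ (al / 2)) ->
  (n + k <= N)%N -> 0 <= j <= J%:Z ->
  `|V (n + k)%N j - V n j| <= HV * (k%:R * dt) `^ (al / 2).
Proof.
move=> GT nk jJ; have nN : (n <= N)%N by apply: leq_trans nk; exact: leq_addr.
have al0 : 0 < al by case/andP: (pr_al P).
apply: product_holder; [exact: scheme_A_norm|exact: (sb_G S)|exact: powR_ge0| |exact: GT|].
- apply: (nonlinear_t P S (g := fun t z p => a t (node l J j) z p)) => // t s y y' p p' ht hs hz hz' hp hp'.
  apply: (le_trans (pr_a P ht hs (node_in P S jJ) (node_in P S jJ) hz hz' hp hp')).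
  by rewrite subrr normr0 powR0 ?addr0// gt_eqF.
- apply: (nonlinear_t P S (g := fun t z p => f t (node l J j) z p)) => // t s y y' p p' ht hs hz hz' hp hp'.
  apply: (le_trans (pr_f P ht hs (node_in P S jJ) (node_in P S jJ) hz hz' hp hp')).
  by rewrite subrr normr0 powR0 ?addr0// gt_eqF.
Qed.

(** Summation of the scheme; the velocity is Holder continuous in time, so its value at level n may
    replace the later ones. *)
Lemma value_taylor n k (j : int) : 0 <= HV ->
  (forall n k (j : int), (n + k <= N)%N -> 0 <= j <= J%:Z ->
      `|G (n + k)%N j - G n j| <= X * (k%:R * dt) `^ (al / 2)) ->
  (n + k <= N)%N -> 0 <= j <= J%:Z ->
  `|v (n + k)%N j - v n j - k%:R * dt * V n j| <= HV * (k%:R * dt * (k%:R * dt) `^ (al / 2)).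
Proof.
move=> HV0 GT nk jJ; have dt0 : 0 < dt := tick_gt0 P S.
have al0 : 0 < al by case/andP: (pr_al P).
suff main i : (i <= k)%N -> `|v (n + i)%N j - v n j - i%:R * dt * V n j| <=
    i%:R * (dt * (HV * (k%:R * dt) `^ (al / 2))).
  have := main k (leqnn k); set Y := (k%:R * dt) `^ _.
  by have -> : k%:R * (dt * (HV * Y)) = HV * (k%:R * dt * Y) by ring.
elim: i => [|i IH] ik; first by rewrite addn0 subrr !mul0r subrr normr0.
have {}IH := IH (ltnW ik).
have -> : v (n + i.+1)%N j - v n j - i.+1%:R * dt * V n j =
  (v (n + i)%N j - v n j - i%:R * dt * V n j) + dt * (V (n + i)%N j - V n j).
  have -> : v (n + i.+1)%N j = v (n + i)%N j + dt * V (n + i)%N j by rewrite addnS.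
  by rewrite -natr1; ring.
apply: (le_trans (ler_normD _ _)); rewrite -[in leRHS]natr1 [in leRHS]mulrDl mul1r lerD//.
rewrite normrM (gtr0_norm dt0) (ler_wpM2l (ltW dt0))//.
have nik : (n + i <= N)%N by rewrite (leq_trans _ nk)// leq_add2l ltnW.
apply: (le_trans (velocity_t GT nik jJ)); rewrite ler_wpM2l// ge0_ler_powR//.
- by rewrite divr_ge0// ltW.
- by rewrite nnegrE mulr_ge0// ltW.
- by rewrite nnegrE mulr_ge0// ltW.
- by rewrite (ler_wpM2r (ltW dt0))// ler_nat ltnW.
Qed.

End Velocity.

(** * Limits of the scheme along an ultrafilter *)

Section Limit.
Context {R : realType}.
Variables (al l T Rb kap0 kap1 Lam lam t0 de B X : R) (a f ph : R -> R -> R -> R -> R).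
Variables (u0 : R -> R) (J0 : nat).
Hypothesis P : problem al l T Rb kap0 kap1 Lam a f ph.
Hypothesis lam0 : 0 < lam.
Hypothesis de0 : 0 <= de.
Hypothesis HS : forall J N, (J0 < J)%N -> N%:R * tick l J lam <= de ->
  let G n := sG l J lam t0 a f ph n (sv l J lam t0 a f ph u0 n) in
  [/\ scheme_bounds l J lam t0 T Rb B a f ph u0 N,
      array_bounds al (mesh l J) B X J N G &
      forall n k (j : int), (n + k <= N)%N -> 0 <= j <= J%:Z ->
      `|G (n + k)%N j - G n j| <= X * (k%:R * tick l J lam) `^ (al / 2)].
Hypothesis u0_lip : forall x y, - l <= x <= l -> - l <= y <= l ->
  `|u0 x - u0 y| <= Rb * `|x - y|.

Let J k := (J0 + k).+1.
Let d k : R := mesh l (J k).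
Let dt k : R := tick l (J k) lam.
Let N k := Num.truncn (de / dt k).
Let ti k (t : R) := Num.truncn ((t - t0) / dt k).
Let xi k (x : R) := Num.truncn ((x + l) / d k).
Let v k := sv l (J k) lam t0 a f ph u0.
Let G k n := sG l (J k) lam t0 a f ph n (v k n).
Let A k n := sA l (J k) lam t0 a n (v k n).
Let F k n := sF l (J k) lam t0 f n (v k n).
Let V k n (j : int) := A k n j * G k n j + F k n j.
Let HV := kap1 * X + nonlinear_const l Rb kap1 Lam lam B * (B + 1).

Lemma lim_d_gt0 k : 0 < d k.
Proof. by rewrite /d /mesh divr_gt0 ?ltr0n// mulr_gt0// (pr_l P). Qed.

Lemma lim_dt_gt0 k : 0 < dt k.
Proof. by rewrite /dt /tick mulr_gt0// exprn_gt0// lim_d_gt0. Qed.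

Lemma lim_dJ k : (J k)%:R * d k = 2 * l.
Proof. by rewrite /d /mesh mulrC divfK// pnatr_eq0. Qed.

Lemma trunc_step (x e : R) : 0 <= x -> 0 < e ->
  (Num.truncn (x / e))%:R * e <= x < (Num.truncn (x / e))%:R * e + e.
Proof.
move=> x0 e0; have /andP[h1 h2] := truncn_itv (divr_ge0 x0 (ltW e0)).
rewrite -ler_pdivlMr// h1/= -[X in _ < _ + X]mul1r -mulrDl -ltr_pdivrMr//.
by rewrite natr1.
Qed.

Lemma lim_scheme k : [/\ scheme_bounds l (J k) lam t0 T Rb B a f ph u0 (N k),
      array_bounds al (d k) B X (J k) (N k) (G k) &
      forall n i (j : int), (n + i <= N k)%N -> 0 <= j <= (J k)%:Z ->
      `|G k (n + i)%N j - G k n j| <= X * (i%:R * dt k) `^ (al / 2)].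
Proof.
apply: HS; first by rewrite /J ltnS leq_addr.
by have /andP[] := trunc_step de0 (lim_dt_gt0 k).
Qed.

Lemma ti_mono k t s : t <= s -> (ti k t <= ti k s)%N.
Proof.
move=> ts; apply: le_truncn; rewrite (ler_wpM2r _)// ?invr_ge0 ?(ltW (lim_dt_gt0 k))//.
by rewrite lerD2r.
Qed.

Lemma ti_le k t : t0 <= t <= t0 + de -> (ti k t <= N k)%N.
Proof.
move=> /andP[_ h]; have := ti_mono k h; rewrite /ti.
by have -> : t0 + de - t0 = de by ring.
Qed.

Lemma xi_mono k x y : x <= y -> (xi k x <= xi k y)%N.
Proof.
move=> xy; apply: le_truncn; rewrite (ler_wpM2r _)// ?invr_ge0 ?(ltW (lim_d_gt0 k))//.
by rewrite lerD2r.
Qed.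

(** Truncation is exact at x = l because the interval consists of a whole number of cells. The end
    conditions can therefore be read off at the end nodes. *)
Lemma xi_end k : xi k l = J k.
Proof.
rewrite /xi (_ : (l + l) / d k = (J k)%:R) ?natrK//.
have -> : l + l = 2 * l by ring.
by rewrite -(lim_dJ k) mulfK// gt_eqF// lim_d_gt0.
Qed.

Lemma xi_start k : xi k (- l) = 0%N.
Proof. by rewrite /xi addNr mul0r truncn0. Qed.

Lemma xi_le k x : - l <= x <= l -> 0 <= (xi k x)%:Z <= (J k)%:Z.
Proof. by move=> /andP[_ h]; have := xi_mono k h; rewrite xi_end; clear; lia. Qed.

Variable FF : set_system nat.
Hypothesis UF : UltraFilter FF.
Hypothesis FE : \oo `<=` FF.

Let PF : ProperFilter FF := @ultra_proper _ _ UF.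

Lemma cvg_d : d @ FF --> (0 : R).
Proof.
have h : (fun k => 2 * l * harmonic k) @ \oo --> 2 * l * (0 : R).
  by apply: cvgM; [exact: cvg_cst|exact: cvg_harmonic].
rewrite mulr0 in h.
have : d @ \oo --> (0 : R).
  apply: (squeeze_cvgr _ (@cvg_cst _ (0 : R) _ _ _) h); apply: nearW => k.
  rewrite (ltW (lim_d_gt0 k))/= /d /mesh /harmonic/= ler_wpM2l ?mulr_ge0 ?(ltW (pr_l P))//.
  by rewrite lef_pV2 ?posrE ?ltr0n// ler_nat /J ltnS leq_addl.
by move=> H A0 /H /FE.
Qed.

Lemma cvg_dt : dt @ FF --> (0 : R).
Proof.
have -> : (0 : R) = lam * (0 * 0) by ring.
have -> : dt = (fun k => lam * (d k * d k)).
  by apply/funext => k; rewrite /dt /tick expr2.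
by apply: cvgM; [exact: cvg_cst|apply: cvgM; exact: cvg_d].
Qed.

Lemma cvg_trunc (e : nat -> R) (x : R) : (forall k, 0 < e k) -> e @ FF --> (0 : R) -> 0 <= x ->
  (fun k => (Num.truncn (x / e k))%:R * e k) @ FF --> x.
Proof.
move=> e0 ee x0.
have h : (fun k => x - e k) @ FF --> x - 0 by apply: cvgB => //; exact: cvg_cst.
rewrite subr0 in h.
apply: (squeeze_cvgr _ h (@cvg_cst _ x _ _ _)); apply: nearW => k.
have /andP[h1 h2] := trunc_step x0 (e0 k).
by rewrite h1 andbT lerBlDr ltW.
Qed.

Lemma cvg_ti t : t0 <= t -> (fun k => (ti k t)%:R * dt k) @ FF --> t - t0.
Proof. by move=> h; apply: cvg_trunc; [exact: lim_dt_gt0|exact: cvg_dt|rewrite subr_ge0]. Qed.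

Lemma cvg_xi x : - l <= x -> (fun k => (xi k x)%:R * d k) @ FF --> x + l.
Proof.
move=> h; apply: cvg_trunc; [exact: lim_d_gt0|exact: cvg_d|].
by rewrite -lerBlDr sub0r.
Qed.

Lemma cvg_tstep t s : t0 <= t <= s ->
  (fun k => (ti k s - ti k t)%:R * dt k) @ FF --> s - t.
Proof.
move=> /andP[h1 h2]; have -> : s - t = (s - t0) - (t - t0) by ring.
have -> : (fun k => (ti k s - ti k t)%:R * dt k) =
   (fun k => (ti k s)%:R * dt k - (ti k t)%:R * dt k).
  by apply/funext => k; rewrite natrB ?ti_mono// mulrBl.
by apply: cvgB; apply: cvg_ti => //; exact: le_trans h2.
Qed.

Lemma cvg_xstep x y : - l <= x <= y ->
  (fun k => (xi k y - xi k x)%:R * d k) @ FF --> y - x.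
Proof.
move=> /andP[h1 h2]; have -> : y - x = (y + l) - (x + l) by ring.
have -> : (fun k => (xi k y - xi k x)%:R * d k) =
   (fun k => (xi k y)%:R * d k - (xi k x)%:R * d k).
  by apply/funext => k; rewrite natrB ?xi_mono// mulrBl.
by apply: cvgB; apply: cvg_xi => //; exact: le_trans h2.
Qed.

Lemma cvg_clock t : t0 <= t -> (fun k => clock l (J k) lam t0 (ti k t)) @ FF --> t.
Proof.
move=> h; rewrite -[X in _ --> X](subrKC t0); apply: cvgD; first exact: cvg_cst.
exact: cvg_ti.
Qed.

Lemma cvg_node x : - l <= x -> (fun k => node l (J k) (xi k x)%:Z) @ FF --> x.
Proof.
move=> h; have -> : x = - l + (x + l) by ring.
apply: cvgD; first exact: cvg_cst.
have -> : - l + (x + l) = x by ring.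
exact: cvg_xi.
Qed.

(** Grid functions are sampled at the level and node obtained by rounding down. *)
Definition grid_limit (g : nat -> nat -> int -> R) (h : R -> R -> R) :=
  forall t x, t0 <= t <= t0 + de -> - l <= x <= l ->
  (fun k => g k (ti k t) (xi k x)%:Z) @ FF --> h t x.

Lemma grid_limit_ex (g : nat -> nat -> int -> R) (K : R) :
  (forall k n j, (n <= N k)%N -> 0 <= j <= (J k)%:Z -> `|g k n j| <= K) ->
  exists h, grid_limit g h.
Proof.
move=> gK.
have : forall tx : R * R, exists b : R, t0 <= tx.1 <= t0 + de -> - l <= tx.2 <= l ->
    (fun k => g k (ti k tx.1) (xi k tx.2)%:Z) @ FF --> b.
  move=> [t x]/=; case: (boolP ((t0 <= t <= t0 + de) && (- l <= x <= l))) => [/andP[ht hx]|].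
    have [b hb] := ultra_limit UF (fun k => gK k _ _ (ti_le k ht) (xi_le k hx)).
    by exists b.
  by move=> h; exists 0 => ht hx; rewrite ht hx in h.
move=> /choice[h hh]; exists (fun t x => h (t, x)) => t x ht hx.
exact: (hh (t, x)).
Qed.

Lemma grid_limit_bound (g : nat -> nat -> int -> R) (K : R) h : grid_limit g h ->
  (forall k n j, (n <= N k)%N -> 0 <= j <= (J k)%:Z -> `|g k n j| <= K) ->
  forall t x, t0 <= t <= t0 + de -> - l <= x <= l -> `|h t x| <= K.
Proof.
move=> gh gK t x ht hx.
have h1 : (fun k => `|g k (ti k t) (xi k x)%:Z|) @ FF --> `|h t x|.
  by apply: cvg_norm; exact: gh.
refine (@lim_le _ FF _ _ _ _ PF h1 (cvg_cst K) _) => k.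
by apply: gK; [exact: ti_le|exact: xi_le].
Qed.

Lemma xi_split k x y : x <= y -> (xi k y)%:Z = (xi k x)%:Z + (xi k y - xi k x)%N%:Z.
Proof. by move=> /(xi_mono k); clear; lia. Qed.

Lemma ti_split k t s : t <= s -> ti k s = (ti k t + (ti k s - ti k t))%N.
Proof. by move=> /(ti_mono k); clear; lia. Qed.

Lemma grid_limit_x (g : nat -> nat -> int -> R) (H : R) h : grid_limit g h ->
  (forall k n (i : int) m, (n <= N k)%N -> 0 <= i -> i + m%:Z <= (J k)%:Z ->
     `|g k n (i + m%:Z) - g k n i| <= H * (m%:R * d k) `^ al) ->
  forall t x y, t0 <= t <= t0 + de -> - l <= x <= l -> - l <= y <= l ->
  `|h t x - h t y| <= H * `|x - y| `^ al.
Proof.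
move=> gh gH t x y ht hx hy.
wlog xy : x y hx hy / x <= y.
  move=> W; case: (leP x y) => h1; first exact: W.
  by rewrite distrC (distrC x); apply: W => //; exact: ltW.
have /andP[al0 al1] := pr_al P.
rewrite distrC (distrC x) (ger0_norm (_ : 0 <= y - x)) ?subr_ge0//.
have hx1 : - l <= x <= y by case/andP: hx => ->.
apply: (lim_le (F := FF) (f := fun k => `|g k (ti k t) (xi k y)%:Z - g k (ti k t) (xi k x)%:Z|)
  (g := fun k => H * ((xi k y - xi k x)%:R * d k) `^ al)).
- by apply: cvg_norm; apply: cvgB; exact: gh.
- apply: cvgM; first exact: cvg_cst.
  apply: cvg_powR; [by rewrite al0 ltW| |by rewrite subr_ge0|exact: cvg_xstep].
  by move=> k; rewrite mulr_ge0// ltW// lim_d_gt0.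
- move=> k; rewrite (xi_split k xy); apply: gH; first exact: ti_le.
    by have /andP[] := xi_le k hx.
  by rewrite -(xi_split k xy); have /andP[] := xi_le k hy.
Qed.

Lemma grid_limit_t (g : nat -> nat -> int -> R) (H : R) h : grid_limit g h ->
  (forall k n i (j : int), (n + i <= N k)%N -> 0 <= j <= (J k)%:Z ->
     `|g k (n + i)%N j - g k n j| <= H * (i%:R * dt k) `^ (al / 2)) ->
  forall t s x, t0 <= t <= t0 + de -> t0 <= s <= t0 + de -> - l <= x <= l ->
  `|h t x - h s x| <= H * `|t - s| `^ (al / 2).
Proof.
move=> gh gH t s x ht hs hx.
wlog ts : t s ht hs / t <= s.
  move=> W; case: (leP t s) => h1; first exact: W.
  by rewrite distrC (distrC t); apply: W => //; exact: ltW.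
have /andP[al0 al1] := pr_al P.
rewrite distrC (distrC t) (ger0_norm (_ : 0 <= s - t)) ?subr_ge0//.
have ht1 : t0 <= t <= s by case/andP: ht => ->.
apply: (lim_le (F := FF) (f := fun k => `|g k (ti k s) (xi k x)%:Z - g k (ti k t) (xi k x)%:Z|)
  (g := fun k => H * ((ti k s - ti k t)%:R * dt k) `^ (al / 2))).
- by apply: cvg_norm; apply: cvgB; exact: gh.
- apply: cvgM; first exact: cvg_cst.
  apply: cvg_powR; [exact: half01 (pr_al P)| |by rewrite subr_ge0|exact: cvg_tstep].
  by move=> k; rewrite mulr_ge0// ltW// lim_dt_gt0.
- move=> k; have := gH k (ti k t) (ti k s - ti k t)%N (xi k x)%:Z.
  by rewrite -(ti_split k ts); apply; [exact: ti_le|exact: xi_le].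
Qed.

Lemma holder_joint (h : R -> R -> R) (H : R) : 
  (forall t x y, t0 <= t <= t0 + de -> - l <= x <= l -> - l <= y <= l ->
    `|h t x - h t y| <= H * `|x - y| `^ al) ->
  (forall t s x, t0 <= t <= t0 + de -> t0 <= s <= t0 + de -> - l <= x <= l ->
    `|h t x - h s x| <= H * `|t - s| `^ (al / 2)) ->
  forall t s x y, t0 <= t <= t0 + de -> t0 <= s <= t0 + de -> - l <= x <= l -> - l <= y <= l ->
  `|h t x - h s y| <= H * (`|t - s| `^ (al / 2) + `|x - y| `^ al).
Proof.
move=> hx ht t s x y t1 s1 x1 y1.
have -> : h t x - h s y = (h t x - h s x) + (h s x - h s y) by ring.
by apply: (le_trans (ler_normD _ _)); rewrite mulrDr lerD// ?ht// hx.
Qed.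

Lemma lim_B_ge0 : 0 <= B.
Proof. by have [S _ _] := lim_scheme 0; exact: (scheme_B_ge0 S). Qed.

Lemma lim_Rb_ge0 : 0 <= Rb.
Proof. by have [S _ _] := lim_scheme 0; exact: (scheme_Rb_ge0 S). Qed.

Lemma lim_HV_ge0 : 0 <= X -> 0 <= HV.
Proof.
move=> X0; have [S _ _] := lim_scheme 0.
have k1 : 0 <= kap1 by case/andP: (pr_kap P) => /ltW h h'; exact: le_trans h'.
apply: addr_ge0; first exact: mulr_ge0.
by rewrite mulr_ge0 ?addr_ge0 ?lim_B_ge0// (nonlinear_const_ge0 P S).
Qed.

(** Points to the right of x use the forward expansion of the scheme, points to the left the
    backward one, which brings the factor 2. *)
Lemma grid_taylor_x u p : grid_limit v u -> grid_limit (fun k n => slope (d k) (J k) (v k n)) p ->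
  forall t x y, t0 <= t <= t0 + de -> - l <= x <= l -> - l <= y <= l ->
  `|u t y - u t x - (y - x) * p t x| <= 2 * B * `|y - x| ^+ 2.
Proof.
move=> lu lp t x y ht hx hy; have B0 := lim_B_ge0.
case: (leP x y) => [xy|/ltW yx].
  have hx1 : - l <= x <= y by case/andP: hx => ->.
  apply: (@le_trans _ _ (B * ((y - x) * (y - x)))); last first.
    by rewrite real_normK ?num_real// -expr2 ler_wpM2r ?sqr_ge0// ler_peMl// ler1n.
  have c := cvg_xstep hx1.
  refine (@lim_le _ FF _ _ _ _ PF (cvg_norm (cvgB (cvgB (lu t y ht hy) (lu t x ht hx)) (cvgM c (lp t x ht hx))))
    (cvgM (cvg_cst B) (cvgM c c)) _) => k /=.
  have [S _ _] := lim_scheme k.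
  have := slope_taylor (scheme_grid P S (ti_le k ht)) (j := (xi k x)%:Z) (m := (xi k y - xi k x)%N).
  rewrite -(xi_split k xy) expr2; apply.
    by have /andP[] := xi_le k hx.
  by have /andP[] := xi_le k hy.
have hy1 : - l <= y <= x by case/andP: hy => ->.
have xy0 : 0 <= x - y by rewrite subr_ge0.
rewrite [`|y - x|]distrC (ger0_norm xy0).
have -> : u t y - u t x - (y - x) * p t x = u t y - u t x + (x - y) * p t x by ring.
have c := cvg_xstep hy1; rewrite expr2.
refine (@lim_le _ FF _ _ _ _ PF (cvg_norm (cvgD (cvgB (lu t y ht hy) (lu t x ht hx)) (cvgM c (lp t x ht hx))))
    (cvgM (cvg_cst (2 * B)) (cvgM c c)) _) => k /=.
have [S _ _] := lim_scheme k.
have := slope_taylor_back (scheme_grid P S (ti_le k ht)) (j := (xi k y)%:Z) (m := (xi k x - xi k y)%N).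
rewrite -(xi_split k yx) expr2; apply.
  by have /andP[] := xi_le k hy.
by have /andP[] := xi_le k hx.
Qed.

(** For y > x the discrete expansion passes to the limit, its error d B tending to zero. For y < x
    the expansion about y is used, and the Holder continuity of w moves the derivative from y to
    x. *)
Lemma grid_taylor_slope p w : 0 <= X -> grid_limit (fun k n => slope (d k) (J k) (v k n)) p ->
  grid_limit G w -> 
  (forall t x y, t0 <= t <= t0 + de -> - l <= x <= l -> - l <= y <= l ->
    `|w t x - w t y| <= X * `|x - y| `^ al) ->
  forall t x y, t0 <= t <= t0 + de -> - l <= x <= l -> - l <= y <= l ->
  `|p t y - p t x - (y - x) * w t x| <= 2 * X * (`|y - x| * `|y - x| `^ al).
Proof.
move=> X0 lp lw wX; have B0 := lim_B_ge0; have /andP[al0 al1] := pr_al P.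
suff main t x y : t0 <= t <= t0 + de -> - l <= x <= l -> - l <= y <= l -> x <= y ->
    `|p t y - p t x - (y - x) * w t x| <= X * (`|y - x| * `|y - x| `^ al).
  move=> t x y ht hx hy; case: (leP x y) => [xy|/ltW yx].
    apply: (le_trans (main t x y ht hx hy xy)).
    by rewrite ler_wpM2r ?mulr_ge0 ?powR_ge0// ler_peMl// ler1n.
  have -> : p t y - p t x - (y - x) * w t x =
    - (p t x - p t y - (x - y) * w t y) + (x - y) * (w t x - w t y) by ring.
  apply: (le_trans (ler_normD _ _)); rewrite normrN normrM (distrC y).
  have -> : 2 * X * (`|x - y| * `|x - y| `^ al) = X * (`|x - y| * `|x - y| `^ al) +
     `|x - y| * (X * `|x - y| `^ al) by ring.
  by rewrite lerD ?main// ler_wpM2l// wX.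
move=> ht hx hy xy.
have hx1 : - l <= x <= y by case/andP: hx => ->.
have yx0 : 0 <= y - x by rewrite subr_ge0.
rewrite (ger0_norm yx0).
have c := cvg_xstep hx1.
have cp : (fun k => ((xi k y - xi k x)%:R * d k) `^ al) @ FF --> (y - x) `^ al.
  apply: cvg_powR => //; first by rewrite al0 ltW.
  by move=> k; rewrite mulr_ge0// ltW// lim_d_gt0.
have -> : X * ((y - x) * (y - x) `^ al) = (y - x) * (X * (y - x) `^ al) + 0 * B by ring.
refine (@lim_le _ FF _ _ _ _ PF (cvg_norm (cvgB (cvgB (lp t y ht hy) (lp t x ht hx)) (cvgM c (lw t x ht hx))))
    (cvgD (cvgM c (cvgM (cvg_cst X) cp)) (cvgM cvg_d (cvg_cst B))) _) => k /=.
have [S [_ GX] _] := lim_scheme k.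
have := slope_taylor2 (scheme_grid P S (ti_le k ht)) (j := (xi k x)%:Z) (m := (xi k y - xi k x)%N) _ _ X0 al0.
rewrite -(xi_split k xy); apply.
- by have /andP[] := xi_le k hx.
- by have /andP[] := xi_le k hy.
- by move=> i m i0 im; apply: GX => //; exact: ti_le.
Qed.

Lemma grid_taylor_t u z : 0 <= HV -> grid_limit v u -> grid_limit V z ->
  (forall t s x, t0 <= t <= t0 + de -> t0 <= s <= t0 + de -> - l <= x <= l ->
    `|z t x - z s x| <= HV * `|t - s| `^ (al / 2)) ->
  forall t s x, t0 <= t <= t0 + de -> t0 <= s <= t0 + de -> - l <= x <= l ->
  `|u s x - u t x - (s - t) * z t x| <= 2 * HV * (`|s - t| * `|s - t| `^ (al / 2)).
Proof.
move=> H0 lu lz zH.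
suff main t s x : t0 <= t <= t0 + de -> t0 <= s <= t0 + de -> - l <= x <= l -> t <= s ->
    `|u s x - u t x - (s - t) * z t x| <= HV * (`|s - t| * `|s - t| `^ (al / 2)).
  move=> t s x ht hs hx; case: (leP t s) => [ts|/ltW st].
    apply: (le_trans (main t s x ht hs hx ts)).
    by rewrite ler_wpM2r ?mulr_ge0 ?powR_ge0// ler_peMl// ler1n.
  have -> : u s x - u t x - (s - t) * z t x =
    - (u t x - u s x - (t - s) * z s x) + (t - s) * (z t x - z s x) by ring.
  apply: (le_trans (ler_normD _ _)); rewrite normrN normrM (distrC s).
  have -> : 2 * HV * (`|t - s| * `|t - s| `^ (al / 2)) = HV * (`|t - s| * `|t - s| `^ (al / 2)) +
     `|t - s| * (HV * `|t - s| `^ (al / 2)) by ring.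
  by rewrite lerD ?main// ler_wpM2l// zH.
move=> ht hs hx ts.
have ht1 : t0 <= t <= s by case/andP: ht => ->.
have ts0 : 0 <= s - t by rewrite subr_ge0.
rewrite (ger0_norm ts0).
have c := cvg_tstep ht1.
have cp : (fun k => ((ti k s - ti k t)%:R * dt k) `^ (al / 2)) @ FF --> (s - t) `^ (al / 2).
  apply: cvg_powR => //; first exact: half01 (pr_al P).
  by move=> k; rewrite mulr_ge0// ltW// lim_dt_gt0.
refine (@lim_le _ FF _ _ _ _ PF (cvg_norm (cvgB (cvgB (lu s x hs hx) (lu t x ht hx)) (cvgM c (lz t x ht hx))))
    (cvgM (cvg_cst HV) (cvgM c cp)) _) => k /=.
have [S _ GT] := lim_scheme k.
have := value_taylor P S (n := ti k t) (k := (ti k s - ti k t)%N) (j := (xi k x)%:Z) H0 GT.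
rewrite -(ti_split k ts); apply; first exact: ti_le.
exact: xi_le.
Qed.

(** Coefficients converge by their modulus of continuity; q1 to q4 stand for the arguments t, x, u
    and u_x. *)
Lemma cvg_coef (g : nat -> R) (b : R) (q1 q2 q3 q4 : nat -> R) (b1 b2 b3 b4 : R) :
  q1 @ FF --> b1 -> q2 @ FF --> b2 -> q3 @ FF --> b3 -> q4 @ FF --> b4 ->
  (forall k, `|g k - b| <= Lam * (`|q1 k - b1| `^ (al / 2) + `|q2 k - b2| `^ al
     + `|q3 k - b3| + `|q4 k - b4|)) -> g @ FF --> b.
Proof.
move=> c1 c2 c3 c4 H; have /andP[al0 al1] := pr_al P.
have z (q : nat -> R) (c : R) : q @ FF --> c -> (fun k => `|q k - c|) @ FF --> (0 : R).
  move=> h; have -> : 0 = `|c - c| by rewrite subrr normr0.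
  by apply: cvg_norm; apply: cvgB => //; exact: cvg_cst.
have zp (q : nat -> R) (c e : R) : 0 < e <= 1 -> q @ FF --> c -> (fun k => `|q k - c| `^ e) @ FF --> (0 : R).
  move=> e01 h; have -> : 0 = 0 `^ e by rewrite powR0// gt_eqF//; case/andP: e01.
  by apply: cvg_powR => //; exact: z.
have E : (fun k => Lam * (`|q1 k - b1| `^ (al / 2) + `|q2 k - b2| `^ al
     + `|q3 k - b3| + `|q4 k - b4|)) @ FF --> Lam * (0 + 0 + 0 + 0 : R).
  apply: cvgM; first exact: cvg_cst.
  apply: cvgD; [apply: cvgD; [apply: cvgD|]|]; [|  |exact: z|exact: z].
    by apply: zp => //; exact: half01 (pr_al P).
  by apply: zp => //; rewrite al0 ltW.
rewrite !addr0 mulr0 in E.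
set e := (fun k => _) in E.
have l1 : (fun k => b - e k) @ FF --> b - 0 by apply: cvgB => //; exact: cvg_cst.
have l2 : (fun k => b + e k) @ FF --> b + 0 by apply: cvgD => //; exact: cvg_cst.
rewrite subr0 in l1; rewrite addr0 in l2.
apply: (squeeze_cvgr _ l1 l2); apply: nearW => k /=.
by have := H k; rewrite ler_distl.
Qed.

Theorem scheme_limit_filter : 0 <= X -> exists u p w z,
  regular al l t0 (t0 + de) (Rb + 2 * B + (kap1 * B + Lam) + 2 * X + 2 * HV) u p w z /\
  solves l t0 (t0 + de) a f ph u0 u p w z.
Proof.
move=> X0; have B0 := lim_B_ge0; have Rb0 := lim_Rb_ge0; have HV0 := lim_HV_ge0 X0.
have Vb k n (j : int) : (n <= N k)%N -> 0 <= j <= (J k)%:Z -> `|V k n j| <= kap1 * B + Lam.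
  by have [S _ _] := lim_scheme k; exact: (scheme_V P S).
have VB0 : 0 <= kap1 * B + Lam by apply: le_trans (Vb 0%N 0%N 0 _ _).
have vb k n (j : int) : (n <= N k)%N -> 0 <= j <= (J k)%:Z -> `|v k n j| <= Rb.
  by have [S _ _] := lim_scheme k; exact: (sb_v S).
have pb k n (j : int) : (n <= N k)%N -> 0 <= j <= (J k)%:Z -> `|slope (d k) (J k) (v k n) j| <= Rb.
  by have [S _ _] := lim_scheme k; exact: (sb_p S).
have wb k n (j : int) : (n <= N k)%N -> 0 <= j <= (J k)%:Z -> `|G k n j| <= B.
  by have [S _ _] := lim_scheme k; exact: (sb_G S).
have [u lu] := grid_limit_ex vb.
have [p lp] := grid_limit_ex pb.
have [w lw] := grid_limit_ex wb.
have [z lz] := grid_limit_ex Vb.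
have ub := grid_limit_bound lu vb; have pb' := grid_limit_bound lp pb.
exists u, p, w, z.
have wx := grid_limit_x lw (fun k => let: And3 _ h _ := lim_scheme k in h.2).
have wt := grid_limit_t lw (fun k => let: And3 _ _ h := lim_scheme k in h).
have zx : forall t x y, t0 <= t <= t0 + de -> - l <= x <= l -> - l <= y <= l ->
    `|z t x - z t y| <= HV * `|x - y| `^ al.
  apply: (grid_limit_x lz) => k n i m nN i0 im; have [S h _] := lim_scheme k.
  exact: (velocity_x P S h).
have zt : forall t s x, t0 <= t <= t0 + de -> t0 <= s <= t0 + de -> - l <= x <= l ->
    `|z t x - z s x| <= HV * `|t - s| `^ (al / 2).
  apply: (grid_limit_t lz) => k n i j ni jJ; have [S _ h] := lim_scheme k.
  exact: (velocity_t P S h).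
have wE := holder_joint wx wt; have zE := holder_joint zx zt.
set C := Rb + _ + _ + _ + _.
have [[C1 C2 C3 C4] C5] : [/\ Rb <= C, 2 * B <= C, kap1 * B + Lam <= C & 2 * X <= C] /\ 2 * HV <= C.
  by apply: sum_ge_terms; rewrite ?mulr_ge0.
have up (x y : R) : `|x| <= y -> y <= C -> `|x| <= C by exact: le_trans.
have B1 : B <= C by apply: le_trans C2; rewrite ler_peMl// ler1n.
have X1 : X <= C by apply: le_trans C4; rewrite ler_peMl// ler1n.
have HV1 : HV <= C by apply: le_trans C5; rewrite ler_peMl// ler1n.
have up2 (x y H : R) : 0 <= y -> `|x| <= H * y -> H <= C -> `|x| <= C * y.
  by move=> y0 h h'; apply: (le_trans h); rewrite ler_wpM2r.
(* The interval of the limit lies in [0, T] because the last clock values of the scheme do and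
   converge to its end. *)
have ttT t : t0 <= t <= t0 + de -> 0 <= t <= T.
  move=> ht; have t00 : t0 <= t by case/andP: ht.
  have [S _ _] := lim_scheme 0; rewrite (le_trans (sb_t0 S) t00)/=.
  case/andP: ht => _ /le_trans; apply.
  have h : (fun k => clock l (J k) lam t0 (N k)) @ FF --> t0 + de.
    have -> : t0 + de = t0 + (t0 + de - t0) by ring.
    apply: cvgD; first exact: cvg_cst.
    have := @cvg_ti (t0 + de); rewrite lerDl /ti; have -> : t0 + de - t0 = de by ring.
    exact.
  refine (@lim_le _ FF _ _ _ _ PF h (cvg_cst T) _) => k; have [S' _ _] := lim_scheme k; exact: (sb_T S').
split; [split|split].
- move=> t x ht hx; split; [exact: up (ub t x ht hx) C1|exact: up (pb' t x ht hx) C1| |].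
    exact: up (grid_limit_bound lw wb ht hx) B1.
  exact: up (grid_limit_bound lz Vb ht hx) C3.
- by move=> t s x y ht hs hx hy; apply: up2 (wE t s x y ht hs hx hy) X1; rewrite addr_ge0 ?powR_ge0.
- by move=> t s x y ht hs hx hy; apply: up2 (zE t s x y ht hs hx hy) HV1; rewrite addr_ge0 ?powR_ge0.
- by move=> t x y ht hx hy; apply: up2 (grid_taylor_x lu lp ht hx hy) C2; rewrite sqr_ge0.
- move=> t x y ht hx hy; apply: up2 (grid_taylor_slope X0 lp lw wx ht hx hy) C4.
  by rewrite mulr_ge0 ?powR_ge0.
- move=> t s x ht hs hx; apply: up2 (grid_taylor_t HV0 lu lz zt ht hs hx) C5.
  by rewrite mulr_ge0 ?powR_ge0.
- move=> t x ht hx; have t00 : t0 <= t by case/andP: ht.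
  have l0 : - l <= x by case/andP: hx.
  have tT := ttT t ht.
  have cA (g : R -> R -> R -> R -> R) : (forall t s x y z z' p p', 0 <= t <= T -> 0 <= s <= T -> - l <= x <= l ->
    - l <= y <= l -> `|z| <= Rb -> `|z'| <= Rb -> `|p| <= Rb -> `|p'| <= Rb ->
    `|g t x z p - g s y z' p'| <=
      Lam * (`|t - s| `^ (al / 2) + `|x - y| `^ al + `|z - z'| + `|p - p'|)) ->
    (fun k => g (clock l (J k) lam t0 (ti k t)) (node l (J k) (xi k x)%:Z) (v k (ti k t) (xi k x)%:Z)
       (slope (d k) (J k) (v k (ti k t)) (xi k x)%:Z)) @ FF --> g t x (u t x) (p t x).
    move=> gL; apply: (cvg_coef (cvg_clock t00) (cvg_node l0) (lu t x ht hx) (lp t x ht hx)) => k.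
    have [S _ _] := lim_scheme k.
    apply: gL => //; [exact: (clock_in P S (ti_le k ht))|exact: (node_in P S (xi_le k hx))| | | |].
    + exact: (sb_v S (ti_le k ht) (xi_le k hx)).
    + exact: ub.
    + exact: (sb_p S (ti_le k ht) (xi_le k hx)).
    + exact: pb'.
  have h : (fun k => V k (ti k t) (xi k x)%:Z) @ FF --> a t x (u t x) (p t x) * w t x + f t x (u t x) (p t x).
    by apply: cvgD; [apply: cvgM; [exact: cA (pr_a P)|exact: lw]|exact: cA (pr_f P)].
  exact: (cvg_unique _ (lz t x ht hx) h).
- move=> s t hs ht; have t00 : t0 <= t by case/andP: ht.
  have l0 := pr_l P.
  have sl := sign_end_in l0 hs.
  have xs k : xi k (s * l) = if s == 1 then J k else 0%N.
    case: hs => ->; rewrite ?eqxx ?mul1r ?xi_end//.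
    by rewrite mulN1r xi_start N1_neq1.
  have tT := ttT t ht.
  have h : (fun k => ph s (clock l (J k) lam t0 (ti k t)) (v k (ti k t) (xi k (s * l))%:Z)
       (slope (d k) (J k) (v k (ti k t)) (xi k (s * l))%:Z)) @ FF --> ph s t (u t (s * l)) (p t (s * l)).
    apply: (cvg_coef (cvg_clock t00) (@cvg_cst _ (0 : R) _ FF _) (lu t _ ht sl) (lp t _ ht sl)) => k.
    have [S _ _] := lim_scheme k; have al0 : 0 < al by case/andP: (pr_al P).
    rewrite subrr normr0 powR0 ?gt_eqF// addr0.
    apply: (pr_ph P) => //; first exact: (clock_in P S (ti_le k ht)).
    + exact: (sb_v S (ti_le k ht) (xi_le k sl)).
    + exact: ub.
    + exact: (sb_p S (ti_le k ht) (xi_le k sl)).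
    + exact: pb'.
  have {}h : (fun k => V k (ti k t) (xi k (s * l))%:Z) @ FF --> ph s t (u t (s * l)) (p t (s * l)).
    suff -> : (fun k => V k (ti k t) (xi k (s * l))%:Z) = (fun k => ph s (clock l (J k) lam t0 (ti k t)) (v k (ti k t) (xi k (s * l))%:Z)
       (slope (d k) (J k) (v k (ti k t)) (xi k (s * l))%:Z)) by [].
    apply/funext => k; have [S _ _] := lim_scheme k.
    apply: (etrans (scheme_end P S (ti_le k ht) _)).
      by rewrite xs; case: ifP => _; [right|left].
    rewrite /sP; congr (ph _ _ _ _); rewrite xs; case: hs => ->; rewrite ?eqxx//.
    by rewrite N1_neq1.
  exact: (cvg_unique _ (lz t _ ht sl) h).
- move=> x hx; have t0in : t0 <= t0 <= t0 + de by rewrite lexx lerDl.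
  have l0 : - l <= x by case/andP: hx.
  have ti0 k : ti k t0 = 0%N by rewrite /ti subrr mul0r truncn0.
  have h : (fun k => v k (ti k t0) (xi k x)%:Z) @ FF --> u0 x.
    have E : (fun k => Rb * `|node l (J k) (xi k x)%:Z - x|) @ FF --> Rb * `|x - x|.
      apply: cvgM; first exact: cvg_cst.
      by apply: cvg_norm; apply: cvgB; [exact: cvg_node|exact: cvg_cst].
    rewrite subrr normr0 mulr0 in E; set e := (fun k => _) in E.
    have l1 : (fun k => u0 x - e k) @ FF --> u0 x - 0 by apply: cvgB => //; exact: cvg_cst.
    have l2 : (fun k => u0 x + e k) @ FF --> u0 x + 0 by apply: cvgD => //; exact: cvg_cst.
    rewrite subr0 in l1; rewrite addr0 in l2.
    apply: (squeeze_cvgr _ l1 l2); apply: nearW => k /=; rewrite ti0 /v/=.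
    have [S _ _] := lim_scheme k.
    by rewrite -ler_distl; apply: u0_lip => //; exact: (node_in P S (xi_le k hx)).
  exact: (cvg_unique _ (lu t0 x t0in hx) h).
Qed.

End Limit.

Theorem scheme_limit {R : realType} (al l T Rb kap0 kap1 Lam lam t0 de B X : R)
    (a f ph : R -> R -> R -> R -> R) (u0 : R -> R) (J0 : nat) :
  problem al l T Rb kap0 kap1 Lam a f ph -> 0 < lam -> 0 <= de ->
  (forall J N, (J0 < J)%N -> N%:R * tick l J lam <= de ->
   let G n := sG l J lam t0 a f ph n (sv l J lam t0 a f ph u0 n) in
   [/\ scheme_bounds l J lam t0 T Rb B a f ph u0 N,
      array_bounds al (mesh l J) B X J N G &
      forall n k (j : int), (n + k <= N)%N -> 0 <= j <= J%:Z ->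
      `|G (n + k)%N j - G n j| <= X * (k%:R * tick l J lam) `^ (al / 2)]) ->
  (forall x y, - l <= x <= l -> - l <= y <= l -> `|u0 x - u0 y| <= Rb * `|x - y|) ->
  0 <= X -> exists u p w z,
  regular al l t0 (t0 + de) (Rb + 2 * B + (kap1 * B + Lam) + 2 * X +
    2 * (kap1 * X + nonlinear_const l Rb kap1 Lam lam B * (B + 1))) u p w z /\
  solves l t0 (t0 + de) a f ph u0 u p w z.
Proof.
move=> P lam0 de0 H u0L X0.
have [FF [UF FE]] := ultraFilterLemma (F := \oo%classic : set_system nat) _.
exact: (scheme_limit_filter P lam0 de0 H u0L UF FE X0).
Qed.

(** * Local existence *)

Section Taylor.
Context {R : realType}.
Implicit Types f df : R -> R.

Lemma is_derive_eps f (x d : R) :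
  (forall e, 0 < e -> exists2 r, 0 < r & forall y, `|y - x| <= r ->
     `|f y - f x - (y - x) * d| <= e * `|y - x|) -> is_derive x (1 : R) f d.
Proof.
move=> H.
suff cv : h^-1 *: (f (h *: (1 : R) + x) - f x) @[h --> 0^'] --> d.
  by apply: DeriveDef; [apply/cvg_ex; exists d|exact: cvg_lim].
apply/cvgrPdist_le => e e0; have [r r0 Hr] := H e e0.
have h1 := dnbhs0_le (V := R) r0; have h2 : \forall h \near (0 : R)^', h != 0 by exact: nbhs_dnbhs_neq.
move: h1 h2; apply: filterS2 => h hr hn.
rewrite distrC; have := Hr (h + x); rewrite addrK => /(_ hr).
have -> : h *: (1 : R) = h by rewrite /GRing.scale/= mulr1.
move=> hh.
have -> : h^-1 *: (f (h + x) - f x) - d = h^-1 * (f (h + x) - f x - h * d).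
  by rewrite /GRing.scale/=; field.
by rewrite normrM normfV mulrC ler_pdivrMr ?normr_gt0.
Qed.

Lemma continuous_eps (A : set R) f :
  (forall x, A x -> exists2 c, 0 <= c & forall y, A y -> `|f y - f x| <= c * `|y - x|) ->
  {within A, continuous f}.
Proof.
move=> H; apply/subspace_continuousP => x Ax; have [c c0 Hc] := H x Ax.
apply/cvgrPdist_le => e e0.
have d0 : 0 < e / (c + 1) by rewrite divr_gt0// ltr_wpDl.
have hb := nbhsx_ballx x _ d0.
rewrite /within/= nearE; move: hb; apply: filterS => y; rewrite /ball/= => yx Ay.
rewrite distrC; apply: (le_trans (Hc y Ay)); rewrite distrC.
apply: (@le_trans _ _ (c * (e / (c + 1)))); first by rewrite ler_wpM2l// ltW.
rewrite mulrCA ler_piMr// ?(ltW e0)// ler_pdivrMr ?ltr_wpDl// mul1r lerDl.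
exact: ler01.
Qed.

(** A first order expansion with a Holder remainder, meaningful at the end points of the interval as
    well. *)
Definition taylor1 (a b C be : R) f df : Prop := forall x y, a <= x <= b -> a <= y <= b ->
  `|f y - f x - (y - x) * df x| <= C * (`|y - x| * `|y - x| `^ be).

Variables (a b C be : R) (f df : R -> R).
Hypothesis be0 : 0 < be.
Hypothesis C0 : 0 <= C.
Hypothesis H : taylor1 a b C be f df.

Lemma taylor_is_derive x : a < x < b -> is_derive x (1 : R) f (df x).
Proof.
move=> /andP[ax xb]; apply: is_derive_eps => e e0.
have e1 : 0 < e / (C + 1) by rewrite divr_gt0// ltr_wpDl.
have [r r0 Hr] := powR_small be0 e1.
exists (Num.min r (Num.min (x - a) (b - x))); first by rewrite !lt_min r0 !subr_gt0 ax.
move=> y; rewrite !le_min => /and3P[y1 y2 y3].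
have yab : a <= y <= b.
  move: y2 y3; rewrite !ler_norml => /andP[h1 h2] /andP[h3 h4].
  by apply/andP; split; lra.
have xab : a <= x <= b by rewrite !ltW.
apply: (le_trans (H xab yab)); rewrite mulrCA mulrC ler_wpM2r//.
have := Hr `|y - x|; rewrite normr_ge0 y1 => /(_ isT) h.
apply: (le_trans (ler_wpM2l C0 h)).
by rewrite mulrCA ler_piMr ?(ltW e0)// ler_pdivrMr ?ltr_wpDl// mul1r lerDl.
Qed.

Lemma taylor_lipschitz x y : a <= x <= b -> a <= y <= b ->
  `|f y - f x| <= (`|df x| + C * (b - a) `^ be) * `|y - x|.
Proof.
move=> xab yab; have h := H xab yab.
have h1 : `|y - x| `^ be <= (b - a) `^ be.
  rewrite ge0_ler_powR ?(ltW be0) ?nnegrE//.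
    by move: xab => /andP[h1 h2]; rewrite subr_ge0 (le_trans h1).
  by rewrite ler_norml; move: xab yab => /andP[? ?] /andP[? ?]; apply/andP; split; lra.
have -> : f y - f x = (f y - f x - (y - x) * df x) + (y - x) * df x by rewrite subrK.
apply: (le_trans (ler_normD _ _)); rewrite normrM addrC [leRHS]mulrDl.
apply: lerD; first by rewrite mulrC.
apply: (le_trans h); rewrite [`|y - x| * _]mulrC mulrA ler_wpM2r//.
by rewrite ler_wpM2l.
Qed.

Lemma taylor_continuous : {within `[a, b], continuous f}.
Proof.
apply: continuous_eps => x /=; rewrite in_itv/= => xab.
exists (`|df x| + C * (b - a) `^ be); first by rewrite addr_ge0// mulr_ge0 ?powR_ge0.
by move=> y; rewrite in_itv/= => yab; exact: taylor_lipschitz.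
Qed.

End Taylor.

(** Strictly between the points the expansion yields derivatives, so the classical theorem applies.
    The bound on the distance from c to x lets Holder estimates about x be used at c. *)
Lemma taylor_mvt {R : realType} (a b C be : R) (f df : R -> R) : 0 < be -> 0 <= C ->
  taylor1 a b C be f df ->
  forall x y, a <= x <= b -> a <= y <= b -> exists2 c, a <= c <= b /\ `|c - x| <= `|y - x| &
    f y - f x = (y - x) * df c.
Proof.
move=> be0 C0 H.
have main x y : a <= x -> y <= b -> x < y -> exists2 c, x < c < y & f y - f x = df c * (y - x).
  move=> ax yb xy.
  have Hxy : taylor1 x y C be f df.
    by move=> s t /andP[s1 s2] /andP[t1 t2]; apply: H; rewrite (le_trans ax)//= (le_trans _ yb).
  have dd z : z \in `]x, y[ -> is_derive z (1 : R) f (df z).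
    by rewrite in_itv/= => hz; exact: (taylor_is_derive be0 C0 Hxy).
  have [c] := MVT xy dd (taylor_continuous be0 C0 Hxy).
  by rewrite in_itv/= => cxy e; exists c.
move=> x y /andP[ax xb] /andP[ay yb].
case: (ltgtP x y) => [xy|yx|->].
- have [c /andP[xc cy] e] := main x y ax yb xy; exists c; last by rewrite e mulrC.
  split; first by rewrite (le_trans ax (ltW xc)) (le_trans (ltW cy) yb).
  by rewrite !gtr0_norm ?subr_gt0// lerD2r ltW.
- have [c /andP[xc cy] e] := main y x ay xb yx; exists c; last by move: e; lra.
  split; first by rewrite (le_trans ay (ltW xc)) (le_trans (ltW cy) xb).
  by rewrite !ltr0_norm ?subr_lt0// lerN2 lerD2r ltW.
- by exists y; rewrite ?subrr ?mul0r ?ay ?yb ?normr0.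
Qed.

(** * Initial data and the consistency of the scheme *)

Section Data.
Context {R : realType}.

(** The functions p0 and w0 are the first two derivatives in the sense of expansions. The last
    remainder is written with the exponent 1 so that both expansions are instances of [taylor1]. *)
Record datum (al l K : R) (u0 p0 w0 : R -> R) : Prop := Datum {
  dt_bd : forall x, - l <= x <= l -> [/\ `|u0 x| <= K, `|p0 x| <= K & `|w0 x| <= K];
  dt_w : forall x y, - l <= x <= l -> - l <= y <= l -> `|w0 x - w0 y| <= K * `|x - y| `^ al;
  dt_p : forall x y, - l <= x <= l -> - l <= y <= l ->
    `|p0 y - p0 x - (y - x) * w0 x| <= K * (`|y - x| * `|y - x| `^ al);
  dt_u : forall x y, - l <= x <= l -> - l <= y <= l ->
    `|u0 y - u0 x - (y - x) * p0 x| <= K * (`|y - x| * `|y - x| `^ 1) }.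

Definition compatible (l t0 : R) (a f ph : R -> R -> R -> R -> R) (u0 p0 w0 : R -> R) : Prop :=
  forall s, s = 1 \/ s = -1 -> ph s t0 (u0 (s * l)) (p0 (s * l)) =
    a t0 (s * l) (u0 (s * l)) (p0 (s * l)) * w0 (s * l) + f t0 (s * l) (u0 (s * l)) (p0 (s * l)).

Variables (al l K : R) (u0 p0 w0 : R -> R).
Hypothesis D : datum al l K u0 p0 w0.
Hypothesis al01 : 0 < al < 1.
Hypothesis l0 : 0 < l.

Let al0 : 0 < al. Proof. by case/andP: al01. Qed.

Lemma datum_K_ge0 : 0 <= K.
Proof.
have [|h _ _] := dt_bd D (x := 0); last exact: le_trans h.
by have ? := l0; apply/andP; split; lra.
Qed.

(** The mean value theorem for u0 minus its second order Taylor polynomial at x, whose derivative is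
    the first order remainder of p0. *)
Lemma datum_taylor2 x y : - l <= x <= l -> - l <= y <= l ->
  `|u0 y - u0 x - (y - x) * p0 x - (y - x) ^+ 2 / 2 * w0 x| <= K * (`|y - x| ^+ 2 * `|y - x| `^ al).
Proof.
move=> hx hy; have K0 := datum_K_ge0.
pose q z := u0 z - z * p0 x - (z - x) ^+ 2 / 2 * w0 x.
pose dq z := p0 z - p0 x - (z - x) * w0 x.
have T : taylor1 (- l) l (K + K / 2) 1 q dq.
  move=> s t hs ht.
  have -> : q t - q s - (t - s) * dq s = (u0 t - u0 s - (t - s) * p0 s) - (t - s) ^+ 2 * (w0 x / 2).
    by rewrite /q /dq; field.
  apply: (le_trans (ler_normB _ _)); rewrite [X in _ <= X]mulrDl; apply: lerD; first exact: (dt_u D hs ht).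
  rewrite powRr1// normrM -expr2 normrX mulrC ler_wpM2r ?sqr_ge0//.
  by rewrite normrM (ger0_norm (x := 2^-1)) ?invr_ge0// ler_wpM2r ?invr_ge0//; case: (dt_bd D hx).
have KK : 0 <= K + K / 2 by rewrite addr_ge0// divr_ge0.
have [c [hc cx] e] := taylor_mvt ltr01 KK T hx hy.
have -> : u0 y - u0 x - (y - x) * p0 x - (y - x) ^+ 2 / 2 * w0 x = q y - q x.
  by rewrite /q subrr expr0n/= !mul0r; ring.
rewrite e normrM.
have h := dt_p D hx hc.
have -> : K * (`|y - x| ^+ 2 * `|y - x| `^ al) = `|y - x| * (K * (`|y - x| * `|y - x| `^ al)) by ring.
rewrite ler_wpM2l//; apply: (le_trans h); rewrite ler_wpM2l// ler_pM ?powR_ge0//.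
by rewrite ge0_ler_powR ?(ltW al0) ?nnegrE.
Qed.

Lemma datum_lip x y : - l <= x <= l -> - l <= y <= l -> `|u0 x - u0 y| <= K * `|x - y|.
Proof.
move=> hx hy; have [c [hc _] e] := taylor_mvt ltr01 datum_K_ge0 (dt_u D) hy hx.
by rewrite e normrM mulrC ler_wpM2r//; case: (dt_bd D hc).
Qed.

Lemma node_succ (J : nat) (j m : int) : node l J (j + m) - node l J j = m%:~R * mesh l J.
Proof. by rewrite /node intrD; ring. Qed.

(** The first term bounds the consistency error of second differences at inner nodes, the other one
    the error at the ends. *)
Definition datum_const (kap0 Lam : R) : R := 2 * K + Lam * K * (2 + K) / kap0.

Section Initial.
Variables (T Rb kap0 kap1 Lam lam t0 : R) (a f ph : R -> R -> R -> R -> R) (J : nat).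
Hypothesis P : problem al l T Rb kap0 kap1 Lam a f ph.
Hypothesis KRb : K <= Rb.
Hypothesis t0T : 0 <= t0 <= T.
Hypothesis compat : compatible l t0 a f ph u0 p0 w0.
Hypothesis J0 : (0 < J)%N.

Let d := mesh l J.
Let v := sv l J lam t0 a f ph u0 0.
Hypothesis d1 : d <= 1.

Let d0 : 0 < d.
Proof. by rewrite /d /mesh divr_gt0 ?mulr_gt0// ltr0n. Qed.

Lemma init_node (j : int) : 0 <= j <= J%:Z -> - l <= node l J j <= l.
Proof.
move=> /andP[j0 jJ]; rewrite /node lerDl -lerBrDl opprK.
rewrite mulr_ge0 ?(ltW d0) ?ler0z//=.
have -> : l + l = J%:R * d by rewrite /d /mesh mulrC divfK ?pnatr_eq0 -?lt0n//; ring.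
by rewrite (ler_wpM2r (ltW d0))// -[X in _ <= X]/((J%:Z)%:~R) ler_int.
Qed.

Lemma init_step (j : int) : 0 <= j -> j + 1 <= J%:Z -> exists2 c, - l <= c <= l &
  v (j + 1) - v j = d * p0 c.
Proof.
move=> j0 jJ.
have h1 := init_node (j := j) ltac:(move: j0 jJ; clear; lia).
have h2 := init_node (j := j + 1) ltac:(move: j0 jJ; clear; lia).
have [c [hc _] e] := taylor_mvt ltr01 datum_K_ge0 (dt_u D) h1 h2.
by exists c => //; rewrite /v/= e node_succ mulr1z mul1r.
Qed.

Lemma init_slope (j : int) : 0 <= j <= J%:Z -> `|slope d J v j| <= K.
Proof.
move=> /andP[j0 jJ]; rewrite /slope; case: ifP => h.
  have [c hc ->] := init_step j0 ltac:(move: h; clear; lia).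
  by rewrite mulrAC divff ?gt_eqF// mul1r; case: (dt_bd D hc).
have [c hc] := init_step (j := j - 1) ltac:(move: h jJ J0; clear; lia) ltac:(move: h jJ J0; clear; lia).
by rewrite subrK => ->; rewrite mulrAC divff ?gt_eqF// mul1r; case: (dt_bd D hc).
Qed.

Lemma init_slope_end (j : int) : j = 0 \/ j = J%:Z -> `|slope d J v j - p0 (node l J j)| <= K * d.
Proof.
have K0 := datum_K_ge0.
have fin (x y : R) : - l <= x <= l -> - l <= y <= l -> `|y - x| = d ->
    `|(u0 y - u0 x) / (y - x) - p0 x| <= K * d.
  move=> hx hy e; have yx : y - x != 0 by rewrite -normr_gt0 e.
  have -> : (u0 y - u0 x) / (y - x) - p0 x = (u0 y - u0 x - (y - x) * p0 x) / (y - x) by field.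
  rewrite normrM normfV ler_pdivrMr ?normr_gt0//.
  by apply: (le_trans (dt_u D hx hy)); rewrite powRr1// e mulrA.
have nd : `|d| = d by rewrite gtr0_norm.
move=> [->|->]; rewrite /slope.
  rewrite (_ : (0 : int) < J%:Z = true); last by move: J0; clear; lia.
  have := fin (node l J 0) (node l J (0 + 1)).
  rewrite node_succ mulr1z mul1r nd; apply=> //; apply: init_node; move: J0; clear; lia.
rewrite ltxx; have := fin (node l J J%:Z) (node l J (J%:Z - 1)).
have -> : node l J (J%:Z - 1) - node l J J%:Z = - d by rewrite node_succ; rewrite mulrN1z mulN1r.
rewrite normrN nd invrN mulrN -mulNr opprB; apply=> //; apply: init_node; move: J0; clear; lia.
Qed.

Lemma init_lap (j : int) : 0 < j < J%:Z ->
  `|lap v j / d ^+ 2 - w0 (node l J j)| <= 2 * K * d `^ al.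
Proof.
move=> jJ.
have hj := init_node (j := j) ltac:(move: jJ; clear; lia).
have hp := init_node (j := j + 1) ltac:(move: jJ; clear; lia).
have hm := init_node (j := j - 1) ltac:(move: jJ; clear; lia).
have tp := datum_taylor2 hj hp; have tm := datum_taylor2 hj hm.
have nd : `|d| = d by rewrite gtr0_norm.
rewrite node_succ mulr1z mul1r -/d nd in tp.
rewrite (_ : node l J (j - 1) - node l J j = - d) in tm; last by rewrite node_succ mulrN1z mulN1r.
rewrite sqrrN normrN nd in tm.
have -> : lap v j / d ^+ 2 - w0 (node l J j) = ((u0 (node l J (j + 1)) - u0 (node l J j) - d * p0 (node l J j) - d ^+ 2 / 2 * w0 (node l J j)) +
  (u0 (node l J (j - 1)) - u0 (node l J j) - - d * p0 (node l J j) - d ^+ 2 / 2 * w0 (node l J j))) / d ^+ 2.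
  by rewrite /lap /v/=; field; rewrite gt_eqF.
have d2 : 0 < d ^+ 2 by rewrite exprn_gt0.
rewrite normrM normfV (gtr0_norm d2) ler_pdivrMr//.
apply: (le_trans (ler_normD _ _)).
have -> : 2 * K * d `^ al * d ^+ 2 = K * (d ^+ 2 * d `^ al) + K * (d ^+ 2 * d `^ al) by ring.
exact: lerD.
Qed.

(** Consistency at the initial time. At an end, compatibility says that the quotient of ph - f by a,
    taken at the exact slope, equals w0; the discrete slope differs from the exact one by order d,
    and the Lipschitz bounds compare the two quotients. *)
Lemma init_G (j : int) : 0 <= j <= J%:Z ->
  `|sG l J lam t0 a f ph 0 v j - w0 (node l J j)| <= datum_const kap0 Lam * d `^ al.
Proof.
move=> jJ; have K0 := datum_K_ge0; have L0 := pr_Lam P.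
have /andP[k0 _] := pr_kap P.
have dal : d <= d `^ al by apply: ger1_powR; rewrite ?d0// ltW//; case/andP: al01.
have E0 : 0 <= Lam * K * (2 + K) / kap0 by rewrite divr_ge0 ?(ltW k0)// !mulr_ge0// addr_ge0.
rewrite /sG; case: ifP => h.
  apply: (le_trans (init_lap h)); rewrite ler_wpM2r ?powR_ge0//.
  by rewrite /datum_const lerDl.
have je : j = 0 \/ j = J%:Z by move: h jJ; clear; lia.
have hs := init_slope_end je.
pose s : R := if j == 0 then -1 else 1.
have s1 : s = 1 \/ s = -1 by rewrite /s; case: ifP; [right|left].
have ns : node l J j = s * l.
  rewrite /s /node; case: je => ->; first by rewrite eqxx mul0r addr0 mulN1r.
  have -> : (J%:Z == 0) = false by move: J0; clear; lia.
  by rewrite /mesh pmulrn mulrC divfK ?pnatr_eq0 -?lt0n//; ring.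
have hc := compat s1; rewrite -ns in hc.
have hn := init_node jJ; have [b1 b2 b3] := dt_bd D hn.
have b4 := init_slope jJ.
have cl : clock l J lam t0 0 = t0 by rewrite /clock mul0r addr0.
have vj : v j = u0 (node l J j) by [].
have al20 : al / 2 != 0 by rewrite gt_eqF// divr_gt0.
have aln0 : al != 0 by rewrite gt_eqF.
have hb1 := le_trans b1 KRb; have hb2 := le_trans b2 KRb; have hb4 := le_trans b4 KRb.
have hA := pr_a P t0T t0T hn hn hb1 hb1 hb4 hb2.
have hF := pr_f P t0T t0T hn hn hb1 hb1 hb4 hb2.
have hP := pr_ph P s1 t0T t0T hb1 hb1 hb4 hb2.
rewrite !subrr normr0 !powR0// !add0r in hA hF hP.
have /andP[a0 _] := pr_pos P t0T hn hb1 hb4.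
rewrite /sP /sF /sA cl vj -/s -/d.
move: hA hF hP a0 hc b3; set A := a _ _ _ (slope _ _ _ _); set A' := a _ _ _ _.
set F := f _ _ _ (slope _ _ _ _); set F' := f _ _ _ _; set Q := ph _ _ _ (slope _ _ _ _); set Q' := ph _ _ _ _.
set w := w0 _ => hA hF hP a0 hc b3.
have A0 : 0 < A := lt_le_trans k0 a0.
have -> : (Q - F) / A - w = ((Q - Q') - (F - F') - (A - A') * w) / A.
  by rewrite hc; field; rewrite gt_eqF.
rewrite normrM normfV (gtr0_norm A0) ler_pdivrMr//.
have LKd : Lam * (K * d) <= Lam * (K * d `^ al) by rewrite !ler_wpM2l.
have up : forall x, x <= Lam * `|slope d J v j - p0 (node l J j)| -> x <= Lam * (K * d `^ al).
  by move=> x hx; apply: (le_trans hx); apply: le_trans LKd; rewrite ler_wpM2l.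
have {}hA := up _ hA; have {}hF := up _ hF; have {}hP := up _ hP.
apply: (@le_trans _ _ (Lam * (K * d `^ al) * (2 + K))).
  have -> : Lam * (K * d `^ al) * (2 + K) = Lam * (K * d `^ al) + Lam * (K * d `^ al) + Lam * (K * d `^ al) * K by ring.
  apply: (le_trans (ler_normB _ _)); rewrite lerD//; last by rewrite normrM ler_pM.
  by apply: (le_trans (ler_normB _ _)); rewrite lerD.
apply: (@le_trans _ _ (Lam * K * (2 + K) / kap0 * d `^ al * kap0)).
  have -> : Lam * K * (2 + K) / kap0 * d `^ al * kap0 = Lam * (K * d `^ al) * (2 + K).
    by field; rewrite gt_eqF.
  exact: lexx.
apply: ler_pM => //; first by rewrite mulr_ge0 ?powR_ge0.
  exact: ltW.
by rewrite ler_wpM2r ?powR_ge0// /datum_const lerDr mulr_ge0.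
Qed.

Lemma datum_const_ge0 : 0 <= datum_const kap0 Lam.
Proof.
have K0 := datum_K_ge0; have L0 := pr_Lam P; have /andP[k0 _] := pr_kap P.
by apply: addr_ge0; [exact: mulr_ge0|rewrite divr_ge0 ?(ltW k0)// !mulr_ge0// addr_ge0].
Qed.

(** An increment over m >= 1 cells absorbs the consistency error, since d^al <= (m d)^al. *)
Theorem datum_initial_bounds : initial_bounds al l lam t0 K (2 * datum_const kap0 Lam + K) a f ph u0 J.
Proof.
have E0 := datum_const_ge0; have K0 := datum_K_ge0.
have d1al : d `^ al <= 1.
  have := @ge0_ler_powR R al (ltW al0) d 1; rewrite powR1; apply; rewrite ?nnegrE ?ler01//; exact: ltW.
split.
- by move=> j jJ; case: (dt_bd D (init_node jJ)).
- by move=> j jJ; exact: init_slope.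
- move=> j jJ; have [_ _ b] := dt_bd D (init_node jJ); have h := init_G jJ.
  apply: (norm_incr b h); rewrite addrC lerD2r.
  by apply: (@le_trans _ _ (datum_const kap0 Lam * 1)); [rewrite ler_wpM2l|rewrite mulr1 ler_peMl// ler1n].
- move=> i m i0 im.
  have h1 : 0 <= i <= J%:Z by move: i0 im; clear; lia.
  have h2 : 0 <= i + m%:Z <= J%:Z by move: i0 im; clear; lia.
  case: (posnP m) => [m0|m0].
    by rewrite m0 addr0 subrr normr0 mulr_ge0 ?powR_ge0// addr_ge0// mulr_ge0.
  have g1 := init_G h1; have g2 := init_G h2.
  have hw := dt_w D (init_node h2) (init_node h1).
  rewrite node_succ normrM (gtr0_norm d0) ger0_norm ?ler0n// in hw.
  have dm : d `^ al <= (m%:R * d) `^ al.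
    have md : 0 <= m%:R * d := mulr_ge0 (ler0n R m) (ltW d0).
    apply: ge0_ler_powR; rewrite ?nnegrE ?(ltW al0) ?(ltW d0)//.
    by apply: ler_peMl; [exact: ltW|rewrite ler1n].
  have {}g1 := le_trans g1 (ler_wpM2l E0 dm); have {}g2 := le_trans g2 (ler_wpM2l E0 dm).
  rewrite -/(sv l J lam t0 a f ph u0 0) -/v; move: g1 g2 hw; rewrite -/d.
  move: (sG _ _ _ _ _ _ _ _ _ i) (sG _ _ _ _ _ _ _ _ _ (i + m%:Z)) (w0 _) (w0 _) ((m%:R * d) `^ al) => x y wy wx Y.
  move=> g1 g2 hw.
  have -> : y - x = (y - wy) - (x - wx) + (wy - wx) by ring.
  apply: (le_trans (ler_normD _ _)); rewrite [leRHS]mulrDl lerD//.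
  apply: (le_trans (ler_normB _ _)).
  by rewrite mulrDl mul1r [leRHS]mulrDl lerD.
Qed.

End Initial.

End Data.

Section Existence.
Context {R : realType}.

Lemma mesh_small (l e : R) : 0 < l -> 0 < e -> exists J0, forall J, (J0 < J)%N -> mesh l J <= e.
Proof.
move=> l0 e0; exists (Num.truncn (2 * l / e)) => J hJ.
have J0 : (0 < J)%N by exact: leq_ltn_trans hJ.
rewrite /mesh ler_pdivrMr ?ltr0n// -ler_pdivrMl// mulrC.
have /andP[_ h] := truncn_itv (divr_ge0 (mulr_ge0 (ler0n R 2) (ltW l0)) (ltW e0)).
by apply: (le_trans (ltW h)); rewrite ler_nat.
Qed.

Theorem local_existence (al l T K kap0 kap1 Lam t0 : R) (a f ph : R -> R -> R -> R -> R)
    (u0 p0 w0 : R -> R) :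
  problem al l T (K + 1) kap0 kap1 Lam a f ph -> 0 <= t0 < T ->
  datum al l K u0 p0 w0 -> compatible l t0 a f ph u0 p0 w0 ->
  exists de C u p w z, [/\ 0 < de, t0 + de <= T, regular al l t0 (t0 + de) C u p w z &
    solves l t0 (t0 + de) a f ph u0 u p w z].
Proof.
move=> P t0T D cmp; have al01 := pr_al P; have l0 := pr_l P.
have K0 := datum_K_ge0 D l0; have /andP[k0 k01] := pr_kap P.
have k10 : 0 < kap1 := lt_le_trans k0 k01.
(* The largest ratio of steps allowed by 3 lam kap1 <= 1. *)
pose lam := (3 * kap1)^-1.
have lam0 : 0 < lam by rewrite invr_gt0 mulr_gt0.
have cfl : 3 * lam * kap1 <= 1.
  by rewrite /lam (_ : 3 * _ * kap1 = 1)//; field; rewrite gt_eqF.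
pose M0 := 2 * datum_const K kap0 Lam + K.
have M00 : 0 <= M0 by rewrite addr_ge0// mulr_ge0// (datum_const_ge0 D l0 P).
have K1 : 1 <= K + 1 by rewrite lerDr.
have [de [d2 [C [de0 d20 deT H]]]] := nonlinear_estimate P t0T lam0 cfl M00 K1.
have [J0 HJ0] := mesh_small l0 d20; have [J1 HJ1] := mesh_small l0 (ltr01 : 0 < 1 :> R).
have KK : K <= K + 1 by rewrite lerDl.
have t0T' : 0 <= t0 <= T by case/andP: t0T => -> /ltW.
pose X := Num.max C 0; pose B := Num.max (M0 + 2) X.
suff [u [p [w [z [h1 h2]]]]] : exists u p w z, regular al l t0 (t0 + de) (K + 1 + 2 * B + (kap1 * B + Lam) + 2 * X +
    2 * (kap1 * X + nonlinear_const l (K + 1) kap1 Lam lam B * (B + 1))) u p w z /\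
    solves l t0 (t0 + de) a f ph u0 u p w z.
  by exists de; eexists; exists u, p, w, z; split; [exact: de0|exact: deT|exact: h1|exact: h2].
apply: (@scheme_limit R al l T (K + 1) kap0 kap1 Lam lam t0 de B X a f ph u0 (maxn J0 J1) P lam0 (ltW de0)); last first.
- by rewrite le_max lexx orbT.
- move=> x y hx hy; apply: (le_trans (datum_lip D l0 hx hy)).
  by rewrite ler_wpM2r.
- move=> J N; rewrite gtn_max => /andP[hJ0 hJ1] hN G.
  have J00 : (0 < J)%N by exact: leq_ltn_trans hJ0.
  have I := datum_initial_bounds D al01 l0 lam P KK t0T' cmp J00 (HJ1 J hJ1).
  have := H u0 J N J00 (HJ0 J hJ0) hN; rewrite addrK => /(_ I)[S [GB GX] GT].
  have MB : M0 + 2 <= B by rewrite le_max lexx.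
  have CX : C <= X by rewrite le_max lexx.
  have S' : scheme_bounds l J lam t0 T (K + 1) B a f ph u0 N.
    case: S => *; split => // n j nN jJ; apply: le_trans MB; auto.
  split => //.
  + split=> [n j nN jJ|n i m nN i0 im]; first by apply: (le_trans (GB n j nN jJ)); rewrite !le_max lexx !orbT.
    by apply: (le_trans (GX n i m nN i0 im)); rewrite ler_wpM2r ?powR_ge0.
  + by move=> n k j nk jJ; apply: (le_trans (GT n k j nk jJ)); rewrite ler_wpM2r ?powR_ge0.
Qed.

Definition linear_problem (a f ph : R -> R -> R -> R -> R) : Prop :=
  [/\ forall t x z p, a t x z p = a t x 0 0, forall t x z p, f t x z p = f t x 0 0 &
      forall s t z p, ph s t z p = ph s t 0 0].

(** Since delta precedes K, the length of existence is the same for every datum; only the constant C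
    depends on K. *)
Theorem linear_existence (al l kap0 kap1 Lam : R) :
  0 < al < 1 -> 0 < l -> 0 < kap0 <= kap1 -> 0 <= Lam ->
  exists2 delta : R, 0 < delta & forall K, exists C, forall (T t0 de : R) (a f ph : R -> R -> R -> R -> R)
    (u0 p0 w0 : R -> R),
  (forall Rb, problem al l T Rb kap0 kap1 Lam a f ph) -> linear_problem a f ph ->
  0 <= t0 -> 0 <= de <= delta -> t0 + de <= T ->
  datum al l K u0 p0 w0 -> compatible l t0 a f ph u0 p0 w0 ->
  exists u p w z, regular al l t0 (t0 + de) C u p w z /\
    solves l t0 (t0 + de) a f ph u0 u p w z.
Proof.
move=> al01 l0 kk L0; have /andP[k0 k01] := kk.
have k10 : 0 < kap1 := lt_le_trans k0 k01.
pose lam := (3 * kap1)^-1.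
have lam0 : 0 < lam by rewrite invr_gt0 mulr_gt0.
have cfl : 3 * lam * kap1 <= 1.
  by rewrite /lam (_ : 3 * _ * kap1 = 1)//; field; rewrite gt_eqF.
have [delta [d2 [C [de0 d20 C0 H]]]] := linear_estimate al01 l0 kk L0 lam0 cfl.
exists delta => // K.
pose M0 := 2 * datum_const K kap0 Lam + K.
pose B := C * (M0 + 1); pose Rb := K + B.
exists (Rb + 2 * B + (kap1 * B + Lam) + 2 * B +
    2 * (kap1 * B + nonlinear_const l Rb kap1 Lam lam B * (B + 1))).
move=> T t0 de a f ph u0 p0 w0 P lin t00 /andP[de00 dede] deT D cmp.
have K0 := datum_K_ge0 D l0.
have M00 : 0 <= M0 by rewrite addr_ge0// mulr_ge0// (datum_const_ge0 D l0 (P 0)).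
have B0 : 0 <= B by rewrite mulr_ge0// addr_ge0.
have [J0 HJ0] := mesh_small l0 d20; have [J1 HJ1] := mesh_small l0 (ltr01 : 0 < 1 :> R).
have t0T' : 0 <= t0 <= T by rewrite t00 (le_trans _ deT)// lerDl.
apply: (@scheme_limit R al l T Rb kap0 kap1 Lam lam t0 de B B a f ph u0 (maxn J0 J1) (P Rb) lam0 de00) => //.
- move=> J N; rewrite gtn_max => /andP[hJ0 hJ1] hN.
  have J00 : (0 < J)%N by exact: leq_ltn_trans hJ0.
  have I := datum_initial_bounds D al01 l0 lam (P K) (lexx K) t0T' cmp J00 (HJ1 J hJ1).
  apply: (H T t0 M0 K a f ph u0 J N P lin t00 M00 J00 (HJ0 J hJ0) (le_trans hN dede) _ I).
  by apply: le_trans deT; rewrite lerD2l.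
- move=> x y hx hy; apply: (le_trans (datum_lip D l0 hx hy)).
  by rewrite ler_wpM2r// lerDl.
Qed.

Lemma regular_datum (al l t0 t1 C : R) (u p w z : R -> R -> R) t : 0 < al < 1 -> 0 <= C ->
  regular al l t0 t1 C u p w z -> t0 <= t <= t1 -> datum al l C (u t) (p t) (w t).
Proof.
move=> /andP[al0 al1] C0 H ht; split.
- by move=> x hx; have [] := rg_bd H ht hx.
- move=> x y hx hy; have := rg_w H ht ht hx hy.
  by rewrite subrr normr0 powR0 ?add0r// gt_eqF// divr_gt0.
- by move=> x y hx hy; exact: (rg_px H).
- by move=> x y hx hy; rewrite powRr1// -expr2; exact: (rg_ux H).
Qed.

End Existence.

(** * Uniqueness and gluing *)

Section MaximumPrinciple.
Context {R : realType}.

Lemma small_le0 (be x K h0 : R) : 0 < be -> 0 < h0 -> 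
  (forall h, 0 < h <= h0 -> x <= K * h `^ be) -> x <= 0.
Proof.
move=> be0 h00 H; rewrite leNgt; apply/negP => x0.
have e0 : 0 < x / (2 * (`|K| + 1)) by rewrite divr_gt0// mulr_gt0// ltr_wpDl.
have [r r0 Hr] := powR_small be0 e0.
have m0 : 0 < Num.min r h0 by rewrite lt_min r0.
have := H (Num.min r h0); rewrite m0 ge_min lexx orbT => /(_ isT).
have := Hr (Num.min r h0); rewrite (ltW m0) ge_min lexx => /(_ isT).
set y := _ `^ be => h1 h2; have y0 : 0 <= y by exact: powR_ge0.
have h3 : K * y <= (`|K| + 1) * y.
  by rewrite ler_wpM2r// (le_trans (ler_norm K))// lerDl.
have h4 : (`|K| + 1) * y <= x / 2.
  apply: (@le_trans _ _ ((`|K| + 1) * (x / (2 * (`|K| + 1))))).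
    by rewrite ler_wpM2l// addr_ge0.
  suff -> : (`|K| + 1) * (x / (2 * (`|K| + 1))) = x / 2 by [].
  by field; rewrite gt_eqF// ltr_wpDl.
by move: h2 h3 h4 x0; clear; lra.
Qed.

Lemma shift_left (l x h : R) : - l < x <= l -> 0 < h <= x + l -> - l <= x - h <= l.
Proof. by move=> /andP[? ?] /andP[? ?]; apply/andP; split; lra. Qed.

Lemma shift_right (l x h : R) : - l <= x < l -> 0 < h <= l - x -> - l <= x + h <= l.
Proof. by move=> /andP[? ?] /andP[? ?]; apply/andP; split; lra. Qed.

Lemma drop_arith (u v q K : R) : u <= v -> `|u - v - q| <= K -> q <= K.
Proof. by move=> h; rewrite ler_norml => /andP[h1 _]; lra. Qed.

(** The computation at a weighted maximum: E is the value of e there, D the value a time h earlier,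
    X the quotient of the weights, and T the time derivative. The result is obtained on division by
    h. *)
Lemma weight_arith (c L C E D T X h y : R) : 0 <= c -> 0 <= L -> 0 <= C -> 0 <= E ->
  0 < h <= 1 -> h <= y -> 1 + c * h <= X -> X * D <= E -> T <= L * E ->
  - (C * (h * y)) <= D - E - - h * T -> c * E - L * E <= (L * E * c + C * (1 + c)) * y.
Proof.
move=> c0 L0 C0 E0 /andP[h0 h1] hy X1 XD TL HD.
have y0 : 0 <= y by exact: le_trans (ltW h0) hy.
have ch : 0 <= c * h by rewrite mulr_ge0// ltW.
have XD' : (1 + c * h) * D <= E.
  case: (leP 0 D) => D0; first by apply: le_trans XD; rewrite ler_wpM2r.
  by apply: le_trans E0; rewrite mulr_ge0_le0 ?ltW ?ltr_wpDr.
have hT : h * T <= h * (L * E) by rewrite ler_wpM2l// ltW.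
have D1 : E - h * (L * E) - C * (h * y) <= D by move: HD hT; clear; lra.
have D2 := ler_wpM2l (addr_ge0 ler01 ch) D1.
have k1 : L * E * c * h <= L * E * c * y by rewrite ler_wpM2l ?mulr_ge0.
have k2 : C * y * (c * h) <= C * y * c.
  by rewrite ler_wpM2l ?mulr_ge0// ler_piMr.
rewrite -(ler_pM2l h0).
have k3 := ler_wpM2l (ltW h0) (lerD k1 k2).
by move: (le_trans D2 XD') k3; clear; lra.
Qed.

Variables (al be l t0 t1 C L : R) (e ex exx et : R -> R -> R).
Hypothesis al0 : 0 < al.
Hypothesis be0 : 0 < be.
Hypothesis be1 : be <= 1.
Hypothesis l0 : 0 < l.
Hypothesis t01 : t0 <= t1.
Hypothesis C0 : 0 <= C.
Hypothesis L0 : 0 <= L.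

Definition in_rect (t x : R) := (t0 <= t <= t1) && (- l <= x <= l).

Hypothesis e_lip : forall t s x y, in_rect t x -> in_rect s y ->
  `|e t x - e s y| <= C * (`|t - s| + `|x - y|).
Hypothesis e_x : forall t x y, in_rect t x -> in_rect t y ->
  `|e t y - e t x - (y - x) * ex t x| <= C * `|y - x| ^+ 2.
Hypothesis e_xx : forall t x y, in_rect t x -> in_rect t y ->
  `|e t y - e t x - (y - x) * ex t x - (y - x) ^+ 2 / 2 * exx t x| <=
     C * (`|y - x| ^+ 2 * `|y - x| `^ al).
Hypothesis e_t : forall t s x, in_rect t x -> in_rect s x ->
  `|e s x - e t x - (s - t) * et t x| <= C * (`|s - t| * `|s - t| `^ be).

(** The condition - l < x leaves room for a comparison with points to the left; at an end of the
    interval only one of the two sign conditions is available. *)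
Lemma spatial_max_left t x : in_rect t x -> (forall y, - l <= y <= l -> e t y <= e t x) ->
  - l < x -> 0 <= ex t x.
Proof.
move=> hx Hm lx; have hx' := hx; case/andP: hx' => ht /andP[x1 x2].
rewrite -oppr_le0; apply: (@small_le0 1 _ C (x + l)) => //.
  by rewrite -(opprK l) subr_gt0.
move=> h /andP[h0 hl]; rewrite (powRr1 (ltW h0)).
have hy : - l <= x - h <= l by apply: shift_left; rewrite ?lx ?h0.
have := e_x hx (y := x - h); rewrite /in_rect ht hy => /(_ isT).
have := Hm _ hy.
rewrite (_ : x - h - x = - h); last by ring.
rewrite normrN (gtr0_norm h0) expr2 => h1 h2.
rewrite -(ler_pM2r h0) -[leRHS]mulrA mulNr mulrC -mulNr.
exact: drop_arith h1 h2.
Qed.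

Lemma spatial_max_right t x : in_rect t x -> (forall y, - l <= y <= l -> e t y <= e t x) ->
  x < l -> ex t x <= 0.
Proof.
move=> hx Hm xl; have hx' := hx; case/andP: hx' => ht /andP[x1 x2].
apply: (@small_le0 1 _ C (l - x)) => //; first by rewrite subr_gt0.
move=> h /andP[h0 hl]; rewrite (powRr1 (ltW h0)).
have hy : - l <= x + h <= l by apply: shift_right; rewrite ?xl ?h0 ?x1.
have := e_x hx (y := x + h); rewrite /in_rect ht hy => /(_ isT).
have := Hm _ hy.
rewrite (_ : x + h - x = h); last by ring.
rewrite (gtr0_norm h0) expr2 => h1 h2.
rewrite -(ler_pM2r h0) -[leRHS]mulrA mulrC.
exact: drop_arith h1 h2.
Qed.

Lemma spatial_max_interior t x : in_rect t x -> (forall y, - l <= y <= l -> e t y <= e t x) ->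
  - l < x < l -> exx t x <= 0.
Proof.
move=> hx Hm /andP[lx xl]; have hx' := hx; case/andP: hx' => ht /andP[x1 x2].
have ex0 : ex t x = 0.
  by apply/eqP; rewrite eq_le spatial_max_left// spatial_max_right.
apply: (@small_le0 al _ (2 * C) (l - x)) => //; first by rewrite subr_gt0.
move=> h /andP[h0 hl].
have hy : - l <= x + h <= l by apply: shift_right; rewrite ?xl ?h0 ?x1.
have := e_xx hx (y := x + h); rewrite /in_rect ht hy => /(_ isT).
have := Hm _ hy.
rewrite (_ : x + h - x = h); last by ring.
rewrite ex0 mulr0 subr0 (gtr0_norm h0) => h1 /(drop_arith h1) h2.
have h20 : 0 < h ^+ 2 by rewrite exprn_gt0.
rewrite -(ler_pM2r h20).
have -> : 2 * C * h `^ al * h ^+ 2 = 2 * (C * (h ^+ 2 * h `^ al)) by ring.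
have -> : exx t x * h ^+ 2 = 2 * (h ^+ 2 / 2 * exx t x) by field.
by rewrite ler_wpM2l.
Qed.

Hypothesis e_init : forall x, - l <= x <= l -> e t0 x <= 0.
Hypothesis e_ineq : forall t x, in_rect t x -> 0 < e t x ->
  (x < l -> ex t x <= 0) -> (- l < x -> 0 <= ex t x) -> (- l < x < l -> exx t x <= 0) ->
  et t x <= L * e t x.

Let c := L + 1.
Let rect : set (R * R) := `[t0, t1]%classic `*` `[- l, l]%classic.
Let g (q : R * R) := e q.1 q.2 * expR (- c * (q.1 - t0)).

Lemma rectE t x : rect (t, x) <-> in_rect t x.
Proof. by rewrite /rect/= /in_rect !in_itv/=; split => [[-> ->]//|/andP[]]. Qed.

Lemma weighted_continuous : {within rect, continuous g}.
Proof.
apply/subspace_continuousP => -[t x] /rectE htx.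
have c1 : (fun q : R * R => q.1) @ within rect (nbhs (t, x)) --> t.
  by apply: cvg_trans (cvg_fst (F := nbhs t) (G := nbhs x)); apply: cvg_app; exact: cvg_within.
have c2 : (fun q : R * R => q.2) @ within rect (nbhs (t, x)) --> x.
  by apply: cvg_trans (cvg_snd (F := nbhs t) (G := nbhs x)); apply: cvg_app; exact: cvg_within.
apply: cvgM; last first.
  apply: continuous_cvg; first exact: continuous_expR.
  by apply: cvgM; [exact: cvg_cst|apply: cvgB => //; exact: cvg_cst].
have E : (fun q : R * R => C * (`|q.1 - t| + `|q.2 - x|)) @ within rect (nbhs (t, x)) --> C * (`|t - t| + `|x - x|).
  apply: cvgM; first exact: cvg_cst.
  by apply: cvgD; apply: cvg_norm; apply: cvgB => //; exact: cvg_cst.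
rewrite !subrr normr0 addr0 mulr0 in E; set k := (fun q => _) in E.
have l1 : (fun q => e t x - k q) @ within rect (nbhs (t, x)) --> e t x - 0.
  by apply: cvgB => //; exact: cvg_cst.
have l2 : (fun q => e t x + k q) @ within rect (nbhs (t, x)) --> e t x + 0.
  by apply: cvgD => //; exact: cvg_cst.
rewrite subr0 in l1; rewrite addr0 in l2.
apply: (squeeze_cvgr _ l1 l2); rewrite near_withinE; apply: nearW => -[s y] /rectE hsy /=.
by rewrite -ler_distl; exact: e_lip.
Qed.

(** If e were positive somewhere, e exp(- c (t - t0)) with c = L + 1 would attain a positive
    maximum, and the time derivative of e there would be at least c e > L e. The hypothesis [e_ineq]
    refers only to points with the first and second order conditions of a spatial maximum, which
    treats inner points and ends alike. *)
Theorem max_principle t x : in_rect t x -> e t x <= 0.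
Proof.
move=> htx; rewrite leNgt; apply/negP => epos.
have rect0 : rect !=set0 by exists (t, x); apply/rectE.
have rectc : compact rect by apply: compact_setX; exact: segment_compact.
have [[s y]] := compact_EVT_max rect0 rectc weighted_continuous.
rewrite inE => /rectE hsy gmax.
have c0 : 0 < c by rewrite /c ltr_wpDl.
have gm s' y' : in_rect s' y' -> g (s', y') <= g (s, y).
  by move=> h; apply: gmax; rewrite inE; apply/rectE.
have E0 r : 0 < expR (- c * (r - t0)) by exact: expR_gt0.
have esy : 0 < e s y.
  rewrite -(pmulr_lgt0 _ (E0 s)); apply: lt_le_trans (gm _ _ htx).
  by rewrite mulr_gt0// E0.
have hsy' := hsy; case/andP: hsy' => hs hy.
have sm y' : - l <= y' <= l -> e s y' <= e s y.
  move=> hy'; have := gm s y'; rewrite /in_rect hs hy' => /(_ isT).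
  by rewrite /g/= (ler_pM2r (E0 s)).
have ts : t0 < s.
  have /andP[h1 _] := hs; rewrite lt_neqAle h1 andbT; apply/negP => /eqP t0s.
  by have := e_init hy; rewrite t0s leNgt esy.
have het := e_ineq hsy esy (spatial_max_right hsy sm) (spatial_max_left hsy sm) (spatial_max_interior hsy sm).
have : c * e s y - L * e s y <= 0.
  apply: (@small_le0 be _ (L * e s y * c + C * (1 + c)) (Num.min 1 (s - t0))) => //.
    by rewrite lt_min ltr01 subr_gt0.
  move=> h /andP[h0]; rewrite le_min => /andP[h1 hst].
  have hs' : t0 <= s - h <= t1.
    have /andP[_ st1] := hs; rewrite lerBrDr addrC -lerBrDr hst/=.
    by rewrite (le_trans _ st1)// gerBl ltW.
  have hin : in_rect (s - h) y by rewrite /in_rect hs'.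
  have := gm _ _ hin; rewrite /g/=.
  have -> : - c * (s - h - t0) = - c * (s - t0) + c * h by ring.
  rewrite expRD mulrCA [leRHS]mulrC (ler_pM2l (E0 s)) mulrC => hg.
  have := e_t hsy hin; rewrite (_ : s - h - s = - h); last by ring.
  rewrite normrN (gtr0_norm h0) ler_norml => /andP[hT _].
  apply: (weight_arith (ltW c0) L0 C0 (ltW esy) _ _ (expR_ge1Dx (c * h)) hg het hT).
    by rewrite h0.
  by apply: ger1_powR; rewrite ?h0.
by rewrite leNgt /c mulrDl mul1r addrAC subrr add0r esy.
Qed.

End MaximumPrinciple.

Section Uniqueness.
Context {R : realType}.

Lemma regular_lipschitz (al l t0 t1 C : R) (u p w z : R -> R -> R) : 0 < al < 1 -> 0 < l -> 0 <= C ->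
  regular al l t0 t1 C u p w z ->
  forall t s x y, t0 <= t <= t1 -> t0 <= s <= t1 -> - l <= x <= l -> - l <= y <= l ->
  `|u t x - u s y| <= C * (2 + (t1 - t0) `^ (al / 2)) * (`|t - s| + `|x - y|).
Proof.
move=> al01 l0 C0 H t s x y ht hs hx hy; have /andP[al0 _] := al01.
have -> : u t x - u s y = (u t x - u s x) + (u s x - u s y) by ring.
have h1 := datum_lip (regular_datum al01 C0 H hs) l0 hx hy.
have h2 := rg_ut H hs ht hx; have [_ _ _ hz] := rg_bd H hs hx.
have T0 : 0 <= t1 - t0 by rewrite subr_ge0; case/andP: ht => /le_trans h /h.
have h3 : `|t - s| `^ (al / 2) <= (t1 - t0) `^ (al / 2).
  rewrite ge0_ler_powR ?nnegrE// ?divr_ge0 ?(ltW al0)//.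
  by move: ht hs => /andP[? ?] /andP[? ?]; rewrite ler_norml; apply/andP; split; lra.
have h4 : `|u t x - u s x| <= C * (1 + (t1 - t0) `^ (al / 2)) * `|t - s|.
  rewrite -(subrK ((t - s) * z s x) (u t x - u s x)).
  apply: (le_trans (ler_normD _ _)).
  have -> : C * (1 + (t1 - t0) `^ (al / 2)) * `|t - s| =
    C * (`|t - s| * (t1 - t0) `^ (al / 2)) + `|t - s| * C by ring.
  rewrite lerD//; first by apply: (le_trans h2); rewrite ler_wpM2l// ler_wpM2l.
  by rewrite normrM ler_wpM2l.
apply: (le_trans (ler_normD _ _)).
set Y := (t1 - t0) `^ _ in h4 *; have Y0 : 0 <= Y by exact: powR_ge0.
have e1 : 0 <= C * (1 + Y) * `|x - y| by rewrite !mulr_ge0// addr_ge0.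
have e2 : 0 <= C * `|t - s| by rewrite mulr_ge0.
by move: (lerD h4 h1) e1 e2; clear; lra.
Qed.

(** A larger outward slope lowers the prescribed velocity, the sign that fits the maximum principle
    at the ends. *)
Definition monotone_end (T Rb : R) (ph : R -> R -> R -> R -> R) : Prop :=
  forall s t z p p', s = 1 \/ s = -1 -> 0 <= t <= T -> `|z| <= Rb -> `|p| <= Rb -> `|p'| <= Rb ->
  p <= p' -> s * ph s t z p' <= s * ph s t z p.

Section Compare.
Variables (al l T Rb kap0 kap1 Lam t0 t1 C : R) (a f ph : R -> R -> R -> R -> R).
Variables (u1 p1 w1 z1 u2 p2 w2 z2 : R -> R -> R) (v1 v2 : R -> R).
Hypothesis P : problem al l T Rb kap0 kap1 Lam a f ph.
Hypothesis mono : monotone_end T Rb ph.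
Hypothesis t00 : 0 <= t0.
Hypothesis t1T : t1 <= T.
Hypothesis C0 : 0 <= C.
Hypothesis CRb : C <= Rb.
Hypothesis R1 : regular al l t0 t1 C u1 p1 w1 z1.
Hypothesis R2 : regular al l t0 t1 C u2 p2 w2 z2.
Hypothesis S1 : solves l t0 t1 a f ph v1 u1 p1 w1 z1.
Hypothesis S2 : solves l t0 t1 a f ph v2 u2 p2 w2 z2.
Hypothesis v12 : forall x, - l <= x <= l -> v1 x <= v2 x.

Lemma split_norm (a1 a2 b1 b2 c1 c2 y K : R) : `|a1 - b1 - c1| <= K * y -> `|a2 - b2 - c2| <= K * y ->
  `|(a1 - a2) - (b1 - b2) - (c1 - c2)| <= 2 * K * y.
Proof.
move=> h1 h2; have -> : (a1 - a2) - (b1 - b2) - (c1 - c2) = (a1 - b1 - c1) - (a2 - b2 - c2) by ring.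
apply: (le_trans (ler_normB _ _)); have -> : 2 * K * y = K * y + K * y by ring.
exact: lerD.
Qed.

(** The maximum principle for u1 - u2. At an inner maximum the slopes agree and the second
    derivatives are ordered; the differences of a and f are controlled by their Lipschitz bounds and
    the bound on w2. At an end the outward slope of u1 is at least that of u2, and the monotonicity
    of ph applies. *)
Lemma compare_solutions t x : t0 <= t <= t1 -> - l <= x <= l -> u1 t x <= u2 t x.
Proof.
move=> ht hx; have al01 := pr_al P; have /andP[al0 al1] := al01; have l0 := pr_l P.
have t01 : t0 <= t1 by case/andP: ht => /le_trans h /h.
have L0 := pr_Lam P.
pose K := C * (2 + (t1 - t0) `^ (al / 2)).
have CK : 2 * C <= K by rewrite mulrC ler_wpM2l// lerDl powR_ge0.
have K0 : 0 <= K by apply: le_trans CK; rewrite mulr_ge0.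
have K2 : K <= 2 * K by rewrite ler_peMl// ler1n.
have CK2 : 2 * C <= 2 * K := le_trans CK K2.
have al20 : 0 < al / 2 by rewrite divr_gt0.
have al21 : al / 2 <= 1 by case/andP: (half01 al01).
have up (x1 y : R) : 0 <= y -> x1 <= 2 * C * y -> x1 <= 2 * K * y.
  by move=> y0 h; apply: (le_trans h); rewrite ler_wpM2r.
suff : (fun t x => u1 t x - u2 t x) t x <= 0 by rewrite subr_le0.
apply: (@max_principle R al (al / 2) l t0 t1 (2 * K) (Lam * (C + 1))
  (fun t x => u1 t x - u2 t x) (fun t x => p1 t x - p2 t x)
  (fun t x => w1 t x - w2 t x) (fun t x => z1 t x - z2 t x)) => //.
- by rewrite mulr_ge0.
- by rewrite mulr_ge0// addr_ge0.
- move=> t' s' x' y' /andP[h1 h2] /andP[h3 h4].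
  have e1 := regular_lipschitz al01 l0 C0 R1 h1 h3 h2 h4.
  have e2 := regular_lipschitz al01 l0 C0 R2 h1 h3 h2 h4.
  rewrite -/K in e1 e2; rewrite -(subr0 (u1 t' x' - u1 s' y')) in e1; rewrite -(subr0 (u2 t' x' - u2 s' y')) in e2.
  by have := split_norm e1 e2; rewrite !subr0.
- move=> t' x' y' /andP[h1 h2] /andP[_ h4]; apply: up; first exact: sqr_ge0.
  by rewrite mulrBr; apply: split_norm; [exact: (rg_ux R1)|exact: (rg_ux R2)].
- move=> t' x' y' /andP[h1 h2] /andP[_ h4]; apply: up; first by rewrite mulr_ge0 ?sqr_ge0 ?powR_ge0.
  have e1 := datum_taylor2 (regular_datum al01 C0 R1 h1) al01 l0 h2 h4.
  have e2 := datum_taylor2 (regular_datum al01 C0 R2 h1) al01 l0 h2 h4.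
  rewrite -addrA -opprD in e1; rewrite -addrA -opprD in e2.
  have := split_norm e1 e2.
  by congr (`|_| <= _); ring.
- move=> t' s' x' /andP[h1 h2] /andP[h3 _]; apply: up; first by rewrite mulr_ge0 ?powR_ge0.
  by rewrite mulrBr; apply: split_norm; [exact: (rg_ut R1)|exact: (rg_ut R2)].
- by move=> y hy; case: S1 => _ _ ->//; case: S2 => _ _ ->//; rewrite subr_le0 v12.
- move=> t' x' /andP[h1 h2]; rewrite subr_gt0 => hu hr hl hi.
  have tT : 0 <= t' <= T.
    by have /andP[g1 g2] := h1; rewrite (le_trans t00 g1) (le_trans g2 t1T).
  have [b1 b2 b3 b4] := rg_bd R1 h1 h2; have [d1 d2 d3 d4] := rg_bd R2 h1 h2.
  have k1 := le_trans b1 CRb; have k2 := le_trans b2 CRb.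
  have k3 := le_trans d1 CRb; have k4 := le_trans d2 CRb.
  have al2n : al / 2 != 0 by rewrite gt_eqF.
  have aln : al != 0 by rewrite gt_eqF.
  have upos : 0 <= u1 t' x' - u2 t' x' by rewrite subr_ge0 ltW.
  have bnd (A : R) : A <= Lam * (u1 t' x' - u2 t' x') -> A <= Lam * (C + 1) * (u1 t' x' - u2 t' x').
    move=> hA; apply: (le_trans hA); rewrite ler_wpM2r// ler_peMr// lerDr//.
  case: (boolP (- l < x' < l)) => hin.
    have pp : p1 t' x' = p2 t' x'.
      case/andP: hin => g1 g2; have := hr g2; have := hl g1; lra.
    have ww : w1 t' x' <= w2 t' x' by have := hi hin; rewrite subr_le0.
    case: S1 => -> // _ _; case: S2 => -> // _ _; rewrite -pp.
    have hA := pr_a P tT tT h2 h2 k1 k3 k2 k2; have hF := pr_f P tT tT h2 h2 k1 k3 k2 k2.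
    rewrite !subrr normr0 !powR0// !add0r addr0 (ger0_norm upos) in hA hF.
    have /andP[A0 _] := pr_pos P tT h2 k1 k2; have /andP[kp _] := pr_kap P.
    rewrite -pp in d2 k4.
    move: hA hF A0; set A1 := a _ _ (u1 _ _) _; set A2 := a _ _ (u2 _ _) _.
    set F1 := f _ _ (u1 _ _) _; set F2 := f _ _ (u2 _ _) _ => hA hF A0.
    have -> : A1 * w1 t' x' + F1 - (A2 * w2 t' x' + F2) =
      A1 * (w1 t' x' - w2 t' x') + (A1 - A2) * w2 t' x' + (F1 - F2) by ring.
    have g1 : A1 * (w1 t' x' - w2 t' x') <= 0.
      by rewrite mulr_ge0_le0 ?subr_le0// (le_trans (ltW kp)).
    have g2 : (A1 - A2) * w2 t' x' <= Lam * (u1 t' x' - u2 t' x') * C.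
      by apply: (le_trans (ler_norm _)); rewrite normrM ler_pM.
    have g3 := le_trans (ler_norm _) hF.
    have -> : Lam * (C + 1) * (u1 t' x' - u2 t' x') =
      0 + Lam * (u1 t' x' - u2 t' x') * C + Lam * (u1 t' x' - u2 t' x') by ring.
    exact: lerD (lerD g1 g2) g3.
  have [s [s1 xs]] : exists s : R, (s = 1 \/ s = -1) /\ x' = s * l.
    move: hin h2; rewrite negb_and -!leNgt => /orP[h|h] /andP[g1 g2].
      by exists (-1); split; [right|apply/eqP; rewrite mulN1r eq_le h g1].
    by exists 1; split; [left|apply/eqP; rewrite mul1r eq_le h g2].
  apply: bnd; rewrite xs.
  case: S1 => _ -> // _; case: S2 => _ -> // _; rewrite -xs.
  have hP := pr_ph P s1 tT tT k1 k3 k4 k4.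
  rewrite !subrr normr0 !powR0// !add0r addr0 (ger0_norm upos) in hP.
  have hQ : ph s t' (u1 t' x') (p1 t' x') <= ph s t' (u1 t' x') (p2 t' x').
    case: s1 xs => -> xs.
      have hlx : - l < x' by rewrite xs mul1r -subr_gt0 opprK addr_gt0.
      have := hl hlx; rewrite subr_ge0 => h.
      by have := mono (or_introl (erefl (1 : R))) tT k1 k4 k2 h; rewrite !mul1r.
    have hlx : x' < l by rewrite xs mulN1r -subr_gt0 opprK addr_gt0.
    have := hr hlx; rewrite subr_le0 => h.
    by have := mono (or_intror (erefl (-1 : R))) tT k1 k2 k4 h; rewrite !mulN1r lerN2.
  by apply: le_trans (le_trans (ler_norm _) hP); rewrite lerB.
- by rewrite /in_rect ht.
Qed.

End Compare.

(** An expansion determines its derivative. At an end point only one side is available, so the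
    increment is taken towards the farther end of the interval. *)
Lemma regular_det (al l t0 t1 C : R) (u v p w z p' w' z' : R -> R -> R) : 0 < al < 1 -> 0 < l ->
  t0 < t1 -> regular al l t0 t1 C u p w z -> regular al l t0 t1 C v p' w' z' ->
  (forall t x, t0 <= t <= t1 -> - l <= x <= l -> u t x = v t x) ->
  forall t x, t0 <= t <= t1 -> - l <= x <= l -> [/\ p t x = p' t x, w t x = w' t x & z t x = z' t x].
Proof.
move=> /andP[al0 al1] l0 t01 H1 H2 uv.
have key (y0 y1 be K D D' : R) (g : R -> R) y : y0 < y1 -> y0 <= y <= y1 -> 0 < be ->
    (forall y', y0 <= y' <= y1 -> `|g y' - g y - (y' - y) * D| <= K * (`|y' - y| * `|y' - y| `^ be)) ->
    (forall y', y0 <= y' <= y1 -> `|g y' - g y - (y' - y) * D'| <= K * (`|y' - y| * `|y' - y| `^ be)) -> D = D'.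
  move=> y01 hy be0 k1 k2; apply/eqP; rewrite -subr_eq0 -normr_eq0 eq_le normr_ge0 andbT.
  apply: (@small_le0 R be _ (2 * K) ((y1 - y0) / 2)) => //; first by rewrite divr_gt0// subr_gt0.
  move=> h /andP[h0 hh].
  have [y' [hy' dy]] : exists y', y0 <= y' <= y1 /\ `|y' - y| = h.
    case: (leP y ((y0 + y1) / 2)) => hy2.
      exists (y + h); split; last by rewrite addrAC subrr add0r gtr0_norm.
      by move: hy hy2 h0 hh; clear => /andP[? ?] ? ? ?; apply/andP; split; lra.
    exists (y - h); split; last by rewrite addrAC subrr add0r normrN gtr0_norm.
    by move: hy hy2 h0 hh; clear => /andP[? ?] ? ? ?; apply/andP; split; lra.
  have := k1 y' hy'; have := k2 y' hy'; rewrite dy => e2 e1.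
  rewrite -(ler_pM2l h0) -{1}dy -normrM.
  have -> : (y' - y) * (D - D') = (g y' - g y - (y' - y) * D') - (g y' - g y - (y' - y) * D) by ring.
  apply: (le_trans (ler_normB _ _)).
  have -> : h * (2 * K * h `^ be) = K * (h * h `^ be) + K * (h * h `^ be) by ring.
  exact: lerD.
have l01 : - l < l by rewrite -subr_gt0 opprK addr_gt0.
have pp t x : t0 <= t <= t1 -> - l <= x <= l -> p t x = p' t x.
  move=> ht hx; apply: (key (- l) l 1 C _ _ (u t) x) => //.
    by move=> y hy; rewrite powRr1// -expr2; exact: (rg_ux H1).
  by move=> y hy; rewrite powRr1// -expr2 !uv//; exact: (rg_ux H2).
move=> t x ht hx; split; first exact: pp.
- apply: (key (- l) l al C _ _ (p t) x) => //; first by move=> y hy; exact: (rg_px H1).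
  by move=> y hy; rewrite !pp//; exact: (rg_px H2).
- apply: (key t0 t1 (al / 2) C _ _ (fun t => u t x) t) => //; first by rewrite divr_gt0.
    by move=> s hs; exact: (rg_ut H1).
  by move=> s hs; rewrite !uv//; exact: (rg_ut H2).
Qed.

(** The constant 7 = 3 + 1 + 1 + 2 counts the remainders, each at most C de^(1 + al/2) since h does
    not exceed the square root of de. *)
Lemma gradient_arith (al th de h C dp A : R) : 0 < al -> 0 < th <= 1 -> 0 < de -> h = th * Num.sqrt de -> 0 <= C ->
  A <= 3 * C * (de * de `^ (al / 2)) + C * (de * h `^ al) -> h * dp <= A + h ^+ 2 * (C * de `^ (al / 2)) + 2 * C * (h ^+ 2 * h `^ al) ->
  dp <= 7 * C / th * de `^ ((1 + al) / 2).
Proof.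
move=> al0 /andP[th0 th1] de0 hE C0 hA hdp.
set s := Num.sqrt de in hE; have s0 : 0 < s by rewrite sqrtr_gt0.
have s2 : de = s ^+ 2 by rewrite sqr_sqrtr// ltW.
have h0 : 0 < h by rewrite hE mulr_gt0.
have hs : h <= s by rewrite hE ler_piMl// ltW.
have sE : de `^ (al / 2) = s `^ al by rewrite s2 powR_half_sq// ltW.
have dE : de `^ ((1 + al) / 2) = s * s `^ al.
  by rewrite s2 powR_half_sq ?ltW// powRD ?powRr1 ?ltW//; apply/implyP => _; rewrite gt_eqF.
have hal : h `^ al <= s `^ al by rewrite ge0_ler_powR ?nnegrE ?(ltW al0) ?(ltW h0) ?(ltW s0).
have Y0 : 0 <= s `^ al by exact: powR_ge0.
have h2 : h ^+ 2 <= s ^+ 2 by rewrite ler_pXn2r ?nnegrE ?(ltW h0) ?(ltW s0).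
rewrite dE; rewrite sE s2 in hA hdp.
have e1 : C * (s ^+ 2 * h `^ al) <= C * (s ^+ 2 * s `^ al) by rewrite ler_wpM2l// ler_wpM2l// sqr_ge0.
have e2 : h ^+ 2 * (C * s `^ al) <= s ^+ 2 * (C * s `^ al) by rewrite ler_wpM2r// mulr_ge0.
have e3 : C * (h ^+ 2 * h `^ al) <= C * (s ^+ 2 * s `^ al).
  by rewrite ler_wpM2l// ler_pM ?sqr_ge0 ?powR_ge0.
rewrite -(ler_pM2l h0).
have -> : h * (7 * C / th * (s * s `^ al)) = 7 * (C * (s ^+ 2 * s `^ al)).
  by rewrite hE; field; rewrite gt_eqF.
by move: hA hdp e1 e2 e3; clear; lra.
Qed.

(** Interpolation: u_x is compared with a difference quotient of u over the distance h = th sqrt |t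
    - s|. The factor th keeps h below l, so that x + h or x - h lies in the interval. *)
Lemma gradient_time (al l t0 t1 C : R) (u p w z : R -> R -> R) : 0 < al < 1 -> 0 < l -> 0 <= C ->
  regular al l t0 t1 C u p w z ->
  forall t s x, t0 <= t <= t1 -> t0 <= s <= t1 -> - l <= x <= l ->
  `|p t x - p s x| <= 7 * C / Num.min 1 (l / (1 + (t1 - t0))) * `|t - s| `^ ((1 + al) / 2).
Proof.
move=> al01 l0 C0 H t s x ht hs hx; have /andP[al0 al1] := al01.
have T0 : 0 <= t1 - t0 by rewrite subr_ge0; case/andP: ht => /le_trans h /h.
set th := Num.min _ _; have th0 : 0 < th by rewrite lt_min ltr01 divr_gt0// ltr_wpDr.
have [->|ts] := eqVneq t s.
  by rewrite !subrr normr0 mulr_ge0 ?powR_ge0// divr_ge0 ?mulr_ge0// ltW.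
set de := `|t - s|; have de0 : 0 < de by rewrite normr_gt0 subr_eq0.
have deT : de <= t1 - t0.
  by move: ht hs => /andP[? ?] /andP[? ?]; rewrite ler_norml; apply/andP; split; lra.
pose h := th * Num.sqrt de.
have sd : Num.sqrt de <= 1 + (t1 - t0).
  have h1 : de <= (1 + (t1 - t0)) ^+ 2.
    by apply: (le_trans deT); move: (t1 - t0) T0 => r r0; have := sqr_ge0 r; rewrite !expr2; lra.
  have e1 : 0 <= 1 + (t1 - t0) by rewrite addr_ge0.
  rewrite -[leRHS](ger0_norm e1) -sqrtr_sqr; exact: ler_wsqrtr.
have hl : h <= l.
  apply: (@le_trans _ _ (l / (1 + (t1 - t0)) * (1 + (t1 - t0)))).
    by apply: ler_pM => //; [exact: ltW|rewrite ge_min lexx orbT].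
  by rewrite divfK// gt_eqF// ltr_wpDr.
have h0 : 0 < h by rewrite mulr_gt0// sqrtr_gt0.
have [y [hy yx]] : exists y, - l <= y <= l /\ `|y - x| = h.
  case: (leP x 0) => x0.
    exists (x + h); split; last by rewrite addrAC subrr add0r gtr0_norm.
    by move: hx x0 h0 hl; clear => /andP[? ?] ? ? ?; apply/andP; split; lra.
  exists (x - h); split; last by rewrite addrAC subrr add0r normrN gtr0_norm.
  by move: hx x0 h0 hl; clear => /andP[? ?] ? ? ?; apply/andP; split; lra.
have th01 : 0 < th <= 1 by rewrite th0 ge_min lexx.
apply: (@gradient_arith al th de h C _ (`|(u t y - u s y) - (u t x - u s x)|) al0 th01 de0 erefl C0).
  have -> : (u t y - u s y) - (u t x - u s x) =
    (u t y - u s y - (t - s) * z s y) - (u t x - u s x - (t - s) * z s x) + (t - s) * (z s y - z s x) by ring.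
  apply: (le_trans (ler_normD _ _)); apply: lerD.
    apply: (le_trans (ler_normB _ _)).
    have e1 := rg_ut H hs ht hx; have e2 := rg_ut H hs ht hy.
    have : 0 <= C * (de * de `^ (al / 2)) by rewrite !mulr_ge0 ?powR_ge0// ltW.
    by move: (lerD e1 e2); rewrite -/de addrC; clear; lra.
  rewrite normrM mulrCA -/de ler_wpM2l ?(ltW de0)//.
  by have := rg_z H hs hs hy hx; rewrite yx subrr normr0 powR0 ?add0r// gt_eqF// divr_gt0.
have e1 := datum_taylor2 (regular_datum al01 C0 H ht) al01 l0 hx hy.
have e2 := datum_taylor2 (regular_datum al01 C0 H hs) al01 l0 hx hy.
rewrite yx in e1 e2.
have e3 : `|w t x - w s x| <= C * de `^ (al / 2).
  by have := rg_w H ht hs hx hx; rewrite subrr normr0 powR0 ?addr0// gt_eqF.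
have -> : h * `|p t x - p s x| = `|(y - x) * (p t x - p s x)| by rewrite normrM yx.
have -> : (y - x) * (p t x - p s x) = ((u t y - u s y) - (u t x - u s x)) - (y - x) ^+ 2 / 2 * (w t x - w s x)
  - ((u t y - u t x - (y - x) * p t x - (y - x) ^+ 2 / 2 * w t x) -
     (u s y - u s x - (y - x) * p s x - (y - x) ^+ 2 / 2 * w s x)) by ring.
apply: (le_trans (ler_normB _ _)); apply: lerD; last first.
  apply: (le_trans (ler_normB _ _)); move: (lerD e1 e2); rewrite -/h; clear; lra.
apply: (le_trans (ler_normB _ _)); rewrite lerD2l normrM normrM normrX yx.
rewrite (ger0_norm (x := 2^-1)) ?invr_ge0//.
apply: ler_pM => //; first by rewrite mulr_ge0 ?sqr_ge0 ?invr_ge0.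
by rewrite ler_piMr ?sqr_ge0// invf_le1// ler1n.
Qed.

Lemma regular_weaken (al l t0 t1 s0 s1 C D : R) (u p w z : R -> R -> R) :
  regular al l t0 t1 C u p w z -> t0 <= s0 -> s1 <= t1 -> C <= D -> regular al l s0 s1 D u p w z.
Proof.
move=> H h0 h1 CD.
have sub t : s0 <= t <= s1 -> t0 <= t <= t1.
  by move=> /andP[g1 g2]; rewrite (le_trans h0)//= (le_trans _ h1).
have up (x y : R) : 0 <= y -> x <= C * y -> x <= D * y.
  by move=> y0 h; apply: (le_trans h); rewrite ler_wpM2r.
split.
- by move=> t x /sub ht hx; have [? ? ? ?] := rg_bd H ht hx; split; exact: le_trans CD.
- by move=> t s x y /sub ht /sub hs hx hy; apply: up (rg_w H ht hs hx hy); rewrite addr_ge0 ?powR_ge0.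
- by move=> t s x y /sub ht /sub hs hx hy; apply: up (rg_z H ht hs hx hy); rewrite addr_ge0 ?powR_ge0.
- by move=> t x y /sub ht hx hy; apply: up (rg_ux H ht hx hy); rewrite sqr_ge0.
- by move=> t x y /sub ht hx hy; apply: up (rg_px H ht hx hy); rewrite mulr_ge0 ?powR_ge0.
- by move=> t s x /sub ht /sub hs hx; apply: up (rg_ut H ht hs hx); rewrite mulr_ge0 ?powR_ge0.
Qed.

Lemma between_norm (t m s : R) : t <= m <= s \/ s <= m <= t ->
  `|s - m| <= `|s - t| /\ `|m - t| <= `|s - t|.
Proof.
have nb (x y : R) : 0 <= x <= y \/ y <= x <= 0 -> `|x| <= `|y|.
  by case=> /andP[h1 h2]; [rewrite !ger0_norm// (le_trans h1)|rewrite !ler0_norm ?lerN2// (le_trans h1)].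
by case=> /andP[h1 h2]; split; apply: nb; [left|left|right|right]; apply/andP; split; lra.
Qed.

(** The expansions from t to m and from m to s combine; the change of the derivative between t and m
    is the third remainder. *)
Lemma taylor_chain (al C : R) (u z : R -> R) t m s : 0 < al -> 0 <= C -> t <= m <= s \/ s <= m <= t ->
  `|u s - u m - (s - m) * z m| <= C * (`|s - m| * `|s - m| `^ al) ->
  `|u m - u t - (m - t) * z t| <= C * (`|m - t| * `|m - t| `^ al) ->
  `|z m - z t| <= C * `|m - t| `^ al ->
  `|u s - u t - (s - t) * z t| <= 3 * C * (`|s - t| * `|s - t| `^ al).
Proof.
move=> al0 C0 /between_norm[n1 n2] h1 h2 h3.
have mon (a b : R) : 0 <= a -> a <= b -> a `^ al <= b `^ al.
  by move=> g1 g2; rewrite ge0_ler_powR ?nnegrE ?(ltW al0)// (le_trans g1).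
have mon2 (a b : R) : 0 <= a -> a <= b -> a * a `^ al <= b * b `^ al.
  by move=> g1 g2; apply: ler_pM => //; [exact: powR_ge0|exact: mon].
have k1 := ler_wpM2l C0 (mon2 _ _ (normr_ge0 _) n1).
have k2 := ler_wpM2l C0 (mon2 _ _ (normr_ge0 _) n2).
have k3 : `|(s - m) * (z m - z t)| <= C * (`|s - t| * `|s - t| `^ al).
  rewrite normrM mulrCA ler_pM//; apply: (le_trans h3).
  by rewrite ler_wpM2l// mon.
have -> : u s - u t - (s - t) * z t = (u s - u m - (s - m) * z m) + (u m - u t - (m - t) * z t)
  + (s - m) * (z m - z t) by ring.
apply: (le_trans (ler_normD _ _)).
have := ler_normD (u s - u m - (s - m) * z m) (u m - u t - (m - t) * z t).
by move: h1 h2 k1 k2 k3; clear; lra.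
Qed.

Lemma holder_glue (al l t0 t1 t2 C : R) (g : R -> R -> R) : 0 < al < 1 -> 0 <= C ->
  (forall t s x y, t0 <= t <= t1 -> t0 <= s <= t1 -> - l <= x <= l -> - l <= y <= l ->
    `|g t x - g s y| <= C * (`|t - s| `^ (al / 2) + `|x - y| `^ al)) ->
  (forall t s x y, t1 <= t <= t2 -> t1 <= s <= t2 -> - l <= x <= l -> - l <= y <= l ->
    `|g t x - g s y| <= C * (`|t - s| `^ (al / 2) + `|x - y| `^ al)) ->
  forall t s x y, t0 <= t <= t2 -> t0 <= s <= t2 -> - l <= x <= l -> - l <= y <= l ->
    `|g t x - g s y| <= 3 * C * (`|t - s| `^ (al / 2) + `|x - y| `^ al).
Proof.
move=> /andP[al0 al1] C0 H1 H2 t s x y ht hs hx hy.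
wlog ts : t s x y ht hs hx hy / t <= s.
  move=> W; case: (leP t s) => h; first exact: W.
  by rewrite distrC (distrC t) (distrC x); apply: W => //; exact: ltW.
have C3 (E : R) : 0 <= E -> C * E <= 3 * C * E.
  by move=> E0; rewrite ler_wpM2r// ler_peMl// ler1n.
have E0 : 0 <= `|t - s| `^ (al / 2) + `|x - y| `^ al by rewrite addr_ge0 ?powR_ge0.
have /andP[t1' t2'] := ht; have /andP[s1' s2'] := hs.
case: (leP s t1) => st1.
  by apply: le_trans (C3 _ E0); apply: H1 => //; apply/andP; split=> //; exact: le_trans st1.
case: (leP t1 t) => tt1.
  by apply: le_trans (C3 _ E0); apply: H2 => //; apply/andP; split=> //; exact: le_trans ts.
have t12 : t1 <= t2 := le_trans (ltW st1) s2'.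
have t01 : t0 <= t1 := le_trans t1' (ltW tt1).
have h1 : `|g t x - g t1 x| <= C * `|t - t1| `^ (al / 2).
  have := H1 t t1 x x; rewrite subrr normr0 powR0 ?gt_eqF// addr0; apply=> //; apply/andP; split=> //.
  exact: ltW.
have h2 : `|g t1 x - g s y| <= C * (`|t1 - s| `^ (al / 2) + `|x - y| `^ al).
  by apply: H2 => //; apply/andP; split=> //; exact: ltW.
have [n1 n2] : `|s - t1| <= `|s - t| /\ `|t1 - t| <= `|s - t|.
  by apply: between_norm; left; rewrite !ltW.
have mon (a b : R) : 0 <= a -> a <= b -> a `^ (al / 2) <= b `^ (al / 2).
  by move=> g1 g2; rewrite ge0_ler_powR ?nnegrE ?divr_ge0 ?(ltW al0)// (le_trans g1).
have m1 : `|t - t1| `^ (al / 2) <= `|t - s| `^ (al / 2) by rewrite (distrC t) (distrC t); exact: mon.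
have m2 : `|t1 - s| `^ (al / 2) <= `|t - s| `^ (al / 2) by rewrite (distrC t1) (distrC t); exact: mon.
have -> : g t x - g s y = (g t x - g t1 x) + (g t1 x - g s y) by ring.
apply: (le_trans (ler_normD _ _)).
have k1 := ler_wpM2l C0 m1; have k2 := ler_wpM2l C0 m2.
have k3 : 0 <= C * `|x - y| `^ al by rewrite mulr_ge0 ?powR_ge0.
have k4 : 0 <= C * `|t - s| `^ (al / 2) by rewrite mulr_ge0 ?powR_ge0.
by move: h1 h2 k1 k2 k3 k4; clear; lra.
Qed.

Lemma taylor_glue (al t0 t1 t2 C : R) (u z : R -> R) : 0 < al -> 0 <= C ->
  (forall t s, t0 <= t <= t1 -> t0 <= s <= t1 -> `|z t - z s| <= C * `|t - s| `^ al) ->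
  (forall t s, t1 <= t <= t2 -> t1 <= s <= t2 -> `|z t - z s| <= C * `|t - s| `^ al) ->
  taylor1 t0 t1 C al u z -> taylor1 t1 t2 C al u z -> taylor1 t0 t2 (3 * C) al u z.
Proof.
move=> al0 C0 Z1 Z2 H1 H2 t s ht hs.
have C3 (E : R) : 0 <= E -> C * E <= 3 * C * E.
  by move=> E0; rewrite ler_wpM2r// ler_peMl// ler1n.
have E0 : 0 <= `|s - t| * `|s - t| `^ al by rewrite mulr_ge0 ?powR_ge0.
have /andP[ta tb] := ht; have /andP[sa sb] := hs.
case: (leP t t1) => tt1; case: (leP s t1) => st1.
- by apply: le_trans (C3 _ E0); apply: H1; rewrite ?ta ?sa.
- have t12 : t1 <= t2 := le_trans (ltW st1) sb; have t01 : t0 <= t1 := le_trans ta tt1.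
  apply: (taylor_chain (m := t1)) => //; first by left; rewrite tt1 ltW.
  + by apply: H2; rewrite ?lexx ?t12 ?(ltW st1).
  + by apply: H1; rewrite ?lexx ?t01 ?ta ?tt1.
  + by apply: Z1; rewrite ?lexx ?t01 ?ta ?tt1.
- have t12 : t1 <= t2 := le_trans (ltW tt1) tb; have t01 : t0 <= t1 := le_trans sa st1.
  apply: (taylor_chain (m := t1)) => //; first by right; rewrite st1 ltW.
  + by apply: H1; rewrite ?lexx ?t01 ?sa ?st1.
  + by apply: H2; rewrite ?lexx ?t12 ?(ltW tt1).
  + by apply: Z2; rewrite ?lexx ?t12 ?(ltW tt1).
- by apply: le_trans (C3 _ E0); apply: H2; rewrite ?(ltW tt1) ?(ltW st1).
Qed.

(** Expansions in space live on single time slices and carry over; moduli and expansions in time are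
    passed through t1 at the cost of a factor 3. *)
Lemma regular_glue (al l t0 t1 t2 C : R) (u p w z : R -> R -> R) : 0 < al < 1 -> 0 <= C -> 
  regular al l t0 t1 C u p w z -> regular al l t1 t2 C u p w z -> regular al l t0 t2 (3 * C) u p w z.
Proof.
move=> al01 C0 H1 H2; have /andP[al0 al1] := al01.
have C3 (E : R) : 0 <= E -> C * E <= 3 * C * E.
  by move=> E0; rewrite ler_wpM2r// ler_peMl// ler1n.
have CC : C <= 3 * C by rewrite -[leLHS]mulr1; apply: le_trans (C3 1 ler01) _; rewrite mulr1.
have two t : t0 <= t <= t2 -> t0 <= t <= t1 \/ t1 <= t <= t2.
  by move=> /andP[-> ->]; case: (leP t t1) => h; [left|right; rewrite ltW].
have zt a b : (forall t s x y, a <= t <= b -> a <= s <= b -> - l <= x <= l -> - l <= y <= l ->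
    `|z t x - z s y| <= C * (`|t - s| `^ (al / 2) + `|x - y| `^ al)) ->
    forall x, - l <= x <= l -> forall t s, a <= t <= b -> a <= s <= b -> `|z t x - z s x| <= C * `|t - s| `^ (al / 2).
  by move=> hh x hx t s ht hs; have := hh t s x x ht hs hx hx; rewrite subrr normr0 powR0 ?gt_eqF// addr0.
split.
- move=> t x /two[]ht hx; [have [? ? ? ?] := rg_bd H1 ht hx|have [? ? ? ?] := rg_bd H2 ht hx];
    by split; exact: le_trans CC.
- exact: holder_glue al01 C0 (rg_w H1) (rg_w H2).
- exact: holder_glue al01 C0 (rg_z H1) (rg_z H2).
- move=> t x y /two[]ht hx hy; apply: le_trans (C3 _ (sqr_ge0 _)); [exact: (rg_ux H1)|exact: (rg_ux H2)].
- move=> t x y ht hx hy; have h0 : 0 <= `|y - x| * `|y - x| `^ al by rewrite mulr_ge0 ?powR_ge0.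
  by case: (two t ht) => {}ht; apply: le_trans (C3 _ h0); [exact: (rg_px H1)|exact: (rg_px H2)].
- move=> t s x ht hs hx; apply: (@taylor_glue (al / 2) t0 t1 t2 C (fun t => u t x) (fun t => z t x)) => //.
  + by rewrite divr_gt0.
  + exact: (zt _ _ (rg_z H1)).
  + exact: (zt _ _ (rg_z H2)).
  + by move=> t' s' ht' hs'; exact: (rg_ut H1).
  + by move=> t' s' ht' hs'; exact: (rg_ut H2).
Qed.

End Uniqueness.

(** * Parabolic Holder spaces *)

Section Norms.
Context {R : realType}.
Implicit Types (u v : R -> R -> R) (I : set R).

Lemma holder_le (be K : R) I (v : R -> R) :
  (forall x y, I x -> I y -> `|v x - v y| <= K * `|x - y| `^ be) ->
  (holder be I v <= K%:E)%E.
Proof.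
move=> H; apply: ub_ereal_sup => _ [[x y] /= [Ix Iy xy] <-].
by rewrite lee_fin ler_pdivrMr ?powR_gt0 ?normr_gt0 ?subr_eq0//; exact: H.
Qed.

Lemma holder_bound (be K : R) I (v : R -> R) x y : 0 < be -> (holder be I v <= K%:E)%E -> I x -> I y ->
  `|v x - v y| <= K * `|x - y| `^ be.
Proof.
move=> be0 H Ix Iy; have [->|xy] := eqVneq x y.
  by rewrite !subrr normr0 powR0 ?mulr0// gt_eqF.
rewrite -ler_pdivrMr ?powR_gt0 ?normr_gt0 ?subr_eq0// -lee_fin.
by apply: le_trans H; apply: ereal_sup_ubound; exists (x, y).
Qed.

(** The supremum of an empty set is -oo in the extended reals; two distinct points exclude this. *)
Lemma holder_ge0 (be : R) I (v : R -> R) x y : I x -> I y -> x != y -> (0 <= holder be I v)%E.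
Proof.
move=> Ix Iy xy; apply: (@le_trans _ _ (`|v x - v y| / `|x - y| `^ be)%:E).
  by rewrite lee_fin divr_ge0 ?powR_ge0.
by apply: ereal_sup_ubound; exists (x, y).
Qed.

Variables (tau l : R).
Hypothesis tau0 : 0 < tau.
Hypothesis l0 : 0 < l.

Lemma CylE t x : Cyl tau l (t, x) <-> 0 < t < tau /\ - l < x < l.
Proof. by rewrite /Cyl/= /Omega/= !in_itv. Qed.

Lemma Omega_two : exists x y, [/\ Omega l x, Omega l y & x != y].
Proof.
have ? := l0; exists 0, (l / 2); rewrite /Omega/= !in_itv/=; split; [by apply/andP; split; lra..|].
by rewrite lt_eqF//; lra.
Qed.

Lemma time_two : exists t s : R, [/\ `]0, tau[%classic t, `]0, tau[%classic s & t != s].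
Proof.
have ? := tau0; exists (tau / 3), (tau / 2); rewrite /= !in_itv/=; split; [by apply/andP; split; lra..|].
by rewrite lt_eqF//; lra.
Qed.

Lemma supnorm_ge0 u : (0 <= supnorm (Cyl tau l) u)%E.
Proof.
have [x [_ [hx _ _]]] := Omega_two; have [t [_ [ht _ _]]] := time_two.
apply: (@le_trans _ _ `|u t x|%:E); first by rewrite lee_fin.
by apply: ereal_sup_ubound; exists (t, x).
Qed.

Lemma supnorm_le (K : R) u : (forall t x, 0 < t < tau -> - l < x < l -> `|u t x| <= K) ->
  (supnorm (Cyl tau l) u <= K%:E)%E.
Proof.
move=> H; apply: ub_ereal_sup => _ [[t x] /CylE[ht hx] <-].
by rewrite lee_fin; exact: H.
Qed.

Lemma supnorm_bound (K : R) u t x : (supnorm (Cyl tau l) u <= K%:E)%E ->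
  0 < t < tau -> - l < x < l -> `|u t x| <= K.
Proof.
move=> H ht hx; rewrite -lee_fin; apply: le_trans H.
by apply: ereal_sup_ubound; exists (t, x) => //; apply/CylE.
Qed.

Lemma holder_t_ge0 (be : R) u : (0 <= holder_t be tau l u)%E.
Proof.
have [x [_ [hx _ _]]] := Omega_two; have [t [s [ht hs ts]]] := time_two.
apply: (@le_trans _ _ (holder be `]0, tau[%classic (fun t => u t x))); first exact: holder_ge0 ts.
by apply: ereal_sup_ubound; exists x.
Qed.

Lemma holder_t_le (be K : R) u :
  (forall t s x, 0 < t < tau -> 0 < s < tau -> - l < x < l -> `|u t x - u s x| <= K * `|t - s| `^ be) ->
  (holder_t be tau l u <= K%:E)%E.
Proof.
move=> H; apply: ub_ereal_sup => _ [x + <-]; rewrite /Omega/= in_itv/= => hx.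
apply: holder_le => t s; rewrite /= !in_itv/= => ht hs.
exact: H.
Qed.

Lemma holder_t_bound (be K : R) u t s x : 0 < be -> (holder_t be tau l u <= K%:E)%E ->
  0 < t < tau -> 0 < s < tau -> - l < x < l -> `|u t x - u s x| <= K * `|t - s| `^ be.
Proof.
move=> be0 H ht hs hx.
have Ht : `]0, tau[%classic t by rewrite /= in_itv.
have Hs : `]0, tau[%classic s by rewrite /= in_itv.
refine (@holder_bound be K _ (fun t => u t x) t s be0 _ Ht Hs).
apply: le_trans H; by apply: ereal_sup_ubound; exists x; rewrite // /Omega/= in_itv.
Qed.

Lemma holder_x_ge0 (be : R) u : (0 <= holder_x be tau l u)%E.
Proof.
have [x [y [hx hy xy]]] := Omega_two; have [t [_ [ht _ _]]] := time_two.
apply: (@le_trans _ _ (holder be (Omega l) (u t))); first exact: holder_ge0 xy.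
by apply: ereal_sup_ubound; exists t.
Qed.

Lemma holder_x_le (be K : R) u :
  (forall t x y, 0 < t < tau -> - l < x < l -> - l < y < l -> `|u t x - u t y| <= K * `|x - y| `^ be) ->
  (holder_x be tau l u <= K%:E)%E.
Proof.
move=> H; apply: ub_ereal_sup => _ [t + <-]; rewrite /= in_itv/= => ht.
apply: holder_le => x y; rewrite /Omega/= !in_itv/= => hx hy.
exact: H.
Qed.

Lemma holder_x_bound (be K : R) u t x y : 0 < be -> (holder_x be tau l u <= K%:E)%E ->
  0 < t < tau -> - l < x < l -> - l < y < l -> `|u t x - u t y| <= K * `|x - y| `^ be.
Proof.
move=> be0 H ht hx hy.
have Hx : Omega l x by rewrite /Omega/= in_itv.
have Hy : Omega l y by rewrite /Omega/= in_itv.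
refine (@holder_bound be K _ (u t) x y be0 _ Hx Hy).
apply: le_trans H; by apply: ereal_sup_ubound; exists t; rewrite //= in_itv.
Qed.

Lemma holder_tx_ge0 (al : R) u : (0 <= holder_tx al tau l u)%E.
Proof. by rewrite adde_ge0 ?holder_t_ge0 ?holder_x_ge0. Qed.

Lemma sum3E (Q : pred nat) (F : nat -> \bar R) : (\sum_(j < 3 | Q j) F j =
  (if Q 0%N then F 0%N else 0) + ((if Q 1%N then F 1%N else 0) + (if Q 2%N then F 2%N else 0)))%E.
Proof. by rewrite big_mkcond/= !big_ord_recl big_ord0 /= adde0. Qed.

Lemma sum33E (Q : nat -> pred nat) (F : nat -> nat -> \bar R) :
  (\sum_(j0 < 3) \sum_(j < 3 | Q j0 j) F j0 j =
  ((if Q 0%N 0%N then F 0%N 0%N else 0) + ((if Q 0%N 1%N then F 0%N 1%N else 0) + (if Q 0%N 2%N then F 0%N 2%N else 0)))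
  + (((if Q 1%N 0%N then F 1%N 0%N else 0) + ((if Q 1%N 1%N then F 1%N 1%N else 0) + (if Q 1%N 2%N then F 1%N 2%N else 0)))
  + ((if Q 2%N 0%N then F 2%N 0%N else 0) + ((if Q 2%N 1%N then F 2%N 1%N else 0) + (if Q 2%N 2%N then F 2%N 2%N else 0)))))%E.
Proof.
under eq_bigr => j0 _ do rewrite (sum3E (Q j0) (F j0)).
by rewrite !big_ord_recl big_ord0 adde0.
Qed.

Lemma sum_order_le2 (F : nat -> nat -> \bar R) :
  (\sum_(j0 < 3) \sum_(j < 3 | (2 * j0 + j <= 2)%N) F j0 j = F 0%N 0%N + F 0%N 1%N + F 0%N 2%N + F 1%N 0%N)%E.
Proof. by rewrite (sum33E (fun j0 j => (2 * j0 + j <= 2)%N)) /= !adde0 !addeA. Qed.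

Lemma sum_order_eq2 (F : nat -> nat -> \bar R) :
  (\sum_(j0 < 3) \sum_(j < 3 | (2 * j0 + j)%N == 2%N) F j0 j = F 0%N 2%N + F 1%N 0%N)%E.
Proof. by rewrite (sum33E (fun j0 j => (2 * j0 + j)%N == 2%N)) /= !adde0 !add0e. Qed.

Lemma sum_order_eq1 (F : nat -> nat -> \bar R) :
  (\sum_(j0 < 3) \sum_(j < 3 | (2 * j0 + j).+1 == 2%N) F j0 j = F 0%N 1%N)%E.
Proof. by rewrite (sum33E (fun j0 j => (2 * j0 + j).+1 == 2%N)) /= !adde0 !add0e. Qed.

Lemma sum_parts_le (s1 s2 s3 s4 h1 h2 h3 K : \bar R) : (0 <= s1)%E -> (0 <= s2)%E -> (0 <= s3)%E ->
  (0 <= s4)%E -> (0 <= h1)%E -> (0 <= h2)%E -> (0 <= h3)%E ->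
  (s1 + s2 + s3 + s4 + (h1 + h2 + h3) <= K)%E ->
  [/\ (s1 <= K)%E, (s2 <= K)%E, (s3 <= K)%E & (s4 <= K)%E] /\ [/\ (h1 <= K)%E, (h2 <= K)%E & (h3 <= K)%E].
Proof.
move=> a1 a2 a3 a4 b1 b2 b3 H.
have a12 := adde_ge0 a1 a2; have a123 := adde_ge0 a12 a3; have a1234 := adde_ge0 a123 a4.
have b12 := adde_ge0 b1 b2; have b123 := adde_ge0 b12 b3.
have H1 := le_trans (leeDl _ b123) H; have H2 := le_trans (leeDr _ a1234) H.
have H3 := le_trans (leeDl _ a4) H1; have H4 := le_trans (leeDl _ a3) H3.
have H5 := le_trans (leeDl _ b3) H2.
split; split.
- exact: le_trans (leeDl _ a2) H4.
- exact: le_trans (leeDr _ a1) H4.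
- exact: le_trans (leeDr _ a12) H3.
- exact: le_trans (leeDr _ a123) H1.
- exact: le_trans (leeDl _ b2) H5.
- exact: le_trans (leeDr _ b1) H5.
- exact: le_trans (leeDr _ b12) H2.
Qed.

(** For k = 2 the index sums leave u, u_x, u_xx and u_t; the last two carry the top order seminorm,
    and u_x alone has order one. *)
Lemma par_norm2E (al : R) u : par_norm 2 al tau l u =
  (supnorm (Cyl tau l) u + supnorm (Cyl tau l) (Dx u) + supnorm (Cyl tau l) (Dx (Dx u))
   + supnorm (Cyl tau l) (Dt u)
   + (holder_tx al tau l (Dx (Dx u)) + holder_tx al tau l (Dt u) + holder_t ((1 + al) / 2) tau l (Dx u)))%E.
Proof.
rewrite /par_norm /par_seminorm (sum_order_le2 (fun j0 j => supnorm (Cyl tau l) (Dtx j0 j u))).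
rewrite (sum_order_eq2 (fun j0 j => holder_tx al tau l (Dtx j0 j u))).
by rewrite (sum_order_eq1 (fun j0 j => holder_t ((1 + al) / 2) tau l (Dtx j0 j u))).
Qed.

Lemma par_norm2_le (al K : R) u : (par_norm 2 al tau l u <= K%:E)%E ->
  [/\ (supnorm (Cyl tau l) u <= K%:E)%E, (supnorm (Cyl tau l) (Dx u) <= K%:E)%E,
      (supnorm (Cyl tau l) (Dx (Dx u)) <= K%:E)%E & (supnorm (Cyl tau l) (Dt u) <= K%:E)%E] /\
  [/\ (holder_tx al tau l (Dx (Dx u)) <= K%:E)%E, (holder_tx al tau l (Dt u) <= K%:E)%E
    & (holder_t ((1 + al) / 2) tau l (Dx u) <= K%:E)%E].
Proof.
rewrite par_norm2E => H.
by apply: sum_parts_le H; [exact: supnorm_ge0|exact: supnorm_ge0|exact: supnorm_ge0|exact: supnorm_ge0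
  |exact: holder_tx_ge0|exact: holder_tx_ge0|exact: holder_t_ge0].
Qed.

Lemma par_norm2_ge0 (al : R) u : (0 <= par_norm 2 al tau l u)%E.
Proof.
rewrite par_norm2E; apply: adde_ge0.
  exact: (adde_ge0 (adde_ge0 (adde_ge0 (supnorm_ge0 _) (supnorm_ge0 _)) (supnorm_ge0 _)) (supnorm_ge0 _)).
exact: (adde_ge0 (adde_ge0 (holder_tx_ge0 _ _) (holder_tx_ge0 _ _)) (holder_t_ge0 _ _)).
Qed.

End Norms.

Section MeanValue.
Context {R : realType}.

Lemma mvt_points (a b : R) (f : R -> R) : (forall x, a < x < b -> derivable f x 1) ->
  forall x y, a < x < b -> a < y < b -> exists2 c, a < c < b /\ `|c - x| <= `|y - x| &
    f y - f x = (y - x) * derive1 f c.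
Proof.
move=> df.
have main x y : a < x -> y < b -> x < y -> exists2 c, x < c < y & f y - f x = derive1 f c * (y - x).
  move=> ax yb xy.
  have dd z : z \in `]x, y[ -> is_derive z (1 : R) f (derive1 f z).
    rewrite in_itv/= => /andP[xz zy]; rewrite derive1E; apply: derivableP; apply: df.
    by rewrite (lt_trans ax xz) (lt_trans zy yb).
  have cf : {within `[x, y], continuous f}.
    apply: derivable_within_continuous => z; rewrite in_itv/= => /andP[xz zy]; apply: df.
    by rewrite (lt_le_trans ax xz) (le_lt_trans zy yb).
  have [c] := MVT xy dd cf.
  by rewrite in_itv/= => cxy e; exists c.
move=> x y /andP[ax xb] /andP[ay yb].
case: (ltgtP x y) => [xy|yx|->].
- have [c /andP[xc cy] e] := main x y ax yb xy; exists c; last by rewrite e mulrC.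
  split; first by rewrite (lt_trans ax xc) (lt_trans cy yb).
  by rewrite !gtr0_norm ?subr_gt0// lerD2r ltW.
- have [c /andP[xc cy] e] := main y x ay xb yx; exists c; last by move: e; lra.
  split; first by rewrite (lt_trans ay xc) (lt_trans cy xb).
  by rewrite !ltr0_norm ?subr_lt0// lerN2 lerD2r ltW.
- by exists y; rewrite ?subrr ?mul0r ?ay ?yb ?normr0.
Qed.

End MeanValue.

Lemma sum_mul_bound {R : realType} (A B K1 K2 a b : R) : 0 <= K1 -> 0 <= K2 -> 0 <= a -> 0 <= b ->
  A <= K1 * b -> B <= K2 * a -> A + B <= (K1 + K2) * (a + b).
Proof.
by move=> k1 k2 a0 b0 h1 h2; have := mulr_ge0 k1 a0; have := mulr_ge0 k2 b0; lra.
Qed.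

(** * From parabolic Holder spaces to expansions and back *)

Section Bridge.
Context {R : realType}.
Variables (al l : R).
Hypothesis al01 : 0 < al < 1.
Hypothesis l0 : 0 < l.

Let al0 : 0 < al. Proof. by case/andP: al01. Qed.

(** The norm speaks of the open cylinder only. The constant is common to all closed subrectangles,
    which permits an extension to the closure. *)
Definition open_regular (tau C : R) (u p w z : R -> R -> R) : Prop :=
  forall l' s0 s1, l' < l -> 0 < s0 -> s1 < tau -> regular al l' s0 s1 C u p w z.

(** The expansions come from the mean value theorem; for u in space it is used twice, with the bound
    on u_xx. *)
Lemma par_open_regular (tau M : R) (u : R -> R -> R) : 0 < tau -> par_space 2 al tau l u ->
  (par_norm 2 al tau l u <= M%:E)%E -> open_regular tau M u (Dx u) (Dx (Dx u)) (Dt u).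
Proof.
move=> tau0 [dx dt _] /(par_norm2_le tau0 l0)[[n1 n2 n3 n4] [n5 n6 n7]] l' s0 s1 l'l s00 s1t.
have al20 : 0 < al / 2 by rewrite divr_gt0.
have al2n : al / 2 != 0 by rewrite gt_eqF.
have aln : al != 0 by rewrite gt_eqF.
have ti t : s0 <= t <= s1 -> 0 < t < tau.
  by move=> /andP[h1 h2]; rewrite (lt_le_trans s00 h1) (le_lt_trans h2 s1t).
have xi x : - l' <= x <= l' -> - l < x < l.
  move=> /andP[h1 h2]; rewrite (le_lt_trans h2 l'l) andbT; apply: lt_le_trans h1.
  by rewrite ltrN2.
have sumw v t s x y : (holder_tx al tau l v <= M%:E)%E -> 0 < t < tau -> 0 < s < tau ->
    - l < x < l -> - l < y < l -> `|v t x - v s y| <= M * (`|t - s| `^ (al / 2) + `|x - y| `^ al).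
  move=> H ht hs hx hy.
  have H1 : (holder_t (al / 2) tau l v <= M%:E)%E := le_trans (leeDl _ (holder_x_ge0 tau0 l0 al v)) H.
  have H2 : (holder_x al tau l v <= M%:E)%E := le_trans (leeDr _ (holder_t_ge0 tau0 l0 (al / 2) v)) H.
  have -> : v t x - v s y = (v t x - v s x) + (v s x - v s y) by ring.
  apply: (le_trans (ler_normD _ _)); rewrite mulrDr lerD//.
    exact: (holder_t_bound al20 H1).
  exact: (holder_x_bound al0 H2).
have M0 : 0 <= M.
  rewrite -lee_fin; apply: le_trans n1; exact: supnorm_ge0.
have cyl t x : 0 < t < tau -> - l < x < l -> Cyl tau l (t, x) by move=> *; apply/CylE.
split.
- by move=> t x /ti ht /xi hx; split; [exact: supnorm_bound n1 ht hx|exact: supnorm_bound n2 ht hx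
   |exact: supnorm_bound n3 ht hx|exact: supnorm_bound n4 ht hx].
- by move=> t s x y /ti ht /ti hs /xi hx /xi hy; exact: sumw.
- by move=> t s x y /ti ht /ti hs /xi hx /xi hy; exact: sumw.
- move=> t x y /ti ht /xi hx /xi hy.
  have d1 x' : - l < x' < l -> derivable (u t) x' 1 by move=> hx'; exact: (dx 0%N t x' isT (cyl _ _ ht hx')).
  have d2 x' : - l < x' < l -> derivable (Dx u t) x' 1 by move=> hx'; exact: (dx 1%N t x' isT (cyl _ _ ht hx')).
  have [c [hc cx] e] := mvt_points d1 hx hy.
  have [c' [hc' _] e'] := mvt_points d2 hx hc.
  rewrite e -mulrBr -/(Dx u t c) -/(Dx u t x) e' normrM normrM.
  have -> : M * `|y - x| ^+ 2 = `|y - x| * (`|y - x| * M) by ring.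
  rewrite ler_wpM2l// ler_pM//.
  exact: (supnorm_bound n3 ht hc').
- move=> t x y /ti ht /xi hx /xi hy.
  have d2 x' : - l < x' < l -> derivable (Dx u t) x' 1 by move=> hx'; exact: (dx 1%N t x' isT (cyl _ _ ht hx')).
  have [c [hc cx] e] := mvt_points d2 hx hy.
  rewrite e -mulrBr -/(Dx (Dx u) t c) normrM mulrCA ler_wpM2l//.
  have := sumw (Dx (Dx u)) t t c x n5 ht ht hc hx; rewrite (subrr t) normr0 (powR0 al2n) add0r => h.
  by apply: (le_trans h); rewrite ler_wpM2l// ge0_ler_powR ?nnegrE ?(ltW al0).
- move=> t s x /ti ht /ti hs /xi hx.
  have d1 t' : 0 < t' < tau -> derivable (fun t => u t x) t' 1 by move=> ht'; exact: (dt 0%N 0%N t' x isT (cyl _ _ ht' hx)).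
  have [c [hc ct] e] := mvt_points d1 ht hs.
  rewrite e -mulrBr -/(Dt u c x) normrM mulrCA ler_wpM2l//.
  have := sumw (Dt u) c t x x n6 hc ht hx hx; rewrite (subrr x) normr0 (powR0 aln) addr0 => h.
  by apply: (le_trans h); rewrite ler_wpM2l// ge0_ler_powR ?nnegrE ?(ltW al20).
Qed.

Lemma open_regular_at (tau C : R) u p w z t s x y : open_regular tau C u p w z ->
  0 < t < tau -> 0 < s < tau -> - l < x < l -> - l < y < l ->
  exists l' s0 s1, [/\ 0 < l' < l, regular al l' s0 s1 C u p w z, s0 <= t <= s1, s0 <= s <= s1 &
    - l' <= x <= l' /\ - l' <= y <= l'].
Proof.
move=> H /andP[t1 t2] /andP[s1 s2] hx hy.
exists (Num.max (l / 2) (Num.max `|x| `|y|)), (Num.min t s), (Num.max t s).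
have ll : Num.max (l / 2) (Num.max `|x| `|y|) < l.
  by rewrite !gt_max ltr_pdivrMr// mulr_natr mulr2n ltrDl l0 !ltr_norml hx hy.
have [m1 m2] : - Num.max (l / 2) (Num.max `|x| `|y|) <= x <= Num.max (l / 2) (Num.max `|x| `|y|) /\
    - Num.max (l / 2) (Num.max `|x| `|y|) <= y <= Num.max (l / 2) (Num.max `|x| `|y|).
  by rewrite -!ler_norml !le_max !lexx !orbT.
split => //.
- by rewrite ll andbT lt_max divr_gt0.
- by apply: H => //; rewrite ?lt_min ?t1 ?gt_max ?t2.
- by rewrite ge_min le_max !lexx.
- by rewrite ge_min le_max !lexx !orbT.
Qed.

Section Extension.
Variables (tau C : R) (u p w z : R -> R -> R).
Hypothesis tau0 : 0 < tau.
Hypothesis C0 : 0 <= C.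
Hypothesis H : open_regular tau C u p w z.

(** Points of the closed cylinder are contracted by 1 - e n towards the centre (tau/2, 0); the
    images are interior and tend to the given points. *)
Let e (n : nat) : R := harmonic n / 2.
Let ct (t : R) (n : nat) : R := t + e n * (tau / 2 - t).
Let cx (x : R) (n : nat) : R := x + e n * (0 - x).

Lemma contraction_e n : 0 < e n < 1.
Proof.
rewrite /e /harmonic/= divr_gt0 ?invr_gt0//= ltr_pdivrMr// mul1r.
by rewrite (@le_lt_trans _ _ 1)// ?invf_le1// ?ltr0n// ?ler1n// ltr1n.
Qed.

Lemma contraction_in (a b m y : R) (n : nat) : a < m < b -> a <= y <= b ->
  a < y + e n * (m - y) < b.
Proof.
move=> /andP[am mb] /andP[ay yb]; have /andP[e0 e1] := contraction_e n.
have -> : y + e n * (m - y) = (1 - e n) * y + e n * m by ring.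
have h1 : (1 - e n) * a <= (1 - e n) * y by rewrite ler_wpM2l// subr_ge0 ltW.
have h2 : (1 - e n) * y <= (1 - e n) * b by rewrite ler_wpM2l// subr_ge0 ltW.
have h3 : e n * a < e n * m by rewrite ltr_pM2l.
have h4 : e n * m < e n * b by rewrite ltr_pM2l.
by move: h1 h2 h3 h4; move: (e n) => r; move=> *; apply/andP; split; lra.
Qed.

Lemma contraction_closed (a b m y : R) (n : nat) : a <= m <= b -> a <= y <= b ->
  a <= y + e n * (m - y) <= b.
Proof.
move=> /andP[am mb] /andP[ay yb]; have /andP[e0 e1] := contraction_e n.
have -> : y + e n * (m - y) = (1 - e n) * y + e n * m by ring.
have h0 : 0 <= 1 - e n by rewrite subr_ge0 ltW.
apply/andP; split.
  have -> : a = (1 - e n) * a + e n * a by ring.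
  by apply: lerD; [exact: ler_wpM2l|apply: ler_wpM2l => //; exact: ltW].
have -> : b = (1 - e n) * b + e n * b by ring.
by apply: lerD; [exact: ler_wpM2l|apply: ler_wpM2l => //; exact: ltW].
Qed.

Lemma ct_in t n : 0 <= t <= tau -> 0 < ct t n < tau.
Proof.
apply: contraction_in; rewrite divr_gt0// ltr_pdivrMr// mulr_natr mulr2n ltrDl tau0//.
Qed.

Lemma cx_in x n : - l <= x <= l -> - l < cx x n < l.
Proof. by apply: contraction_in; rewrite oppr_lt0 l0. Qed.

Variable FF : set_system nat.
Hypothesis UF : UltraFilter FF.
Hypothesis FE : \oo `<=` FF.
Let PF : ProperFilter FF := @ultra_proper _ _ UF.

Lemma cvg_contraction (m y : R) : (fun n => y + e n * (m - y)) @ FF --> y.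
Proof.
have h : e @ FF --> (0 : R) / 2.
  apply: cvgM; last exact: cvg_cst.
  by move=> A /(@cvg_harmonic R) /FE.
rewrite mul0r in h.
have h2 : (fun n => y + e n * (m - y)) @ FF --> y + 0 * (m - y).
  by apply: cvgD; [exact: cvg_cst|apply: cvgM => //; exact: cvg_cst].
by rewrite mul0r addr0 in h2.
Qed.

Lemma cvg_ct t : ct t @ FF --> t. Proof. exact: cvg_contraction. Qed.
Lemma cvg_cx x : cx x @ FF --> x. Proof. exact: cvg_contraction. Qed.

Definition limit_fun (v V : R -> R -> R) :=
  forall t x, 0 <= t <= tau -> - l <= x <= l -> (fun n => v (ct t n) (cx x n)) @ FF --> V t x.

Lemma limit_fun_ex (v : R -> R -> R) : 
  (forall t x, 0 < t < tau -> - l < x < l -> `|v t x| <= C) -> exists V, limit_fun v V.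
Proof.
move=> vC.
have : forall tx : R * R, exists b : R, 0 <= tx.1 <= tau -> - l <= tx.2 <= l ->
    (fun n => v (ct tx.1 n) (cx tx.2 n)) @ FF --> b.
  move=> [t x]/=; case: (boolP ((0 <= t <= tau) && (- l <= x <= l))) => [/andP[ht hx]|].
    have [b hb] := ultra_limit UF (fun n => vC _ _ (ct_in n ht) (cx_in n hx)).
    by exists b.
  by move=> h; exists 0 => ht hx; rewrite ht hx in h.
move=> /choice[V hV]; exists (fun t x => V (t, x)) => t x ht hx.
exact: (hV (t, x)).
Qed.

Lemma limit_fun_eq (v V : R -> R -> R) t x : limit_fun v V ->
  0 < t < tau -> - l < x < l ->
  (exists K b1 b2 : R, [/\ 0 < b1 <= 1, 0 < b2 <= 1 & forall n,
     `|v (ct t n) (cx x n) - v t x| <= K * (`|ct t n - t| `^ b1 + `|cx x n - x| `^ b2)]) -> V t x = v t x.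
Proof.
move=> hV ht hx [K [b1 [b2 [hb1 hb2 hK]]]].
have ht' : 0 <= t <= tau by case/andP: ht => *; rewrite !ltW.
have hx' : - l <= x <= l by case/andP: hx => *; rewrite !ltW.
have c1 : (fun n => `|ct t n - t|) @ FF --> `|t - t|.
  by apply: cvg_norm; apply: cvgB; [exact: cvg_ct|exact: cvg_cst].
have c2 : (fun n => `|cx x n - x|) @ FF --> `|x - x|.
  by apply: cvg_norm; apply: cvgB; [exact: cvg_cx|exact: cvg_cst].
have E : (fun n => K * (`|ct t n - t| `^ b1 + `|cx x n - x| `^ b2)) @ FF --> K * (`|t - t| `^ b1 + `|x - x| `^ b2).
  apply: cvgM; first exact: cvg_cst.
  by apply: cvgD; apply: cvg_powR.
have h1 : (fun n => `|v (ct t n) (cx x n) - v t x|) @ FF --> `|V t x - v t x|.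
  by apply: cvg_norm; apply: cvgB; [exact: hV|exact: cvg_cst].
have := @lim_le _ FF _ _ _ _ PF h1 E hK.
rewrite !subrr normr0 !powR0 ?addr0 ?mulr0; [|by case/andP: hb2 => h _; rewrite gt_eqF|by case/andP: hb1 => h _; rewrite gt_eqF].
by rewrite normr_le0 subr_eq0 => /eqP.
Qed.

Lemma cvg_diff_ct t s : (fun n => ct s n - ct t n) @ FF --> s - t.
Proof. by apply: cvgB; exact: cvg_ct. Qed.

Lemma cvg_diff_cx x y : (fun n => cx y n - cx x n) @ FF --> y - x.
Proof. by apply: cvgB; exact: cvg_cx. Qed.

Lemma cvg_powR_norm (q : nat -> R) (b r : R) : 0 < b <= 1 -> q @ FF --> r ->
  (fun n => `|q n| `^ b) @ FF --> `|r| `^ b.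
Proof. by move=> hb hq; apply: cvg_powR => //; exact: cvg_norm. Qed.

(** Each clause of [regular] is a non-strict inequality between values at finitely many points, so
    it passes to the limit along contracted points. In the interior the limits agree with the given
    functions by continuity. *)
Theorem open_regular_extension_aux : exists U P W Z, regular al l 0 tau C U P W Z /\
  forall t x, 0 < t < tau -> - l < x < l -> [/\ U t x = u t x, P t x = p t x, W t x = w t x & Z t x = z t x].
Proof.
have bd t x : 0 < t < tau -> - l < x < l -> [/\ `|u t x| <= C, `|p t x| <= C, `|w t x| <= C & `|z t x| <= C].
  move=> ht hx; have [l' [s0 [s1 [_ Hr h1 _ [h2 _]]]]] := open_regular_at H ht ht hx hx.
  exact: (rg_bd Hr).
have [U lU] := limit_fun_ex (fun t x ht hx => let: And4 h _ _ _ := bd t x ht hx in h).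
have [P lP] := limit_fun_ex (fun t x ht hx => let: And4 _ h _ _ := bd t x ht hx in h).
have [W lW] := limit_fun_ex (fun t x ht hx => let: And4 _ _ h _ := bd t x ht hx in h).
have [Z lZ] := limit_fun_ex (fun t x ht hx => let: And4 _ _ _ h := bd t x ht hx in h).
have al2 := half01 al01; have al1 : 0 < al <= 1 by case/andP: al01 => -> /ltW.
exists U, P, W, Z; split; first split.
- move=> t x ht hx.
  have b (v V : R -> R -> R) : limit_fun v V -> (forall t x, 0 < t < tau -> - l < x < l -> `|v t x| <= C) -> `|V t x| <= C.
    move=> lv vb; have h : (fun n => `|v (ct t n) (cx x n)|) @ FF --> `|V t x| by apply: cvg_norm; exact: lv.
    refine (@lim_le _ FF _ _ _ _ PF h (cvg_cst C) _) => n; apply: vb; [exact: ct_in|exact: cx_in].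
  by split; [apply: (b _ _ lU)|apply: (b _ _ lP)|apply: (b _ _ lW)|apply: (b _ _ lZ)] => t' x' ht' hx'; case: (bd t' x' ht' hx').
- move=> t s x y ht hs hx hy.
  refine (@lim_le _ FF (fun n => `|w (ct t n) (cx x n) - w (ct s n) (cx y n)|)
   (fun n => C * (`|ct t n - ct s n| `^ (al / 2) + `|cx x n - cx y n| `^ al)) _ _ PF _ _ _).
  + by apply: cvg_norm; apply: cvgB; exact: lW.
  + apply: cvgM; [exact: cvg_cst|].
    by apply: cvgD; apply: cvg_powR_norm => //; [exact: cvg_diff_ct|exact: cvg_diff_cx].
  + move=> n; have [l' [s0 [s1 [_ Hr h1 h2 [h3 h4]]]]] := open_regular_at H (ct_in n ht) (ct_in n hs) (cx_in n hx) (cx_in n hy).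
    exact: (rg_w Hr).
- move=> t s x y ht hs hx hy.
  refine (@lim_le _ FF (fun n => `|z (ct t n) (cx x n) - z (ct s n) (cx y n)|)
   (fun n => C * (`|ct t n - ct s n| `^ (al / 2) + `|cx x n - cx y n| `^ al)) _ _ PF _ _ _).
  + by apply: cvg_norm; apply: cvgB; exact: lZ.
  + apply: cvgM; [exact: cvg_cst|].
    by apply: cvgD; apply: cvg_powR_norm => //; [exact: cvg_diff_ct|exact: cvg_diff_cx].
  + move=> n; have [l' [s0 [s1 [_ Hr h1 h2 [h3 h4]]]]] := open_regular_at H (ct_in n ht) (ct_in n hs) (cx_in n hx) (cx_in n hy).
    exact: (rg_z Hr).
- move=> t x y ht hx hy; rewrite expr2.
  refine (@lim_le _ FF (fun n => `|u (ct t n) (cx y n) - u (ct t n) (cx x n) - (cx y n - cx x n) * p (ct t n) (cx x n)|)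
   (fun n => C * (`|cx y n - cx x n| * `|cx y n - cx x n|)) _ _ PF _ _ _).
  + apply: cvg_norm; apply: cvgB; first by apply: cvgB; exact: lU.
    by apply: cvgM; [exact: cvg_diff_cx|exact: lP].
  + apply: cvgM; [exact: cvg_cst|].
    by apply: cvgM; apply: cvg_norm; exact: cvg_diff_cx.
  + move=> n; have [l' [s0 [s1 [_ Hr h1 h2 [h3 h4]]]]] := open_regular_at H (ct_in n ht) (ct_in n ht) (cx_in n hx) (cx_in n hy).
    by rewrite -expr2; exact: (rg_ux Hr).
- move=> t x y ht hx hy.
  refine (@lim_le _ FF (fun n => `|p (ct t n) (cx y n) - p (ct t n) (cx x n) - (cx y n - cx x n) * w (ct t n) (cx x n)|)
   (fun n => C * (`|cx y n - cx x n| * `|cx y n - cx x n| `^ al)) _ _ PF _ _ _).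
  + apply: cvg_norm; apply: cvgB; first by apply: cvgB; exact: lP.
    by apply: cvgM; [exact: cvg_diff_cx|exact: lW].
  + apply: cvgM; [exact: cvg_cst|].
    by apply: cvgM; [apply: cvg_norm|apply: cvg_powR_norm => //]; exact: cvg_diff_cx.
  + move=> n; have [l' [s0 [s1 [_ Hr h1 h2 [h3 h4]]]]] := open_regular_at H (ct_in n ht) (ct_in n ht) (cx_in n hx) (cx_in n hy).
    exact: (rg_px Hr).
- move=> t s x ht hs hx.
  refine (@lim_le _ FF (fun n => `|u (ct s n) (cx x n) - u (ct t n) (cx x n) - (ct s n - ct t n) * z (ct t n) (cx x n)|)
   (fun n => C * (`|ct s n - ct t n| * `|ct s n - ct t n| `^ (al / 2))) _ _ PF _ _ _).
  + apply: cvg_norm; apply: cvgB; first by apply: cvgB; exact: lU.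
    by apply: cvgM; [exact: cvg_diff_ct|exact: lZ].
  + apply: cvgM; [exact: cvg_cst|].
    by apply: cvgM; [apply: cvg_norm|apply: cvg_powR_norm => //]; exact: cvg_diff_ct.
  + move=> n; have [l' [s0 [s1 [_ Hr h1 h2 [h3 h4]]]]] := open_regular_at H (ct_in n ht) (ct_in n hs) (cx_in n hx) (cx_in n hx).
    exact: (rg_ut Hr).
move=> t x ht hx.
have tm : 0 < tau / 2 < tau by rewrite divr_gt0// ltr_pdivrMr// mulr_natr mulr2n ltrDl tau0.
have xm : - l < 0 < l by rewrite oppr_lt0 l0.
have [l' [s0 [s1 [hl' Hr h1 h2 [h3 h4]]]]] := open_regular_at H ht tm hx xm.
have hc n : s0 <= ct t n <= s1 by exact: contraction_closed.
have hd n : - l' <= cx x n <= l' by exact: contraction_closed.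
have l'0 : 0 < l' by case/andP: hl'.
split.
- apply: (limit_fun_eq lU ht hx); exists (C * (2 + (s1 - s0) `^ (al / 2))), 1, 1.
  split; rewrite ?ltr01 ?lexx// => n; rewrite !powRr1//.
  exact: (regular_lipschitz al01 l'0 C0 Hr).
- pose K1 := C + C * (l' - - l') `^ al; pose K2 := 7 * C / Num.min 1 (l' / (1 + (s1 - s0))).
  have s01 : 0 <= s1 - s0 by rewrite subr_ge0; case/andP: h1 => /le_trans h /h.
  have K10 : 0 <= K1 by rewrite addr_ge0// mulr_ge0 ?powR_ge0.
  have K20 : 0 <= K2.
    apply: divr_ge0; first exact: mulr_ge0.
    by rewrite le_min ler01; exact: divr_ge0 (ltW l'0) (addr_ge0 ler01 s01).
  apply: (limit_fun_eq lP ht hx); exists (K1 + K2), ((1 + al) / 2), 1; split; rewrite ?ltr01 ?lexx//.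
    by have /andP[? ?] := al01; apply/andP; split; lra.
  move=> n; rewrite powRr1//.
  have g1 := gradient_time al01 l'0 C0 Hr (hc n) h1 h3.
  have g2 := taylor_lipschitz al0 C0 (fun y y' hy hy' => rg_px Hr (hc n) hy hy') h3 (hd n).
  have [_ _ g3 _] := rg_bd Hr (hc n) h3.
  have {}g2 : `|p (ct t n) (cx x n) - p (ct t n) x| <= K1 * `|cx x n - x|.
    by apply: (le_trans g2); rewrite ler_wpM2r// lerD2r.
  have -> : p (ct t n) (cx x n) - p t x = (p (ct t n) (cx x n) - p (ct t n) x) + (p (ct t n) x - p t x) by ring.
  apply: (le_trans (ler_normD _ _)); rewrite -/K2 in g1.
  exact: (sum_mul_bound K10 K20 (powR_ge0 _ _) (normr_ge0 _) g2 g1).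
- apply: (limit_fun_eq lW ht hx); exists C, (al / 2), al; split => // n.
  exact: (rg_w Hr).
- apply: (limit_fun_eq lZ ht hx); exists C, (al / 2), al; split => // n.
  exact: (rg_z Hr).
Qed.

End Extension.

Theorem open_regular_extension (tau C : R) u p w z : 0 < tau -> 0 <= C -> open_regular tau C u p w z ->
  exists U P W Z, regular al l 0 tau C U P W Z /\
  forall t x, 0 < t < tau -> - l < x < l -> [/\ U t x = u t x, P t x = p t x, W t x = w t x & Z t x = z t x].
Proof.
move=> tau0 C0 H; have [FF [UF FE]] := ultraFilterLemma (F := \oo%classic : set_system nat) _.
exact: (open_regular_extension_aux tau0 C0 H UF FE).
Qed.

Definition continuous_on (tau : R) (V : R -> R -> R) : Prop :=
  forall t x, 0 <= t <= tau -> - l <= x <= l -> forall e, 0 < e -> exists2 r, 0 < r &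
  forall s y, 0 <= s <= tau -> - l <= y <= l -> `|s - t| <= r -> `|y - x| <= r -> `|V s y - V t x| <= e.

Lemma holder_continuous_on (tau K b1 b2 : R) V : 0 < b1 -> 0 < b2 -> 0 <= K ->
  (forall t s x y, 0 <= t <= tau -> 0 <= s <= tau -> - l <= x <= l -> - l <= y <= l ->
    `|V t x - V s y| <= K * (`|t - s| `^ b1 + `|x - y| `^ b2)) -> continuous_on tau V.
Proof.
move=> b10 b20 K0 H t x ht hx e e0.
have e1 : 0 < e / (2 * (K + 1)) by rewrite divr_gt0// mulr_gt0// ltr_wpDl.
have [r1 r10 h1] := powR_small b10 e1; have [r2 r20 h2] := powR_small b20 e1.
exists (Num.min r1 r2); first by rewrite lt_min r10.
move=> s y hs hy; rewrite !le_min => /andP[g1 _] /andP[_ g2].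
apply: (le_trans (H s t y x hs ht hy hx)).
have k1 := h1 `|s - t|; rewrite normr_ge0 g1 in k1; have {}k1 := k1 isT.
have k2 := h2 `|y - x|; rewrite normr_ge0 g2 in k2; have {}k2 := k2 isT.
apply: (le_trans (ler_wpM2l K0 (lerD k1 k2))).
have -> : K * (e / (2 * (K + 1)) + e / (2 * (K + 1))) = e * (K / (K + 1)).
  by field; rewrite gt_eqF// ltr_wpDl.
by rewrite ler_piMr ?(ltW e0)// ler_pdivrMr ?ltr_wpDl// mul1r lerDl ler01.
Qed.

Lemma regular_continuous_on (tau C : R) u p w z : 0 <= tau -> 0 <= C -> regular al l 0 tau C u p w z ->
  [/\ continuous_on tau u, continuous_on tau p, continuous_on tau w & continuous_on tau z].
Proof.
move=> tau0 C0 H; have al20 : 0 < al / 2 by rewrite divr_gt0.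
have t00 : 0 <= tau - 0 by rewrite subr0.
split.
- apply: (@holder_continuous_on tau (C * (2 + (tau - 0) `^ (al / 2))) 1 1) => //.
    by rewrite mulr_ge0// addr_ge0 ?powR_ge0.
  move=> t s x y ht hs hx hy; rewrite !powRr1//.
  exact: (regular_lipschitz al01 l0 C0 H).
- pose K1 := C + C * (l - - l) `^ al; pose K2 := 7 * C / Num.min 1 (l / (1 + (tau - 0))).
  have K10 : 0 <= K1 by rewrite addr_ge0// mulr_ge0 ?powR_ge0.
  have K20 : 0 <= K2.
    apply: divr_ge0; first exact: mulr_ge0.
    by rewrite le_min ler01; exact: divr_ge0 (ltW l0) (addr_ge0 ler01 t00).
  apply: (@holder_continuous_on tau (K1 + K2) ((1 + al) / 2) 1) => //.
  + by rewrite divr_gt0// addr_gt0.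
  + exact: addr_ge0.
  move=> t s x y ht hs hx hy; rewrite powRr1//.
  have g1 := gradient_time al01 l0 C0 H ht hs hy.
  have g2 := taylor_lipschitz al0 C0 (fun y y' hy hy' => rg_px H ht hy hy') hy hx.
  have [_ _ g3 _] := rg_bd H ht hy.
  have {}g2 : `|p t x - p t y| <= K1 * `|x - y|.
    by apply: (le_trans g2); rewrite ler_wpM2r// lerD2r.
  have -> : p t x - p s y = (p t x - p t y) + (p t y - p s y) by ring.
  apply: (le_trans (ler_normD _ _)); rewrite -/K2 in g1.
  exact: (sum_mul_bound K10 K20 (powR_ge0 _ _) (normr_ge0 _) g2 g1).
- by apply: (@holder_continuous_on tau C (al / 2) al) => //; exact: (rg_w H).
- by apply: (@holder_continuous_on tau C (al / 2) al) => //; exact: (rg_z H).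
Qed.

Lemma Cyl_closure (tau t x : R) : 0 < tau -> 0 <= t <= tau -> - l <= x <= l ->
  closure (Cyl tau l) (t, x).
Proof.
move=> tau0 ht hx B nB.
have h : (fun n : nat => (t + harmonic n / 2 * (tau / 2 - t), x + harmonic n / 2 * (0 - x))) @ \oo --> (t, x).
  have hh (m y : R) : (fun n : nat => y + harmonic n / 2 * (m - y)) @ \oo --> y.
    have h0 : (fun n : nat => y + harmonic n / 2 * (m - y)) @ \oo --> y + 0 / 2 * (m - y).
      apply: cvgD; first exact: cvg_cst.
      apply: cvgM; last exact: cvg_cst.
      by apply: cvgM; [exact: cvg_harmonic|exact: cvg_cst].
    by rewrite mul0r mul0r addr0 in h0.
  exact: (cvg_pair (hh (tau / 2) t) (hh 0 x)).
have [n _ hn] := h B nB; have Bn := hn n (leqnn n).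
exists (t + harmonic n / 2 * (tau / 2 - t), x + harmonic n / 2 * (0 - x)); split => //.
by apply/CylE; split; [exact: ct_in|exact: cx_in].
Qed.

(** The extension V need only be known up to a time sigma > t, while [ext] refers to the whole
    cylinder: near (t, x) the two cylinders coincide. *)
Lemma ext_eq (tau sigma : R) (v V : R -> R -> R) t x : 0 < sigma <= tau -> continuous_on sigma V ->
  (forall s y, 0 < s < sigma -> - l < y < l -> V s y = v s y) ->
  0 <= t < sigma -> - l <= x <= l -> ext (Cyl tau l) v t x = V t x.
Proof.
move=> /andP[s0 st] cV Vv /andP[t0 ts] hx.
have tau0 := lt_le_trans s0 st.
have PFw : ProperFilter (within (Cyl tau l) (nbhs (t, x))).
  by apply: within_nbhs_proper; apply: Cyl_closure; rewrite ?t0 ?(le_trans (ltW ts)).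
apply: cvg_lim => //; apply/cvgrPdist_le => e e0.
have ht : 0 <= t <= sigma by rewrite t0 ltW.
have [r r0 Hr] := cV t x ht hx e e0.
rewrite near_withinE.
have m0 : 0 < Num.min r (sigma - t) by rewrite lt_min r0 subr_gt0.
have := nbhsx_ballx (t, x) _ m0; apply: filterS => -[s y] [/= b1 b2] /CylE[hs hy].
move: b1 b2; rewrite /ball/= => b1 b2.
have ss : 0 < s < sigma.
  case/andP: hs => -> _ /=; have := ler_norm (s - t); move: b1; rewrite distrC lt_min => /andP[_].
  lra.
rewrite -Vv// distrC; apply: Hr.
- by case/andP: ss => *; rewrite !ltW.
- by case/andP: hy => *; rewrite !ltW.
- by move: b1; rewrite distrC lt_min => /andP[/ltW].
- by move: b2; rewrite distrC lt_min => /andP[/ltW].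
Qed.

Lemma regular_is_derive (tau C : R) u p w z t x : 0 <= C -> regular al l 0 tau C u p w z ->
  0 < t < tau -> - l < x < l ->
  [/\ is_derive x (1 : R) (u t) (p t x), is_derive x (1 : R) (p t) (w t x) &
      is_derive t (1 : R) (fun s => u s x) (z t x)].
Proof.
move=> C0 H ht hx.
have ht' : 0 <= t <= tau by case/andP: ht => *; rewrite !ltW.
have hx' : - l <= x <= l by case/andP: hx => *; rewrite !ltW.
split.
- apply: (@taylor_is_derive R (- l) l C 1) => // y y' hy hy'.
  by rewrite powRr1// -expr2; exact: (rg_ux H).
- by apply: (@taylor_is_derive R (- l) l C al) => // y y' hy hy'; exact: (rg_px H).
- apply: (@taylor_is_derive R 0 tau C (al / 2) (fun s => u s x) (fun s => z s x)) => //.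
    by rewrite divr_gt0.
  by move=> s s' hs hs'; exact: (rg_ut H).
Qed.

Lemma near_interval (a b x : R) (Q : R -> Prop) : a < x < b -> (forall y, a < y < b -> Q y) ->
  \forall y \near x, Q y.
Proof.
move=> hx H; have := @near_in_itvoo R a b x; rewrite in_itv/= => /(_ hx).
by apply: filterS => y; rewrite in_itv/=; exact: H.
Qed.

(** The derivative of [Dx u] is that of p, since the two agree near x. *)
Lemma regular_derivatives (tau C : R) u p w z t x : 0 <= C -> regular al l 0 tau C u p w z ->
  0 < t < tau -> - l < x < l ->
  [/\ Dx u t x = p t x, Dx (Dx u) t x = w t x & Dt u t x = z t x] /\
  [/\ derivable (u t) x 1, derivable (Dx u t) x 1 & derivable (fun s => u s x) t 1].
Proof.
move=> C0 H ht hx.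
have dxE y : - l < y < l -> Dx u t y = p t y.
  by move=> hy; have [d _ _] := regular_is_derive C0 H ht hy; rewrite /Dx derive1E; exact: derive_val.
have [d1 d2 d3] := regular_is_derive C0 H ht hx.
have e : \forall y \near x, p t y = Dx u t y.
  by apply: near_interval hx _ => y hy; rewrite dxE.
have e' : \forall y \near x, Dx u t y = p t y.
  by apply: near_interval hx _ => y hy; rewrite dxE.
split; split.
- exact: dxE.
- by rewrite {1}/Dx derive1E (near_eq_derive _ e') ?oner_eq0//; exact: derive_val.
- by rewrite /Dt derive1E; exact: derive_val.
- exact: ex_derive.
- by apply: (near_eq_derivable e); exact: ex_derive.
- exact: ex_derive.
Qed.

(** The parts of the norm are read off from [regular], except the Holder seminorm of u_x in time,
    which is [gradient_time]. *)
Lemma regular_par_space (tau C : R) u p w z : 0 < tau -> 0 <= C -> regular al l 0 tau C u p w z ->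
  par_space 2 al tau l u.
Proof.
move=> tau0 C0 H.
have E t x ht hx := regular_derivatives (t := t) (x := x) C0 H ht hx.
have cl t : 0 < t < tau -> 0 <= t <= tau by move=> /andP[h1 h2]; rewrite !ltW.
have cx x : - l < x < l -> - l <= x <= l by move=> /andP[h1 h2]; rewrite !ltW.
split.
- move=> [|[|//]] t x _ /CylE[ht hx]; have [_ [h1 h2 _]] := E t x ht hx; [exact: h1|exact: h2].
- move=> j0 j t x hj /CylE[ht hx]; have [_ [_ _ h]] := E t x ht hx.
  have [-> ->] : j0 = 0%N /\ j = 0%N by move: hj; clear; lia.
  exact: h.
rewrite par_norm2E.
have K2 : exists K2, forall t s x, 0 < t < tau -> 0 < s < tau -> - l < x < l ->
    `|Dx u t x - Dx u s x| <= K2 * `|t - s| `^ ((1 + al) / 2).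
  exists (7 * C / Num.min 1 (l / (1 + (tau - 0)))) => t s x ht hs hx.
  have [[-> _ _] _] := E t x ht hx; have [[-> _ _] _] := E s x hs hx.
  exact: (gradient_time al01 l0 C0 H (cl _ ht) (cl _ hs) (cx _ hx)).
case: K2 => K2 HK2.
have bd t x ht hx := rg_bd H (cl t ht) (cx x hx).
have s1 : (supnorm (Cyl tau l) u <= C%:E)%E.
  by apply: supnorm_le => t x ht hx; case: (bd t x ht hx).
have s2 : (supnorm (Cyl tau l) (Dx u) <= C%:E)%E.
  by apply: supnorm_le => t x ht hx; have [[-> _ _] _] := E t x ht hx; case: (bd t x ht hx).
have s3 : (supnorm (Cyl tau l) (Dx (Dx u)) <= C%:E)%E.
  by apply: supnorm_le => t x ht hx; have [[_ -> _] _] := E t x ht hx; case: (bd t x ht hx).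
have s4 : (supnorm (Cyl tau l) (Dt u) <= C%:E)%E.
  by apply: supnorm_le => t x ht hx; have [[_ _ ->] _] := E t x ht hx; case: (bd t x ht hx).
have al2n : al / 2 != 0 by rewrite gt_eqF// divr_gt0.
have aln : al != 0 by rewrite gt_eqF.
have h1 : (holder_tx al tau l (Dx (Dx u)) <= (C + C)%:E)%E.
  rewrite EFinD; apply: leeD.
    apply: holder_t_le => t s x ht hs hx.
    have [[_ -> _] _] := E t x ht hx; have [[_ -> _] _] := E s x hs hx.
    by have := rg_w H (cl _ ht) (cl _ hs) (cx _ hx) (cx _ hx); rewrite (subrr x) normr0 (powR0 aln) addr0.
  apply: holder_x_le => t x y ht hx hy.
  have [[_ -> _] _] := E t x ht hx; have [[_ -> _] _] := E t y ht hy.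
  by have := rg_w H (cl _ ht) (cl _ ht) (cx _ hx) (cx _ hy); rewrite (subrr t) normr0 (powR0 al2n) add0r.
have h2 : (holder_tx al tau l (Dt u) <= (C + C)%:E)%E.
  rewrite EFinD; apply: leeD.
    apply: holder_t_le => t s x ht hs hx.
    have [[_ _ ->] _] := E t x ht hx; have [[_ _ ->] _] := E s x hs hx.
    by have := rg_z H (cl _ ht) (cl _ hs) (cx _ hx) (cx _ hx); rewrite (subrr x) normr0 (powR0 aln) addr0.
  apply: holder_x_le => t x y ht hx hy.
  have [[_ _ ->] _] := E t x ht hx; have [[_ _ ->] _] := E t y ht hy.
  by have := rg_z H (cl _ ht) (cl _ ht) (cx _ hx) (cx _ hy); rewrite (subrr t) normr0 (powR0 al2n) add0r.
have h3 : (holder_t ((1 + al) / 2) tau l (Dx u) <= K2%:E)%E by exact: holder_t_le.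
have := leeD (leeD (leeD (leeD s1 s2) s3) s4) (leeD (leeD h1 h2) h3).
by move=> /le_lt_trans; apply; rewrite -!EFinD ltry.
Qed.

Lemma par_norm_mono (sigma tau : R) u : 0 < sigma -> sigma <= tau ->
  (par_norm 2 al sigma l u <= par_norm 2 al tau l u)%E.
Proof.
move=> s0 st.
have sub (t : R) : `]0, sigma[%classic t -> `]0, tau[%classic t.
  by rewrite /= !in_itv/= => /andP[-> h]; exact: lt_le_trans st.
have m1 v : (supnorm (Cyl sigma l) v <= supnorm (Cyl tau l) v)%E.
  by apply: le_ereal_sup => _ [[t x] [/sub ht hx] <-]; exists (t, x).
have m2 be v : (holder_t be sigma l v <= holder_t be tau l v)%E.
  apply: ub_ereal_sup => _ [x hx <-]; apply: (@le_trans _ _ (holder be `]0, tau[%classic (fun t => v t x))).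
    by apply: le_ereal_sup => _ [[t s] [/sub ht /sub hs ts] <-]; exists (t, s).
  by apply: ereal_sup_ubound; exists x.
have m3 be v : (holder_x be sigma l v <= holder_x be tau l v)%E.
  by apply: le_ereal_sup => _ [t /sub ht <-]; exists t.
have m4 v : (holder_tx al sigma l v <= holder_tx al tau l v)%E by exact: leeD.
rewrite !par_norm2E; exact: (leeD (leeD (leeD (leeD (m1 _) (m1 _)) (m1 _)) (m1 _)) (leeD (leeD (m4 _) (m4 _)) (m2 _ _))).
Qed.

Lemma gradient_norm_mono (sigma tau : R) u : 0 < sigma -> sigma <= tau ->
  (supnorm (Cyl sigma l) u + supnorm (Cyl sigma l) (Dx u) + holder_tx al sigma l (Dx u) <=
   supnorm (Cyl tau l) u + supnorm (Cyl tau l) (Dx u) + holder_tx al tau l (Dx u))%E.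
Proof.
move=> s0 st.
have sub (t : R) : `]0, sigma[%classic t -> `]0, tau[%classic t.
  by rewrite /= !in_itv/= => /andP[-> h]; exact: lt_le_trans st.
have m1 v : (supnorm (Cyl sigma l) v <= supnorm (Cyl tau l) v)%E.
  by apply: le_ereal_sup => _ [[t x] [/sub ht hx] <-]; exists (t, x).
apply: leeD; [exact: leeD|apply: leeD].
  apply: ub_ereal_sup => _ [x hx <-]; apply: (@le_trans _ _ (holder (al / 2) `]0, tau[%classic (fun t => Dx u t x))).
    by apply: le_ereal_sup => _ [[t s] [/sub ht /sub hs ts] <-]; exists (t, s).
  by apply: ereal_sup_ubound; exists x.
by apply: le_ereal_sup => _ [t /sub ht <-]; exists t.
Qed.

End Bridge.

Lemma regular_congr {R : realType} (al l t0 t1 C : R) u p w z u' p' w' z' :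
  (forall t x, t0 <= t <= t1 -> - l <= x <= l -> [/\ u t x = u' t x, p t x = p' t x, w t x = w' t x & z t x = z' t x]) ->
  regular al l t0 t1 C u p w z -> regular al l t0 t1 C u' p' w' z'.
Proof.
move=> E H; split.
- by move=> t x ht hx; have [<- <- <- <-] := E t x ht hx; exact: (rg_bd H).
- move=> t s x y ht hs hx hy; have [_ _ <- _] := E t x ht hx; have [_ _ <- _] := E s y hs hy; exact: (rg_w H).
- move=> t s x y ht hs hx hy; have [_ _ _ <-] := E t x ht hx; have [_ _ _ <-] := E s y hs hy; exact: (rg_z H).
- move=> t x y ht hx hy; have [<- <- _ _] := E t x ht hx; have [<- _ _ _] := E t y ht hy; exact: (rg_ux H).
- move=> t x y ht hx hy; have [_ <- <- _] := E t x ht hx; have [_ <- _ _] := E t y ht hy; exact: (rg_px H).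
- move=> t s x ht hs hx; have [<- _ _ <-] := E t x ht hx; have [<- _ _ _] := E s x hs hx; exact: (rg_ut H).
Qed.

Lemma solves_congr {R : realType} (l t0 t1 : R) a f ph u0 u p w z u' p' w' z' : t0 <= t1 -> 0 < l ->
  (forall t x, t0 <= t <= t1 -> - l <= x <= l -> [/\ u t x = u' t x, p t x = p' t x, w t x = w' t x & z t x = z' t x]) ->
  @solves R l t0 t1 a f ph u0 u p w z -> solves l t0 t1 a f ph u0 u' p' w' z'.
Proof.
move=> t01 l0 E [H1 H2 H3]; split.
- by move=> t x ht hx; have [<- <- <- <-] := E t x ht hx; exact: H1.
- move=> s t hs ht; have hx := sign_end_in l0 hs.
  by have [<- <- _ <-] := E t _ ht hx; exact: H2.
- by move=> x hx; have [<- _ _ _] := E t0 x ltac:(by rewrite lexx) hx; exact: H3.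
Qed.

(** The end condition solved for u_t. *)
Definition flux {R : realType} (l : R) (b g : R -> R -> R -> R -> R) (s t z p : R) : R :=
  g t (s * l) z p - s * b t (s * l) z p * p.

(** The counterpart of [is_solution] in terms of expansions. The constant may grow as sigma
    approaches tau; p, w and z are carried along because they have values on the boundary. *)
Definition solution {R : realType} (al l : R) (a f ph : R -> R -> R -> R -> R) (u0 : R -> R) (tau : R)
    (u p w z : R -> R -> R) : Prop :=
  forall sigma, 0 < sigma < tau -> exists2 C, 0 <= C &
    regular al l 0 sigma C u p w z /\ solves l 0 sigma a f ph u0 u p w z.

(** * Equivalence of the two notions of solution *)

Section Equivalence.
Context {R : realType}.
Variables (al l T : R) (a f b g : R -> R -> R -> R -> R) (u0 : R -> R).
Hypothesis al01 : 0 < al < 1.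
Hypothesis l0 : 0 < l.
Let ph := flux l b g.

Lemma ends_mem (s : R) : s \in [:: 1; -1] <-> s = 1 \/ s = -1.
Proof. by rewrite !inE; split => [/orP[/eqP|/eqP]|[->|->]]; [left|right| |]; rewrite ?eqxx ?orbT. Qed.

Lemma solution_ext (tau : R) u p w z : solution al l a f ph u0 tau u p w z ->
  forall t x, 0 <= t < tau -> - l <= x <= l ->
  [/\ ext (Cyl tau l) u t x = u t x, ext (Cyl tau l) (Dx u) t x = p t x,
      ext (Cyl tau l) (Dx (Dx u)) t x = w t x & ext (Cyl tau l) (Dt u) t x = z t x].
Proof.
move=> H t x /andP[t0 tt] hx.
pose sg := (t + tau) / 2.
have sg0 : 0 < sg < tau by rewrite /sg; apply/andP; split; lra.
have [C C0 [Hr _]] := H sg sg0; have /andP[g1 g2] := sg0.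
have [c1 c2 c3 c4] := regular_continuous_on al01 l0 (ltW g1) C0 Hr.
have st : 0 < sg <= tau by rewrite g1 ltW.
have ts : 0 <= t < sg by rewrite t0 /sg; lra.
have E s y hs hy := regular_derivatives al01 (t := s) (x := y) C0 Hr hs hy.
split; apply: (ext_eq l0 st _ _ ts hx) => // s y hs hy; by have [[h1 h2 h3] _] := E s y hs hy.
Qed.

Lemma solution_is_solution (tau : R) u p w z : solution al l a f ph u0 tau u p w z -> 0 < tau ->
  is_solution l al a f b g u0 tau u.
Proof.
move=> H tau0; have EX := solution_ext H.
split.
- move=> sg hsg; have [C C0 [Hr _]] := H sg hsg; have /andP[g1 _] := hsg.
  exact: regular_par_space Hr.
- move=> t x /CylE[/andP[t1 t2] hx].
  pose sg := (t + tau) / 2.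
  have sg0 : 0 < sg < tau by rewrite /sg; apply/andP; split; lra.
  have ts : 0 < t < sg by rewrite t1 /sg; lra.
  have [C C0 [Hr [Hs _ _]]] := H sg sg0.
  have [[-> -> ->] _] := regular_derivatives al01 C0 Hr ts hx.
  rewrite Hs; first by ring.
    by case/andP: ts => *; rewrite !ltW.
  by case/andP: hx => *; rewrite !ltW.
- move=> s t /ends_mem hs /andP[t1 t2] x.
  have hx : - l <= x <= l := sign_end_in l0 hs.
  pose sg := (t + tau) / 2.
  have sg0 : 0 < sg < tau by rewrite /sg; apply/andP; split; lra.
  have ts : 0 <= t <= sg by rewrite /sg; apply/andP; split; lra.
  have [C C0 [Hr [_ Hs _]]] := H sg sg0.
  have [-> -> _ ->] := EX t x ltac:(by rewrite (ltW t1) t2) hx.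
  by rewrite /x Hs// /ph /flux subrK.
- move=> x hx.
  have [-> _ _ _] := EX 0 x ltac:(by rewrite lexx tau0) hx.
  have sg0 : 0 < tau / 2 < tau by apply/andP; split; lra.
  by have [C C0 [Hr [_ _ Hs]]] := H (tau / 2) sg0; exact: Hs.
Qed.

Lemma continuous_on_cvg (tau : R) V (FF : set_system nat) (tn xn : nat -> R) t x : Filter FF ->
  continuous_on l tau V -> 0 <= t <= tau -> - l <= x <= l ->
  (forall n, 0 <= tn n <= tau) -> (forall n, - l <= xn n <= l) ->
  tn @ FF --> t -> xn @ FF --> x -> (fun n => V (tn n) (xn n)) @ FF --> V t x.
Proof.
move=> FFF cV ht hx htn hxn /cvgrPdist_le ct /cvgrPdist_le cx; apply/cvgrPdist_le => e e0.
have [r r0 Hr] := cV t x ht hx e e0.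
move: (ct r r0) (cx r r0); apply: filterS2 => n h1 h2.
by rewrite distrC; apply: Hr => //; rewrite distrC.
Qed.

Hypothesis HP : forall Rb, exists kap0 kap1 Lam, problem al l T Rb kap0 kap1 Lam a f ph.

(** On each shorter cylinder the norm is finite, so v extends regularly to the closure; the
    extension is [ext], hence independent of that cylinder. The equation reaches the ends and the
    initial time along contracted points, and the end condition reaches t = 0 as a limit in time. *)
Lemma is_solution_solution (tau : R) v : 0 < tau <= T -> is_solution l al a f b g u0 tau v ->
  exists u p w z, solution al l a f ph u0 tau u p w z /\
    forall t x, Cyl tau l (t, x) -> v t x = u t x.
Proof.
move=> /andP[tau0 tauT] [Hspace Hpde Hbc Hini].
pose bar := ext (Cyl tau l).
have step sigma : 0 < sigma < tau -> exists C U P W Z, [/\ 0 <= C, regular al l 0 sigma C U P W Z,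
    forall t x, 0 < t < sigma -> - l < x < l -> [/\ U t x = v t x, P t x = Dx v t x, W t x = Dx (Dx v) t x & Z t x = Dt v t x] &
    forall t x, 0 <= t < sigma -> - l <= x <= l -> [/\ U t x = bar v t x, P t x = bar (Dx v) t x, W t x = bar (Dx (Dx v)) t x & Z t x = bar (Dt v) t x]].
  move=> hs; have [s0 st] := andP hs.
  have [d1 d2 Hn] := Hspace sigma hs.
  have Hpar : par_space 2 al sigma l v by [].
  have n0 := par_norm2_ge0 s0 l0 al v.
  pose M := fine (par_norm 2 al sigma l v).
  have HM : par_norm 2 al sigma l v = M%:E by rewrite fineK// ge0_fin_numE.
  have M0 : 0 <= M by rewrite -lee_fin -HM.
  have Ho := par_open_regular al01 l0 s0 Hpar (_ : (par_norm 2 al sigma l v <= M%:E)%E).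
  rewrite HM lexx in Ho.
  have [U [P [W [Z [Hr E]]]]] := open_regular_extension al01 l0 s0 M0 (Ho isT).
  exists M, U, P, W, Z; split => // t x ht hx.
  have [c1 c2 c3 c4] := regular_continuous_on al01 l0 (ltW s0) M0 Hr.
  have st' : 0 < sigma <= tau by rewrite s0 ltW.
  by split; apply/esym; apply: (ext_eq l0 st' _ _ ht hx) => // s y hs' hy; have [] := E s y hs' hy.
exists (bar v), (bar (Dx v)), (bar (Dx (Dx v))), (bar (Dt v)); split; last first.
  move=> t x /CylE[/andP[t1 t2] hx].
  have hs : 0 < (t + tau) / 2 < tau by apply/andP; split; lra.
  have [C [U [P [W [Z [_ _ E1 E2]]]]]] := step _ hs.
  have [<- _ _ _] := E1 t x ltac:(by apply/andP; split; lra) hx.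
  have [-> //] := E2 t x ltac:(by apply/andP; split; lra) ltac:(by case/andP: hx => *; rewrite !ltW).
move=> sigma hs0; have [s0 st] := andP hs0.
(* A slightly longer cylinder, because [ext] is identified only strictly before the final time. *)
pose sg := (sigma + tau) / 2.
have ssg : sigma < sg by rewrite /sg; lra.
have hs : 0 < sg < tau by rewrite /sg; apply/andP; split; lra.
have [C [U [P [W [Z [C0 Hr E1 E2]]]]]] := step _ hs.
exists C => //.
have inc t : 0 <= t <= sigma -> 0 <= t < sg by move=> /andP[-> h]; exact: le_lt_trans ssg.
have inc' t : 0 <= t < sg -> 0 <= t <= sg by move=> /andP[-> h]; rewrite ltW.
have Eq t x : 0 <= t <= sigma -> - l <= x <= l ->
   [/\ U t x = bar v t x, P t x = bar (Dx v) t x, W t x = bar (Dx (Dx v)) t x & Z t x = bar (Dt v) t x].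
  by move=> /inc ht hx; exact: E2.
split; first by apply: (regular_congr Eq); apply: (regular_weaken Hr); rewrite ?lexx ?ltW.
have sg0 : 0 < sg by case/andP: hs.
have sgT : sg <= T by case/andP: hs => _ h; rewrite (le_trans (ltW h)).
have [c1 c2 c3 c4] := regular_continuous_on al01 l0 (ltW sg0) C0 Hr.
have [kap0 [kap1 [Lam PC]]] := HP C.
have [FF [UF FE]] := ultraFilterLemma (F := \oo%classic : set_system nat) _.
have PF : ProperFilter FF := @ultra_proper _ _ UF.
have inT t : 0 <= t <= sg -> 0 <= t <= T by move=> /andP[-> h]; exact: le_trans sgT.
apply: (solves_congr (ltW s0) l0 Eq); split.
- move=> t x /inc/inc' ht hx.
  pose tn n := t + harmonic n / 2 * (sg / 2 - t); pose xn n := x + harmonic n / 2 * (0 - x).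
  have tnin n : 0 < tn n < sg := ct_in sg0 n ht.
  have xnin n : - l < xn n < l := cx_in l0 n hx.
  have ctn : tn @ FF --> t by exact: (cvg_contraction UF FE).
  have cxn : xn @ FF --> x by exact: (cvg_contraction UF FE).
  have tnin' n : 0 <= tn n <= sg by case/andP: (tnin n) => *; rewrite !ltW.
  have xnin' n : - l <= xn n <= l by case/andP: (xnin n) => *; rewrite !ltW.
  have lim V : continuous_on l sg V -> (fun n => V (tn n) (xn n)) @ FF --> V t x.
    by move=> cV; exact: (continuous_on_cvg _ cV ht hx tnin' xnin' ctn cxn).
  have bU s y hs' hy := rg_bd Hr (t := s) (x := y) hs' hy.
  have cA (k : R -> R -> R -> R -> R) : (forall t s x y z z' p p', 0 <= t <= T -> 0 <= s <= T -> - l <= x <= l ->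
    - l <= y <= l -> `|z| <= C -> `|z'| <= C -> `|p| <= C -> `|p'| <= C ->
    `|k t x z p - k s y z' p'| <=
      Lam * (`|t - s| `^ (al / 2) + `|x - y| `^ al + `|z - z'| + `|p - p'|)) ->
    (fun n => k (tn n) (xn n) (U (tn n) (xn n)) (P (tn n) (xn n))) @ FF --> k t x (U t x) (P t x).
    move=> kL; apply: (cvg_coef PC UF ctn cxn (lim _ c1) (lim _ c2)) => n.
    have [b1 b2 _ _] := bU _ _ (tnin' n) (xnin' n); have [b3 b4 _ _] := bU _ _ ht hx.
    by apply: kL => //; apply: inT.
  have h : (fun n => Z (tn n) (xn n)) @ FF --> a t x (U t x) (P t x) * W t x + f t x (U t x) (P t x).
    have -> : (fun n => Z (tn n) (xn n)) = (fun n => a (tn n) (xn n) (U (tn n) (xn n)) (P (tn n) (xn n)) * W (tn n) (xn n)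
       + f (tn n) (xn n) (U (tn n) (xn n)) (P (tn n) (xn n))).
      apply/funext => n; have [-> -> -> ->] := E1 _ _ (tnin n) (xnin n).
      have hc : Cyl tau l (tn n, xn n).
        apply/CylE; split => //; case/andP: (tnin n) => -> g1 /=; case/andP: hs => _; exact: lt_trans.
      by rewrite -(Hpde _ _ hc) addrC subrK.
    by apply: cvgD; [apply: cvgM; [exact: cA (pr_a PC)|exact: lim]|exact: cA (pr_f PC)].
  exact: (cvg_unique _ (lim _ c4) h).
- move=> s t hs1 /inc ht.
  have hx := sign_end_in l0 hs1.
  have pos t' : 0 < t' < sg -> Z t' (s * l) = ph s t' (U t' (s * l)) (P t' (s * l)).
    move=> /andP[g1 g2]; have [-> -> _ ->] := E2 t' (s * l) ltac:(by rewrite (ltW g1) g2) hx.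
    have hmem : s \in [:: 1; -1] by apply/ends_mem.
    have := Hbc s t' hmem ltac:(by rewrite g1; case/andP: hs => _; exact: lt_trans).
    by rewrite /= -/bar /ph /flux => <-; rewrite addrK.
  have [t0|tpos] := eqVneq t 0; last first.
    by apply: pos; case/andP: ht => g1 ->; rewrite lt_neqAle eq_sym tpos g1.
  rewrite t0; have h0 : (0 : R) <= 0 <= sg by rewrite lexx ltW.
  pose tn n := 0 + harmonic n / 2 * (sg / 2 - 0).
  have tnin n : 0 < tn n < sg := ct_in sg0 n h0.
  have ctn : tn @ FF --> (0 : R) by exact: (cvg_contraction UF FE).
  have tnin' n : 0 <= tn n <= sg by case/andP: (tnin n) => *; rewrite !ltW.
  have lim V : continuous_on l sg V -> (fun n => V (tn n) (s * l)) @ FF --> V 0 (s * l).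
    move=> cV; apply: (continuous_on_cvg (xn := fun=> s * l) _ cV h0 hx tnin' _ ctn) => //.
    exact: cvg_cst.
  have h : (fun n => Z (tn n) (s * l)) @ FF --> ph s 0 (U 0 (s * l)) (P 0 (s * l)).
    have -> : (fun n => Z (tn n) (s * l)) = (fun n => ph s (tn n) (U (tn n) (s * l)) (P (tn n) (s * l))).
      by apply/funext => n; exact: pos.
    apply: (cvg_coef PC UF ctn (@cvg_cst _ (0 : R) _ FF _) (lim _ c1) (lim _ c2)) => n.
    have [b1 b2 _ _] := rg_bd Hr (tnin' n) hx; have [b3 b4 _ _] := rg_bd Hr h0 hx.
    rewrite (subrr (0 : R)) normr0 (powR0 (_ : al != 0)) ?addr0; last by case/andP: al01 => ? _; rewrite gt_eqF.
    by apply: (pr_ph PC) => //; apply: inT.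
  exact: (cvg_unique _ (lim _ c4) h).
- move=> x hx; have [-> _ _ _] := E2 0 x ltac:(by rewrite lexx sg0) hx.
  exact: Hini.
Qed.

End Equivalence.

(** * Coefficients of class C^2 *)

Section Segments.
Context {R : realType} {V : normedModType R}.
Variables (D : set V) (v x : V) (F : V -> R) (a b : R).
Hypothesis segD : forall r, a <= r <= b -> D (r *: v + x).

(** Strictly inside the segment small increments stay in D, so the relative derivative is an
    ordinary one. *)
Lemma segment_is_derive r : (forall y, D y -> derivable_in D v F y) -> a < r < b ->
  is_derive r (1 : R) (fun r => F (r *: v + x)) (derive_in D v F (r *: v + x)).
Proof.
move=> dF /andP[ar rb].
have Dr : D (r *: v + x) by apply: segD; rewrite !ltW.
have h := dF _ Dr; rewrite /derivable_in in h.
have near0 : \forall h \near (0 : R)^', D (h *: v + (r *: v + x)).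
  have m0 : 0 < Num.min (r - a) (b - r) by rewrite lt_min !subr_gt0 ar.
  have := dnbhs0_lt (V := R) m0; apply: filterS => k; rewrite lt_min ltr_norml => /andP[/andP[k1 k2]].
  rewrite ltr_norml => /andP[k3 k4].
  by rewrite addrA -scalerDl; apply: segD; apply/andP; split; lra.
have sub : (0 : R)^' `=>` within [set h : R | D (h *: v + (r *: v + x))] (0 : R)^'.
  by move=> A; rewrite /within/= => HA; move: near0 HA; apply: filterS2 => k h1; apply.
have cv : (fun k : R => k^-1 * (F (k *: v + (r *: v + x)) - F (r *: v + x))) @ (0 : R)^' -->
    derive_in D v F (r *: v + x).
  have h' : (fun k : R => k^-1 * (F (k *: v + (r *: v + x)) - F (r *: v + x))) @ within [set h : R | D (h *: v + (r *: v + x))] (0 : R)^' -->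
    derive_in D v F (r *: v + x) by exact: h.
  by move=> A /h' /sub.
have E : (fun k : R => k^-1 *: (F ((k *: (1 : R) + r) *: v + x) - F (r *: v + x))) @ (0 : R)^' -->
    derive_in D v F (r *: v + x).
  have -> // : (fun k : R => k^-1 *: (F ((k *: (1 : R) + r) *: v + x) - F (r *: v + x))) =
     (fun k : R => k^-1 * (F (k *: v + (r *: v + x)) - F (r *: v + x))).
  by apply/funext => k; rewrite addrA -scalerDl /GRing.scale/= mulr1.
by apply: DeriveDef; [apply/cvg_ex; exists (derive_in D v F (r *: v + x)); exact: E|exact: cvg_lim].
Qed.

Lemma segment_continuous : {within D, continuous F} -> {within `[a, b], continuous (fun r => F (r *: v + x))}.
Proof.
move=> cF; apply/subspace_continuousP => r /=; rewrite in_itv/= => hr.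
have Dr := segD hr.
have /subspace_continuousP hc := cF; have := hc _ Dr.
have c0 : (fun r : R => r *: v + x) @ nbhs r --> r *: v + x.
  by apply: cvgD; [apply: cvgZl; exact: cvg_id|exact: cvg_cst].
move=> h A /h HA; have {}HA : \forall y \near r *: v + x, D y -> A (F y) by exact: HA.
have {}HA := c0 _ HA.
have {}HA : \forall s \near r, D (s *: v + x) -> A (F (s *: v + x)) by exact: HA.
rewrite /nbhs/= /within/=; apply: (@filterS R (nbhs r) _ _ _ _ HA) => s hs /=.
by rewrite in_itv/= => /segD /hs.
Qed.

Lemma segment_mvt : {within D, continuous F} -> (forall y, D y -> derivable_in D v F y) -> a <= b ->
  exists2 c, a <= c <= b & F (b *: v + x) - F (a *: v + x) = (b - a) * derive_in D v F (c *: v + x).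
Proof.
move=> cF dF ab.
have d r : r \in `]a, b[ -> is_derive r (1 : R) (fun r => F (r *: v + x)) (derive_in D v F (r *: v + x)).
  by rewrite in_itv/= => hr; exact: segment_is_derive.
have [c] := MVT_segment ab d (segment_continuous cF).
by rewrite in_itv/= => hc e; exists c => //; rewrite e mulrC.
Qed.

End Segments.

Section Compactness.
Context {R : realType} {T : topologicalType}.
Variables (D K : set T) (G : T -> R).
Hypothesis cG : {within D, continuous G}.
Hypothesis KD : K `<=` D.
Hypothesis cK : compact K.
Hypothesis K0 : K !=set0.

Lemma compact_bound : exists2 L, 0 <= L & forall y, K y -> `|G y| <= L.
Proof.
have cG' : {within K, continuous G} := continuous_subspaceW KD cG.
have [m1 _ h1] := compact_EVT_max K0 cK cG'.
have [m2 _ h2] := compact_EVT_min K0 cK cG'.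
exists (`|G m1| + `|G m2|) => [|y Ky]; first by rewrite addr_ge0.
have := h1 y; rewrite inE => /(_ Ky) g1; have := h2 y; rewrite inE => /(_ Ky) g2.
have := ler_norm (G m1); have := ler_norm (- G m2); rewrite normrN => n2 n1.
have := normr_ge0 (G m1); have := normr_ge0 (G m2) => p2 p1.
by rewrite ler_norml; apply/andP; split; lra.
Qed.

Lemma compact_positive : (forall y, K y -> 0 < G y) -> exists2 k, 0 < k & forall y, K y -> k <= G y.
Proof.
move=> pos; have cG' : {within K, continuous G} := continuous_subspaceW KD cG.
have [m + h] := compact_EVT_min K0 cK cG'; rewrite inE => Km.
by exists (G m) => [|y Ky]; [exact: pos|apply: h; rewrite inE].
Qed.

End Compactness.

Section Boxes.
Context {R : realType} {n : nat}.
Variables (lo hi : 'I_n -> R) (D : set 'rV[R]_n) (F : 'rV[R]_n -> R).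

Definition box : set 'rV[R]_n := [set v | forall i, `[lo i, hi i]%classic (v 0 i)].

Hypothesis lohi : forall i, lo i <= hi i.
Hypothesis boxD : box `<=` D.
Hypothesis F2 : Ck 2 (@coords R n) D F.

Lemma box_compact : compact box.
Proof. by apply: (@rV_compact R n (fun i => `[lo i, hi i]%classic)) => i; exact: segment_compact. Qed.

Lemma box_nonempty : box !=set0.
Proof. by exists (\row_i lo i) => i /=; rewrite mxE in_itv/= lexx lohi. Qed.

(** Only one coordinate varies, so the mean value theorem is used on a segment parallel to an axis;
    the partial derivatives are bounded on the compact box. *)
Lemma box_lipschitz : exists2 L, 0 <= L & forall i (v w : 'rV[R]_n), box v -> box w ->
  (forall j, j != i -> v 0 j = w 0 j) -> `|F v - F w| <= L * `|v 0 i - w 0 i|.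
Proof.
have [cF dF] := F2.
have Li (i : 'I_n) : exists2 L, 0 <= L & forall y, box y -> `|derive_in D (delta_mx 0 i : 'rV[R]_n) F y| <= L.
  have [_ [cd _]] := dF (delta_mx 0 i) (ex_intro2 _ _ i I erefl).
  exact: (compact_bound cd boxD box_compact box_nonempty).
have /choice[L HL] : forall i : 'I_n, exists L, 0 <= L /\ forall y, box y -> `|derive_in D (delta_mx 0 i : 'rV[R]_n) F y| <= L.
  by move=> i; have [L h1 h2] := Li i; exists L.
exists (\sum_i L i) => [|i v w bv bw vw]; first by apply: sumr_ge0 => i _; case: (HL i).
have LL : L i <= \sum_i L i.
  by rewrite (bigD1 i)//= lerDl sumr_ge0// => j _; case: (HL j).
apply: (@le_trans _ _ (L i * `|v 0 i - w 0 i|)); last by rewrite ler_wpM2r.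
wlog vwi : v w bv bw vw / v 0 i <= w 0 i.
  move=> W; case: (leP (v 0 i) (w 0 i)) => h; first exact: W.
  by rewrite distrC [`|v 0 i - _|]distrC; apply: W => // [j /vw //|]; exact: ltW.
pose x := v - v 0 i *: delta_mx 0 i.
have xE (r : R) j : (r *: delta_mx 0 i + x) 0 j = if j == i then r else v 0 j.
  rewrite /x !mxE eqxx/=; case: eqVneq => [->|_]; first by rewrite !mulr1 subrr addr0.
  by rewrite !mulr0 subr0 add0r.
have vE : v = v 0 i *: delta_mx 0 i + x by rewrite /x subrKC.
have wE : w = w 0 i *: delta_mx 0 i + x.
  by apply/rowP => j; rewrite xE; case: eqVneq => [->//|ji]; rewrite vw.
have seg r : v 0 i <= r <= w 0 i -> box (r *: delta_mx 0 i + x).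
  move=> /andP[h1 h2] j; rewrite xE; case: eqVneq => [->|_]; last exact: bv.
  have := bv i; have := bw i; rewrite /= !in_itv/= => /andP[_ g2] /andP[g1 _].
  by rewrite (le_trans g1)// (le_trans h2).
have [dF1 _] := dF (delta_mx 0 i) (ex_intro2 _ _ i I erefl).
have [c hc e] := segment_mvt (fun r hr => boxD (seg r hr)) cF dF1 vwi.
rewrite -wE -vE in e; rewrite distrC e normrM mulrC (distrC (v 0 i)) ler_wpM2r//.
by case: (HL i) => _; apply; exact: seg.
Qed.

End Boxes.

Section Coefficients.
Context {R : realType}.

Definition row4 (t x z p : R) : 'rV[R]_4 := \row_(i < 4) nth 0 [:: t; x; z; p] i.
Definition row3 (t z p : R) : 'rV[R]_3 := \row_(i < 3) nth 0 [:: t; z; p] i.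

(** The unbounded variables are confined to [-|Rb|, |Rb|], an interval that is nonempty for every
    Rb, and the arguments are changed one at a time inside the box. *)
Lemma C2_4_lipschitz (T l Rb : R) (F : R -> R -> R -> R -> R) : 0 < T -> 0 < l ->
  C2_4 `[0, T] `[- l, l] setT setT F ->
  exists2 L, 0 <= L & forall t s x y z z' p p', 0 <= t <= T -> 0 <= s <= T -> - l <= x <= l ->
    - l <= y <= l -> `|z| <= Rb -> `|z'| <= Rb -> `|p| <= Rb -> `|p'| <= Rb ->
    `|F t x z p - F s y z' p'| <= L * (`|t - s| + `|x - y| + `|z - z'| + `|p - p'|) /\ `|F t x z p| <= L.
Proof.
move=> T0 l0 HF; pose r : R := `|Rb|.
pose lo (i : 'I_4) := nth 0 [:: 0; - l; - r; - r] i; pose hi (i : 'I_4) := nth 0 [:: T; l; r; r] i.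
have r0 : - r <= r by rewrite -subr_ge0 opprK addr_ge0 ?normr_ge0.
have lohi i : lo i <= hi i.
  by case: i => -[|[|[|[|//]]]] ?; rewrite /lo /hi/= ?(ltW T0)// -subr_ge0 opprK addr_ge0 ?(ltW l0).
have boxD : box lo hi `<=` [set v | [/\ `[0, T]%classic (v 0 0), `[- l, l]%classic (v 0 1), setT (v 0 2) & setT (v 0 3)]].
  by move=> v bv; split => //; [exact: (bv 0)|exact: (bv 1)].
have [L L0 HL] := box_lipschitz lohi boxD HF.
have [M M0 HM] := compact_bound (HF.1) boxD (@box_compact R 4 lo hi) (box_nonempty lohi).
have inb t x z p : 0 <= t <= T -> - l <= x <= l -> `|z| <= Rb -> `|p| <= Rb -> box lo hi (row4 t x z p).
  move=> ht hx hz hp; have zr q : `|q| <= Rb -> - r <= q <= r.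
    by move=> hq; rewrite -ler_norml (le_trans hq)// ler_norm.
  by case=> -[|[|[|[|//]]]] ?; rewrite /= in_itv/= mxE /lo /hi/= ?zr.
have E t x z p : (fun v : 'rV[R]_4 => F (v 0 0) (v 0 1) (v 0 2) (v 0 3)) (row4 t x z p) = F t x z p.
  by rewrite /row4 !mxE.
exists (L + M) => [|t s x y z z' p p' ht hs hx hy hz hz' hp hp']; first exact: addr_ge0.
split; last first.
  by have := HM _ (inb t x z p ht hx hz hp); rewrite E => /le_trans; apply; rewrite lerDr.
have step (i : 'I_4) v w := HL i v w.
have s1 : `|F t x z p - F s x z p| <= L * `|t - s|.
  have := step 0 _ _ (inb t x z p ht hx hz hp) (inb s x z p hs hx hz hp).
  rewrite !E !mxE/=; apply=> -[[|[|[|[|//]]]] ?] //= _; by rewrite !mxE.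
have s2 : `|F s x z p - F s y z p| <= L * `|x - y|.
  have := step 1 _ _ (inb s x z p hs hx hz hp) (inb s y z p hs hy hz hp).
  rewrite !E !mxE/=; apply=> -[[|[|[|[|//]]]] ?] //= _; by rewrite !mxE.
have s3 : `|F s y z p - F s y z' p| <= L * `|z - z'|.
  have := step 2 _ _ (inb s y z p hs hy hz hp) (inb s y z' p hs hy hz' hp).
  rewrite !E !mxE/=; apply=> -[[|[|[|[|//]]]] ?] //= _; by rewrite !mxE.
have s4 : `|F s y z' p - F s y z' p'| <= L * `|p - p'|.
  have := step 3 _ _ (inb s y z' p hs hy hz' hp) (inb s y z' p' hs hy hz' hp').
  rewrite !E !mxE/=; apply=> -[[|[|[|[|//]]]] ?] //= _; by rewrite !mxE.
have -> : F t x z p - F s y z' p' = (F t x z p - F s x z p) + (F s x z p - F s y z p) +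
  (F s y z p - F s y z' p) + (F s y z' p - F s y z' p') by ring.
apply: (@le_trans _ _ (L * (`|t - s| + `|x - y| + `|z - z'| + `|p - p'|))); last first.
  by rewrite ler_wpM2r ?addr_ge0// lerDl.
rewrite !mulrDr; do 3 (apply: (le_trans (ler_normD _ _)); apply: lerD => //).
Qed.

Lemma C2_4_positive (T l Rb : R) (F : R -> R -> R -> R -> R) : 0 < T -> 0 < l ->
  C2_4 `[0, T] `[- l, l] setT setT F ->
  (forall t x z p, 0 <= t <= T -> - l <= x <= l -> 0 < F t x z p) ->
  exists2 k, 0 < k & forall t x z p, 0 <= t <= T -> - l <= x <= l -> `|z| <= Rb -> `|p| <= Rb -> k <= F t x z p.
Proof.
move=> T0 l0 HF pos; pose r : R := `|Rb|.
pose lo (i : 'I_4) := nth 0 [:: 0; - l; - r; - r] i; pose hi (i : 'I_4) := nth 0 [:: T; l; r; r] i.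
have r0 : - r <= r by rewrite -subr_ge0 opprK addr_ge0 ?normr_ge0.
have lohi i : lo i <= hi i.
  by case: i => -[|[|[|[|//]]]] ?; rewrite /lo /hi/= ?(ltW T0)// -subr_ge0 opprK addr_ge0 ?(ltW l0).
have boxD : box lo hi `<=` [set v | [/\ `[0, T]%classic (v 0 0), `[- l, l]%classic (v 0 1), setT (v 0 2) & setT (v 0 3)]].
  by move=> v bv; split => //; [exact: (bv 0)|exact: (bv 1)].
have pos' v : box lo hi v -> 0 < F (v 0 0) (v 0 1) (v 0 2) (v 0 3).
  by move=> bv; apply: pos; [have := bv 0|have := bv 1]; rewrite /= in_itv.
have [k k0 Hk] := compact_positive (HF.1) boxD (@box_compact R 4 lo hi) (box_nonempty lohi) pos'.
exists k => // t x z p ht hx hz hp.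
have zr q : `|q| <= Rb -> - r <= q <= r by move=> hq; rewrite -ler_norml (le_trans hq)// ler_norm.
have := Hk (row4 t x z p); rewrite !mxE/=; apply.
by case=> -[|[|[|[|//]]]] ?; rewrite /= in_itv/= mxE /lo /hi/= ?zr.
Qed.

Lemma C2_3_lipschitz (T Rb : R) (F : R -> R -> R -> R) : 0 < T ->
  C2_3 `[0, T] setT setT F ->
  exists2 L, 0 <= L & forall t s z z' p p', 0 <= t <= T -> 0 <= s <= T ->
    `|z| <= Rb -> `|z'| <= Rb -> `|p| <= Rb -> `|p'| <= Rb ->
    `|F t z p - F s z' p'| <= L * (`|t - s| + `|z - z'| + `|p - p'|) /\ `|F t z p| <= L.
Proof.
move=> T0 HF; pose r : R := `|Rb|.
pose lo (i : 'I_3) := nth 0 [:: 0; - r; - r] i; pose hi (i : 'I_3) := nth 0 [:: T; r; r] i.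
have r0 : - r <= r by rewrite -subr_ge0 opprK addr_ge0 ?normr_ge0.
have lohi i : lo i <= hi i by case: i => -[|[|[|//]]] ?; rewrite /lo /hi/= ?(ltW T0).
have boxD : box lo hi `<=` [set v | [/\ `[0, T]%classic (v 0 0), setT (v 0 1) & setT (v 0 2)]].
  by move=> v bv; split => //; exact: (bv 0).
have [L L0 HL] := box_lipschitz lohi boxD HF.
have [M M0 HM] := compact_bound (HF.1) boxD (@box_compact R 3 lo hi) (box_nonempty lohi).
have inb t z p : 0 <= t <= T -> `|z| <= Rb -> `|p| <= Rb -> box lo hi (row3 t z p).
  move=> ht hz hp; have zr q : `|q| <= Rb -> - r <= q <= r.
    by move=> hq; rewrite -ler_norml (le_trans hq)// ler_norm.
  by case=> -[|[|[|//]]] ?; rewrite /= in_itv/= mxE /lo /hi/= ?zr.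
have E t z p : (fun v : 'rV[R]_3 => F (v 0 0) (v 0 1) (v 0 2)) (row3 t z p) = F t z p.
  by rewrite /row3 !mxE.
exists (L + M) => [|t s z z' p p' ht hs hz hz' hp hp']; first exact: addr_ge0.
split; last first.
  by have := HM _ (inb t z p ht hz hp); rewrite E => /le_trans; apply; rewrite lerDr.
have s1 : `|F t z p - F s z p| <= L * `|t - s|.
  have := HL 0 _ _ (inb t z p ht hz hp) (inb s z p hs hz hp).
  rewrite !E !mxE/=; apply=> -[[|[|[|//]]] ?] //= _; by rewrite !mxE.
have s3 : `|F s z p - F s z' p| <= L * `|z - z'|.
  have := HL 1 _ _ (inb s z p hs hz hp) (inb s z' p hs hz' hp).
  rewrite !E !mxE/=; apply=> -[[|[|[|//]]] ?] //= _; by rewrite !mxE.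
have s4 : `|F s z' p - F s z' p'| <= L * `|p - p'|.
  have := HL 2 _ _ (inb s z' p hs hz' hp) (inb s z' p' hs hz' hp').
  rewrite !E !mxE/=; apply=> -[[|[|[|//]]] ?] //= _; by rewrite !mxE.
have -> : F t z p - F s z' p' = (F t z p - F s z p) + (F s z p - F s z' p) + (F s z' p - F s z' p') by ring.
apply: (@le_trans _ _ (L * (`|t - s| + `|z - z'| + `|p - p'|))); last first.
  by rewrite ler_wpM2r ?addr_ge0// lerDl.
rewrite !mulrDr; do 2 (apply: (le_trans (ler_normD _ _)); apply: lerD => //).
Qed.

Lemma C2_3_derivable (T : R) (F : R -> R -> R -> R) t z p : 
  C2_3 `[0, T] setT setT F -> 0 <= t <= T -> derivable (F t z) p 1.
Proof.
move=> HF ht; have [cF dF] := HF.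
pose D : set 'rV[R]_3 := [set v | [/\ `[0, T]%classic (v 0 0), setT (v 0 1) & setT (v 0 2)]].
pose G := fun v : 'rV[R]_3 => F (v 0 0) (v 0 1) (v 0 2).
have [dF1 _] := dF (delta_mx 0 2) (ex_intro2 _ _ (2 : 'I_3) I erefl).
have seg r : p - 1 <= r <= p + 1 -> D (r *: delta_mx 0 2 + row3 t z 0).
  by move=> _; split => //; rewrite /= !mxE/= mulr0 add0r in_itv.
have h := segment_is_derive (r := p) seg dF1.
have {}h := h ltac:(by apply/andP; split; lra).
have E : F t z = (fun r => G (r *: delta_mx 0 2 + row3 t z 0)).
  by apply/funext => r; rewrite /G !mxE/= !mulr0 !add0r mulr1 addr0.
by rewrite E; exact: ex_derive.
Qed.

End Coefficients.

(** * Constants and structure of the problem from the assumptions *)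

Section FromC2.
Context {R : realType}.

Lemma dist_range (a b x y : R) : a <= x <= b -> a <= y <= b -> `|x - y| <= b - a.
Proof. by move=> /andP[? ?] /andP[? ?]; rewrite ler_norml; apply/andP; split; lra. Qed.

Lemma dist_range_sym (a x y : R) : - a <= x <= a -> - a <= y <= a -> `|x - y| <= 2 * a.
Proof. by move=> hx hy; rewrite (le_trans (dist_range hx hy))//; lra. Qed.

(** On bounded distances a Lipschitz bound implies a Holder bound, by the factorization d = d^be
    d^(1 - be). *)
Lemma le_powR_bounded (be D d : R) : 0 < be <= 1 -> 0 <= d <= D -> d <= (1 + D) * d `^ be.
Proof.
move=> /andP[be0 be1] /andP[d0 dD].
have [->|dn0] := eqVneq d 0; first by rewrite powR0 ?gt_eqF// mulr0.
have d1 : d = d `^ be * d `^ (1 - be).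
  by rewrite -powRD ?dn0 ?implybT// subrKC powRr1.
have h1 : d `^ (1 - be) <= (1 + D) `^ (1 - be).
  by apply: ge0_ler_powR; rewrite ?nnegrE//; lra.
have h2 : (1 + D) `^ (1 - be) <= 1 + D.
  by rewrite -[leRHS]powRr1; [apply: ler_powR|]; lra.
by rewrite {1}d1 mulrC ler_wpM2r ?powR_ge0// (le_trans h1).
Qed.

Variables (T l al : R) (a f b g : R -> R -> R -> R -> R).
Hypothesis T0 : 0 < T.
Hypothesis l0 : 0 < l.
Hypothesis al01 : 0 < al < 1.
Hypothesis b_C2 : forall s, s \in [:: 1; -1] -> C2_3 `[0, T] setT setT (fun t z p => b t (s * l) z p).
Hypothesis g_C2 : forall s, s \in [:: 1; -1] -> C2_3 `[0, T] setT setT (fun t z p => g t (s * l) z p).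

Lemma product_diff (b1 b2 p1 p2 s L S r : R) : `|s| = 1 -> `|b1 - b2| <= L * S -> `|b2| <= L -> `|p1| <= r ->
  `|p1 - p2| <= S -> 0 <= L -> `|s * b1 * p1 - s * b2 * p2| <= L * (r + 1) * S.
Proof.
move=> s1 h1 h2 h3 h4 L0.
have -> : s * b1 * p1 - s * b2 * p2 = s * ((b1 - b2) * p1 + b2 * (p1 - p2)) by ring.
rewrite normrM s1 mul1r (le_trans (ler_normD _ _))// !normrM.
have -> : L * (r + 1) * S = L * S * r + L * S by ring.
by apply: lerD; apply: ler_pM.
Qed.

Lemma flux_lipschitz (Rb : R) : exists2 L, 0 <= L & forall s t t' z z' p p', s = 1 \/ s = -1 ->
  0 <= t <= T -> 0 <= t' <= T -> `|z| <= Rb -> `|z'| <= Rb -> `|p| <= Rb -> `|p'| <= Rb ->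
  `|flux l b g s t z p - flux l b g s t' z' p'| <= L * (`|t - t'| + `|z - z'| + `|p - p'|).
Proof.
have one s : s = 1 \/ s = -1 -> exists L, 0 <= L /\ forall t t' z z' p p',
    0 <= t <= T -> 0 <= t' <= T -> `|z| <= Rb -> `|z'| <= Rb -> `|p| <= Rb -> `|p'| <= Rb ->
    `|flux l b g s t z p - flux l b g s t' z' p'| <= L * (`|t - t'| + `|z - z'| + `|p - p'|).
  move=> hs; have ms : s \in [:: 1; -1] by exact/ends_mem.
  have [Lb Lb0 HLb] := C2_3_lipschitz Rb T0 (b_C2 ms).
  have [Lg Lg0 HLg] := C2_3_lipschitz Rb T0 (g_C2 ms).
  exists (Lg + Lb * (`|Rb| + 1)); split; first by rewrite addr_ge0// mulr_ge0// addr_ge0.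
  move=> t t' z z' p p' ht ht' hz hz' hp hp'; rewrite /flux.
  have [gd _] := HLg t t' z z' p p' ht ht' hz hz' hp hp'.
  have [bd _] := HLb t t' z z' p p' ht ht' hz hz' hp hp'.
  have [_ bb] := HLb t' t z' z p' p ht' ht hz' hz hp' hp.
  rewrite (_ : forall x1 x2 x3 x4 : R, x1 - x2 - (x3 - x4) = (x1 - x3) - (x2 - x4)); last by move=> *; ring.
  rewrite (le_trans (ler_normB _ _))// [leRHS]mulrDl; apply: lerD => //.
  apply: product_diff => //; first by case: hs => ->; rewrite ?normrN normr1.
    by rewrite (le_trans hp)// ler_norm.
  by rewrite lerDr addr_ge0.
have [L1 [L10 H1]] := one 1 (or_introl erefl).
have [L2 [L20 H2]] := one (-1) (or_intror erefl).
exists (L1 + L2); first exact: addr_ge0.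
move=> s t t' z z' p p' hs ht ht' hz hz' hp hp'.
have S0 : 0 <= `|t - t'| + `|z - z'| + `|p - p'| by rewrite !addr_ge0.
case: hs => ->.
  by apply: (le_trans (H1 _ _ _ _ _ _ ht ht' hz hz' hp hp')); rewrite ler_wpM2r// lerDl.
by apply: (le_trans (H2 _ _ _ _ _ _ ht ht' hz hz' hp hp')); rewrite ler_wpM2r// lerDr.
Qed.

Lemma holder_of_lipschitz4 (L Lam m dt dx dz dp : R) : 0 <= L -> L * m <= Lam -> 1 <= m ->
  0 <= dt -> dt <= m * dt `^ (al / 2) -> dx <= m * dx `^ al -> 0 <= dz -> 0 <= dp ->
  L * (dt + dx + dz + dp) <= Lam * (dt `^ (al / 2) + dx `^ al + dz + dp).
Proof.
move=> L0 Lm m1 dt0 ht hx z0 p0.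
apply: (@le_trans _ _ (L * m * (dt `^ (al / 2) + dx `^ al + dz + dp))).
  rewrite -mulrA ler_wpM2l//; have := ler_peMl z0 m1; have := ler_peMl p0 m1; lra.
by rewrite ler_wpM2r// !addr_ge0// powR_ge0.
Qed.

Lemma holder_of_lipschitz3 (L Lam m dt dz dp : R) : 0 <= L -> L * m <= Lam -> 1 <= m ->
  0 <= dt -> dt <= m * dt `^ (al / 2) -> 0 <= dz -> 0 <= dp ->
  L * (dt + dz + dp) <= Lam * (dt `^ (al / 2) + dz + dp).
Proof.
move=> L0 Lm m1 dt0 ht z0 p0.
apply: (@le_trans _ _ (L * m * (dt `^ (al / 2) + dz + dp))).
  rewrite -mulrA ler_wpM2l//; have := ler_peMl z0 m1; have := ler_peMl p0 m1; lra.
by rewrite ler_wpM2r// !addr_ge0// powR_ge0.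
Qed.

Lemma problem_of_C2 : C2_4 `[0, T] `[- l, l] setT setT a -> C2_4 `[0, T] `[- l, l] setT setT f ->
  (forall t x z p, 0 <= t <= T -> - l <= x <= l -> 0 < a t x z p) ->
  forall Rb, exists kap0 kap1 Lam, problem al l T Rb kap0 kap1 Lam a f (flux l b g).
Proof.
move=> a_C2 f_C2 a_gt0 Rb.
have [La La0 HLa] := C2_4_lipschitz Rb T0 l0 a_C2.
have [Lf Lf0 HLf] := C2_4_lipschitz Rb T0 l0 f_C2.
have [Lp Lp0 HLp] := flux_lipschitz Rb.
have [k k0 Hk] := C2_4_positive Rb T0 l0 a_C2 a_gt0.
pose m : R := 1 + (T + 2 * l).
have T0' := T0; have l0' := l0; have al01' := al01; have hal := half01 al01.
have m1 : 1 <= m by rewrite /m; lra.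
have m0 : 0 <= m by rewrite /m; lra.
have Em (d1 d2 : R) : 0 <= d1 <= T -> 0 <= d2 <= T -> `|d1 - d2| <= m * `|d1 - d2| `^ (al / 2).
  move=> h1 h2; apply: le_powR_bounded => //; rewrite normr_ge0/=.
  by apply: (le_trans (dist_range h1 h2)); rewrite subr0 lerDl mulr_ge0// ltW.
have Ex (d1 d2 : R) : - l <= d1 <= l -> - l <= d2 <= l -> `|d1 - d2| <= m * `|d1 - d2| `^ al.
  move=> h1 h2; apply: le_powR_bounded; first by case/andP: al01' => -> /ltW.
  rewrite normr_ge0/=; apply: (le_trans (dist_range_sym h1 h2)).
  by rewrite lerDr ltW.
have [[SA SF SP _] _] := sum_ge_terms La0 Lf0 Lp0 (lexx 0) (lexx 0).
have La' := ler_wpM2r m0 SA; have Lf' := ler_wpM2r m0 SF; have Lp' := ler_wpM2r m0 SP.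
exists k, (k + La), ((La + Lf + Lp + 0 + 0) * m); split => //.
- by rewrite mulr_ge0// !addr_ge0.
- by rewrite k0 lerDl.
- move=> t s x y z z' p p' ht hs hx hy hz hz' hp hp'.
  have [h _] := HLa t s x y z z' p p' ht hs hx hy hz hz' hp hp'.
  by apply: (le_trans h); apply: (holder_of_lipschitz4 La0 La' m1) => //; auto.
- move=> t s x y z z' p p' ht hs hx hy hz hz' hp hp'.
  have [h _] := HLf t s x y z z' p p' ht hs hx hy hz hz' hp hp'.
  by apply: (le_trans h); apply: (holder_of_lipschitz4 Lf0 Lf' m1) => //; auto.
- move=> sg t s z z' p p' hsg ht hs hz hz' hp hp'.
  apply: (le_trans (HLp sg t s z z' p p' hsg ht hs hz hz' hp hp')).
  by apply: (holder_of_lipschitz3 Lp0 Lp' m1) => //; auto.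
- move=> t x z p ht hx hz hp; rewrite Hk//=.
  have [_ h] := HLa t t x x z z p p ht ht hx hx hz hz hp hp.
  by apply: (le_trans (ler_norm _)); apply: (le_trans h); rewrite lerDr ltW.
- move=> t x z p ht hx hz hp.
  have [_ h] := HLf t t x x z z p p ht ht hx hx hz hz hp hp.
  apply: (le_trans h); apply: (le_trans _ Lf'); exact: ler_peMr.
Qed.

(** Since s^2 = 1, the derivative of s times the flux in p is s g_p - (b_p p + b), which is negative
    by the structural assumption. *)
Lemma monotone_flux (Rb : R) :
  (forall s t z p, s \in [:: 1; -1] -> 0 <= t <= T ->
       0 < derive1 (b t (s * l) z) p * p + b t (s * l) z p - s * derive1 (g t (s * l) z) p) ->
  monotone_end T Rb (flux l b g).
Proof.
move=> bg s t z p p' hs ht _ _ _ pp'.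
have ms : s \in [:: 1; -1] by exact/ends_mem.
have ss : s * s = 1 by case: hs => ->; rewrite ?mulrNN mulr1.
have db (q : R) : derivable (b t (s * l) z) q 1 := C2_3_derivable (b_C2 ms) ht.
have dg (q : R) : derivable (g t (s * l) z) q 1 := C2_3_derivable (g_C2 ms) ht.
pose F (q : R) : R := s * flux l b g s t z q.
have FE : F = (s \*: g t (s * l) z) \- (b t (s * l) z * id).
  by apply/funext => q; rewrite /F /flux /= mulrBr !mulrA ss mul1r.
have dF (q : R) : is_derive q (1 : R) F (s * derive1 (g t (s * l) z) q - (derive1 (b t (s * l) z) q * q + b t (s * l) z q)).
  rewrite FE.
  have hb : is_derive q (1 : R) (b t (s * l) z) (derive1 (b t (s * l) z) q) by rewrite derive1E; exact: derivableP.
  have hg : is_derive q (1 : R) (g t (s * l) z) (derive1 (g t (s * l) z) q) by rewrite derive1E; exact: derivableP.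
  have h1 : is_derive q (1 : R) (s \*: g t (s * l) z) (s * derive1 (g t (s * l) z) q) by apply: is_deriveZ.
  have h2 : is_derive q (1 : R) (b t (s * l) z * id) (derive1 (b t (s * l) z) q * q + b t (s * l) z q).
    have hd := is_deriveM hb (is_derive_id q (1 : R)).
    by apply: (is_derive_eq hd); rewrite /GRing.scale/=; ring.
  exact: is_deriveB.
have dF' (x : R) : p - 1 < x < p' + 1 -> derivable F x 1 by move=> _; have [h _] := dF x; exact: h.
have hp : p - 1 < p < p' + 1 by apply/andP; split; lra.
have hp' : p - 1 < p' < p' + 1 by apply/andP; split; lra.
have [c _ e] := mvt_points dF' hp hp'.
have dc : derive1 F c = s * derive1 (g t (s * l) z) c - (derive1 (b t (s * l) z) c * c + b t (s * l) z c).
  by rewrite derive1E; have [_ h] := dF c.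
have := bg s t z c ms ht.
rewrite -/(F p') -/(F p) -subr_le0 e dc => h.
by rewrite mulr_ge0_le0 ?subr_ge0//; lra.
Qed.



Lemma dx_mvt (F : R -> R) : {within (`[- l, l]%classic : set R^o), continuous F} ->
  (forall y, (`[- l, l]%classic : set R^o) y -> derivable_in (`[- l, l]%classic : set R^o) 1 F y) ->
  forall x y, - l <= x <= l -> - l <= y <= l -> exists c, [/\ - l <= c <= l, `|c - x| <= `|y - x| &
    F y - F x = (y - x) * dx `[- l, l] F c].
Proof.
move=> cF dF.
have main (x y : R) : - l <= x -> y <= l -> x <= y -> exists2 c, x <= c <= y & F y - F x = (y - x) * dx `[- l, l] F c.
  move=> lx yl xy.
  have seg (r : R) : x <= r <= y -> (`[- l, l]%classic : set R^o) (r *: (1 : R^o) + 0).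
    by move=> /andP[h1 h2]; rewrite /= in_itv/= addr0 /GRing.scale/= mulr1; apply/andP; split; lra.
  have [c hc] := segment_mvt seg cF dF xy.
  by rewrite !addr0 /GRing.scale/= !mulr1 => e; exists c.
move=> x y /andP[lx xl] /andP[ly yl]; case: (leP x y) => xy.
  have [c /andP[h1 h2] e] := main x y lx yl xy; exists c; split => //; first by apply/andP; split; lra.
  by rewrite !ger0_norm; lra.
have [c /andP[h1 h2] e] := main y x ly xl (ltW xy); exists c; split => //; first by apply/andP; split; lra.
  by rewrite !ler0_norm; lra.
by move: e; lra.
Qed.

(** Derivatives relative to [-l, l] obey a mean value theorem up to the ends, which turns membership
    in the Holder space into expansions. *)
Lemma datum_of_holder (u0 : R -> R) : holder_space 2 al `[- l, l] u0 ->
  exists K, datum al l K u0 (dx `[- l, l] u0) (dx `[- l, l] (dx `[- l, l] u0)).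
Proof.
move=> [[c0 h0] hol]; have [d0 [c1 h1]] := h0 1 erefl; have [d1 [c2 _]] := h1 1 erefl.
have l0' := l0; have /andP[al0 al1] := al01.
pose I : set R^o := `[- l, l]%classic.
have l0N : - l <= l by rewrite ge0_cp// ltW.
have I0 : I !=set0 by exists l; rewrite /I /= in_itv/= l0N lexx.
have cI : compact I by exact: segment_compact.
have Iin x : - l <= x <= l -> I x by rewrite /I /= in_itv.
have [K0 K00 H0] := compact_bound c0 (@subset_refl _ I) cI I0.
have [K1 K10 H1] := compact_bound c1 (@subset_refl _ I) cI I0.
have [K2 K20 H2] := compact_bound c2 (@subset_refl _ I) cI I0.
pose w0 := dx `[- l, l] (dx `[- l, l] u0).
pose hh : \bar R := holder al `[- l, l] w0.
have ge : (0 <= hh)%E.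
  apply: (@holder_ge0 _ _ _ _ (- l) l); rewrite /= ?in_itv/=; first by rewrite lexx.
    by rewrite l0N lexx.
  by rewrite lt_eqF// gt0_cp.
have fn : hh \is a fin_num by rewrite ge0_fin_numE.
pose H := fine hh.
have H00 : 0 <= H by rewrite fine_ge0.
have Hw x y : - l <= x <= l -> - l <= y <= l -> `|w0 x - w0 y| <= H * `|x - y| `^ al.
  move=> hx hy; apply: (holder_bound (I := `[- l, l]%classic)) => //; by rewrite fineK.
have [[S0 S1 S2 SH] _] := sum_ge_terms K00 K10 K20 H00 (lexx 0).
exists (K0 + K1 + K2 + H + 0); split.
- move=> x hx; split; [exact: le_trans (H0 x (Iin _ hx)) S0|exact: le_trans (H1 x (Iin _ hx)) S1|].
  exact: le_trans (H2 x (Iin _ hx)) S2.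
- by move=> x y hx hy; apply: (le_trans (Hw x y hx hy)); rewrite ler_wpM2r ?powR_ge0.
- move=> x y hx hy; have [c [hc cx ->]] := dx_mvt c1 d1 hx hy.
  rewrite -mulrBr normrM mulrCA ler_wpM2l//; apply: (le_trans (Hw c x hc hx)).
  apply: ler_pM; rewrite ?powR_ge0//.
  by apply: ge0_ler_powR; rewrite ?nnegrE// ltW.
- move=> x y hx hy; have [c [hc cx ->]] := dx_mvt c0 d0 hx hy.
  rewrite -mulrBr normrM mulrCA ler_wpM2l// powRr1//.
  have [d [hd _ ->]] := dx_mvt c1 d1 hx hc.
  rewrite normrM mulrC; apply: ler_pM => //.
  exact: le_trans (H2 d (Iin _ hd)) S2.
Qed.

Lemma flux_compatible (u0 : R -> R) :
  (forall s, s \in [:: 1; -1] ->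
       let x := s * l in
       let u0x := dx `[- l, l] u0 x in
       let u0xx := dx `[- l, l] (dx `[- l, l] u0) x in
       - s * b 0 x (u0 x) u0x * u0x + g 0 x (u0 x) u0x
         = a 0 x (u0 x) u0x * u0xx + f 0 x (u0 x) u0x) ->
  compatible l 0 a f (flux l b g) u0 (dx `[- l, l] u0) (dx `[- l, l] (dx `[- l, l] u0)).
Proof.
move=> compat s /ends_mem hs; have := compat s hs; rewrite /= => <-.
by rewrite /flux; ring.
Qed.

End FromC2.

(** * Maximal solutions *)

(* A function constant in time is regular, so [regular_det] applies. *)
Lemma datum_det {R : realType} (al l K : R) (u p w p' w' : R -> R) : 0 < al < 1 -> 0 < l ->
  datum al l K u p w -> datum al l K u p' w' ->
  forall x, - l <= x <= l -> p x = p' x /\ w x = w' x.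
Proof.
move=> al01 l0 H1 H2 x hx; have /andP[al0 al1] := al01.
have reg q v : datum al l K u q v -> regular al l 0 1 K (fun=> u) (fun=> q) (fun=> v) (fun _ _ => 0).
  move=> H; have K0 := datum_K_ge0 H l0.
  split => [t y _ hy|t s y y' _ _ hy hy'|t s y y' _ _ hy hy'|t y y' _ hy hy'|t y y' _ hy hy'|t s y _ _ hy].
  - by have [h1 h2 h3] := dt_bd H hy; rewrite normr0.
  - by apply: (le_trans (dt_w H hy hy')); rewrite ler_wpM2l// lerDr powR_ge0.
  - by rewrite subrr normr0 mulr_ge0// addr_ge0 ?powR_ge0.
  - by have := dt_u H hy hy'; rewrite powRr1// -expr2.
  - exact: (dt_p H).
  - by rewrite mulr0 !subrr normr0 !mulr_ge0 ?powR_ge0.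
have t0 : (0 : R) <= (0 : R) <= (1 : R) by rewrite lexx ler01.
by have [-> -> _] := regular_det al01 l0 ltr01 (reg _ _ H1) (reg _ _ H2) (fun _ _ _ _ => erefl) t0 hx.
Qed.

Section Evolution.
Context {R : realType}.
Variables (al l T K0 : R) (a f ph : R -> R -> R -> R -> R) (u0 p0 w0 : R -> R).
Hypothesis al01 : 0 < al < 1.
Hypothesis l0 : 0 < l.
Hypothesis T0 : 0 < T.
Hypothesis HP : forall Rb, exists kap0 kap1 Lam, problem al l T Rb kap0 kap1 Lam a f ph.
Hypothesis mono : forall Rb, monotone_end T Rb ph.
Hypothesis D0 : datum al l K0 u0 p0 w0.
Hypothesis cmp0 : compatible l 0 a f ph u0 p0 w0.

Definition is_sol (s : R) (u p w z : R -> R -> R) : Prop := exists2 C, 0 <= C &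
  regular al l 0 s C u p w z /\ solves l 0 s a f ph u0 u p w z.

Lemma is_sol_sub s s' u p w z : s <= s' -> is_sol s' u p w z -> is_sol s u p w z.
Proof.
move=> ss [C C0 [H [S1 S2 S3]]]; exists C => //; split; first exact: regular_weaken H _ ss _.
have sub t : 0 <= t <= s -> 0 <= t <= s' by move=> /andP[-> h]; exact: le_trans ss.
by split => [t x /sub|s1 t h /sub|]; [exact: S1|exact: S2|exact: S3].
Qed.

(** Comparison in both directions gives equal values, and these determine the derivatives. The
    problem is taken on the range given by the sum of the two constants. *)
Lemma closed_unique s u p w z u' p' w' z' : 0 < s <= T -> is_sol s u p w z -> is_sol s u' p' w' z' ->
  forall t x, 0 <= t <= s -> - l <= x <= l -> [/\ u t x = u' t x, p t x = p' t x, w t x = w' t x & z t x = z' t x].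
Proof.
move=> /andP[s0 sT] [C C0 [H S]] [C' C0' [H' S']] t x ht hx.
pose Cm : R := C + C'.
have Cm0 : 0 <= Cm by rewrite addr_ge0.
have G : regular al l 0 s Cm u p w z by apply: (regular_weaken H) => //; rewrite lerDl.
have G' : regular al l 0 s Cm u' p' w' z' by apply: (regular_weaken H') => //; rewrite lerDr.
have [kap0 [kap1 [Lam P]]] := HP Cm.
have eqv y : - l <= y <= l -> u0 y <= u0 y by [].
have E r y : 0 <= r <= s -> - l <= y <= l -> u r y = u' r y.
  move=> hr hy; apply: le_anti; apply/andP; split.
    exact: (compare_solutions P (@mono Cm) (lexx 0) sT Cm0 (lexx Cm) G G' S S' eqv).
  exact: (compare_solutions P (@mono Cm) (lexx 0) sT Cm0 (lexx Cm) G' G S' S eqv).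
by have [h1 h2 h3] := regular_det al01 l0 s0 G G' E ht hx; split => //; exact: E.
Qed.

Definition join (t1 : R) (v v' : R -> R -> R) (t x : R) : R := if t <= t1 then v t x else v' t x.

Lemma regular_join t1 t2 C1 C2 u p w z u' p' w' z' : 0 <= C1 -> 0 <= C2 -> 0 <= t1 ->
  regular al l 0 t1 C1 u p w z -> regular al l t1 t2 C2 u' p' w' z' ->
  (forall x, - l <= x <= l -> [/\ u t1 x = u' t1 x, p t1 x = p' t1 x, w t1 x = w' t1 x & z t1 x = z' t1 x]) ->
  let j := join t1 in
  regular al l 0 t2 (3 * (C1 + C2)) (j u u') (j p p') (j w w') (j z z') /\
  (forall t x, t1 <= t -> - l <= x <= l ->
     [/\ u' t x = j u u' t x, p' t x = j p p' t x, w' t x = j w w' t x & z' t x = j z z' t x]).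
Proof.
move=> C10 C20 t10 H H' E j.
have E1 t x : 0 <= t <= t1 -> - l <= x <= l ->
    [/\ u t x = j u u' t x, p t x = j p p' t x, w t x = j w w' t x & z t x = j z z' t x].
  by move=> /andP[_ h] _; rewrite /j /join h.
have E2 t x : t1 <= t -> - l <= x <= l ->
    [/\ u' t x = j u u' t x, p' t x = j p p' t x, w' t x = j w w' t x & z' t x = j z z' t x].
  move=> h hx; rewrite /j /join; case: ifP => // h'.
  have -> : t = t1 by apply: le_anti; rewrite h'.
  by have [-> -> -> ->] := E x hx.
split => //; apply: (@regular_glue R al l 0 t1 t2); rewrite ?addr_ge0//.
  by apply: (regular_congr E1); apply: (regular_weaken H); rewrite ?lexx// lerDl.
apply: (@regular_congr R al l t1 t2 _ u' p' w' z'); first by move=> t x /andP[h _]; exact: E2.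
by apply: (regular_weaken H'); rewrite ?lexx// lerDr.
Qed.

Lemma local_start : exists s u p w z, 0 < s <= T /\ is_sol s u p w z.
Proof.
have [kap0 [kap1 [Lam P]]] := HP (K0 + 1).
have [de [C [u [p [w [z [de0 deT Hr Hs]]]]]]] := local_existence P (ltac:(by rewrite lexx T0) : 0 <= 0 < T) D0 cmp0.
rewrite add0r in deT Hr Hs.
exists de, u, p, w, z; rewrite de0; split => //; exists C => //.
have h0 : (0 : R) <= 0 <= de by rewrite lexx ltW.
have hx : - l <= 0 <= l by rewrite oppr_le0 ltW.
by have [h _ _ _] := rg_bd Hr h0 hx; exact: le_trans h.
Qed.

(** The slice at time s is a compatible datum, because the equation and the end condition both hold
    there. The restarted solution has the same u at time s, hence the same p and w by [datum_det]
    and the same z by the equation, so the pieces join regularly. *)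
Lemma local_extend s u p w z : 0 < s < T -> is_sol s u p w z ->
  exists s' u' p' w' z', s < s' <= T /\ is_sol s' u' p' w' z'.
Proof.
move=> /andP[s0 sT] [C C0 [H [S1 S2 S3]]].
have hs : 0 <= s <= s by rewrite lexx ltW.
have D := regular_datum al01 C0 H hs.
have cm : compatible l s a f ph (u s) (p s) (w s).
  by move=> r hr; have hx := sign_end_in l0 hr; rewrite -(S2 r s hr hs) (S1 s _ hs hx).
have [kap0 [kap1 [Lam P]]] := HP (C + 1).
have [de [C' [u' [p' [w' [z' [de0 deT Hr [S1' S2' S3']]]]]]]] :=
  local_existence P (ltac:(by rewrite (ltW s0)) : 0 <= s < T) D cm.
have hs' : s <= s <= s + de by rewrite lexx lerDl ltW.
have C0' : 0 <= C'.
  have hx : - l <= 0 <= l by rewrite oppr_le0 ltW.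
  by have [h _ _ _] := rg_bd Hr hs' hx; exact: le_trans h.
have D' := regular_datum al01 C0' Hr hs'.
have wk K (q1 q2 q3 : R -> R) : datum al l K q1 q2 q3 -> K <= C + C' -> datum al l (C + C') q1 q2 q3.
  move=> [h1 h2 h3 h4] KC; split.
  - by move=> x hx; have [g1 g2 g3] := h1 x hx; split; exact: le_trans KC.
  - by move=> x y hx hy; apply: (le_trans (h2 x y hx hy)); rewrite ler_wpM2r ?powR_ge0.
  - by move=> x y hx hy; apply: (le_trans (h3 x y hx hy)); rewrite ler_wpM2r// mulr_ge0 ?powR_ge0.
  - by move=> x y hx hy; apply: (le_trans (h4 x y hx hy)); rewrite ler_wpM2r// mulr_ge0 ?powR_ge0.
have E x : - l <= x <= l -> [/\ u s x = u' s x, p s x = p' s x, w s x = w' s x & z s x = z' s x].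
  move=> hx; have W1 : datum al l (C + C') (u s) (p s) (w s) by apply: wk D _; rewrite lerDl.
  have W2 : datum al l (C + C') (u s) (p' s) (w' s).
    have [g1 g2 g3 g4] : datum al l (C + C') (u' s) (p' s) (w' s) by apply: wk D' _; rewrite lerDr.
    split=> [y hy|//|//|y y' hy hy'].
      by rewrite -S3'//; exact: g1.
    by rewrite -!S3'//; exact: g4.
  have [Ep Ew] := datum_det al01 l0 W1 W2 hx.
  by split => //; rewrite ?S3'// S1// S1'// S3'// Ep Ew.
have [Hj E2] := regular_join C0 C0' (ltW s0) H Hr E.
set j := join s in Hj E2.
exists (s + de), (j u u'), (j p p'), (j w w'), (j z z'); split; first by rewrite ltrDl de0.
exists (3 * (C + C')); first by rewrite mulr_ge0// addr_ge0.
split => //.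
have E1 t x : t <= s -> [/\ j u u' t x = u t x, j p p' t x = p t x, j w w' t x = w t x & j z z' t x = z t x].
  by move=> h; rewrite /j /join h.
split.
- move=> t x /andP[t0 t1] hx; case: (leP t s) => h.
    by have [-> -> -> ->] := E1 t x h; apply: S1 => //; rewrite t0.
  by have [<- <- <- <-] := E2 t x (ltW h) hx; apply: S1' => //; rewrite ltW.
- move=> r t hr /andP[t0 t1]; have hx := sign_end_in l0 hr; case: (leP t s) => h.
    by have [-> -> _ ->] := E1 t (r * l) h; apply: S2 => //; rewrite t0.
  by have [<- <- _ <-] := E2 t _ (ltW h) hx; apply: S2' => //; rewrite ltW.
- by move=> x hx; have [-> _ _ _] := E1 0 x (ltW s0); exact: S3.
Qed.

(* The equations pass to the final time by continuity. *)
Lemma closed_of_open tau C u p w z : 0 < tau <= T -> 0 <= C -> solution al l a f ph u0 tau u p w z ->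
  open_regular al l tau C u p w z -> exists u' p' w' z', is_sol tau u' p' w' z'.
Proof.
move=> /andP[tau0 tauT] C0 H Ho.
have [U [P [W [Z [Hr E]]]]] := open_regular_extension al01 l0 tau0 C0 Ho.
have [c1 c2 c3 c4] := regular_continuous_on al01 l0 (ltW tau0) C0 Hr.
have Eq t x : 0 <= t < tau -> - l <= x <= l -> [/\ u t x = U t x, p t x = P t x, w t x = W t x & z t x = Z t x].
  move=> /andP[t0 tt] hx; pose sg := (t + tau) / 2.
  have sg0 : 0 < sg < tau by rewrite /sg; apply/andP; split; lra.
  have [C' C0' [Hr' _]] := H sg sg0; have /andP[g1 g2] := sg0.
  have [d1 d2 d3 d4] := regular_continuous_on al01 l0 (ltW g1) C0' Hr'.
  have st : 0 < sg <= tau by rewrite g1 ltW.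
  have st' : 0 < tau <= tau by rewrite tau0 lexx.
  have ts : 0 <= t < sg by rewrite t0 /sg; lra.
  have ts' : 0 <= t < tau by rewrite t0.
  have eqv (v V : R -> R -> R) : continuous_on l sg v -> continuous_on l tau V ->
      (forall s y, 0 < s < tau -> - l < y < l -> V s y = v s y) -> v t x = V t x.
    move=> cv cV vV.
    rewrite -(ext_eq l0 st cv (v := v) _ ts hx)// (ext_eq l0 st' cV _ ts' hx)//.
  by split; apply: eqv => // s y hs hy; have [] := E s y hs hy.
exists U, P, W, Z; exists C => //; split => //.
have pos t : 0 <= t < tau -> exists2 C', 0 <= C' & regular al l 0 t C' u p w z /\ solves l 0 t a f ph u0 u p w z.
  move=> /andP[t0 tt]; have hsg : 0 < (t + tau) / 2 < tau by apply/andP; split; lra.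
  have le : t <= (t + tau) / 2 by lra.
  exact: is_sol_sub le (H _ hsg).
have [kap0 [kap1 [Lam PC]]] := HP C.
have [FF [UF FE]] := ultraFilterLemma (F := \oo%classic : set_system nat) _.
have PF : ProperFilter FF := @ultra_proper _ _ UF.
have htau : 0 <= tau <= tau by rewrite lexx ltW.
pose tn n := tau + harmonic n / 2 * (tau / 2 - tau).
have tnin n : 0 < tn n < tau := ct_in tau0 n htau.
have ctn : tn @ FF --> tau by exact: (cvg_contraction UF FE).
have tnin' n : 0 <= tn n <= tau by case/andP: (tnin n) => *; rewrite !ltW.
have tnin2 n : 0 <= tn n < tau by case/andP: (tnin n) => h1 h2; rewrite ltW.
have inT t : 0 <= t <= tau -> 0 <= t <= T by move=> /andP[-> h]; exact: le_trans tauT.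
have lim V x : - l <= x <= l -> continuous_on l tau V -> (fun n => V (tn n) x) @ FF --> V tau x.
  move=> hx cV; apply: (continuous_on_cvg (xn := fun=> x) _ cV htau hx tnin' _ ctn) => //.
  exact: cvg_cst.
have aln : al != 0 by case/andP: al01 => h _; rewrite gt_eqF.
split.
- move=> t x ht hx; have [tE|tne] := eqVneq t tau; last first.
    have ht' : 0 <= t < tau by case/andP: ht => -> h; rewrite lt_neqAle tne h.
    have [C' C0' [_ [S1 _ _]]] := pos t ht'; have [<- <- <- <-] := Eq t x ht' hx.
    by apply: S1 => //; rewrite lexx andbT; case/andP: ht.
  rewrite tE.
  have cA (k : R -> R -> R -> R -> R) : (forall t s x y z z' p p', 0 <= t <= T -> 0 <= s <= T -> - l <= x <= l ->
    - l <= y <= l -> `|z| <= C -> `|z'| <= C -> `|p| <= C -> `|p'| <= C ->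
    `|k t x z p - k s y z' p'| <=
      Lam * (`|t - s| `^ (al / 2) + `|x - y| `^ al + `|z - z'| + `|p - p'|)) ->
    (fun n => k (tn n) x (U (tn n) x) (P (tn n) x)) @ FF --> k tau x (U tau x) (P tau x).
    move=> kL; apply: (cvg_coef PC UF ctn (@cvg_cst _ x _ FF _) (lim _ _ hx c1) (lim _ _ hx c2)) => n.
    have [b1 b2 _ _] := rg_bd Hr (tnin' n) hx; have [b3 b4 _ _] := rg_bd Hr htau hx.
    by apply: kL => //; apply: inT.
  have h : (fun n => Z (tn n) x) @ FF --> a tau x (U tau x) (P tau x) * W tau x + f tau x (U tau x) (P tau x).
    have -> : (fun n => Z (tn n) x) = (fun n => a (tn n) x (U (tn n) x) (P (tn n) x) * W (tn n) x
       + f (tn n) x (U (tn n) x) (P (tn n) x)).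
      apply/funext => n; have [<- <- <- <-] := Eq _ _ (tnin2 n) hx.
      have [C' C0' [_ [S1 _ _]]] := pos _ (tnin2 n).
      by apply: S1 => //; rewrite lexx andbT; case/andP: (tnin' n).
    by apply: cvgD; [apply: cvgM; [exact: cA (pr_a PC)|exact: lim]|exact: cA (pr_f PC)].
  exact: (cvg_unique _ (lim _ _ hx c4) h).
- move=> s t hs ht; have hx := sign_end_in l0 hs.
  have bc t' : 0 <= t' < tau -> Z t' (s * l) = ph s t' (U t' (s * l)) (P t' (s * l)).
    move=> ht'; have [C' C0' [_ [_ S2 _]]] := pos t' ht'; have [<- <- _ <-] := Eq t' _ ht' hx.
    by apply: S2 => //; rewrite lexx andbT; case/andP: ht'.
  have [tE|tne] := eqVneq t tau; last first.
    by apply: bc; case/andP: ht => -> h; rewrite lt_neqAle tne h.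
  rewrite tE.
  have h : (fun n => Z (tn n) (s * l)) @ FF --> ph s tau (U tau (s * l)) (P tau (s * l)).
    have -> : (fun n => Z (tn n) (s * l)) = (fun n => ph s (tn n) (U (tn n) (s * l)) (P (tn n) (s * l))).
      by apply/funext => n; exact: bc.
    apply: (cvg_coef PC UF ctn (@cvg_cst _ (0 : R) _ FF _) (lim _ _ hx c1) (lim _ _ hx c2)) => n.
    have [b1 b2 _ _] := rg_bd Hr (tnin' n) hx; have [b3 b4 _ _] := rg_bd Hr htau hx.
    rewrite (subrr (0 : R)) normr0 (powR0 aln) addr0.
    by apply: (pr_ph PC) => //; apply: inT.
  exact: (cvg_unique _ (lim _ _ hx c4) h).
- move=> x hx; have h0 : (0 : R) <= 0 < tau by rewrite lexx.
  have [C' C0' [_ [_ _ S3]]] := pos 0 h0; have [<- _ _ _] := Eq 0 x h0 hx.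
  exact: S3.
Qed.

(** Four functions bundled so that a family of solutions can be picked by choice. *)
Record profile := Profile { pf_u : R -> R -> R; pf_p : R -> R -> R; pf_w : R -> R -> R; pf_z : R -> R -> R }.

(** Here tau is the supremum of the closed existence times. At t < tau the value is taken from some
    solution that lasts beyond t, and uniqueness makes it independent of the selection. Either a
    regular solution exists up to and including tau, and extension forces tau = T; or no uniform
    bound holds before tau, since it would produce such a solution. *)
Theorem maximal_solution : exists tau u p w z, [/\ 0 < tau <= T,
  solution al l a f ph u0 tau u p w z,
  forall tau' u' p' w' z', 0 < tau' <= T -> solution al l a f ph u0 tau' u' p' w' z' ->
    tau' <= tau /\ forall t x, 0 < t < tau' -> - l < x < l -> u' t x = u t x &
  (tau = T /\ is_sol T u p w z) \/ forall C, 0 <= C -> ~ open_regular al l tau C u p w z].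
Proof.
pose S := [set s : R | 0 < s <= T /\ exists u p w z, is_sol s u p w z].
have S0 : S !=set0.
  by have [s [u [p [w [z [h1 h2]]]]]] := local_start; exists s; split => //; exists u, p, w, z.
have SU : has_ubound S by exists T => s [/andP[_ h] _].
have HS : has_sup S by split.
pose tau := sup S.
have Sle s : S s -> s <= tau by move=> h; exact: ub_le_sup.
have tau0 : 0 < tau by have [s hs] := S0; have := Sle s hs; case: hs => /andP[h _] _; exact: lt_le_trans.
have tauT : tau <= T by apply: ge_sup => // s [/andP[_ h] _].
have adh t : t < tau -> exists s, t < s /\ S s.
  by move=> h; have [s hs1 hs2] := sup_adherent (eps := tau - t) ltac:(by rewrite subr_gt0) HS; exists s; split => //; move: hs2; rewrite opprB subrKC.
have /choice[F HF] : forall t, exists q : profile, t < tau -> exists s, [/\ t < s, 0 < s <= T & is_sol s (pf_u q) (pf_p q) (pf_w q) (pf_z q)].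
  move=> t; case: (ltP t tau) => h; last by exists (Profile (fun=> id) (fun=> id) (fun=> id) (fun=> id)).
  have [s [ts [hs [u [p [w [z Hs]]]]]]] := adh t h.
  by exists (Profile u p w z) => _; exists s.
pose U t := pf_u (F t) t; pose P t := pf_p (F t) t; pose W t := pf_w (F t) t; pose Z t := pf_z (F t) t.
have agree s u p w z : 0 < s <= T -> is_sol s u p w z -> forall t x, 0 <= t <= s -> t < tau -> - l <= x <= l ->
    [/\ u t x = U t x, p t x = P t x, w t x = W t x & z t x = Z t x].
  move=> /andP[s0 sT] Hs t x /andP[t0 ts] tt hx; have [s' [ts' /andP[s0' sT'] Hs']] := HF t tt.
  case: (leP s s') => ss.
    have A := is_sol_sub ss Hs'.
    by apply: (closed_unique _ Hs A); rewrite ?s0 ?t0.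
  have A := is_sol_sub (ltW ss) Hs.
  by apply: (closed_unique _ A Hs'); rewrite ?s0' ?t0// ltW.
have USol : solution al l a f ph u0 tau U P W Z.
  move=> sg /andP[sg0 sgt]; have [s [ss hs Hs]] := HF sg sgt.
  have [C C0 [Hr Hsol]] := is_sol_sub (ltW ss) Hs.
  have E t x : 0 <= t <= sg -> - l <= x <= l -> [/\ pf_u (F sg) t x = U t x, pf_p (F sg) t x = P t x,
      pf_w (F sg) t x = W t x & pf_z (F sg) t x = Z t x].
    move=> /andP[t0 ts] hx; apply: (agree _ _ _ _ _ hs Hs) => //; last exact: le_lt_trans sgt.
    by rewrite t0 (le_trans ts)// ltW.
  exists C => //; split; first exact: regular_congr E Hr.
  exact: solves_congr (ltW sg0) l0 E Hsol.
have tle tau' u' p' w' z' : 0 < tau' <= T -> solution al l a f ph u0 tau' u' p' w' z' -> tau' <= tau.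
  move=> /andP[t0 tT] H; rewrite leNgt; apply/negP => lt.
  pose s := (tau + tau') / 2.
  have hs : 0 < s < tau' by rewrite /s; apply/andP; split; lra.
  have : s <= tau by apply: Sle; split; [rewrite /s; apply/andP; split; lra|exists u', p', w', z'; exact: H].
  by rewrite /s; lra.
have small (tau' t : R) : 0 < t < tau' -> 0 < (t + tau') / 2 < tau' /\ t <= (t + tau') / 2.
  by move=> /andP[h1 h2]; split; [apply/andP; split|]; lra.
have [[u [p [w [z Hu]]]]|no] := pselect (exists u p w z, is_sol tau u p w z).
  have tT : tau = T.
    apply: le_anti; rewrite tauT leNgt; apply/negP => lt.
    have [s [u' [p' [w' [z' [/andP[h1 h2] h3]]]]]] := local_extend (ltac:(by rewrite tau0) : 0 < tau < T) Hu.
    have : s <= tau by apply: Sle; split; [rewrite h2 (lt_trans tau0)|exists u', p', w', z'].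
    by rewrite leNgt h1.
  exists tau, u, p, w, z; split; first by rewrite tau0.
  - by move=> sg /andP[_ h]; exact: is_sol_sub (ltW h) Hu.
  - move=> tau' u' p' w' z' ht' H; have le := tle _ _ _ _ _ ht' H; split => // t x ht hx.
    have [hm h3] := small _ _ ht; have /andP[h1 h2] := hm; have /andP[t0 tt] := ht; have /andP[x1 x2] := hx.
    have A := H _ hm.
    have B := is_sol_sub (ltW (lt_le_trans h2 le)) Hu.
    have hh : 0 < (t + tau') / 2 <= T by rewrite h1 (le_trans (ltW h2))//; case/andP: ht'.
    have [-> //] := closed_unique hh A B (t := t) (x := x) ltac:(by rewrite ltW) ltac:(by rewrite !ltW).
  - by left; rewrite -tT.
exists tau, U, P, W, Z; split => //; first by rewrite tau0.
- move=> tau' u' p' w' z' ht' H; have le := tle _ _ _ _ _ ht' H; split => // t x ht hx.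
  have [hm h3] := small _ _ ht; have /andP[h1 h2] := hm; have /andP[t0 tt] := ht; have /andP[x1 x2] := hx.
  have A := H _ hm.
  have hh : 0 < (t + tau') / 2 <= T by rewrite h1 (le_trans (ltW h2))//; case/andP: ht'.
  have [-> //] := agree _ _ _ _ _ hh A t x ltac:(by rewrite ltW) (lt_le_trans tt le) ltac:(by rewrite !ltW).
- by right => C C0 Ho; apply: no; exact: (closed_of_open (ltac:(by rewrite tau0) : 0 < tau <= T) C0 USol Ho).
Qed.

End Evolution.

(** * Control by the gradient *)

Section Density.
Context {R : realType}.
Variables (al l tau M : R) (V : R -> R -> R).
Hypothesis al01 : 0 < al < 1.
Hypothesis l0 : 0 < l.
Hypothesis tau0 : 0 < tau.
Hypothesis cV : continuous_on l tau V.

(** A non-strict bound passes to the closed cylinder along points contracted into the interior. *)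
Lemma closed_bound : (forall t x, 0 < t < tau -> - l < x < l -> `|V t x| <= M) ->
  forall t x, 0 <= t <= tau -> - l <= x <= l -> `|V t x| <= M.
Proof.
move=> H t x ht hx.
have [FF [UF FE]] := ultraFilterLemma (F := \oo%classic : set_system nat) _.
have PF : ProperFilter FF := @ultra_proper _ _ UF.
pose tn n := t + harmonic n / 2 * (tau / 2 - t); pose xn n := x + harmonic n / 2 * (0 - x).
have tnin n : 0 < tn n < tau := ct_in tau0 n ht.
have xnin n : - l < xn n < l := cx_in l0 n hx.
have ctn : tn @ FF --> t by exact: (cvg_contraction UF FE).
have cxn : xn @ FF --> x by exact: (cvg_contraction UF FE).
have tnin' n : 0 <= tn n <= tau by case/andP: (tnin n) => *; rewrite !ltW.
have xnin' n : - l <= xn n <= l by case/andP: (xnin n) => *; rewrite !ltW.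
have lim : (fun n => `|V (tn n) (xn n)|) @ FF --> `|V t x|.
  by apply: cvg_norm; exact: (continuous_on_cvg _ cV ht hx tnin' xnin' ctn cxn).
refine (@lim_le _ FF _ _ _ _ PF lim (@cvg_cst _ M _ FF _) _) => k.
exact: H.
Qed.

Lemma closed_holder : (forall t s x y, 0 < t < tau -> 0 < s < tau -> - l < x < l -> - l < y < l ->
    `|V t x - V s y| <= M * (`|t - s| `^ (al / 2) + `|x - y| `^ al)) ->
  forall t s x y, 0 <= t <= tau -> 0 <= s <= tau -> - l <= x <= l -> - l <= y <= l ->
    `|V t x - V s y| <= M * (`|t - s| `^ (al / 2) + `|x - y| `^ al).
Proof.
move=> H t s x y ht hs hx hy.
have [FF [UF FE]] := ultraFilterLemma (F := \oo%classic : set_system nat) _.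
have PF : ProperFilter FF := @ultra_proper _ _ UF.
pose tn (t : R) n := t + harmonic n / 2 * (tau / 2 - t); pose xn (x : R) n := x + harmonic n / 2 * (0 - x).
have tnin t' n : 0 <= t' <= tau -> 0 < tn t' n < tau by exact: ct_in.
have xnin x' n : - l <= x' <= l -> - l < xn x' n < l by exact: cx_in.
have ctn t' : tn t' @ FF --> t' by exact: (cvg_contraction UF FE).
have cxn x' : xn x' @ FF --> x' by exact: (cvg_contraction UF FE).
have lim t' x' : 0 <= t' <= tau -> - l <= x' <= l -> (fun n => V (tn t' n) (xn x' n)) @ FF --> V t' x'.
  move=> ht' hx'; apply: (continuous_on_cvg _ cV ht' hx' _ _ (ctn t') (cxn x')) => n.
    by case/andP: (tnin t' n ht') => *; rewrite !ltW.
  by case/andP: (xnin x' n hx') => *; rewrite !ltW.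
have h1 : (fun n => `|V (tn t n) (xn x n) - V (tn s n) (xn y n)|) @ FF --> `|V t x - V s y|.
  by apply: cvg_norm; apply: cvgB; exact: lim.
have h2 : (fun n => M * (`|tn t n - tn s n| `^ (al / 2) + `|xn x n - xn y n| `^ al)) @ FF -->
    M * (`|t - s| `^ (al / 2) + `|x - y| `^ al).
  apply: cvgM; [exact: cvg_cst|apply: cvgD; apply: (cvg_powR_norm UF)].
  - exact: half01 al01.
  - by apply: cvgB; exact: ctn.
  - by case/andP: al01 => -> h; rewrite ltW.
  - by apply: cvgB; exact: cxn.
refine (@lim_le _ FF _ _ _ _ PF h1 h2 _) => k.
by apply: H; [exact: tnin|exact: tnin|exact: xnin|exact: xnin].
Qed.

End Density.

Section GradientControl.
Context {R : realType}.
Variables (al l T M : R) (a f ph : R -> R -> R -> R -> R) (u0 : R -> R).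
Variables (tau : R) (u p w z : R -> R -> R).
Hypothesis al01 : 0 < al < 1.
Hypothesis l0 : 0 < l.
Hypothesis tauT : 0 < tau <= T.
Hypothesis HP : forall Rb, exists kap0 kap1 Lam, problem al l T Rb kap0 kap1 Lam a f ph.
Hypothesis US : solution al l a f ph u0 tau u p w z.
Hypothesis M0 : 0 <= M.
Hypothesis Mu : forall t x, 0 <= t < tau -> - l <= x <= l -> `|u t x| <= M.
Hypothesis Mp : forall t x, 0 <= t < tau -> - l <= x <= l -> `|p t x| <= M.
Hypothesis Mpd : forall t s x y, 0 <= t < tau -> 0 <= s < tau -> - l <= x <= l -> - l <= y <= l ->
  `|p t x - p s y| <= M * (`|t - s| `^ (al / 2) + `|x - y| `^ al).

Lemma value_x t x y : 0 <= t < tau -> - l <= x <= l -> - l <= y <= l -> `|u t x - u t y| <= M * `|x - y|.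
Proof.
move=> /andP[t0 tt] hx hy; have hs : 0 < (t + tau) / 2 < tau by apply/andP; split; lra.
have [C C0 [Hr _]] := US hs.
have ht : 0 <= t <= (t + tau) / 2 by apply/andP; split; lra.
have tay : taylor1 (- l) l C 1 (u t) (p t).
  by move=> x' y' hx' hy'; rewrite powRr1// -expr2; exact: (rg_ux Hr).
have [c [hc _] ->] := taylor_mvt ltr01 C0 tay hy hx.
by rewrite normrM mulrC ler_wpM2r//; apply: Mp; rewrite ?t0.
Qed.

(* On the boundary [u_t] is a bounded function of [u] and [u_x]; inside, the
   Holder continuity of [u_x] in time is integrated from the boundary. *)
Lemma value_t : exists2 N, 0 <= N & forall t s x, 0 <= t < tau -> 0 <= s < tau -> - l <= x <= l ->
  `|u t x - u s x| <= N * `|t - s| `^ (al / 2).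
Proof.
have [kap0 [kap1 [Lam P]]] := HP M; have L0 := pr_Lam P; have /andP[tau0 tT] := tauT.
have /andP[al0 al1] := al01; have hal := half01 al01.
have l0' := l0; have M0' := M0.
(* A bound for the end velocity: its value at one argument plus its modulus over the bounded
   range. *)
pose B := `|ph 1 0 0 0| + Lam * (T `^ (al / 2) + M + M).
have B0 : 0 <= B by rewrite addr_ge0// mulr_ge0// !addr_ge0// powR_ge0.
have hone : (1 : R) = 1 \/ (1 : R) = -1 by left.
have hl : - l <= 1 * l <= l := sign_end_in l0 hone.
have HB t : 0 <= t < tau -> `|ph 1 t (u t (1 * l)) (p t (1 * l))| <= B.
  move=> ht; have /andP[t0 tt] := ht.
  have h := pr_ph P (t := t) (s := 0) (z := u t (1 * l)) (z' := 0) (p := p t (1 * l)) (p' := 0) hone.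
  have tT' : t <= T by apply: le_trans tT; exact: ltW.
  have {}h := h ltac:(by rewrite t0) ltac:(by rewrite lexx/= (le_trans t0)) (Mu ht hl) ltac:(by rewrite normr0) (Mp ht hl) ltac:(by rewrite normr0).
  rewrite !subr0 (ger0_norm t0) in h.
  have -> : ph 1 t (u t (1 * l)) (p t (1 * l)) = ph 1 0 0 0 + (ph 1 t (u t (1 * l)) (p t (1 * l)) - ph 1 0 0 0) by ring.
  apply: (le_trans (ler_normD _ _)); rewrite lerD2l; apply: (le_trans h); rewrite ler_wpM2l//.
  apply: lerD; [apply: lerD|exact: Mp]; last exact: Mu.
  by apply: ge0_ler_powR; rewrite ?nnegrE//; [case/andP: hal => /ltW|exact: le_trans tT'].
exists (B * (1 + T) + 2 * l * M); first by rewrite addr_ge0 ?mulr_ge0//; lra.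
move=> t s x ht hs hx; have /andP[t0 tt] := ht; have /andP[s0 st] := hs.
pose sg := (Num.max t s + tau) / 2.
have mx : Num.max t s < tau by rewrite gt_max tt.
have tm : t <= Num.max t s by rewrite le_max lexx.
have sm : s <= Num.max t s by rewrite le_max lexx orbT.
have [msg sgt] := midf_lt mx.
have sg0 : 0 < sg < tau by rewrite (le_lt_trans t0 (le_lt_trans tm msg)) sgt.
have [C C0 [Hr [_ S2 _]]] := US sg0.
have ht' : 0 <= t <= sg by rewrite t0 (le_trans tm)// ltW.
have hs' : 0 <= s <= sg by rewrite s0 (le_trans sm)// ltW.
have ab : `|t - s| <= (1 + T) * `|t - s| `^ (al / 2).
  apply: le_powR_bounded => //; rewrite normr_ge0/= -[leRHS]subr0.
  by apply: dist_range; apply/andP; split=> //; apply: le_trans tT; exact: ltW.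
have hb : `|u t (1 * l) - u s (1 * l)| <= B * (1 + T) * `|t - s| `^ (al / 2).
  have tay : taylor1 0 sg C (al / 2) (u^~ (1 * l)) (z^~ (1 * l)).
    by move=> t' s' h1 h2; exact: (rg_ut Hr).
  have [c [hc _] ->] := taylor_mvt (divr_gt0 al0 (ltr0n _ 2)) C0 tay hs' ht'.
  rewrite normrM mulrC -mulrA; apply: ler_pM => //.
  rewrite (S2 1 c hone hc); apply: HB.
  by case/andP: hc => -> h; apply: (le_lt_trans h); case/andP: sg0.
(* The mean value theorem in x for u(t) - u(s) reduces an arbitrary point to the end x = l. *)
have tay : taylor1 (- l) l (2 * C) 1 (fun y => u t y - u s y) (fun y => p t y - p s y).
  by move=> x' y' hx' hy'; rewrite powRr1// -expr2 mulrBr; apply: split_norm; exact: (rg_ux Hr).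
have [c [hc _] e] := taylor_mvt ltr01 (mulr_ge0 (ler0n _ 2) C0) tay hl hx.
have -> : u t x - u s x = (u t (1 * l) - u s (1 * l)) + (x - 1 * l) * (p t c - p s c).
  by rewrite -e; ring.
apply: (le_trans (ler_normD _ _)); rewrite [leRHS]mulrDl; apply: lerD => //.
rewrite normrM -[leRHS]mulrA; apply: ler_pM => //.
  by rewrite dist_range_sym.
have := Mpd ht hs hc hc.
by rewrite (subrr c) normr0 (powR0 (_ : al != 0)) ?addr0// gt_eqF.
Qed.

Lemma frozen_arith (L A1 A2 N dt dx du dp : R) : 0 <= L -> 0 <= dt -> 0 <= dx ->
  0 <= N -> 0 <= A1 ->
  du <= N * dt + A1 * dx -> dp <= A2 * (dt + dx) -> 0 <= A2 ->
  L * (dt + dx + du + dp) <= L * (1 + N + A1 + A2) * (dt + dx).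
Proof.
move=> L0 dt0 dx0 N0 A10 h1 h2 A20; rewrite -mulrA ler_wpM2l//.
have e1 := mulr_ge0 N0 dx0; have e2 := mulr_ge0 A10 dt0.
by move: h1 h2 e1 e2; rewrite !mulrDl !mul1r !mulrDr; lra.
Qed.

(** Evaluated along u, the coefficients are functions of t and x alone, and M controls their Holder
    constants. The constants are common to all t1 < tau and all Rb, since z and p no longer
    enter. *)
Lemma frozen_problem : exists kap0 kap1 Lam, forall t1, 0 <= t1 < tau -> forall Rb,
  problem al l t1 Rb kap0 kap1 Lam (fun t x _ _ => a t x (u t x) (p t x))
    (fun t x _ _ => f t x (u t x) (p t x)) (fun s t _ _ => ph s t (u t (s * l)) (p t (s * l))).
Proof.
have [kap0 [kap1 [Lam P]]] := HP M; have L0 := pr_Lam P; have /andP[tau0 tT] := tauT.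
have [N N0 HN] := value_t.
have /andP[al0 al1] := al01; have l0' := l0; have M0' := M0.
pose A1 := M * (1 + 2 * l).
have A10 : 0 <= A1 by rewrite mulr_ge0//; lra.
exists kap0, kap1, (Lam * (1 + N + A1 + M)) => t1 /andP[t10 t1t] Rb.
have inc t : 0 <= t <= t1 -> 0 <= t < tau by move=> /andP[-> h]; exact: le_lt_trans t1t.
have inT t : 0 <= t <= t1 -> 0 <= t <= T.
  by move=> /andP[-> h]; rewrite (le_trans h)// (le_trans (ltW t1t)).
have du t s x y : 0 <= t <= t1 -> 0 <= s <= t1 -> - l <= x <= l -> - l <= y <= l ->
    `|u t x - u s y| <= N * `|t - s| `^ (al / 2) + A1 * `|x - y| `^ al.
  move=> /inc ht /inc hs hx hy.
  have -> : u t x - u s y = (u t x - u s x) + (u s x - u s y) by ring.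
  apply: (le_trans (ler_normD _ _)); apply: lerD; first exact: HN.
  apply: (le_trans (value_x hs hx hy)); rewrite /A1 -mulrA ler_wpM2l//.
  apply: le_powR_bounded; first by rewrite al0 ltW.
  by rewrite normr_ge0/= dist_range_sym.
have du0 t s x : 0 <= t <= t1 -> 0 <= s <= t1 -> - l <= x <= l ->
    `|u t x - u s x| <= N * `|t - s| `^ (al / 2).
  by move=> /inc ht /inc hs hx; exact: HN.
have dp t s x y : 0 <= t <= t1 -> 0 <= s <= t1 -> - l <= x <= l -> - l <= y <= l ->
    `|p t x - p s y| <= M * (`|t - s| `^ (al / 2) + `|x - y| `^ al).
  by move=> /inc ht /inc hs hx hy; exact: Mpd.
have LL : Lam <= Lam * (1 + N + A1 + M) by rewrite ler_peMr//; lra.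
have fin t s x y (D1 D2 : R) : D1 = `|t - s| `^ (al / 2) -> D2 = `|x - y| `^ al ->
  0 <= t <= t1 -> 0 <= s <= t1 -> - l <= x <= l -> - l <= y <= l ->
  Lam * (D1 + D2 + `|u t x - u s y| + `|p t x - p s y|) <= Lam * (1 + N + A1 + M) * (D1 + D2).
  move=> -> -> ht hs hx hy; apply: (@frozen_arith _ A1 M) => //; rewrite ?powR_ge0//.
  - exact: du.
  - exact: dp.
split => //.
- by rewrite mulr_ge0//; lra.
- exact: (pr_kap P).
- move=> t s x y q q' r r' ht hs hx hy _ _ _ _.
  have := pr_a P (inT t ht) (inT s hs) hx hy (Mu (inc t ht) hx) (Mu (inc s hs) hy) (Mp (inc t ht) hx) (Mp (inc s hs) hy).
  move=> /le_trans; apply; apply: (le_trans (fin t s x y _ _ erefl erefl ht hs hx hy)).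
  by rewrite ler_wpM2l ?(le_trans L0)// -addrA lerDl addr_ge0.
- move=> t s x y q q' r r' ht hs hx hy _ _ _ _.
  have := pr_f P (inT t ht) (inT s hs) hx hy (Mu (inc t ht) hx) (Mu (inc s hs) hy) (Mp (inc t ht) hx) (Mp (inc s hs) hy).
  move=> /le_trans; apply; apply: (le_trans (fin t s x y _ _ erefl erefl ht hs hx hy)).
  by rewrite ler_wpM2l ?(le_trans L0)// -addrA lerDl addr_ge0.
- move=> sg t s q q' r r' hsg ht hs _ _ _ _; have hx := sign_end_in l0 hsg.
  have := pr_ph P hsg (inT t ht) (inT s hs) (Mu (inc t ht) hx) (Mu (inc s hs) hx) (Mp (inc t ht) hx) (Mp (inc s hs) hx).
  move=> /le_trans; apply.
  have := fin t s (sg * l) (sg * l) _ _ erefl erefl ht hs hx hx.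
  rewrite (subrr (sg * l)) normr0 (powR0 (_ : al != 0)) ?addr0; last by rewrite gt_eqF.
  move=> /le_trans; apply.
  by rewrite ler_wpM2l ?(le_trans L0)// -addrA lerDl addr_ge0.
- move=> t x _ _ ht hx _ _; exact: (pr_pos P (inT t ht) hx (Mu (inc t ht) hx) (Mp (inc t ht) hx)).
- move=> t x _ _ ht hx _ _; apply: le_trans LL.
  exact: (pr_fb P (inT t ht) hx (Mu (inc t ht) hx) (Mp (inc t ht) hx)).
Qed.

(* The step length of the linear problem does not depend on the datum, so a
   fixed starting time reaches every later time before [tau]. *)
Theorem gradient_control : exists2 C, 0 <= C & forall t1, 0 < t1 < tau -> regular al l 0 t1 C u p w z.
Proof.
have [kap0 [kap1 [Lam FP]]] := frozen_problem; have /andP[tau0 tT] := tauT.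
have P0 := FP 0 (ltac:(by rewrite lexx) : 0 <= 0 < tau) 0.
have [delta de0 HL] := linear_existence al01 l0 (pr_kap P0) (pr_Lam P0).
(* From t0 a single linear step of length at most delta reaches any t1 < tau, so that K and C are
   fixed before t1. *)
pose t0 := Num.max 0 (tau - delta).
have t00 : 0 <= t0 by rewrite le_max lexx.
have t0t : t0 < tau by rewrite gt_max tau0/=; lra.
have t0d : tau - delta <= t0 by rewrite le_max lexx orbT.
have hs0 : 0 < (t0 + tau) / 2 < tau by apply/andP; split; lra.
have [K K0 [HK _]] := US hs0.
have [C HC] := HL K.
have C0' : 0 <= `|C| by [].
have H0 : regular al l 0 t0 K u p w z by apply: (regular_weaken HK) => //; lra.
have key t1 : t0 < t1 < tau -> regular al l t0 t1 `|C| u p w z.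
  move=> /andP[t01 t1t]; have t1p : 0 < t1 by exact: le_lt_trans t01.
  have [C1 C10 [H1 [S1 S2 S3]]] := US (ltac:(by rewrite t1p) : 0 < t1 < tau).
  have ht0 : 0 <= t0 <= t1 by rewrite t00 ltW.
  have D : datum al l K (u t0) (p t0) (w t0) by apply: (regular_datum al01 K0 H0); rewrite t00 lexx.
  have PP := FP t1 (ltac:(by rewrite (ltW t1p)) : 0 <= t1 < tau).
  pose A (t x q r : R) := a t x (u t x) (p t x).
  pose F (t x q r : R) := f t x (u t x) (p t x).
  pose E (s t q r : R) := ph s t (u t (s * l)) (p t (s * l)).
  have lin : linear_problem A F E by [].
  have cm : compatible l t0 A F E (u t0) (p t0) (w t0).
    by move=> s hs; have hx := sign_end_in l0 hs; rewrite /E /A /F -(S2 s t0 hs ht0) (S1 t0 _ ht0 hx).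
  have hde : 0 <= t1 - t0 <= delta by apply/andP; split; lra.
  have e1 : t0 + (t1 - t0) = t1 by ring.
  have [u' [p' [w' [z' [Hr Hs]]]]] := HC t1 t0 (t1 - t0) A F E _ _ _ PP lin t00 hde (ltac:(by rewrite e1) : t0 + (t1 - t0) <= t1) D cm.
  rewrite e1 in Hr Hs.
  have Hr' : regular al l t0 t1 `|C| u' p' w' z' by apply: (regular_weaken Hr); rewrite ?lexx// ler_norm.
  have sub t : t0 <= t <= t1 -> 0 <= t <= t1 by move=> /andP[h ->]; rewrite (le_trans t00 h).
  have Hs2 : solves l t0 t1 A F E (u t0) u p w z.
    by split => // [t x /sub ht hx|s t hs /sub ht]; [exact: S1|exact: S2].
  pose Cm := `|C| + C1.
  have Cm0 : 0 <= Cm by rewrite addr_ge0.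
  have G : regular al l t0 t1 Cm u p w z by apply: (regular_weaken H1) => //; rewrite lerDr.
  have G' : regular al l t0 t1 Cm u' p' w' z' by apply: (regular_weaken Hr'); rewrite ?lexx// lerDl.
  have mn : monotone_end t1 Cm E by move=> s t q r r' _ _ _ _ _ _; exact: lexx.
  have eqv y : - l <= y <= l -> u t0 y <= u t0 y by [].
  have EQ r y : t0 <= r <= t1 -> - l <= y <= l -> u' r y = u r y.
    move=> hr hy; apply: le_anti; apply/andP; split.
      exact: (compare_solutions (PP Cm) mn t00 (lexx t1) Cm0 (lexx Cm) G' G Hs Hs2 eqv).
    exact: (compare_solutions (PP Cm) mn t00 (lexx t1) Cm0 (lexx Cm) G G' Hs2 Hs eqv).
  apply: (regular_congr _ Hr') => r y hr hy.
  by have [g1 g2 g3] := regular_det al01 l0 t01 G' G EQ hr hy; split => //; exact: EQ.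
exists (3 * (K + `|C|)); first by rewrite mulr_ge0// addr_ge0.
have CC : K + `|C| <= 3 * (K + `|C|) by rewrite ler_peMl ?addr_ge0// ler1n.
move=> t1 /andP[t10 t1t]; case: (ltP t0 t1) => h.
  apply: (@regular_glue R al l 0 t0 t1) => //; first exact: addr_ge0.
    by apply: (regular_weaken H0); rewrite ?lexx// lerDl.
  by apply: (regular_weaken (key t1 (ltac:(by rewrite h) : t0 < t1 < tau))); rewrite ?lexx// lerDr.
by apply: (regular_weaken H0) => //; apply: le_trans CC; rewrite lerDl.
Qed.

End GradientControl.

(** * Blow-up alternatives *)

Section Blowup.
Context {R : realType}.

(** For a quantity that is monotone in time, unboundedness already gives the limit. *)
Lemma cvg_at_left_pinfty (tau : R) (N : R -> \bar R) :
  (forall sigma tau', 0 < sigma -> sigma <= tau' -> (N sigma <= N tau')%E) ->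
  (forall M, 0 <= M -> exists2 sigma, 0 < sigma < tau & (M%:E < N sigma)%E) ->
  N t @[t --> tau^'-] --> +oo%E.
Proof.
move=> mono big; apply/cvgeyPger => A _.
have [sg /andP[s0 st] h] := big `|A| (normr_ge0 A).
have nr : \forall t \near tau^'-, sg < t by exact: nbhs_left_gt.
apply: filterS nr => t lt.
apply: (@le_trans _ _ `|A|%:E); first by rewrite lee_fin ler_norm.
by apply: (le_trans (ltW h)); apply: mono => //; exact: ltW.
Qed.

Lemma gradient_parts (A B C D M : \bar R) : (0 <= A)%E -> (0 <= B)%E -> (0 <= C)%E -> (0 <= D)%E ->
  (A + B + (C + D) <= M)%E -> [/\ (A <= M)%E, (B <= M)%E, (C <= M)%E & (D <= M)%E].
Proof.
move=> A0 B0 C0 D0 H.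
have AB0 : (0 <= A + B)%E by exact: adde_ge0.
have CD0 : (0 <= C + D)%E by exact: adde_ge0.
have h1 : (A + B <= M)%E by apply: le_trans H; exact: leeDl.
have h2 : (C + D <= M)%E by apply: le_trans H; exact: leeDr.
split.
- by apply: le_trans h1; exact: leeDl.
- by apply: le_trans h1; exact: leeDr.
- by apply: le_trans h2; exact: leeDl.
- by apply: le_trans h2; exact: leeDr.
Qed.

Variables (al l T : R) (a f ph : R -> R -> R -> R -> R) (u0 : R -> R).
Variables (tau : R) (u p w z : R -> R -> R).
Hypothesis al01 : 0 < al < 1.
Hypothesis l0 : 0 < l.
Hypothesis tauT : 0 < tau <= T.
Hypothesis HP : forall Rb, exists kap0 kap1 Lam, problem al l T Rb kap0 kap1 Lam a f ph.
Hypothesis US : solution al l a f ph u0 tau u p w z.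

Lemma solution_derivatives t x : 0 < t < tau -> - l < x < l ->
  [/\ Dx u t x = p t x, Dx (Dx u) t x = w t x & Dt u t x = z t x].
Proof.
move=> /andP[t0 tt] hx; have hs : 0 < (t + tau) / 2 < tau by apply/andP; split; lra.
have [C C0 [Hr _]] := US hs.
have ht : 0 < t < (t + tau) / 2 by apply/andP; split; lra.
by have [h _] := regular_derivatives al01 C0 Hr ht hx.
Qed.

(** The norm bound is used on a cylinder ending between s1 and tau, in which p, w and z are the
    derivatives of u. *)
Lemma par_bound_open_regular M :
  (forall sigma, 0 < sigma < tau -> (par_norm 2 al sigma l u <= M%:E)%E) ->
  open_regular al l tau M u p w z.
Proof.
move=> HM l' s0 s1 l'l s00 s1t; have /andP[tau0 _] := tauT.
have mx : Num.max s1 (tau / 2) < tau by rewrite gt_max s1t/=; lra.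
have m1 : s1 <= Num.max s1 (tau / 2) by rewrite le_max lexx.
have m2 : tau / 2 <= Num.max s1 (tau / 2) by rewrite le_max lexx orbT.
pose sg := (Num.max s1 (tau / 2) + tau) / 2.
have hs : 0 < sg < tau by rewrite /sg; apply/andP; split; lra.
have ssg : s1 < sg by rewrite /sg; lra.
have /andP[sg0 sgt] := hs; have [C C0 [Hr _]] := US hs.
have sp := regular_par_space al01 l0 sg0 C0 Hr.
have Ho := par_open_regular al01 l0 sg0 sp (HM sg hs).
apply: (regular_congr _ (Ho l' s0 s1 l'l s00 ssg)) => t x /andP[t0 t1] /andP[x0 x1].
have ht : 0 < t < tau by rewrite (lt_le_trans s00 t0) (le_lt_trans t1).
have hx : - l < x < l by rewrite (lt_le_trans _ x0) ?ltrN2// (le_lt_trans x1).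
by have [-> -> ->] := solution_derivatives ht hx.
Qed.

Lemma uniform_open_regular C : (forall t1, 0 < t1 < tau -> regular al l 0 t1 C u p w z) ->
  open_regular al l tau C u p w z.
Proof.
move=> H l' s0 s1 l'l s00 s1t; have /andP[tau0 _] := tauT.
have mx : Num.max s1 (tau / 2) < tau by rewrite gt_max s1t/=; lra.
have m1 : s1 <= Num.max s1 (tau / 2) by rewrite le_max lexx.
have m2 : tau / 2 <= Num.max s1 (tau / 2) by rewrite le_max lexx orbT.
have hs : 0 < Num.max s1 (tau / 2) < tau by rewrite mx andbT; lra.
have Hr := H _ hs.
have st t : s0 <= t <= s1 -> 0 <= t <= Num.max s1 (tau / 2).
  by move=> /andP[h1 h2]; rewrite (le_trans h2 m1) andbT ltW// (lt_le_trans s00).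
have sx x : - l' <= x <= l' -> - l <= x <= l.
  by move=> /andP[h1 h2]; apply/andP; split; lra.
split.
- by move=> t x /st ht /sx hx; exact: (rg_bd Hr).
- by move=> t s x y /st ht /st hs' /sx hx /sx hy; exact: (rg_w Hr).
- by move=> t s x y /st ht /st hs' /sx hx /sx hy; exact: (rg_z Hr).
- by move=> t x y /st ht /sx hx /sx hy; exact: (rg_ux Hr).
- by move=> t x y /st ht /sx hx /sx hy; exact: (rg_px Hr).
- by move=> t s x /st ht /st hs' /sx hx; exact: (rg_ut Hr).
Qed.

Lemma gradient_bound_open_regular M : 0 <= M ->
  (forall sigma, 0 < sigma < tau -> (supnorm (Cyl sigma l) u + supnorm (Cyl sigma l) (Dx u)
     + holder_tx al sigma l (Dx u) <= M%:E)%E) ->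
  exists2 C, 0 <= C & open_regular al l tau C u p w z.
Proof.
move=> M0 HM; have /andP[tau0 _] := tauT; have /andP[al0 al1] := al01.
have al20 : 0 < al / 2 by rewrite divr_gt0.
have bounds sg : 0 < sg < tau -> [/\ forall t x, 0 <= t <= sg -> - l <= x <= l -> `|u t x| <= M,
    forall t x, 0 <= t <= sg -> - l <= x <= l -> `|p t x| <= M &
    forall t s x y, 0 <= t <= sg -> 0 <= s <= sg -> - l <= x <= l -> - l <= y <= l ->
      `|p t x - p s y| <= M * (`|t - s| `^ (al / 2) + `|x - y| `^ al)].
  move=> hs; have /andP[sg0 sgt] := hs; have [C C0 [Hr _]] := US hs.
  have [c1 c2 _ _] := regular_continuous_on al01 l0 (ltW sg0) C0 Hr.
  have [n1 n2 n3 n4] := gradient_parts (supnorm_ge0 sg0 l0 u) (supnorm_ge0 sg0 l0 (Dx u))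
    (holder_t_ge0 sg0 l0 (al / 2) (Dx u)) (holder_x_ge0 sg0 l0 al (Dx u)) (HM sg hs).
  have dE t x : 0 < t < sg -> - l < x < l -> Dx u t x = p t x.
    move=> /andP[t0 tt] hx; have ht : 0 < t < tau by rewrite t0 (lt_trans tt).
    by have [] := solution_derivatives ht hx.
  split.
  - by apply: (closed_bound l0 sg0 c1) => t x; exact: supnorm_bound.
  - apply: (closed_bound l0 sg0 c2) => t x ht hx; rewrite -dE//.
    exact: (supnorm_bound n2).
  - apply: (closed_holder al01 l0 sg0 c2) => t s x y ht hs' hx hy; rewrite -!dE//.
    have -> : Dx u t x - Dx u s y = (Dx u t x - Dx u s x) + (Dx u s x - Dx u s y) by ring.
    apply: (le_trans (ler_normD _ _)); rewrite mulrDr; apply: lerD.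
      exact: (holder_t_bound al20 n3).
    exact: (holder_x_bound al0 n4).
have mid t : 0 <= t < tau -> 0 < (t + tau) / 2 < tau /\ 0 <= t <= (t + tau) / 2.
  by move=> /andP[h1 h2]; split; apply/andP; split; lra.
have Mu t x : 0 <= t < tau -> - l <= x <= l -> `|u t x| <= M.
  by move=> /mid[h1 h2] hx; have [h _ _] := bounds _ h1; exact: h.
have Mp t x : 0 <= t < tau -> - l <= x <= l -> `|p t x| <= M.
  by move=> /mid[h1 h2] hx; have [_ h _] := bounds _ h1; exact: h.
have Mpd t s x y : 0 <= t < tau -> 0 <= s < tau -> - l <= x <= l -> - l <= y <= l ->
    `|p t x - p s y| <= M * (`|t - s| `^ (al / 2) + `|x - y| `^ al).
  move=> /andP[t0 tt] /andP[s0 st] hx hy.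
  have mx : Num.max t s < tau by rewrite gt_max tt.
  have m1 : t <= Num.max t s by rewrite le_max lexx.
  have m2 : s <= Num.max t s by rewrite le_max lexx orbT.
  have [h1 h2] := midf_lt mx.
  have hs : 0 < (Num.max t s + tau) / 2 < tau by rewrite (le_lt_trans t0 (le_lt_trans m1 h1)) h2.
  have [_ _ h] := bounds _ hs; apply: h => //.
    by rewrite t0 (le_trans m1)// ltW.
  by rewrite s0 (le_trans m2)// ltW.
have [C C0 HC] := gradient_control al01 l0 tauT HP US M0 Mu Mp Mpd.
by exists C => //; exact: uniform_open_regular.
Qed.

End Blowup.

Theorem theorem2p2 (R : realType) (T l alpha : R)
    (a f b g : R -> R -> R -> R -> R) (u0 : R -> R)
    (T_gt0 : 0 < T) (l_gt0 : 0 < l) (alpha01 : 0 < alpha < 1)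
    (a_C2 : C2_4 `[0, T] `[- l, l] setT setT a)
    (f_C2 : C2_4 `[0, T] `[- l, l] setT setT f)
    (b_C2 : forall s, s \in [:: 1; -1] ->
       C2_3 `[0, T] setT setT (fun t z p => b t (s * l) z p))
    (g_C2 : forall s, s \in [:: 1; -1] ->
       C2_3 `[0, T] setT setT (fun t z p => g t (s * l) z p))
    (a_gt0 : forall t x z p, 0 <= t <= T -> - l <= x <= l -> 0 < a t x z p)
    (bg_gt0 : forall s t z p, s \in [:: 1; -1] -> 0 <= t <= T ->
       0 < derive1 (b t (s * l) z) p * p + b t (s * l) z p
           - s * derive1 (g t (s * l) z) p)
    (u0_holder : holder_space 2 alpha `[- l, l] u0)
    (compat : forall s, s \in [:: 1; -1] ->
       let x := s * l in
       let u0x := dx `[- l, l] u0 x in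
       let u0xx := dx `[- l, l] (dx `[- l, l] u0) x in
       - s * b 0 x (u0 x) u0x * u0x + g 0 x (u0 x) u0x
         = a 0 x (u0 x) u0x * u0xx + f 0 x (u0 x) u0x) :
  exists (tau_oo : R) (u : R -> R -> R),
    [/\ 0 < tau_oo <= T,
        is_solution l alpha a f b g u0 tau_oo u,
        forall (tau : R) (v : R -> R -> R), 0 < tau <= T ->
          is_solution l alpha a f b g u0 tau v ->
          tau <= tau_oo /\ (forall t x, Cyl tau l (t, x) -> v t x = u t x),
        par_norm 2 alpha tau l u @[tau --> tau_oo^'-] --> +oo%E \/
          (tau_oo = T /\ par_space 2 alpha T l u)
      & (forall s t z p p', s \in [:: 1; -1] -> 0 <= t <= T ->
           b t (s * l) z p = b t (s * l) z p' /\
           g t (s * l) z p = g t (s * l) z p') ->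
        (forall s t z p, s \in [:: 1; -1] -> 0 <= t <= T ->
           0 < b t (s * l) z p) ->
        (supnorm (Cyl tau l) u + supnorm (Cyl tau l) (Dx u)
           + holder_tx alpha tau l (Dx u))%E
             @[tau --> tau_oo^'-] --> +oo%E \/
          (tau_oo = T /\ par_space 2 alpha T l u)].
Proof.
have HP := problem_of_C2 T_gt0 l_gt0 alpha01 b_C2 g_C2 a_C2 f_C2 a_gt0.
have mono Rb := monotone_flux (Rb := Rb) b_C2 g_C2 bg_gt0.
have [K D] := datum_of_holder l_gt0 alpha01 u0_holder.
have cmp := flux_compatible compat.
have [tau [u [p [w [z [ht US uniq alt]]]]]] := maximal_solution alpha01 l_gt0 T_gt0 HP mono D cmp.
have /andP[tau0 tauT] := ht.
(* Both alternatives follow one pattern: a norm that is monotone in tau and whose boundedness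
   implies [open_regular] must tend to infinity, unless the solution reaches T. *)
have big (N : R -> \bar R) : (forall sigma tau', 0 < sigma -> sigma <= tau' -> (N sigma <= N tau')%E) ->
    (forall M, 0 <= M -> (forall sigma, 0 < sigma < tau -> (N sigma <= M%:E)%E) ->
       exists2 C, 0 <= C & open_regular alpha l tau C u p w z) ->
    N t @[t --> tau^'-] --> +oo%E \/ (tau = T /\ par_space 2 alpha T l u).
  move=> Nm HN; case: alt => [[tT [C C0 [Hr _]]]|no].
    by right; split => //; exact: (regular_par_space alpha01 l_gt0 T_gt0 C0 Hr).
  left; apply: (cvg_at_left_pinfty Nm) => M M0; apply: contrapT => nb.
  have [sg hs|C C0 Ho] := HN M M0; last exact: (no C C0 Ho).
  by rewrite leNgt; apply/negP => lt; apply: nb; exists sg.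
exists tau, u; split => //.
- exact: (solution_is_solution alpha01 l_gt0 US tau0).
- move=> tau' v ht' Hv.
  have [u' [p' [w' [z' [US' E]]]]] := is_solution_solution alpha01 l_gt0 HP ht' Hv.
  have [le Eu] := uniq _ _ _ _ _ ht' US'; split => // t x hc.
  by rewrite E//; have /CylE[h1 h2] := hc; exact: Eu.
- apply: big => [sigma tau' h1 h2|M M0 HM]; first exact: par_norm_mono.
  by exists M => //; exact: (par_bound_open_regular alpha01 l_gt0 ht US HM).
- move=> _ _; apply: big => [sigma tau' h1 h2|M M0 HM]; first exact: gradient_norm_mono.
  exact: (gradient_bound_open_regular alpha01 l_gt0 ht HP US M0 HM).
Qed.
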